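(* Let $M\in\mathbb{Z}_{>0}$ and let $f:\mathbb{Z}\to\mathbb{C}$ be $M$-periodic, with even and odd parts $f^{\mathrm{ev}}$, $f^{\mathrm{od}}$. Write $\hat f^{\mathrm{ev}}=U_M(f^{\mathrm{ev}})$ and $\hat f^{\mathrm{od}}=U_M(f^{\mathrm{od}})$, where $U_M$ is the Discrete Fourier Transform. Then for all $\tau\in\mathbb{H}$, $$\Theta(\tau;0,f)=\tfrac12\,\hat f^{\mathrm{ev}}(0)\Big(\frac{\tau}{i}\Big)^{-1/2}-\tfrac12 f^{\mathrm{ev}}(0)+\mathscr{S}^{\frac\pi2}_{\mathrm{med}}\,\tilde\Theta(\tau;0,f^{\mathrm{od}})+\Big(\frac{\tau}{i}\Big)^{-\frac12}\Theta(-\tau^{-1};0,\hat f^{\mathrm{ev}}),$$ $$\Theta(\tau;1,f)=-\frac{M^{1/2}}{2\pi i}\,\hat f^{\mathrm{ev}}(0)\,\tau^{-1}+\mathscr{S}^{\frac\pi2}_{\mathrm{med}}\,\tilde\Theta(\tau;1,f^{\mathrm{ev}})+i\Big(\frac{\tau}{i}\Big)^{-\frac32}\Theta(-\tau^{-1};1,\hat f^{\mathrm{od}}).$$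
   Context: $\mathbb{H}=\{\operatorname{Im}\tau>0\}$; powers of $\tau/i$ use $\arg(\tau/i)\in(-\frac\pi2,\frac\pi2)$. For $\nu\in\mathbb{Z}_{\ge0}$ and $g:\mathbb{Z}\to\mathbb{C}$ $M$-periodic, $$\Theta(\tau;\nu,g)=\Theta(\tau;\nu,g,M)=\sum_{n\ge1}n^\nu g(n)e^{i\pi n^2\tau/M},\qquad \tilde\Theta(\tau;\nu,g)=\sum_{p\ge0}\frac{1}{p!}L(-2p-\nu,g)\Big(\frac{\pi i}{M}\Big)^p\tau^p,$$ where $L(s,g)$ is the analytic continuation of $\sum_{n\ge1}g(n)n^{-s}$. Even and odd parts: $g^{\mathrm{ev}}(n)=\frac{g(n)+g(-n)}2$, $g^{\mathrm{od}}(n)=\frac{g(n)-g(-n)}2$. Discrete Fourier Transform: $(U_Mg)(n)=\hat g(n)=\frac1{\sqrt M}\sum_{\ell\bmod M}g(\ell)e^{-2\pi i\ell n/M}$. Median sum. The Borel transform of a formal series $\tilde\psi(\tau)=\sum_{p\ge0}c_p\tau^p$ is $c_0\delta+\hat\psi(\xi)$ with $\hat\psi(\xi)=\sum_{p\ge1}c_p\frac{\xi^{p-1}}{(p-1)!}$, and its Borel–Laplace sum in a direction $\theta$ is $\mathscr{S}^\theta\tilde\psi(\tau)=c_0+\int_0^{e^{i\theta}\infty}e^{-\xi/\tau}\hat\psi(\xi)\,d\xi$ for $\arg\tau\in(\theta-\frac\pi2,\theta+\frac\pi2)$. The Borel transforms of the series $\tilde\Theta(\tau;\nu,g)$ have analytic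 continuation with singular points only among $\frac{i\pi n^2}{M}$, $n\ge1$. $\mathscr{S}^{\frac\pi2}_{\mathrm{med}}$ denotes Écalle's median summation in the direction $\frac\pi2$; for these series it is the arithmetic average $\frac12\big(\mathscr{S}^{\frac\pi2-\varepsilon}+\mathscr{S}^{\frac\pi2+\varepsilon}\big)$, evaluated at $\tau$ with $\varepsilon<\arg\tau<\pi-\varepsilon$ and independent of such $\varepsilon\in(0,\frac\pi2)$. *)

(* Defs.v *)
(* Stdlib reals with Coquelicot's complex numbers. *)
From Stdlib Require Import Reals ZArith ClassicalEpsilon Factorial.
From Coquelicot Require Import Coquelicot.
Open Scope R_scope.

Definition Cexp (z : C) : C :=
  (exp (Re z) * cos (Im z), exp (Re z) * sin (Im z)).

(* Principal argument, with values in (-PI, PI] for z <> 0. *)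
Definition Carg (z : C) : R :=
  if Rle_dec 0 (Im z) then acos (Re z / Cmod z) else - acos (Re z / Cmod z).

Definition Clog (z : C) : C := (ln (Cmod z), Carg z).

(* Principal power; meaningful for z <> 0. *)
Definition Cpower (z s : C) : C := Cexp (s * Clog z).

(* Coquelicot's [Series] is real-valued only. *)
Definition CSeries (a : nat -> C) : C :=
  (Series (fun n => Re (a n)), Series (fun n => Im (a n))).

Definition analytic_at (F : C -> C) (z0 : C) : Prop :=
  exists (a : nat -> C) (r : R), 0 < r /\
    forall z : C, Cmod (z - z0) < r ->
      @is_pseries C_AbsRing C_NormedModule a (z - z0)%C (F z).

Definition periodic (M : nat) (g : Z -> C) : Prop :=
  forall n : Z, g (n + Z.of_nat M)%Z = g n.

Definition even_part (g : Z -> C) (n : Z) : C := ((g n + g (- n)%Z) / 2)%C.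
Definition odd_part (g : Z -> C) (n : Z) : C := ((g n - g (- n)%Z) / 2)%C.

(* The residues mod M are represented by 0, ..., M - 1 (for 0 < M). *)
Definition DFT (M : nat) (g : Z -> C) (n : Z) : C :=
  (/ RtoC (sqrt (INR M)) *
   sum_n (fun l : nat =>
            g (Z.of_nat l) *
            Cexp (- (2 * PI * Ci * INR l * IZR n / INR M)))%C (pred M))%C.

(* The index k : nat stands for n = k + 1 >= 1. *)
Definition Theta (tau : C) (nu : nat) (g : Z -> C) (M : nat) : C :=
  CSeries (fun k : nat =>
    RtoC (INR (S k)) ^ nu * g (Z.of_nat (S k)) *
    Cexp (Ci * PI * RtoC (INR (S k)) ^ 2 * tau / INR M))%C.

(* For periodic g the Dirichlet series has a meromorphic continuation to C
   with at most a simple pole, at s = 1; hence the continuation to the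
   connected set C \ {1} exists and is unique. *)
Definition is_L_continuation (g : Z -> C) (L : C -> C) : Prop :=
  (forall s : C, s <> 1 -> analytic_at L s) /\
  (forall s : C, 1 < Re s ->
     @is_series C_AbsRing C_NormedModule
       (fun k : nat =>
          g (Z.of_nat (S k)) * Cpower (RtoC (INR (S k))) (- s))%C (L s)).

(* The value at s = 1 is left unspecified. *)
Definition L_function (g : Z -> C) : C -> C :=
  epsilon (inhabits (fun _ : C => RtoC 0)) (is_L_continuation g).

(* Formal power series in tau are given by their sequence of coefficients. *)
Definition Theta_tilde (nu : nat) (g : Z -> C) (M : nat) : nat -> C :=
  fun p : nat =>
    (/ RtoC (INR (fact p)) * L_function g (- (2 * INR p + INR nu))
     * (PI * Ci / INR M) ^ p)%C.

(* Coefficients, in powers of xi, of the regular part of the Borel transform;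
   the constant term c 0 (the coefficient of delta) is treated separately. *)
Definition Borel_coeff (c : nat -> C) (q : nat) : C :=
  (c (S q) / RtoC (INR (fact q)))%C.

(* phi extends the germ at 0 of the Borel transform analytically along the
   closed half-line of direction theta; its values on this half-line are
   uniquely determined. *)
Definition is_Borel_continuation (theta : R) (c : nat -> C) (phi : C -> C)
  : Prop :=
  (exists r : R, 0 < r /\
     forall xi : C, Cmod xi < r ->
       @is_pseries C_AbsRing C_NormedModule (Borel_coeff c) xi (phi xi)) /\
  (forall t : R, 0 <= t -> analytic_at phi (RtoC t * Cexp (Ci * theta))%C).

(* S is the Borel-Laplace sum at tau, in the direction theta, of the formal
   series with coefficients c.  The half-line is parametrized by
   xi = t e^(i theta).  The principal argument is the right determination of
   arg tau as long as 0 < Im tau and 0 < theta < PI. *)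
Definition is_Borel_Laplace_sum (theta : R) (c : nat -> C) (tau S : C)
  : Prop :=
  theta - PI / 2 < Carg tau < theta + PI / 2 /\
  exists (phi : C -> C) (I : C),
    is_Borel_continuation theta c phi /\
    @is_RInt_gen C_R_NormedModule
      (fun t : R =>
         let xi := (RtoC t * Cexp (Ci * theta))%C in
         (Cexp (- (xi / tau)) * phi xi * Cexp (Ci * theta))%C)
      (at_point 0) (Rbar_locally p_infty) I /\
    S = (c 0%nat + I)%C.

(* Median sum in the direction PI/2, in the case where it is the half-sum of
   the two lateral Borel-Laplace sums: both exist for every admissible
   epsilon, and their half-sum does not depend on epsilon.  For 0 < Im tau
   the set of admissible epsilon is not empty. *)
Definition is_median_sum (c : nat -> C) (tau S : C) : Prop :=
  0 < Im tau /\
  forall eps : R, 0 < eps < PI / 2 -> eps < Carg tau < PI - eps ->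
    exists S_minus S_plus : C,
      is_Borel_Laplace_sum (PI / 2 - eps) c tau S_minus /\
      is_Borel_Laplace_sum (PI / 2 + eps) c tau S_plus /\
      S = ((S_minus + S_plus) / 2)%C.

(* Main.v *)
(** Expand Theta by Euler-Maclaurin summation on each residue class mod M, with
    seed v^nu exp(-c v^2), and write the remainder with the Fourier series of the
    periodic Bernoulli polynomial; this is Poisson summation, but with half-line
    Fourier integrals.  In the even (nu = 0) or odd (nu = 1) part the frequencies
    k and -k combine to full Gaussian integrals and give the theta series at -1/tau.
    In the other part they combine to the Dawson-type functions
    exp(-b) int_0^1 exp(b w^2) dw with b = xi_k / tau, xi_k = i pi k^2 / M.

    On the other side, the values L(-m) are computed from the Hurwitz zeta function
    as Fourier series, so that the Borel transform is explicitly the sum over k of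
    multiples of (1 - xi / xi_k)^(- nu - 3/2).  Each term has a primitive, after
    multiplication by exp(- xi / tau), whose transcendental part is odd in the square
    root (1 - xi / xi_k)^(1/2).  On the two sides of the cut this root has opposite
    limits, so the contribution from infinity cancels in the average of the lateral
    sums, and the value at the origin is the same Dawson-type function. *)

(* The series is one-sided and the seed is summed over n >= 1 in both parities. In the parity where
   the symmetric sum over all integers vanishes, two-sided Poisson summation says nothing, hence the
   half-line integrals. The Fourier series of the first Bernoulli function converges only
   conditionally, so Euler-Maclaurin is carried to second order, where the kernel [Fm 1] converges
   absolutely and is paired with the second derivative of the seed.

   [L_function] is an [epsilon] choice: its values are accessible only after a continuation has been
   constructed (Hurwitz zeta function, analytic by weighted l^1 norms) and shown unique along
   segments that avoid the point 1.

   No Cauchy theorem is invoked. Every displacement of a contour goes through the entire primitive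
   [Efun] of a Gaussian exponential: the difference of its values at two points is an integral along
   the segment that joins them. The Gaussian mass is first an unknown limit; the summation formula
   itself then determines it. *)
Require Import Defs.
From Stdlib Require Import Reals ZArith Lra Lia Psatz Classical ClassicalEpsilon.
From Coquelicot Require Import Coquelicot.
Open Scope R_scope.

(** Series use [C] as a normed module over itself; derivatives and integrals in a real variable use
    it as a real normed module, whose norm is also [Cmod] by [Cnorm_R]. *)
Notation is_Cser := (@is_series C_AbsRing C_NormedModule).
Notation is_CRInt := (@is_RInt C_R_NormedModule).
Notation is_Cder := (@is_derive R_AbsRing C_R_NormedModule).
Notation Ccont := (@continuous R_UniformSpace C_UniformSpace).
Notation Csum := (@sum_n (NormedModule.AbelianMonoid C_AbsRing C_NormedModule)).

(** * Complex series *)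

Lemma Cnorm_R (z : C) : @norm R_AbsRing C_R_NormedModule z = Cmod z.
Proof.
  unfold norm, Cmod; simpl. unfold prod_norm, norm; simpl. unfold abs; simpl.
  f_equal. f_equal; rewrite !Rmult_1_r; symmetry; apply Rsqr_abs.
Qed.

Lemma filterlim_C {T} (F : (T -> Prop) -> Prop) {FF : Filter F} (f : T -> C) (l : C) :
  filterlim f F (locally l) <-> (forall eps : R, 0 < eps -> F (fun x => Cmod (f x - l) < eps)).
Proof.
  rewrite (@filterlim_locally_ball_norm C_AbsRing T C_NormedModule F FF f l).
  unfold ball_norm; split; intros H.
  - intros e He; exact (H (mkposreal e He)).
  - intros e; exact (H e (cond_pos e)).
Qed.

Lemma is_Cser_eps (a : nat -> C) (l : C) :
  is_Cser a l <->
  (forall eps : R, 0 < eps -> exists N, forall n, (N <= n)%nat -> Cmod (Csum a n - l) < eps).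
Proof. exact (filterlim_C eventually (Csum a) l). Qed.

Lemma filterlim_C_split {T} (F : (T -> Prop) -> Prop) {FF : Filter F} (f : T -> C) (l : C) :
  filterlim f F (locally l) <->
  filterlim (fun x => Re (f x)) F (locally (Re l)) /\
  filterlim (fun x => Im (f x)) F (locally (Im l)).
Proof.
  rewrite (filterlim_C F), !(filterlim_locally (F := F)). split.
  - intros H; split; intros e; specialize (H e (cond_pos e)); revert H; apply filter_imp; intros x H;
      unfold ball; simpl; unfold AbsRing_ball, abs, minus, plus, opp; simpl;
      (eapply Rle_lt_trans; [|exact H]).
    + replace (Re (f x) + - Re l) with (Re (f x - l)) by reflexivity. apply re_le_Cmod.
    + replace (Im (f x) + - Im l) with (Im (f x - l)) by reflexivity.
      eapply Rle_trans; [apply Rmax_r|apply Rmax_Cmod].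
  - intros [H1 H2] e He.
    assert (He2 : 0 < e / 2) by lra.
    specialize (H1 (mkposreal _ He2)). specialize (H2 (mkposreal _ He2)).
    generalize (filter_and _ _ H1 H2); apply filter_imp; intros x [Hx Hy].
    unfold ball in Hx, Hy; simpl in Hx, Hy; unfold AbsRing_ball, abs, minus, plus, opp in Hx, Hy; simpl in Hx, Hy.
    eapply Rle_lt_trans; [apply Cmod_2Rmax|].
    assert (sqrt 2 < 2). { rewrite <- (sqrt_Rsqr 2) at 2 by lra. apply sqrt_lt_1; unfold Rsqr; lra. }
    assert (H0 : Rmax (Rabs (fst (f x - l)%C)) (Rabs (snd (f x - l)%C)) < e / 2).
    { apply Rmax_lub_lt; assumption. }
    assert (0 <= Rmax (Rabs (fst (f x - l)%C)) (Rabs (snd (f x - l)%C))).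
    { eapply Rle_trans; [|apply Rmax_l]. apply Rabs_pos. }
    assert (0 < sqrt 2) by (apply sqrt_lt_R0; lra).
    nra.
Qed.

Lemma Csum_Re (a : nat -> C) n : Re (Csum a n) = sum_n (fun k => Re (a k)) n.
Proof. induction n; [rewrite !sum_O; reflexivity|rewrite !sum_Sn, <- IHn; reflexivity]. Qed.
Lemma Csum_Im (a : nat -> C) n : Im (Csum a n) = sum_n (fun k => Im (a k)) n.
Proof. induction n; [rewrite !sum_O; reflexivity|rewrite !sum_Sn, <- IHn; reflexivity]. Qed.

Lemma is_Cser_split (a : nat -> C) (l : C) :
  is_Cser a l <-> is_series (fun k => Re (a k)) (Re l) /\ is_series (fun k => Im (a k)) (Im l).
Proof.
  unfold is_series. rewrite (filterlim_C_split eventually).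
  split; intros [H1 H2]; split; (eapply filterlim_ext; [|eassumption]); intros n; cbv beta;
   (exact (Csum_Re a n) || exact (Csum_Im a n) || (symmetry; exact (Csum_Re a n)) || (symmetry; exact (Csum_Im a n))).
Qed.

Lemma CSeries_unique (a : nat -> C) (l : C) : is_Cser a l -> CSeries a = l.
Proof.
  intros [H1 H2]%is_Cser_split. unfold CSeries.
  rewrite (is_series_unique _ _ H1), (is_series_unique _ _ H2). destruct l; reflexivity.
Qed.

Lemma Csum_le (a : nat -> C) (B : nat -> R) (N n : nat) :
  (forall k, Cmod (a k) <= B k) -> (N <= n)%nat ->
  Cmod (Csum a n - Csum a N) <= sum_n B n - sum_n B N.
Proof.
  intros H Hn. induction Hn.
  - replace (Csum a N - Csum a N)%C with (RtoC 0) by ring. rewrite Cmod_0. lra.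
  - rewrite !sum_Sn.
    replace (plus (Csum a m) (a (S m)) - Csum a N)%C with ((Csum a m - Csum a N) + a (S m))%C
      by (change (plus (Csum a m) (a (S m))) with (Csum a m + a (S m))%C; ring).
    eapply Rle_trans; [apply Cmod_triangle|]. specialize (H (S m)).
    unfold plus; simpl. lra.
Qed.

Lemma ex_Cser_le (a : nat -> C) (B : nat -> R) :
  (forall k, Cmod (a k) <= B k) -> ex_series B -> exists l : C, is_Cser a l.
Proof. intros H HB. exact (@ex_series_le C_AbsRing C_CompleteNormedModule a B H HB). Qed.

Lemma sum_n_le_Series (B : nat -> R) n : (forall k, 0 <= B k) -> ex_series B -> sum_n B n <= Series B.
Proof.
  intros H0 HB. apply Series_correct in HB.
  assert (H : is_lim_seq (sum_n B) (Series B)) by exact HB.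
  apply (is_lim_seq_incr_compare _ _ H). intros m. rewrite sum_Sn; unfold plus; simpl. specialize (H0 (S m)); lra.
Qed.

Lemma Cmod_lim_le (u : nat -> C) (l : C) (b : R) N :
  filterlim u eventually (locally l) -> (forall n, (N <= n)%nat -> Cmod (u n) <= b) -> Cmod l <= b.
Proof.
  intros H Hb. apply Rnot_lt_le; intros Hlt.
  rewrite (filterlim_C eventually) in H. destruct (H (Cmod l - b)) as [N' HN']; [lra|].
  specialize (HN' (N + N')%nat ltac:(lia)). specialize (Hb (N + N')%nat ltac:(lia)).
  assert (Cmod l <= Cmod (u (N + N')%nat) + Cmod (u (N + N')%nat - l)).
  { rewrite <- (Cmod_opp (u (N + N')%nat - l)).
    replace l with (u (N + N')%nat + - (u (N + N')%nat - l))%C at 1 by ring. apply Cmod_triangle. }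
  lra.
Qed.

Lemma Cser_tail (a : nat -> C) (B : nat -> R) s N :
  (forall k, Cmod (a k) <= B k) -> ex_series B -> is_Cser a s ->
  Cmod (s - Csum a N) <= Series B - sum_n B N.
Proof.
  intros H HB Hs.
  assert (HB0 : forall k, 0 <= B k) by (intros k; eapply Rle_trans; [apply Cmod_ge_0|apply H]).
  apply (Cmod_lim_le (fun n => Csum a n - Csum a N)%C _ _ N).
  - rewrite (filterlim_C eventually). intros e He. apply is_Cser_eps with (2 := He) in Hs. destruct Hs as [M HM].
    exists M; intros n Hn. specialize (HM n Hn).
    replace (Csum a n - Csum a N - (s - Csum a N))%C with (Csum a n - s)%C by ring. exact HM.
  - intros n Hn. eapply Rle_trans; [apply Csum_le; eassumption|].
    generalize (sum_n_le_Series B n HB0 HB). lra.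
Qed.

Lemma Cser_norm_le (a : nat -> C) (B : nat -> R) s :
  (forall k, Cmod (a k) <= B k) -> ex_series B -> is_Cser a s -> Cmod s <= Series B.
Proof.
  intros H HB Hs.
  assert (HB0 : forall k, 0 <= B k) by (intros k; eapply Rle_trans; [apply Cmod_ge_0|apply H]).
  apply (Cmod_lim_le (Csum a) _ _ 0); [exact Hs|].
  intros n _. eapply Rle_trans; [|apply (sum_n_le_Series B n HB0 HB)].
  clear -H. induction n.
  - rewrite !sum_O; apply H.
  - rewrite !sum_Sn. eapply Rle_trans; [apply Cmod_triangle|]. specialize (H (S n)). unfold plus; simpl. lra.
Qed.

Lemma series_tail_small (B : nat -> R) (eps : R) : ex_series B -> 0 < eps ->
  exists N, forall n, (N <= n)%nat -> Series B - sum_n B n < eps.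
Proof.
  intros HB He. apply Series_correct in HB.
  assert (H : filterlim (sum_n B) eventually (locally (Series B))) by exact HB.
  rewrite (filterlim_locally (F := eventually) (sum_n B) (Series B)) in H. destruct (H (mkposreal _ He)) as [N HN].
  exists N; intros n Hn. specialize (HN n Hn).
  unfold ball in HN; simpl in HN; unfold AbsRing_ball, abs, minus, plus, opp in HN; simpl in HN.
  apply Rabs_def2 in HN. lra.
Qed.

Lemma filterlim_Cplus {T} (F : (T -> Prop) -> Prop) {FF : Filter F} (f g : T -> C) (l m : C) :
  filterlim f F (locally l) -> filterlim g F (locally m) ->
  filterlim (fun x => f x + g x)%C F (locally (l + m)%C).
Proof.
  intros H1 H2. eapply filterlim_comp_2; [exact H1|exact H2|exact (@filterlim_plus C_AbsRing C_NormedModule l m)].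
Qed.

(** Dominated convergence for series: the majorant makes the partial sums converge uniformly in the
    parameter, so the limit along [F] and the limit of partial sums can be exchanged. *)
Lemma tannery {T} (F : (T -> Prop) -> Prop) {FF : ProperFilter F}
  (f : T -> nat -> C) (S : T -> C) (l : nat -> C) (B : nat -> R) :
  (forall x n, Cmod (f x n) <= B n) -> ex_series B ->
  (forall x, is_Cser (f x) (S x)) ->
  (forall n, filterlim (fun x => f x n) F (locally (l n))) ->
  exists L : C, is_Cser l L /\ filterlim S F (locally L).
Proof.
  intros Hb HB HS Hl.
  destruct (@filterlim_switch nat T C_R_CompleteNormedModule eventually _ F _
    (fun N x => Csum (f x) N) S (fun N => Csum l N)) as [L [H1 H2]].
  - apply filterlim_locally. intros eps.
    destruct (series_tail_small B eps HB (cond_pos eps)) as [N HN].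
    exists N; intros n Hn x.
    specialize (HN n Hn).
    assert (HC : Cmod (Csum (f x) n - S x) < eps).
    { rewrite <- Cmod_opp.
      replace (- (Csum (f x) n - S x))%C with (S x - Csum (f x) n)%C by ring.
      eapply Rle_lt_trans; [|exact HN]. apply Cser_tail; auto. }
    apply (@norm_compat1 R_AbsRing C_R_NormedModule). rewrite Cnorm_R. exact HC.
  - intros N. induction N.
    + rewrite sum_O. eapply filterlim_ext; [|apply (Hl 0%nat)]. intros x; cbv beta; rewrite sum_O; reflexivity.
    + rewrite sum_Sn. eapply filterlim_ext; [|apply (filterlim_Cplus F _ _ _ _ IHN (Hl (Datatypes.S N)))].
      intros x; cbv beta. rewrite sum_Sn. reflexivity.
  - exists L; split; assumption.
Qed.

Lemma is_Cser_unique (a : nat -> C) (l m : C) : is_Cser a l -> is_Cser a m -> l = m.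
Proof. intros H1 H2. rewrite <- (CSeries_unique a l H1). apply CSeries_unique; assumption. Qed.

Lemma filterlim_C_unique {T} (F : (T -> Prop) -> Prop) {FF : ProperFilter F} (f : T -> C) (l m : C) :
  filterlim f F (locally l) -> filterlim f F (locally m) -> l = m.
Proof.
  exact (@filterlim_locally_unique T R_AbsRing C_R_NormedModule F _ f l m).
Qed.

Lemma Cser_plus (a b : nat -> C) (l m : C) : is_Cser a l -> is_Cser b m -> is_Cser (fun n => a n + b n)%C (l + m)%C.
Proof. exact (is_series_plus a b l m). Qed.
Lemma Cser_scal (c : C) (a : nat -> C) (l : C) : is_Cser a l -> is_Cser (fun n => c * a n)%C (c * l)%C.
Proof. exact (is_series_scal c a l). Qed.
Lemma Cser_ext (a b : nat -> C) (l : C) : (forall n, a n = b n) -> is_Cser a l -> is_Cser b l.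
Proof. exact (is_series_ext a b l). Qed.

Lemma Cser_zero : is_Cser (fun _ => RtoC 0) (RtoC 0).
Proof.
  apply is_Cser_eps. intros e He. exists 0%nat. intros n _.
  replace (Csum (fun _ => RtoC 0) n) with (RtoC 0).
  - replace (0 - 0)%C with (RtoC 0) by ring. rewrite Cmod_0; exact He.
  - induction n; [rewrite sum_O; reflexivity|rewrite sum_Sn, <- IHn]. symmetry; apply Cplus_0_l.
Qed.

Lemma Cser_Csum (a : nat -> nat -> C) (s : nat -> C) (K : nat) :
  (forall k, is_Cser (fun n => a n k) (s k)) ->
  is_Cser (fun n => Csum (a n) K) (Csum s K).
Proof.
  intros H. induction K.
  - rewrite sum_O. eapply Cser_ext; [|apply H]. intros n; rewrite sum_O; reflexivity.
  - rewrite sum_Sn. eapply Cser_ext; [|apply (Cser_plus _ _ _ _ IHK (H (S K)))].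
    intros n; rewrite sum_Sn; reflexivity.
Qed.

(** The case of [tannery] in which the parameter is the truncation index [K] of the rows. *)
Lemma double_series (a : nat -> nat -> C) (b : nat -> nat -> R) (B : nat -> R) (s t : nat -> C) :
  (forall n k, Cmod (a n k) <= b n k) ->
  (forall n, ex_series (b n)) -> (forall n, Series (b n) <= B n) -> ex_series B ->
  (forall n, is_Cser (a n) (s n)) -> (forall k, is_Cser (fun n => a n k) (t k)) ->
  exists L : C, is_Cser s L /\ is_Cser t L.
Proof.
  intros Hab Hb HbB HB Hs Ht.
  destruct (tannery eventually (fun K n => Csum (a n) K) (fun K => Csum t K) s B) as [L [H1 H2]].
  - intros K n. eapply Rle_trans; [|apply HbB].
    assert (Hb0 : forall k, 0 <= b n k) by (intros k; eapply Rle_trans; [apply Cmod_ge_0|apply Hab]).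
    eapply Rle_trans; [|apply (sum_n_le_Series _ K Hb0 (Hb n))].
    induction K; [rewrite !sum_O; apply Hab|]. rewrite !sum_Sn.
    eapply Rle_trans; [apply Cmod_triangle|]. specialize (Hab n (S K)). unfold plus; simpl; lra.
  - exact HB.
  - intros K. apply Cser_Csum. exact Ht.
  - intros n. exact (Hs n).
  - exists L; split; assumption.
Qed.

(** * Derivatives and integrals of complex-valued functions *)

Notation is_Cholo := (@is_derive C_AbsRing C_NormedModule).

Lemma evar_last {T} (P : T -> Prop) (x y : T) : P x -> x = y -> P y.
Proof. intros H <-; exact H. Qed.

Ltac to_C := cbv beta; match goal with |- @eq _ ?a ?b => change (@eq C a b) end.
Ltac to_R := cbv beta; match goal with |- @eq _ ?a ?b => change (@eq R a b) end.
Ltac scal_R := cbv beta; repeat match goal with |- context [@scal ?K ?V ?a ?b] => change (@scal K V a b) with (Rmult a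
  b) end.

Lemma derive_eps {K : AbsRing} {V : NormedModule K} (f : K -> V) (x : K) (l : V) :
  is_derive f x l <->
  (forall eps : R, 0 < eps -> locally x (fun y => norm (minus (minus (f y) (f x)) (scal (minus y x) l)) <= eps * abs
    (minus y x))).
Proof.
  split.
  - intros [_ H] e He. exact (H x (fun P HP => HP) (mkposreal e He)).
  - intros H. split; [apply is_linear_scal_l|].
    intros y Hy e. apply (@is_filter_lim_locally_unique K (AbsRing_NormedModule K)) in Hy. subst y. exact (H e (cond_pos e)).
Qed.

Lemma addsub (t h : R) : t + h + - t = h.
Proof. ring. Qed.
Lemma subadd (t h : R) : t + (h + - t) = h.
Proof. ring. Qed.

Lemma Cder_eps (f : R -> C) (t : R) (l : C) :
  is_Cder f t l <->
  (forall eps : R, 0 < eps -> exists d, 0 < d /\ forall h, Rabs h < d ->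
     Cmod (f (t + h) - f t - h * l) <= eps * Rabs h).
Proof.
  rewrite derive_eps. split; intros H e He; specialize (H e He).
  - destruct H as [d Hd]. exists d; split; [apply cond_pos|]. intros h Hh.
    specialize (Hd (t + h)). rewrite Cnorm_R in Hd.
    unfold abs, minus, plus, opp in Hd; simpl in Hd.
    rewrite addsub in Hd. rewrite scal_R_Cmult in Hd. apply Hd.
    unfold ball; simpl. unfold AbsRing_ball, abs, minus, plus, opp; simpl. rewrite addsub. exact Hh.
  - destruct H as [d [Hd H]]. exists (mkposreal d Hd). intros y Hy.
    unfold ball in Hy; simpl in Hy. unfold AbsRing_ball, abs, minus, plus, opp in Hy; simpl in Hy.
    specialize (H (y + - t) Hy). rewrite subadd in H.
    rewrite Cnorm_R, scal_R_Cmult. exact H.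
Qed.

Lemma Rder_eps (f : R -> R) (t : R) (l : R) :
  is_derive f t l <->
  (forall eps : R, 0 < eps -> exists d, 0 < d /\ forall h, Rabs h < d ->
     Rabs (f (t + h) - f t - h * l) <= eps * Rabs h).
Proof.
  rewrite derive_eps. split; intros H e He; specialize (H e He).
  - destruct H as [d Hd]. exists d; split; [apply cond_pos|]. intros h Hh.
    specialize (Hd (t + h)).
    unfold norm, abs, minus, plus, opp, scal in Hd; simpl in Hd.
    unfold abs, mult in Hd; simpl in Hd.
    rewrite addsub in Hd. apply Hd.
    unfold ball; simpl. unfold AbsRing_ball, abs, minus, plus, opp; simpl. rewrite addsub. exact Hh.
  - destruct H as [d [Hd H]]. exists (mkposreal d Hd). intros y Hy.
    unfold ball in Hy; simpl in Hy. unfold AbsRing_ball, abs, minus, plus, opp in Hy; simpl in Hy.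
    specialize (H (y + - t) Hy). rewrite subadd in H.
    exact H.
Qed.

Lemma im_le_Cmod (c : C) : Rabs (Im c) <= Cmod c.
Proof. eapply Rle_trans; [apply Rmax_r|apply Rmax_Cmod]. Qed.

Lemma Cmod_le_add (c : C) : Cmod c <= Rabs (Re c) + Rabs (Im c).
Proof.
  destruct c as [x y].
  replace (x, y) with (RtoC x + RtoC y * Ci)%C
    by (unfold RtoC, Ci, Cplus, Cmult; simpl; f_equal; ring).
  eapply Rle_trans; [apply Cmod_triangle|]. rewrite Cmod_mult, !Cmod_R.
  replace (Cmod Ci) with 1. simpl.
  - replace (x + (y * 0 - 0 * 1)) with x by ring. replace (0 + (y * 1 + 0 * 0)) with y by ring. lra.
  - unfold Cmod, Ci; simpl. replace (0 * (0 * 1) + 1 * (1 * 1)) with 1 by ring. rewrite sqrt_1; reflexivity.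
Qed.

Lemma Cder_split (f : R -> C) (t : R) (l : C) :
  is_Cder f t l <->
  is_derive (fun s => Re (f s)) t (Re l) /\ is_derive (fun s => Im (f s)) t (Im l).
Proof.
  rewrite Cder_eps, !Rder_eps. split.
  - intros H; split; intros e He; destruct (H e He) as [d [Hd Hd']]; exists d; split; trivial; intros h Hh;
    (eapply Rle_trans; [|apply (Hd' h Hh)]).
    + replace (Re (f (t + h)) - Re (f t) - h * Re l) with (Re (f (t + h)%R - f t - h * l)%C) by (unfold Re, Im, Cminus,
      Copp, Cplus, Cmult, RtoC; simpl; ring).
      apply re_le_Cmod.
    + replace (Im (f (t + h)) - Im (f t) - h * Im l) with (Im (f (t + h)%R - f t - h * l)%C) by (unfold Re, Im, Cminus,
      Copp, Cplus, Cmult, RtoC; simpl; ring).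
      apply im_le_Cmod.
  - intros [H1 H2] e He. destruct (H1 (e / 2)) as [d1 [Hd1 Hd1']]; [lra|]. destruct (H2 (e / 2)) as [d2 [Hd2 Hd2']]; [lra|].
    exists (Rmin d1 d2). split; [apply Rmin_glb_lt; assumption|]. intros h Hh.
    specialize (Hd1' h (Rlt_le_trans _ _ _ Hh (Rmin_l _ _))). specialize (Hd2' h (Rlt_le_trans _ _ _ Hh (Rmin_r _ _))).
    eapply Rle_trans; [apply Cmod_le_add|].
    replace (Re (f (t + h)%R - f t - h * l)%C) with (Re (f (t + h)) - Re (f t) - h * Re l) by (unfold Re, Im, Cminus,
      Copp, Cplus, Cmult, RtoC; simpl; ring).
    replace (Im (f (t + h)%R - f t - h * l)%C) with (Im (f (t + h)) - Im (f t) - h * Im l) by (unfold Re, Im, Cminus,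
      Copp, Cplus, Cmult, RtoC; simpl; ring).
    lra.
Qed.

Lemma Cder_ext (f g : R -> C) (t : R) (l : C) : (forall s, f s = g s) -> is_Cder f t l -> is_Cder g t l.
Proof. intros H. apply is_derive_ext. exact H. Qed.

Lemma Cder_const (c : C) (t : R) : is_Cder (fun _ => c) t (RtoC 0).
Proof. exact (@is_derive_const R_AbsRing C_R_NormedModule c t). Qed.

Lemma Cder_plus (f g : R -> C) t l m : is_Cder f t l -> is_Cder g t m -> is_Cder (fun s => f s + g s)%C t (l + m)%C.
Proof. exact (@is_derive_plus R_AbsRing C_R_NormedModule f g t l m). Qed.

Lemma Cder_mult (f g : R -> C) t l m : is_Cder f t l -> is_Cder g t m ->
  is_Cder (fun s => f s * g s)%C t (l * g t + f t * m)%C.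
Proof.
  rewrite !Cder_split. intros [H1 H2] [H3 H4].
  assert (Hm : forall (f g : R -> R) t l m, is_derive f t l -> is_derive g t m ->
     is_derive (fun s => f s * g s) t (l * g t + f t * m)).
  { intros f0 g0 t0 l0 m0 Ha Hb. exact (is_derive_mult f0 g0 t0 l0 m0 Ha Hb Rmult_comm). }
  split.
  - eapply is_derive_ext; [|eapply evar_last; [apply (@is_derive_minus R_AbsRing R_NormedModule); [apply (Hm _ _ _ _ _
    H1 H3)|apply (Hm _ _ _ _ _ H2 H4)]|]].
    + intros s; reflexivity.
    + unfold minus, plus, opp, Re, Im, Cplus, Cmult; simpl. ring.
  - eapply is_derive_ext; [|eapply evar_last; [apply (@is_derive_plus R_AbsRing R_NormedModule); [apply (Hm _ _ _ _ _
    H1 H4)|apply (Hm _ _ _ _ _ H2 H3)]|]].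
    + intros s; reflexivity.
    + unfold plus, Re, Im, Cplus, Cmult; simpl. ring.
Qed.

Lemma Cder_RtoC (f : R -> R) t l : is_derive f t l -> is_Cder (fun s => RtoC (f s)) t (RtoC l).
Proof. intros H. apply Cder_split; split; simpl; [exact H|apply @is_derive_const]. Qed.

Lemma Cder_id t : is_Cder RtoC t (RtoC 1).
Proof. apply (Cder_RtoC (fun s => s)). apply @is_derive_id. Qed.

Lemma Cder_cmult (c : C) (f : R -> C) t l : is_Cder f t l -> is_Cder (fun s => c * f s)%C t (c * l)%C.
Proof.
  intros H. eapply evar_last; [apply (Cder_mult _ _ _ _ _ (Cder_const c t) H)|]. to_C; ring.
Qed.

(** A chain rule across two fields: the outer derivative is complex, the inner one real. *)
Lemma Cder_comp (F : C -> C) (f : R -> C) t l m : is_Cholo F (f t) m -> is_Cder f t l ->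
  is_Cder (fun s => F (f s)) t (m * l)%C.
Proof.
  intros HF Hf. apply Cder_eps. intros e He.
  (* [A] is a Lipschitz constant of [f] near [t]. The outer error is at most [e / (2 * A)] times
     [A * Rabs h], the inner one at most [Bm * e / (2 * (Bm + 1))] times [Rabs h]; each is at most
     half of the tolerance. *)
  set (A := Cmod l + 1). set (Bm := Cmod m).
  assert (HA : 0 < A) by (unfold A; generalize (Cmod_ge_0 l); lra).
  assert (HB : 0 <= Bm) by apply Cmod_ge_0.
  rewrite derive_eps in HF.
  destruct (HF (e / (2 * A))) as [d1 Hd1]; [apply Rdiv_lt_0_compat; lra|].
  rewrite Cder_eps in Hf.
  destruct (Hf (Rmin 1 (e / (2 * (Bm + 1))))) as [d2 [Hd2 Hd2']].
  { apply Rmin_glb_lt; [lra|apply Rdiv_lt_0_compat; lra]. }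
  exists (Rmin d2 (d1 / (2 * A))). split.
  { apply Rmin_glb_lt; trivial. apply Rdiv_lt_0_compat; [apply cond_pos|lra]. }
  intros h Hh.
  assert (Hh1 : Rabs h < d2) by (eapply Rlt_le_trans; [exact Hh|apply Rmin_l]).
  assert (Hh2 : Rabs h < d1 / (2 * A)) by (eapply Rlt_le_trans; [exact Hh|apply Rmin_r]).
  specialize (Hd2' h Hh1).
  assert (Hq : Cmod (f (t + h)%R - f t - h * l) <= Rabs h).
  { eapply Rle_trans; [exact Hd2'|]. generalize (Rmin_l 1 (e / (2 * (Bm + 1)))) (Rabs_pos h). nra. }
  assert (Hq2 : Cmod (f (t + h)%R - f t - h * l) <= e / (2 * (Bm + 1)) * Rabs h).
  { eapply Rle_trans; [exact Hd2'|]. apply Rmult_le_compat_r; [apply Rabs_pos|apply Rmin_r]. }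
  assert (Hn : Cmod (f (t + h)%R - f t) <= A * Rabs h).
  { replace (f (t + h)%R - f t)%C with ((f (t + h)%R - f t - h * l) + h * l)%C by ring.
    eapply Rle_trans; [apply Cmod_triangle|]. rewrite Cmod_mult, Cmod_R. unfold A. nra. }
  specialize (Hd1 (f (t + h)%R)).
  change (Cmod (f (t + h)%R - f t) < d1 -> Cmod (F (f (t + h)%R) - F (f t) - (f (t + h)%R - f t) * m) <= e / (2 * A) *
    Cmod (f (t + h)%R - f t)) in Hd1.
  assert (Hb : Cmod (f (t + h)%R - f t) < d1).
  { eapply Rle_lt_trans; [exact Hn|].
    apply (Rmult_lt_compat_l A) in Hh2; [|lra].
    replace (A * (d1 / (2 * A))) with (d1 / 2) in Hh2 by (field; lra).
    generalize (cond_pos d1). lra. }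
  specialize (Hd1 Hb).
  replace (F (f (t + h)%R) - F (f t) - h * (m * l))%C with
    ((F (f (t + h)%R) - F (f t) - (f (t + h)%R - f t) * m) + m * (f (t + h)%R - f t - h * l))%C by ring.
  eapply Rle_trans; [apply Cmod_triangle|]. rewrite Cmod_mult. fold Bm.
  assert (e / (2 * A) * Cmod (f (t + h)%R - f t) <= e / 2 * Rabs h).
  { apply (Rmult_le_compat_l (e / (2 * A))) in Hn; [|apply Rlt_le, Rdiv_lt_0_compat; lra].
    replace (e / (2 * A) * (A * Rabs h)) with (e / 2 * Rabs h) in Hn by (field; lra). exact Hn. }
  assert (Bm * Cmod (f (t + h)%R - f t - h * l) <= e / 2 * Rabs h).
  { apply (Rmult_le_compat_l Bm) in Hq2; [|lra]. eapply Rle_trans; [exact Hq2|].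
    replace (Bm * (e / (2 * (Bm + 1)) * Rabs h)) with (Bm / (Bm + 1) * (e / 2 * Rabs h)) by (field; lra).
    assert (Bm / (Bm + 1) <= 1). { apply Rle_div_l; lra. }
    assert (0 <= e / 2 * Rabs h). { apply Rmult_le_pos; [lra|apply Rabs_pos]. }
    nra. }
  lra.
Qed.

Lemma Cder_continuous (f : R -> C) t l : is_Cder f t l -> Ccont f t.
Proof. intros H. apply (@ex_derive_continuous R_AbsRing C_R_NormedModule f t). exists l; exact H. Qed.

Lemma Ccont_split (f : R -> C) t :
  Ccont f t <->
  continuous (fun s => Re (f s)) t /\ continuous (fun s => Im (f s)) t.
Proof. exact (filterlim_C_split (locally t) f (f t)). Qed.

Lemma CRInt_split (f : R -> C) a b I :
  is_CRInt f a b I <-> is_RInt (fun s => Re (f s)) a b (Re I) /\ is_RInt (fun s => Im (f s)) a b (Im I).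
Proof.
  split.
  - intros H; split; [exact (@is_RInt_fct_extend_fst R_NormedModule R_NormedModule f a b I H)|exact
    (@is_RInt_fct_extend_snd R_NormedModule R_NormedModule f a b I H)].
  - intros [H1 H2]. destruct I. exact (@is_RInt_fct_extend_pair R_NormedModule R_NormedModule f a b _ _ H1 H2).
Qed.

Lemma CRInt_FTC (f df : R -> C) a b :
  (forall x, Rmin a b <= x <= Rmax a b -> is_Cder f x (df x)) ->
  (forall x, Rmin a b <= x <= Rmax a b -> Ccont df x) ->
  is_CRInt df a b (f b - f a)%C.
Proof. exact (@is_RInt_derive C_R_CompleteNormedModule f df a b). Qed.

Lemma CRInt_unique (f : R -> C) a b I J : is_CRInt f a b I -> is_CRInt f a b J -> I = J.
Proof.
  intros H1 H2. rewrite <- (@is_RInt_unique C_R_CompleteNormedModule f a b I H1).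
  exact (@is_RInt_unique C_R_CompleteNormedModule f a b J H2).
Qed.

Lemma Ccont_mult (f g : R -> C) t : Ccont f t -> Ccont g t ->
  Ccont (fun s => f s * g s)%C t.
Proof.
  rewrite !Ccont_split. intros [H1 H2] [H3 H4]. split; simpl.
  - apply (continuous_minus (fun s => Re (f s) * Re (g s)) (fun s => Im (f s) * Im (g s)));
    apply (continuous_mult (K := R_AbsRing)); assumption.
  - apply (continuous_plus (fun s => Re (f s) * Im (g s)) (fun s => Im (f s) * Re (g s)));
    apply (continuous_mult (K := R_AbsRing)); assumption.
Qed.
Lemma Ccont_plus (f g : R -> C) t : Ccont f t -> Ccont g t ->
  Ccont (fun s => f s + g s)%C t.
Proof. intros H1 H2. exact (@continuous_plus R_UniformSpace R_AbsRing C_R_NormedModule f g t H1 H2). Qed.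
Lemma Ccont_const (c : C) t : Ccont (fun _ => c) t.
Proof. apply continuous_const. Qed.
Lemma Ccont_RtoC (f : R -> R) t : continuous f t -> Ccont (fun s => RtoC (f s)) t.
Proof. intros H. apply Ccont_split; split; simpl; [exact H|apply continuous_const]. Qed.

Lemma CRInt_norm_le (f : R -> C) (g : R -> R) a b I J : a <= b ->
  (forall x, a <= x <= b -> Cmod (f x) <= g x) -> is_CRInt f a b I -> is_RInt g a b J -> Cmod I <= J.
Proof.
  intros Hab H HI HJ. rewrite <- Cnorm_R.
  apply (@norm_RInt_le C_R_NormedModule f g a b I J Hab); trivial. intros x Hx. rewrite Cnorm_R. auto.
Qed.

Lemma CRInt_cmult (c : C) (f : R -> C) a b I : is_CRInt f a b I -> is_CRInt (fun s => c * f s)%C a b (c * I)%C.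
Proof.
  rewrite !CRInt_split. intros [H1 H2]. split.
  - apply (@is_RInt_minus R_NormedModule (fun s => Re c * Re (f s)) (fun s => Im c * Im (f s)) a b);
    apply (@is_RInt_scal R_NormedModule); assumption.
  - apply (@is_RInt_plus R_NormedModule (fun s => Re c * Im (f s)) (fun s => Im c * Re (f s)) a b);
    apply (@is_RInt_scal R_NormedModule); assumption.
Qed.

Lemma CRInt_plus (f g : R -> C) a b I J : is_CRInt f a b I -> is_CRInt g a b J -> is_CRInt (fun s => f s + g s)%C a b
  (I + J)%C.
Proof. exact (@is_RInt_plus C_R_NormedModule f g a b I J). Qed.

Lemma CRInt_ext (f g : R -> C) a b I : (forall x, Rmin a b < x < Rmax a b -> f x = g x) -> is_CRInt f a b I -> is_CRInt
  g a b I.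
Proof. exact (@is_RInt_ext C_R_NormedModule f g a b I). Qed.

(** Term-by-term integration under a uniform majorant. *)
Lemma CRInt_series (f : nat -> R -> C) (g : R -> C) (B : nat -> R) a b (I : nat -> C) : a <= b ->
  (forall k, is_CRInt (f k) a b (I k)) ->
  (forall k t, a <= t <= b -> Cmod (f k t) <= B k) -> ex_series B ->
  (forall t, a <= t <= b -> is_Cser (fun k => f k t) (g t)) ->
  exists J : C, is_Cser I J /\ is_CRInt g a b J.
Proof.
  intros Hab HI HB HBs Hg.
  (* Clamping the variable to [[a, b]] makes the convergence uniform on the whole line, as
     [filterlim_RInt] requires. *)
  pose (cl := fun t => Rmax a (Rmin b t)).
  assert (Hcl : forall t, a <= cl t <= b).
  { intros t; unfold cl. split; [apply Rmax_l|]. apply Rmax_lub; [lra|apply Rmin_l]. }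
  assert (Hcl' : forall t, a <= t <= b -> cl t = t).
  { intros t Ht; unfold cl. rewrite Rmin_right by lra. apply Rmax_right; lra. }
  destruct (@filterlim_RInt nat C_R_CompleteNormedModule (fun N t => Csum (fun k => f k (cl t)) N) a b eventually _
     (fun t => g (cl t)) (fun N => Csum I N)) as [J [H1 H2]].
  - intros N. induction N.
    + rewrite sum_O. apply (CRInt_ext (f 0%nat)); [|apply HI].
      rewrite Rmin_left, Rmax_right by lra. intros x Hx. rewrite sum_O, Hcl' by lra. reflexivity.
    + rewrite sum_Sn. apply (CRInt_ext (fun t => Csum (fun k => f k (cl t)) N + f (S N) t)%C); [|apply CRInt_plus;
      [exact IHN|apply HI]].
      rewrite Rmin_left, Rmax_right by lra. intros x Hx. rewrite sum_Sn, (Hcl' x) by lra. reflexivity.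
  - apply filterlim_locally. intros eps.
    destruct (series_tail_small B eps HBs (cond_pos eps)) as [N HN].
    exists N; intros n Hn x. specialize (HN n Hn).
    apply (@norm_compat1 R_AbsRing C_R_NormedModule). rewrite Cnorm_R.
    change (Cmod (Csum (fun k => f k (cl x)) n - g (cl x)) < eps).
    rewrite <- Cmod_opp.
    replace (- (Csum (fun k => f k (cl x)) n - g (cl x)))%C with (g (cl x) - Csum (fun k => f k (cl x)) n)%C by ring.
    eapply Rle_lt_trans; [|exact HN]. apply Cser_tail; auto.
  - exists J; split; [exact H1|].
    apply (CRInt_ext (fun t => g (cl t))); [|exact H2].
    rewrite Rmin_left, Rmax_right by lra. intros x Hx. rewrite Hcl' by lra. reflexivity.
Qed.

Lemma CRInt_gen_0_infty (f : R -> C) (J : R -> C) (I : C) :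
  (forall T, 0 <= T -> is_CRInt f 0 T (J T)) -> filterlim J (Rbar_locally p_infty) (locally I) ->
  @is_RInt_gen C_R_NormedModule f (at_point 0) (Rbar_locally p_infty) I.
Proof.
  intros H HJ P HP. specialize (HJ P HP).
  destruct HJ as [M HM].
  apply (Filter_prod _ _ _ (fun x => x = 0) (fun y => Rmax 0 M < y)).
  - reflexivity.
  - exists (Rmax 0 M); auto.
  - intros x y -> Hy. exists (J y). split.
    + apply H. generalize (Rmax_l 0 M); lra.
    + apply HM. generalize (Rmax_r 0 M); lra.
Qed.

Lemma exp_RInt (k T : R) : 0 < k -> 0 <= T -> is_RInt (fun t => exp (- (k * t))) 0 T ((1 - exp (- (k * T))) / k).
Proof.
  intros Hk HT.
  replace ((1 - exp (- (k * T))) / k) with (minus (- exp (- (k * T)) / k) (- exp (- (k * 0)) / k)).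
  - apply (@is_RInt_derive R_CompleteNormedModule (fun t => - exp (- (k * t)) / k)).
    + intros x _. auto_derive; trivial. field. lra.
    + intros x _. apply (@ex_derive_continuous R_AbsRing R_NormedModule). auto_derive; trivial.
  - unfold minus, plus, opp; simpl. rewrite Rmult_0_r, Ropp_0, exp_0. field. lra.
Qed.

(** The integrals over [[0, T]] are bounded by [B n / k] uniformly in [T], so [tannery] applies with
    [T] as the parameter. *)
Lemma CRInt_gen_series (f : nat -> R -> C) (g : R -> C) (B : nat -> R) (k : R)
  (J : nat -> R -> C) (I : nat -> C) : 0 < k ->
  (forall n T, 0 <= T -> is_CRInt (f n) 0 T (J n T)) ->
  (forall n t, 0 <= t -> Cmod (f n t) <= B n * exp (- (k * t))) -> ex_series B ->
  (forall t, 0 <= t -> is_Cser (fun n => f n t) (g t)) ->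
  (forall n, filterlim (J n) (Rbar_locally p_infty) (locally (I n))) ->
  exists (L : C) (G : R -> C), is_Cser I L /\ (forall T, 0 <= T -> is_CRInt g 0 T (G T)) /\ filterlim G (Rbar_locally
    p_infty) (locally L).
Proof.
  intros Hk HJ HB HBs Hg HI.
  assert (HB0 : forall n, 0 <= B n).
  { intros n. specialize (HB n 0 (Rle_refl _)). rewrite Rmult_0_r, Ropp_0, exp_0 in HB.
    generalize (Cmod_ge_0 (f n 0)); lra. }
  (* [Rmax 0 T] extends the integrals to negative [T] as well, since the bounds of [tannery] must
     hold for every value of the parameter. *)
  assert (HG : forall T, exists G, is_Cser (fun n => J n (Rmax 0 T)) G /\ is_CRInt g 0 (Rmax 0 T) G).
  { intros T. apply (CRInt_series f g B).
    - apply Rmax_l.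
    - intros n; apply HJ, Rmax_l.
    - intros n t [Ht _]. eapply Rle_trans; [apply HB; exact Ht|].
      rewrite <- (Rmult_1_r (B n)) at 2. apply Rmult_le_compat_l; [apply HB0|].
      rewrite <- exp_0. destruct (Req_dec t 0) as [->|Hne]; [rewrite Rmult_0_r, Ropp_0; lra|].
      apply Rlt_le, exp_increasing. assert (0 < k * t) by (apply Rmult_lt_0_compat; lra). lra.
    - exact HBs.
    - intros t [Ht _]; apply Hg, Ht. }
  pose (G := fun T => RInt (V := C_R_CompleteNormedModule) g 0 (Rmax 0 T)).
  assert (HG' : forall T, is_Cser (fun n => J n (Rmax 0 T)) (G T) /\ is_CRInt g 0 (Rmax 0 T) (G T)).
  { intros T. destruct (HG T) as [x [H1 H2]]. unfold G.
    rewrite (@is_RInt_unique C_R_CompleteNormedModule g 0 (Rmax 0 T) x H2). split; assumption. }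
  destruct (tannery (Rbar_locally p_infty) (fun T n => J n (Rmax 0 T)) G I (fun n => B n * / k)) as [L [H1 H2]].
  - intros T n.
    replace (B n * / k) with (B n * (1 / k)) by (unfold Rdiv; ring).
    assert (Hr := exp_RInt k (Rmax 0 T) Hk (Rmax_l 0 T)).
    apply (@is_RInt_scal R_NormedModule _ _ _ (B n)) in Hr.
    eapply Rle_trans; [apply (CRInt_norm_le (f n) _ 0 (Rmax 0 T) _ _ (Rmax_l 0 T) (fun x Hx => HB n x (proj1 Hx)) (HJ n
      _ (Rmax_l 0 T)) Hr)|].
    apply Rmult_le_compat_l; [apply HB0|]. apply Rmult_le_compat_r; [apply Rlt_le, Rinv_0_lt_compat, Hk|].
    generalize (exp_pos (- (k * Rmax 0 T))); lra.
  - apply (ex_series_scal_r (/ k)). exact HBs.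
  - intros T; apply HG'.
  - intros n. eapply filterlim_ext_loc; [|apply HI].
    exists 0. intros x Hx. rewrite Rmax_right by lra. reflexivity.
  - exists L, G. split; [exact H1|]. split; [|exact H2].
    intros T HT. destruct (HG' T) as [_ H3]. rewrite Rmax_right in H3 by lra. exact H3.
Qed.

(** Cauchy criterion: the integral over [[S, T]] is at most [B / k * exp (- (k * S))]. *)
Lemma CRInt_lim_exp (f : R -> C) (J : R -> C) (B k : R) : 0 < k ->
  (forall T, 0 <= T -> is_CRInt f 0 T (J T)) ->
  (forall t, 0 <= t -> Cmod (f t) <= B * exp (- (k * t))) ->
  exists I : C, filterlim J (Rbar_locally p_infty) (locally I).
Proof.
  intros Hk HJ HB.
  assert (HB0 : 0 <= B).
  { specialize (HB 0 (Rle_refl _)). rewrite Rmult_0_r, Ropp_0, exp_0 in HB. generalize (Cmod_ge_0 (f 0)); lra. }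
  apply (@filterlim_locally_cauchy R C_R_CompleteNormedModule (Rbar_locally p_infty) _ J).
  intros eps.
  assert (Hb : forall S T, 0 <= S -> S <= T -> Cmod (J T - J S) <= B / k * exp (- (k * S))).
  { intros S T HS HT.
    assert (HI : is_CRInt f S T (J T - J S)%C).
    { assert (H1 := @is_RInt_swap C_R_NormedModule f S 0 (J S) (HJ S HS)).
      assert (H2 := @is_RInt_Chasles C_R_NormedModule f S 0 T _ _ H1 (HJ T ltac:(lra))).
      replace (J T - J S)%C with (- J S + J T)%C by ring. exact H2. }
    assert (Hr : is_RInt (fun t => B * exp (- (k * t))) S T (B * ((1 - exp (- (k * T))) / k) - B * ((1 - exp (- (k *
      S))) / k))).
    { assert (H1 := exp_RInt k S Hk HS). assert (H2 := exp_RInt k T Hk ltac:(lra)).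
      apply (@is_RInt_scal R_NormedModule _ _ _ B) in H1. apply (@is_RInt_scal R_NormedModule _ _ _ B) in H2.
      apply (@is_RInt_swap R_NormedModule) in H1.
      assert (H3 := @is_RInt_Chasles R_NormedModule _ _ _ _ _ _ H1 H2).
      eapply evar_last; [exact H3|]. unfold plus, opp, scal; simpl; unfold mult; simpl. ring. }
    eapply Rle_trans; [apply (CRInt_norm_le f _ S T _ _ HT (fun x Hx => HB x ltac:(lra)) HI Hr)|].
    unfold Rdiv. generalize (exp_pos (- (k * T))); intros HE.
    assert (0 <= B * / k * exp (- (k * T))). { apply Rmult_le_pos; [apply Rmult_le_pos; [lra|apply Rlt_le,
      Rinv_0_lt_compat, Hk]|lra]. }
    lra. }
  assert (Hlim : exists S, 0 <= S /\ B / k * exp (- (k * S)) < eps).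
  (* With this [S], [exp (k * S) >= 1 + k * S] exceeds [B / k / eps]. *)
  { exists (B / k / k / eps).
    assert (0 <= B / k) by (apply Rmult_le_pos; [lra|apply Rlt_le, Rinv_0_lt_compat, Hk]).
    generalize (cond_pos eps); intros He.
    assert (H0 : 0 <= B / k / k / eps).
    { repeat apply Rmult_le_pos; try lra; apply Rlt_le, Rinv_0_lt_compat; lra. }
    split; [exact H0|].
    rewrite exp_Ropp.
    assert (Hx := exp_ineq1_le (k * (B / k / k / eps))).
    assert (He1 : 0 < exp (k * (B / k / k / eps))) by apply exp_pos.
    apply (Rmult_lt_reg_r (exp (k * (B / k / k / eps)))); [exact He1|].
    rewrite Rmult_assoc, Rinv_l, Rmult_1_r by lra.
    replace (k * (B / k / k / eps)) with (B / k / eps) in * by (field; lra).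
    assert (eps * (1 + B / k / eps) = eps + B / k) by (field; lra). nra. }
  destruct Hlim as [S [HS0 HS]].
  exists (fun T => S < T). split.
  - exists S; auto.
  - intros u v Hu Hv.
    assert (Hmain : forall u v, S < u -> u <= v -> Cmod (J v - J u) < eps).
    { intros u0 v0 Hu0 Hv0. eapply Rle_lt_trans; [apply Hb; lra|]. eapply Rle_lt_trans; [|exact HS].
      apply Rmult_le_compat_l; [apply Rmult_le_pos; [lra|apply Rlt_le, Rinv_0_lt_compat, Hk]|].
      apply Rlt_le, exp_increasing. nra. }
    apply (@norm_compat1 R_AbsRing C_R_NormedModule). rewrite Cnorm_R.
    change (Cmod (J v - J u) < eps).
    destruct (Rle_dec u v).
    + apply Hmain; assumption.
    + rewrite <- Cmod_opp. replace (- (J v - J u))%C with (J u - J v)%C by ring. apply Hmain; lra.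
Qed.

(** * Power series and the exponential *)

Lemma Cpow_pow_n (z : C) (k : nat) : @pow_n C_Ring z k = (z ^ k)%C.
Proof. induction k; [reflexivity|]. change (z * @pow_n C_Ring z k = z * z ^ k)%C. rewrite IHk. reflexivity. Qed.

Lemma Cpseries_iff (a : nat -> C) (z l : C) :
  @is_pseries C_AbsRing C_NormedModule a z l <-> is_Cser (fun k => a k * z ^ k)%C l.
Proof.
  unfold is_pseries. split; apply Cser_ext; intros k;
  rewrite <- Cpow_pow_n; [rewrite Cmult_comm; reflexivity|apply Cmult_comm].
Qed.

(** With [p = sqrt q] the quantity is the square of [INR k * p ^ k], which Bernoulli's inequality
    for [/ p = 1 + d] bounds by [/ d]. *)
Lemma sq_mul_pow_bounded (q : R) : 0 <= q < 1 -> exists K, 0 <= K /\ forall k, INR k ^ 2 * q ^ k <= K.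
Proof.
  intros [Hq0 Hq1]. destruct (Req_dec q 0) as [->|Hq].
  { exists 0. split; [lra|]. intros [|k]; simpl; lra. }
  set (p := sqrt q). assert (Hp : 0 < p) by (apply sqrt_lt_R0; lra).
  assert (Hpp : p * p = q) by (apply sqrt_sqrt; lra).
  assert (Hp1 : p < 1) by nra.
  set (d := / p - 1). assert (Hd : 0 < d).
  { unfold d. assert (1 < / p) by (rewrite <- Rinv_1; apply Rinv_lt_contravar; lra). lra. }
  exists (/ d * / d). split; [apply Rlt_le, Rmult_lt_0_compat; apply Rinv_0_lt_compat, Hd|].
  intros k.
  assert (Hk : INR k * p ^ k <= / d).
  { assert (H := poly k d Hd). unfold d in H at 2. replace (1 + (/ p - 1)) with (/ p) in H by ring.
    rewrite pow_inv in H.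
    assert (0 < p ^ k) by (apply pow_lt; lra).
    apply (Rmult_le_compat_r (p ^ k)) in H; [|lra]. rewrite Rinv_l in H by lra.
    apply (Rmult_le_reg_l d); [lra|]. rewrite Rinv_r by lra. nra. }
  rewrite <- Hpp, Rpow_mult_distr.
  assert (0 <= INR k * p ^ k). { apply Rmult_le_pos; [apply pos_INR|apply pow_le; lra]. }
  replace (INR k ^ 2 * (p ^ k * p ^ k)) with ((INR k * p ^ k) * (INR k * p ^ k)) by ring.
  apply Rmult_le_compat; lra.
Qed.

Lemma ex_series_Rle (a b : nat -> R) : (forall k, 0 <= a k <= b k) -> ex_series b -> ex_series a.
Proof.
  intros H. apply (@ex_series_le R_AbsRing R_CompleteNormedModule a b).
  intros n. unfold norm; simpl; unfold abs; simpl. rewrite Rabs_right; [apply H|apply Rle_ge, H].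
Qed.

Lemma Series_nonneg (a : nat -> R) : (forall k, 0 <= a k) -> ex_series a -> 0 <= Series a.
Proof.
  intros H Ha. eapply Rle_trans; [|apply (sum_n_le_Series a 0 H Ha)]. rewrite sum_O; apply H.
Qed.

(** Second-order Taylor remainder of a power. The factor [rho ^ 2] on the left avoids the exponent
    [k - 1] on the right. In the induction the remainder is multiplied by [z + h] and gains
    [INR (S k) * h ^ 2 * z ^ k]. *)
Lemma pow_diff_bound (z h : C) (rho : R) (k : nat) : Cmod z <= rho -> Cmod (z + h) <= rho ->
  rho ^ 2 * Cmod ((z + h) ^ S k - z ^ S k - INR (S k) * z ^ k * h) <= Cmod h ^ 2 * INR (S k) ^ 2 * rho ^ S k.
Proof.
  intros Hz Hzh. assert (Hr : 0 <= rho) by (eapply Rle_trans; [apply Cmod_ge_0|exact Hz]).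
  induction k.
  - simpl. replace ((z + h) * 1 - z * 1 - 1 * 1 * h)%C with (RtoC 0) by ring. rewrite Cmod_0.
    rewrite Rmult_0_r. generalize (Cmod_ge_0 h). intros. repeat (apply Rmult_le_pos || lra).
  - replace ((z + h) ^ S (S k) - z ^ S (S k) - INR (S (S k)) * z ^ S k * h)%C with
      ((z + h) * ((z + h) ^ S k - z ^ S k - INR (S k) * z ^ k * h) + INR (S k) * h ^ 2 * z ^ k)%C.
    2:{ rewrite (S_INR (S k)), RtoC_plus, !Cpow_S. simpl (z ^ 2)%C. ring. }
    assert (Hpk : Cmod (z ^ k)%C <= rho ^ k).
    { rewrite Cmod_pow. apply pow_incr. split; [apply Cmod_ge_0|exact Hz]. }
    assert (Ht : Cmod ((z + h) * ((z + h) ^ S k - z ^ S k - INR (S k) * z ^ k * h) + INR (S k) * h ^ 2 * z ^ k)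
      <= rho * Cmod ((z + h) ^ S k - z ^ S k - INR (S k) * z ^ k * h) + INR (S k) * Cmod h ^ 2 * rho ^ k).
    { eapply Rle_trans; [apply Cmod_triangle|]. rewrite !Cmod_mult, Cmod_R, Cmod_pow.
      rewrite (Rabs_right (INR (S k))) by apply Rle_ge, pos_INR.
      apply Rplus_le_compat.
      - apply Rmult_le_compat_r; [apply Cmod_ge_0|exact Hzh].
      - apply Rmult_le_compat_l; [apply Rmult_le_pos; [apply pos_INR|apply pow2_ge_0]|].
        exact Hpk. }
    apply (Rmult_le_compat_l (rho ^ 2)) in Ht; [|apply pow2_ge_0].
    eapply Rle_trans; [exact Ht|].
    apply (Rmult_le_compat_l rho) in IHk; [|exact Hr].
    rewrite (S_INR (S k)).
    assert (0 <= Cmod h ^ 2 * rho ^ S (S k)) by (apply Rmult_le_pos; [apply pow2_ge_0|apply pow_le, Hr]).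
    assert (0 <= INR (S k)) by apply pos_INR.
    change (rho ^ S (S k)) with (rho * (rho * rho ^ k)) in *. change (rho ^ S k) with (rho * rho ^ k) in *.
    nra.
Qed.

Lemma pseries_deriv_ex (a : nat -> C) (r : R) (z : C) : 0 < r ->
  ex_series (fun k => Cmod (a k) * r ^ k) -> Cmod z < r ->
  ex_series (fun k => Cmod (INR (S k) * a (S k) * z ^ k)%C).
Proof.
  intros Hr Ha Hz.
  set (rho := (Cmod z + r) / 2). assert (Hz0 := Cmod_ge_0 z).
  destruct (sq_mul_pow_bounded (rho / r)) as [K [HK0 HK]].
  { split; [unfold rho; apply Rmult_le_pos; [lra|apply Rlt_le, Rinv_0_lt_compat, Hr]|].
    apply Rlt_div_l; unfold rho; lra. }
  assert (Hrho : 0 < rho) by (unfold rho; lra).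
  apply ex_series_Rle with (fun k => K / rho * (Cmod (a (S k)) * r ^ S k)).
  - intros k; split; [apply Cmod_ge_0|].
    rewrite !Cmod_mult, Cmod_R, Cmod_pow, Rabs_right by apply Rle_ge, pos_INR.
    specialize (HK (S k)). assert (H1 : 1 <= INR (S k)) by (rewrite S_INR; generalize (pos_INR k); lra).
    assert (Hzk : Cmod z ^ k <= rho ^ k) by (apply pow_incr; unfold rho; lra).
    assert (Hk : INR (S k) * rho ^ S k <= K * r ^ S k).
    { unfold Rdiv in HK. rewrite Rpow_mult_distr, pow_inv in HK.
      assert (0 < r ^ S k) by (apply pow_lt, Hr). assert (0 < rho ^ S k) by (apply pow_lt, Hrho).
      apply (Rmult_le_compat_r (r ^ S k)) in HK; [|lra].
      replace (INR (S k) ^ 2 * (rho ^ S k * / r ^ S k) * r ^ S k) with (INR (S k) ^ 2 * rho ^ S k) in HK by (field; lra).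
      eapply Rle_trans; [|exact HK]. apply Rmult_le_compat_r; [lra|]. set (u := INR (S k)) in *; replace (u ^ 2) with
        (u * u) by ring; nra. }
    assert (Hk' : INR (S k) * rho ^ k <= K / rho * r ^ S k).
    { apply (Rmult_le_reg_l rho); [exact Hrho|]. replace (rho * (K / rho * r ^ S k)) with (K * r ^ S k) by (field; lra).
      change (rho ^ S k) with (rho * rho ^ k) in Hk. lra. }
    assert (HA := Cmod_ge_0 (a (S k))).
    apply Rle_trans with (Cmod (a (S k)) * (INR (S k) * rho ^ k)).
    + replace (INR (S k) * Cmod (a (S k)) * Cmod z ^ k) with (Cmod (a (S k)) * (INR (S k) * Cmod z ^ k)) by ring.
      apply Rmult_le_compat_l; [exact HA|]. apply Rmult_le_compat_l; lra.
    + replace (K / rho * (Cmod (a (S k)) * r ^ S k)) with (Cmod (a (S k)) * (K / rho * r ^ S k)) by ring.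
      apply Rmult_le_compat_l; assumption.
  - apply (ex_series_scal (V := R_NormedModule) (K / rho) (fun k => Cmod (a (S k)) * r ^ S k)). apply (ex_series_incr_1
    (fun k => Cmod (a k) * r ^ k)). exact Ha.
Qed.

(** On a radius [rho] strictly between [Cmod z] and [r], the factor k^2 of [pow_diff_bound] is
    absorbed by (r / rho)^k; the total error is then quadratic in [h]. *)
Lemma pseries_holo (a : nat -> C) (r : R) (F : C -> C) (z l : C) : 0 < r ->
  ex_series (fun k => Cmod (a k) * r ^ k) ->
  (forall w, Cmod w < r -> is_Cser (fun k => a k * w ^ k)%C (F w)) ->
  Cmod z < r -> is_Cser (fun k => INR (S k) * a (S k) * z ^ k)%C l -> is_Cholo F z l.
Proof.
  intros Hr Ha HF Hz Hl.
  set (rho := (Cmod z + r) / 2). assert (Hz0 := Cmod_ge_0 z).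
  destruct (sq_mul_pow_bounded (rho / r)) as [K [HK0 HK]].
  { split; [unfold rho; apply Rmult_le_pos; [lra|apply Rlt_le, Rinv_0_lt_compat, Hr]|].
    apply Rlt_div_l; unfold rho; lra. }
  assert (Hrho : 0 < rho) by (unfold rho; lra).
  set (B := fun k => K / rho ^ 2 * (Cmod (a (S k)) * r ^ S k)).
  assert (HB : ex_series B).
  { apply (ex_series_scal (V := R_NormedModule) (K / rho ^ 2) (fun k => Cmod (a (S k)) * r ^ S k)). apply
    (ex_series_incr_1 (fun k => Cmod (a k) * r ^ k)). exact Ha. }
  assert (Hmain : forall h, Cmod h < rho - Cmod z -> Cmod (F (z + h)%C - F z - h * l) <= Cmod h ^ 2 * Series B).
  { intros h Hh.
    assert (Hzh : Cmod (z + h) <= rho) by (eapply Rle_trans; [apply Cmod_triangle|]; lra).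
    assert (H1 := HF (z + h)%C ltac:(unfold rho in *; lra)). assert (H2 := HF z Hz).
    assert (H3 := Cser_plus _ _ _ _ H1 (Cser_scal (-1) _ _ H2)).
    assert (H4 : is_Cser (fun k => a (S k) * ((z + h) ^ S k - z ^ S k - INR (S k) * z ^ k * h))%C (F (z + h)%C - F z -
      h * l)%C).
    { assert (H5 : is_Cser (fun k => a (S k) * ((z + h) ^ S k - z ^ S k))%C (F (z + h)%C - F z)%C).
      { apply (is_series_incr_1 (V := C_NormedModule) (fun k => a k * ((z + h) ^ k - z ^ k))%C).
        eapply evar_last; [eapply Cser_ext; [|exact H3]|].
        - intros k; cbv beta. ring.
        - change (F (z + h)%C + -1 * F z = (F (z + h)%C - F z) + a 0%nat * (1 - 1))%C. ring. }
      eapply evar_last; [eapply Cser_ext; [|apply (Cser_plus _ _ _ _ H5 (Cser_scal (- h) _ _ Hl))]|].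
      - intros k; cbv beta. ring.
      - to_C; ring. }
    apply Rle_trans with (Series (fun k => Cmod h ^ 2 * B k)); [|rewrite Series_scal_l; lra].
    eapply Cser_norm_le; [|apply (ex_series_scal (V := R_NormedModule) (Cmod h ^ 2) B); exact HB|exact H4].
    intros k; cbv beta. rewrite Cmod_mult.
    assert (Hp := pow_diff_bound z h rho k ltac:(unfold rho; lra) Hzh).
    set (X := Cmod ((z + h) ^ S k - z ^ S k - INR (S k) * z ^ k * h)) in *.
    specialize (HK (S k)). unfold Rdiv in HK. rewrite Rpow_mult_distr, pow_inv in HK.
    assert (Hrk : 0 < r ^ S k) by (apply pow_lt, Hr).
    apply (Rmult_le_compat_r (r ^ S k)) in HK; [|lra].
    replace (INR (S k) ^ 2 * (rho ^ S k * / r ^ S k) * r ^ S k) with (INR (S k) ^ 2 * rho ^ S k) in HK by (field; lra).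
    assert (HX : X <= Cmod h ^ 2 * (K / rho ^ 2 * r ^ S k)).
    { apply (Rmult_le_reg_l (rho ^ 2)); [apply pow_lt, Hrho|].
      eapply Rle_trans; [exact Hp|].
      replace (rho ^ 2 * (Cmod h ^ 2 * (K / rho ^ 2 * r ^ S k))) with (Cmod h ^ 2 * (K * r ^ S k)) by (field; lra).
      rewrite Rmult_assoc. apply Rmult_le_compat_l; [apply pow2_ge_0|exact HK]. }
    unfold B. replace (Cmod h ^ 2 * (K / rho ^ 2 * (Cmod (a (S k)) * r ^ S k))) with
       (Cmod (a (S k)) * (Cmod h ^ 2 * (K / rho ^ 2 * r ^ S k))) by ring.
    apply Rmult_le_compat_l; [apply Cmod_ge_0|exact HX]. }
  assert (HS0 : 0 <= Series B).
  { apply Series_nonneg; [|exact HB]. intros n. unfold B. apply Rmult_le_pos.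
    - apply Rmult_le_pos; [exact HK0|apply Rlt_le, Rinv_0_lt_compat, pow_lt, Hrho].
    - apply Rmult_le_pos; [apply Cmod_ge_0|apply pow_le; lra]. }
  apply derive_eps. intros e He.
  assert (Hd : 0 < Rmin (rho - Cmod z) (e / (Series B + 1))).
  { apply Rmin_glb_lt; [unfold rho; lra|apply Rdiv_lt_0_compat; lra]. }
  exists (mkposreal _ Hd). intros y Hy.
  change (Cmod (y - z) < Rmin (rho - Cmod z) (e / (Series B + 1))) in Hy.
  change (Cmod (F y - F z - (y - z) * l) <= e * Cmod (y - z)).
  specialize (Hmain (y - z)%C (Rlt_le_trans _ _ _ Hy (Rmin_l _ _))).
  assert (Hzy : (z + (y - z))%C = y) by (to_C; ring). rewrite Hzy in Hmain.
  eapply Rle_trans; [exact Hmain|].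
  assert (Hy2 := Rlt_le_trans _ _ _ Hy (Rmin_r _ _)).
  apply Rlt_div_r in Hy2; [|lra].
  generalize (Cmod_ge_0 (y - z)). intros. nra.
Qed.

(** Serves to prove identities between analytic functions: both sides are compared along a ray from
    0, where they agree. *)
Lemma Cder_zero_const (f : R -> C) a b : a <= b ->
  (forall x, a <= x <= b -> is_Cder f x (RtoC 0)) -> f b = f a.
Proof.
  intros Hab H.
  assert (H1 : is_CRInt (fun _ => RtoC 0) a b (f b - f a)%C).
  { apply (CRInt_FTC f).
    - intros x Hx. rewrite Rmin_left, Rmax_right in Hx by lra. apply H, Hx.
    - intros x _. apply Ccont_const. }
  assert (H2 := @is_RInt_const C_R_NormedModule a b (RtoC 0)).
  assert (H3 := CRInt_unique _ _ _ _ _ H1 H2).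
  rewrite scal_R_Cmult, Cmult_0_r in H3.
  apply Ceq_minus. exact H3.
Qed.

Lemma Cexp_plus (z w : C) : Cexp (z + w) = (Cexp z * Cexp w)%C.
Proof.
  unfold Cexp. destruct z as [x y], w as [u v]. simpl. rewrite exp_plus, cos_plus, sin_plus.
  unfold Cmult; simpl. f_equal; ring.
Qed.
Lemma Cexp_0 : Cexp 0 = 1.
Proof. unfold Cexp; simpl. rewrite exp_0, cos_0, sin_0. unfold RtoC; f_equal; ring. Qed.
Lemma Cmod_Cexp (z : C) : Cmod (Cexp z) = exp (Re z).
Proof.
  unfold Cexp, Cmod; simpl.
  match goal with |- sqrt ?e = _ => replace e with (Rsqr (exp (Re z)) * (Rsqr (sin (Im z)) + Rsqr (cos (Im z)))) by
    (unfold Rsqr; ring) end.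
  rewrite sin2_cos2, Rmult_1_r. apply sqrt_Rsqr, Rlt_le, exp_pos.
Qed.
Lemma Cexp_neq_0 (z : C) : Cexp z <> 0.
Proof. intros H. assert (H1 := Cmod_Cexp z). rewrite H, Cmod_0 in H1. generalize (exp_pos (Re z)); lra. Qed.
Lemma Cexp_opp (z : C) : Cexp (- z) = (/ Cexp z)%C.
Proof.
  assert (H : (Cexp (- z) * Cexp z = 1)%C) by (rewrite <- Cexp_plus; replace (- z + z)%C with (RtoC 0) by ring; apply
    Cexp_0).
  assert (Hz := Cexp_neq_0 z).
  replace (Cexp (- z)) with (Cexp (- z) * Cexp z * / Cexp z)%C by (field; exact Hz). rewrite H. ring.
Qed.

Lemma INR_fact_neq_0_C (k : nat) : RtoC (INR (fact k)) <> 0.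
Proof. intros H. apply RtoC_inj in H. exact (INR_fact_neq_0 k H). Qed.

Lemma exp_abs_series (r : R) : 0 <= r -> is_series (fun k => / INR (fact k) * r ^ k) (exp r).
Proof. intros Hr. apply is_pseries_R. apply is_exp_Reals. Qed.

Lemma Cder_Cexp_lin (z : C) (t : R) : is_Cder (fun s => Cexp (RtoC s * z)) t (z * Cexp (RtoC t * z))%C.
Proof.
  apply Cder_split. destruct z as [x y]. split.
  - apply is_derive_ext with (fun s => exp (s * x) * cos (s * y)).
    + intros s. unfold Cexp; simpl. f_equal; f_equal; ring.
    + auto_derive; trivial. unfold Cexp; simpl.
      replace (t * x - 0 * y) with (t * x) by ring. replace (t * y + 0 * x) with (t * y) by ring. ring.
  - apply is_derive_ext with (fun s => exp (s * x) * sin (s * y)).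
    + intros s. unfold Cexp; simpl. f_equal; f_equal; ring.
    + auto_derive; trivial. unfold Cexp; simpl.
      replace (t * x - 0 * y) with (t * x) by ring. replace (t * y + 0 * x) with (t * y) by ring. ring.
Qed.

Lemma Cexp_series (z : C) : is_Cser (fun k => / RtoC (INR (fact k)) * z ^ k)%C (Cexp z).
Proof.
  set (a := fun k => (/ RtoC (INR (fact k)))%C).
  assert (Ha : forall r, 0 <= r -> ex_series (fun k => Cmod (a k) * r ^ k)).
  { intros r Hr. exists (exp r). eapply is_series_ext; [|apply exp_abs_series, Hr].
    intros k; cbv beta. unfold a. rewrite Cmod_inv by apply INR_fact_neq_0_C.
    rewrite Cmod_R, Rabs_right; [reflexivity|]. apply Rle_ge, pos_INR. }
  assert (Hex : forall w, is_Cser (fun k => a k * w ^ k)%C (CSeries (fun k => a k * w ^ k)%C)).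
  { intros w. destruct (ex_Cser_le (fun k => a k * w ^ k)%C (fun k => Cmod (a k) * Cmod w ^ k)) as [l Hl].
    - intros k. rewrite Cmod_mult, Cmod_pow. lra.
    - apply Ha, Cmod_ge_0.
    - rewrite (CSeries_unique _ _ Hl). exact Hl. }
  set (e := fun w => CSeries (fun k => a k * w ^ k)%C) in *.
  assert (Hh : forall w, is_Cholo e w (e w)).
  { intros w. assert (Hw := Cmod_ge_0 w). apply (pseries_holo a (Cmod w + 1) e); try lra.
    - apply Ha; lra.
    - intros v _. apply Hex.
    - eapply Cser_ext; [|apply (Hex w)]. intros k; cbv beta. unfold a.
      change (fact (S k)) with (S k * fact k)%nat. rewrite mult_INR, RtoC_mult. field. split; [apply INR_fact_neq_0_C|].
      intros H. apply RtoC_inj in H. rewrite S_INR in H. generalize (pos_INR k); lra. }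
  replace (Cexp z) with (e z); [apply Hex|].
  (* The power series [e] is its own derivative, so [e (s z) * Cexp (- s z)] is constant in [s],
     with value 1 at 0. *)
  set (g := fun s : R => (e (RtoC s * z) * Cexp (RtoC s * - z))%C).
  assert (Hg : g 1 = g 0).
  { apply Cder_zero_const; [lra|]. intros x _. unfold g.
    eapply evar_last; [apply Cder_mult; [apply (Cder_comp e (fun s => RtoC s * z)%C); [apply Hh|]|apply Cder_Cexp_lin]|].
    - eapply Cder_ext; [|apply (Cder_cmult z), Cder_id]. intros s; cbv beta; ring.
    - to_C; ring. }
  unfold g in Hg. replace (1 * z)%C with z in Hg by ring. replace (1 * - z)%C with (- z)%C in Hg by ring.
  replace (0 * z)%C with (RtoC 0) in Hg by ring. replace (0 * - z)%C with (RtoC 0) in Hg by ring.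
  rewrite Cexp_0, Cexp_opp in Hg.
  assert (He0 : e 0 = 1).
  { unfold e. apply CSeries_unique. apply is_Cser_eps. intros eps Heps. exists 0%nat. intros n _.
    replace (Csum (fun k => a k * 0 ^ k)%C n) with (RtoC 1).
    - replace (1 - 1)%C with (RtoC 0) by ring. rewrite Cmod_0; exact Heps.
    - induction n; [rewrite sum_O; unfold a; simpl; field|].
      rewrite sum_Sn, <- IHn. change (RtoC 1 = 1 + a (S n) * (0 * 0 ^ n))%C. ring. }
  rewrite He0 in Hg. assert (Hz := Cexp_neq_0 z).
  replace (e z) with (e z * / Cexp z * Cexp z)%C by (field; exact Hz). rewrite Hg. ring.
Qed.

Lemma Cholo_Cexp (z : C) : is_Cholo Cexp z (Cexp z).
Proof.
  assert (Hw := Cmod_ge_0 z).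
  apply (pseries_holo (fun k => (/ RtoC (INR (fact k)))%C) (Cmod z + 1)); try lra.
  - exists (exp (Cmod z + 1)). eapply is_series_ext; [|apply exp_abs_series; lra].
    intros k; cbv beta. rewrite Cmod_inv by apply INR_fact_neq_0_C.
    rewrite Cmod_R, Rabs_right; [reflexivity|]. apply Rle_ge, pos_INR.
  - intros w _; apply Cexp_series.
  - eapply Cser_ext; [|apply (Cexp_series z)]. intros k; cbv beta.
    change (fact (S k)) with (S k * fact k)%nat. rewrite mult_INR, RtoC_mult. field. split; [apply INR_fact_neq_0_C|].
    intros H. apply RtoC_inj in H. rewrite S_INR in H. generalize (pos_INR k); lra.
Qed.

Lemma Cder_Cexp (f : R -> C) t l : is_Cder f t l -> is_Cder (fun s => Cexp (f s)) t (Cexp (f t) * l)%C.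
Proof. intros H. apply Cder_comp; [apply Cholo_Cexp|exact H]. Qed.

(** * Analyticity by majorants *)

(* [F] is, near [s0], a power series whose coefficients have weighted l^1-norm at most [B] for the radius [r].
   These norms are submultiplicative, so analyticity of series and integrals of such functions reduces to bounds. *)
Definition wiener (s0 : C) (r : R) (F : C -> C) (B : R) : Prop :=
  exists a : nat -> C,
    ex_series (fun k => Cmod (a k) * r ^ k) /\ Series (fun k => Cmod (a k) * r ^ k) <= B /\
    forall s, Cmod (s - s0) <= r -> is_Cser (fun k => a k * (s - s0) ^ k)%C (F s).

Lemma Cser_RtoC (a : nat -> R) (l : R) : is_series a l -> is_Cser (fun k => RtoC (a k)) (RtoC l).
Proof.
  intros H. apply is_Cser_split. simpl. split; [exact H|].
  apply (proj2 (proj1 (is_Cser_split _ _) Cser_zero)).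
Qed.

Lemma wiener_analytic s0 r F B : 0 < r -> wiener s0 r F B -> analytic_at F s0.
Proof.
  intros Hr [a [_ [_ H]]]. exists a, r. split; [exact Hr|]. intros z Hz. apply Cpseries_iff, H. lra.
Qed.

Lemma wiener_ext s0 r F G B : (forall s, Cmod (s - s0) <= r -> F s = G s) -> wiener s0 r F B -> wiener s0 r G B.
Proof. intros H [a [H1 [H2 H3]]]. exists a. repeat split; trivial. intros s Hs. rewrite <- H; auto. Qed.

Lemma wiener_le s0 r F B B' : B <= B' -> wiener s0 r F B -> wiener s0 r F B'.
Proof. intros H [a [H1 [H2 H3]]]. exists a. repeat split; trivial. lra. Qed.

Lemma wiener_nonneg s0 r F B : 0 < r -> wiener s0 r F B -> 0 <= B.
Proof.
  intros Hr [a [H1 [H2 _]]]. eapply Rle_trans; [|exact H2]. apply Series_nonneg; [|exact H1].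
  intros k. apply Rmult_le_pos; [apply Cmod_ge_0|apply pow_le; lra].
Qed.

Lemma wiener_norm s0 r F B s : 0 < r -> wiener s0 r F B -> Cmod (s - s0) <= r -> Cmod (F s) <= B.
Proof.
  intros Hr [a [H1 [H2 H3]]] Hs. eapply Rle_trans; [|exact H2].
  eapply Cser_norm_le; [|exact H1|exact (H3 s Hs)].
  intros k; cbv beta. rewrite Cmod_mult, Cmod_pow. apply Rmult_le_compat_l; [apply Cmod_ge_0|].
  apply pow_incr. split; [apply Cmod_ge_0|exact Hs].
Qed.

Lemma Cser_eventually_0 (a : nat -> C) N : (forall k, (N < k)%nat -> a k = 0) -> is_Cser a (Csum a N).
Proof.
  intros H. apply is_Cser_eps. intros e He. exists N. intros n Hn.
  replace (Csum a n) with (Csum a N).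
  - replace (Csum a N - Csum a N)%C with (RtoC 0) by ring. rewrite Cmod_0; exact He.
  - induction Hn; [reflexivity|]. rewrite sum_Sn, <- IHHn, H by lia. symmetry. apply Cplus_0_r.
Qed.

Lemma wiener_const s0 r c : wiener s0 r (fun _ => c) (Cmod c).
Proof.
  exists (fun k => match k with O => c | _ => RtoC 0 end).
  assert (H : is_series (fun k => Cmod (match k with O => c | _ => RtoC 0 end) * r ^ k) (Cmod c)).
  { apply is_series_decr_1. apply is_series_ext with (fun _ => 0).
    - intros n. rewrite Cmod_0; to_R; ring.
    - unfold plus, opp; simpl. rewrite Rmult_1_r, Rplus_opp_r. exact (proj1 (proj1 (is_Cser_split _ _) Cser_zero)). }
  repeat split.
  - eexists; exact H.
  - rewrite (is_series_unique _ _ H). lra.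
  - intros s _. eapply evar_last; [apply (Cser_eventually_0 _ 0)|].
    + intros [|k] Hk; [lia|]. ring.
    + rewrite sum_O. simpl. to_C; ring.
Qed.

Lemma wiener_plus s0 r F G A B : wiener s0 r F A -> wiener s0 r G B -> 0 < r -> wiener s0 r (fun s => F s + G s)%C (A + B).
Proof.
  intros [a [H1 [H2 H3]]] [b [K1 [K2 K3]]] Hr. exists (fun k => a k + b k)%C.
  assert (He := ex_series_plus _ _ H1 K1).
  assert (Hle : forall k, 0 <= Cmod (a k + b k) * r ^ k <= Cmod (a k) * r ^ k + Cmod (b k) * r ^ k).
  { intros k. split.
    - apply Rmult_le_pos; [apply Cmod_ge_0|apply pow_le; lra].
    - rewrite <- Rmult_plus_distr_r. apply Rmult_le_compat_r; [apply pow_le; lra|apply Cmod_triangle]. }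
  repeat split.
  - eapply ex_series_Rle; [exact Hle|exact He].
  - eapply Rle_trans; [apply Series_le; [exact Hle|exact He]|]. rewrite Series_plus by assumption. lra.
  - intros s Hs. eapply Cser_ext; [|apply (Cser_plus _ _ _ _ (H3 s Hs) (K3 s Hs))]. intros k; cbv beta; ring.
Qed.

Lemma wiener_scal s0 r F A c : wiener s0 r F A -> wiener s0 r (fun s => c * F s)%C (Cmod c * A).
Proof.
  intros [a [H1 [H2 H3]]]. exists (fun k => c * a k)%C.
  assert (Hx : forall k, Cmod c * (Cmod (a k) * r ^ k) = Cmod (c * a k) * r ^ k) by (intros k; rewrite Cmod_mult; ring).
  repeat split.
  - eapply ex_series_ext; [exact Hx|]. apply (ex_series_scal (V := R_NormedModule)); exact H1.
  - rewrite <- (Series_ext _ _ Hx), Series_scal_l. apply Rmult_le_compat_l; [apply Cmod_ge_0|exact H2].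
  - intros s Hs. eapply Cser_ext; [|apply (Cser_scal c _ _ (H3 s Hs))]. intros k; cbv beta; ring.
Qed.

Lemma wiener_var s0 r F A : 0 < r -> wiener s0 r F A -> wiener s0 r (fun s => (s - s0) * F s)%C (r * A).
Proof.
  intros Hr [a [H1 [H2 H3]]]. exists (fun k => match k with O => RtoC 0 | S n => a n end).
  assert (H : is_series (fun k => Cmod (match k with O => RtoC 0 | S n => a n end) * r ^ k) (r * Series (fun k => Cmod
    (a k) * r ^ k))).
  { apply is_series_decr_1. eapply evar_last; [eapply is_series_ext; [|apply (is_series_scal (V := R_NormedModule) r);
    apply Series_correct, H1]|].
    - intros n. unfold scal; simpl; unfold mult; simpl. to_R; ring.
    - unfold plus, opp, scal; simpl; unfold mult; simpl. rewrite Cmod_0; ring. }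
  repeat split.
  - eexists; exact H.
  - rewrite (is_series_unique _ _ H). apply Rmult_le_compat_l; lra.
  - intros s Hs. apply (is_series_decr_1 (V := C_NormedModule)).
    eapply evar_last; [eapply Cser_ext; [|apply (Cser_scal (s - s0) _ _ (H3 s Hs))]|].
    + intros k; cbv beta. rewrite Cpow_S; ring.
    + unfold plus, opp; simpl. to_C; ring.
Qed.

Lemma wiener_var_pow s0 r F A k : 0 < r -> wiener s0 r F A -> wiener s0 r (fun s => (s - s0) ^ k * F s)%C (r ^ k * A).
Proof.
  intros Hr HF. induction k.
  - simpl. rewrite Rmult_1_l. eapply wiener_ext; [|exact HF]. intros s _; cbv beta; ring.
  - simpl. rewrite Rmult_assoc. eapply wiener_ext; [|apply wiener_var; [exact Hr|exact IHk]]. intros s _; cbv beta; ring.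
Qed.

(** Tonelli for nonnegative entries, with the bound by [Series B] retained. *)
Lemma double_series_real (b : nat -> nat -> R) (B : nat -> R) :
  (forall n k, 0 <= b n k) -> (forall n, ex_series (b n)) -> (forall n, Series (b n) <= B n) -> ex_series B ->
  ex_series (fun k => Series (fun n => b n k)) /\ Series (fun k => Series (fun n => b n k)) <= Series B.
Proof.
  intros H0 Hb HbB HB.
  assert (HBn : forall n, 0 <= B n) by (intros n; eapply Rle_trans; [apply Series_nonneg; [apply H0|apply Hb]|apply HbB]).
  assert (Hk : forall k, ex_series (fun n => b n k)).
  { intros k. apply ex_series_Rle with B; [|exact HB]. intros n; split; [apply H0|].
    eapply Rle_trans; [|apply HbB]. eapply Rle_trans; [|apply (sum_n_le_Series (b n) k); [apply H0|apply Hb]].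
    clear -H0. destruct k; [rewrite sum_O; lra|]. rewrite sum_Sn.
    assert (0 <= sum_n (b n) k). { clear -H0; induction k; [rewrite sum_O; apply H0|rewrite sum_Sn; unfold plus; simpl;
      generalize (H0 n (S k)); lra]. }
    unfold plus; simpl; lra. }
  destruct (double_series (fun n k => RtoC (b n k)) b B (fun n => RtoC (Series (b n))) (fun k => RtoC (Series (fun n =>
    b n k)))) as [L [H1 H2]]; trivial.
  - intros n k. rewrite Cmod_R, Rabs_right; [lra|]. apply Rle_ge, H0.
  - intros n. apply Cser_RtoC, Series_correct, Hb.
  - intros k. apply (Cser_RtoC (fun n => b n k)), Series_correct, Hk.
  - apply is_Cser_split in H1. apply is_Cser_split in H2. destruct H1 as [H1 _], H2 as [H2 _]. simpl in H1, H2.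
    split; [eexists; exact H2|]. rewrite (is_series_unique _ _ H2), <- (is_series_unique _ _ H1).
    apply Series_le; [|exact HB]. intros n; split; [|apply HbB]. apply Series_nonneg; [apply H0|apply Hb].
Qed.

(** The Taylor coefficients of the sum are the column sums of those of the terms; the l^1 bounds on
    the rows justify the exchange. This is the completeness of the weighted l^1 space. *)
Lemma wiener_series s0 r (F : nat -> C -> C) (G : C -> C) (B : nat -> R) : 0 < r ->
  (forall n, wiener s0 r (F n) (B n)) -> ex_series B ->
  (forall s, Cmod (s - s0) <= r -> is_Cser (fun n => F n s) (G s)) ->
  wiener s0 r G (Series B).
Proof.
  intros Hr HF HB HG.
  pose (a := fun n => proj1_sig (constructive_indefinite_description _ (HF n))).
  assert (Ha : forall n, ex_series (fun k => Cmod (a n k) * r ^ k) /\ Series (fun k => Cmod (a n k) * r ^ k) <= B n /\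
    forall s, Cmod (s - s0) <= r -> is_Cser (fun k => a n k * (s - s0) ^ k)%C (F n s)).
  { intros n. exact (proj2_sig (constructive_indefinite_description _ (HF n))). }
  assert (H0 : forall n k, 0 <= Cmod (a n k) * r ^ k).
  { intros; apply Rmult_le_pos; [apply Cmod_ge_0|apply pow_le; lra]. }
  destruct (double_series_real (fun n k => Cmod (a n k) * r ^ k) B H0) as [D1 D2]; try (intros n; apply Ha); trivial.
  (* The analogue of Cauchy's estimate: one coefficient is dominated by the whole norm. *)
  assert (HBn : forall n k, Cmod (a n k) <= B n * / r ^ k).
  { intros n k. apply (Rmult_le_reg_r (r ^ k)); [apply pow_lt, Hr|].
    rewrite Rmult_assoc, Rinv_l, Rmult_1_r by (apply pow_nonzero; lra).
    destruct (Ha n) as [E1 [E2 _]]. eapply Rle_trans; [|exact E2].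
    eapply Rle_trans; [|apply (sum_n_le_Series _ k (H0 n) E1)].
    specialize (H0 n). clear -H0. destruct k; [rewrite sum_O; lra|]. rewrite sum_Sn.
    assert (Hs : forall f : nat -> R, (forall k, 0 <= f k) -> 0 <= sum_n f k).
    { intros f Hf; clear -Hf; induction k; [rewrite sum_O; apply Hf|rewrite sum_Sn; unfold plus; simpl; generalize (Hf
      (S k)); lra]. }
    specialize (Hs _ H0). unfold plus; simpl in *; lra. }
  assert (HBk : forall k, ex_series (fun n => B n * / r ^ k)) by (intros k; apply (ex_series_scal_r (/ r ^ k)), HB).
  pose (A := fun k => CSeries (fun n => a n k)).
  assert (HA : forall k, is_Cser (fun n => a n k) (A k)).
  { intros k. destruct (ex_Cser_le (fun n => a n k) (fun n => B n * / r ^ k)) as [l Hl]; [intros n; apply HBn|apply HBk|].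
    unfold A. rewrite (CSeries_unique _ _ Hl). exact Hl. }
  assert (Hak : forall k, ex_series (fun n => Cmod (a n k))).
  { intros k. apply ex_series_Rle with (fun n => B n * / r ^ k); [|apply HBk]. intros n; split; [apply Cmod_ge_0|apply
    HBn]. }
  assert (HAk : forall k, 0 <= Cmod (A k) * r ^ k <= Series (fun n => Cmod (a n k) * r ^ k)).
  { intros k; split; [apply Rmult_le_pos; [apply Cmod_ge_0|apply pow_le; lra]|].
    rewrite Series_scal_r. apply Rmult_le_compat_r; [apply pow_le; lra|].
    apply (Cser_norm_le (fun n => a n k)); [intros; lra|apply Hak|apply HA]. }
  exists A. repeat split.
  - eapply ex_series_Rle; [exact HAk|exact D1].
  - eapply Rle_trans; [apply Series_le; [exact HAk|exact D1]|exact D2].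
  - intros s Hs.
    destruct (double_series (fun n k => a n k * (s - s0) ^ k)%C (fun n k => Cmod (a n k) * r ^ k) B (fun n => F n s)
       (fun k => A k * (s - s0) ^ k)%C) as [L [L1 L2]]; trivial; try (intros n; apply Ha).
    + intros n k. rewrite Cmod_mult, Cmod_pow. apply Rmult_le_compat_l; [apply Cmod_ge_0|].
      apply pow_incr. split; [apply Cmod_ge_0|exact Hs].
    + exact Hs.
    + intros k. eapply evar_last; [eapply Cser_ext; [|apply (Cser_scal ((s - s0) ^ k)%C _ _ (HA k))]|].
      * intros n; cbv beta; ring.
      * to_C; ring.
    + rewrite (is_Cser_unique _ _ _ (HG s Hs) L1). exact L2.
Qed.

(** The product is the series of the functions [a k * (s - s0) ^ k * G s], of norm at most
    [Cmod (a k) * r ^ k * B]; no Cauchy product is formed. *)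
Lemma wiener_mult s0 r F G A B : 0 < r -> wiener s0 r F A -> wiener s0 r G B -> wiener s0 r (fun s => F s * G s)%C (A * B).
Proof.
  intros Hr [a [H1 [H2 H3]]] HG. assert (HB := wiener_nonneg _ _ _ _ Hr HG).
  apply (wiener_le _ _ _ (Series (fun k => (Cmod (a k) * r ^ k) * B))).
  { rewrite Series_scal_r. apply Rmult_le_compat_r; assumption. }
  apply (wiener_series s0 r (fun k s => a k * ((s - s0) ^ k * G s))%C); trivial.
  - intros k. rewrite Rmult_assoc. apply wiener_scal, wiener_var_pow; assumption.
  - apply ex_series_scal_r; exact H1.
  - intros s Hs. eapply evar_last; [eapply Cser_ext; [|apply (Cser_scal (G s) _ _ (H3 s Hs))]|].
    + intros k; cbv beta; ring.
    + to_C; ring.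
Qed.

Lemma wiener_shift s0 r c : 0 < r -> wiener s0 r (fun s => s + c)%C (r + Cmod (s0 + c)).
Proof.
  intros Hr. apply (wiener_ext s0 r (fun s => (s - s0) * 1 + (s0 + c))%C).
  2:{ eapply wiener_le; [|eapply wiener_plus; [apply wiener_var; [exact Hr|apply (wiener_const s0 r 1)]|apply
    (wiener_const s0 r (s0 + c))|exact Hr]].
    rewrite Cmod_1. lra. }
  intros s _; cbv beta; ring.
Qed.

Lemma wiener_exp s0 r c : 0 < r -> wiener s0 r (fun s => Cexp (c * s)) (exp (Re (c * s0)) * exp (Cmod c * r)).
Proof.
  intros Hr. exists (fun k => Cexp (c * s0) * (/ RtoC (INR (fact k)) * c ^ k))%C.
  assert (H : is_series (fun k => Cmod (Cexp (c * s0) * (/ RtoC (INR (fact k)) * c ^ k)) * r ^ k) (exp (Re (c * s0)) *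
    exp (Cmod c * r))).
  { eapply is_series_ext; [|apply (is_series_scal (V := R_NormedModule) (exp (Re (c * s0)%C))), (exp_abs_series (Cmod c
    * r))].
    - intros k. scal_R.
      rewrite !Cmod_mult, Cmod_Cexp, Cmod_inv, Cmod_R, Cmod_pow, Rpow_mult_distr by apply INR_fact_neq_0_C.
      rewrite Rabs_right by apply Rle_ge, pos_INR. to_R; ring.
    - apply Rmult_le_pos; [apply Cmod_ge_0|lra]. }
  repeat split.
  - eexists; exact H.
  - rewrite (is_series_unique _ _ H); lra.
  - intros s Hs. eapply evar_last; [eapply Cser_ext; [|apply (Cser_scal (Cexp (c * s0)) _ _ (Cexp_series (c * (s - s0))))]|].
    + intros k; cbv beta. rewrite Cpow_mult_l. ring.
    + to_C. rewrite <- Cexp_plus. f_equal. ring.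
Qed.

Lemma Cser_geom (q : C) : Cmod q < 1 -> is_Cser (fun k => q ^ k)%C (/ (1 - q))%C.
Proof.
  intros Hq.
  destruct (ex_Cser_le (fun k => q ^ k)%C (fun k => Cmod q ^ k)) as [l Hl].
  - intros k. rewrite Cmod_pow; lra.
  - apply ex_series_geom. rewrite Rabs_right; [exact Hq|apply Rle_ge, Cmod_ge_0].
  - assert (H1 : is_Cser (fun k => q ^ S k)%C (l - 1)%C).
    { apply (is_series_incr_1 (V := C_NormedModule) (fun k => q ^ k)%C). eapply evar_last; [exact Hl|].
      change (l = l - 1 + 1)%C. to_C; ring. }
    assert (H2 := Cser_scal q _ _ Hl).
    assert (E : (l - 1 = q * l)%C) by (eapply is_Cser_unique; [exact H1|exact H2]).
    assert (Hn : (1 - q)%C <> 0).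
    { intros H. assert (Hq1 : q = 1) by (apply Ceq_minus; replace (q - 1)%C with (- (1 - q))%C by ring; rewrite H;
      ring). rewrite Hq1, Cmod_1 in Hq. lra. }
    replace (/ (1 - q))%C with l; [exact Hl|].
    replace l with ((l - q * l) / (1 - q))%C by (field; exact Hn). rewrite <- E. field. exact Hn.
Qed.

(** Geometric expansion about [s0] in powers of [- (s - s0) / (s0 - p)]. *)
Lemma wiener_inv s0 r p : 0 < r -> r < Cmod (s0 - p) -> wiener s0 r (fun s => / (s - p))%C (/ (Cmod (s0 - p) - r)).
Proof.
  intros Hr Hp. set (d := (s0 - p)%C) in *. assert (Hd : d <> 0) by (apply Cmod_gt_0; lra).
  exists (fun k => / d * (- / d) ^ k)%C.
  assert (Hm : Cmod (- / d) = / Cmod d) by (rewrite Cmod_opp; apply Cmod_inv, Hd).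
  assert (Hq : r / Cmod d < 1) by (apply Rlt_div_l; lra).
  assert (H : is_series (fun k => Cmod (/ d * (- / d) ^ k) * r ^ k) (/ (Cmod d - r))).
  { eapply evar_last; [eapply is_series_ext; [|apply (is_series_scal (V := R_NormedModule) (/ Cmod d)), (is_series_geom
    (r / Cmod d))]|].
    - intros k. scal_R. rewrite Cmod_mult, Cmod_pow, Hm, Cmod_inv by exact Hd.
      unfold Rdiv. rewrite Rpow_mult_distr. to_R; ring.
    - rewrite Rabs_right; [exact Hq|]. apply Rle_ge, Rmult_le_pos; [lra|apply Rlt_le, Rinv_0_lt_compat; lra].
    - scal_R. to_R. field. lra. }
  repeat split.
  - eexists; exact H.
  - rewrite (is_series_unique _ _ H); lra.
  - intros s Hs.
    assert (Hsp : Cmod (- / d * (s - s0)) < 1).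
    { rewrite Cmod_mult, Hm. eapply Rle_lt_trans; [|exact Hq]. unfold Rdiv. rewrite Rmult_comm.
      apply Rmult_le_compat_r; [apply Rlt_le, Rinv_0_lt_compat; lra|exact Hs]. }
    eapply evar_last; [eapply Cser_ext; [|apply (Cser_scal (/ d) _ _ (Cser_geom _ Hsp))]|].
    + intros k; cbv beta. rewrite Cpow_mult_l. ring.
    + to_C.
      assert (Hn : (s - p)%C <> 0).
      { intros E. assert (E2 : (s - s0 = - d)%C) by (unfold d; replace (s - s0)%C with ((s - p) - (s0 - p))%C by ring;
        rewrite E; ring).
        rewrite E2, Cmod_opp in Hs. lra. }
      replace (1 - - / d * (s - s0))%C with ((s - p) / d)%C by (unfold d; field; exact Hd).
      field. split; assumption.
Qed.

Lemma wiener_RInt s0 r (f : R -> C -> C) (G : C -> C) (a : nat -> R -> C) (A : nat -> C) (B : nat -> R) x y :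
  0 < r -> x <= y ->
  (forall k, is_CRInt (a k) x y (A k)) ->
  (forall k u, x <= u <= y -> Cmod (a k u) * r ^ k <= B k) -> ex_series B ->
  (forall u s, x <= u <= y -> Cmod (s - s0) <= r -> is_Cser (fun k => a k u * (s - s0) ^ k)%C (f u s)) ->
  (forall s, Cmod (s - s0) <= r -> is_CRInt (fun u => f u s) x y (G s)) ->
  wiener s0 r G ((y - x) * Series B).
Proof.
  intros Hr Hxy HA HB HBs Hf HG. exists A.
  assert (HAk : forall k, 0 <= Cmod (A k) * r ^ k <= (y - x) * B k).
  { intros k; split; [apply Rmult_le_pos; [apply Cmod_ge_0|apply pow_le; lra]|].
    assert (Hrk : 0 < r ^ k) by (apply pow_lt, Hr).
    assert (H2 := @is_RInt_const R_NormedModule x y (B k * / r ^ k)).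
    assert (H3 : Cmod (A k) <= (y - x) * (B k * / r ^ k)).
    { apply (CRInt_norm_le (a k) (fun _ => B k * / r ^ k) x y (A k) _ Hxy); [|apply HA|exact H2].
      intros u Hu. apply (Rmult_le_reg_r (r ^ k)); [exact Hrk|].
      rewrite Rmult_assoc, Rinv_l, Rmult_1_r by lra. apply HB, Hu. }
    apply (Rmult_le_compat_r (r ^ k)) in H3; [|lra].
    replace ((y - x) * (B k * / r ^ k) * r ^ k) with ((y - x) * B k) in H3 by (field; lra). exact H3. }
  assert (HBs' : ex_series (fun k => (y - x) * B k)) by (apply (ex_series_scal (V := R_NormedModule)); exact HBs).
  repeat split.
  - eapply ex_series_Rle; [exact HAk|exact HBs'].
  - eapply Rle_trans; [apply Series_le; [exact HAk|exact HBs']|]. rewrite Series_scal_l; lra.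
  - intros s Hs.
    destruct (CRInt_series (fun k u => (s - s0) ^ k * a k u)%C (fun u => f u s) B x y (fun k => (s - s0) ^ k * A k)%C)
      as [J [J1 J2]]; trivial.
    + intros k. apply CRInt_cmult, HA.
    + intros k u Hu. eapply Rle_trans; [|apply (HB k u Hu)]. rewrite Cmod_mult, Cmod_pow, Rmult_comm.
      apply Rmult_le_compat_l; [apply Cmod_ge_0|]. apply pow_incr. split; [apply Cmod_ge_0|exact Hs].
    + intros u Hu. eapply Cser_ext; [|apply (Hf u s Hu Hs)]. intros k; cbv beta; ring.
    + rewrite (CRInt_unique _ _ _ _ _ (HG s Hs) J2). eapply Cser_ext; [|exact J1]. intros k; cbv beta; ring.
Qed.

(** * Uniqueness of the continuation of L *)

(** Abel's lemma: the terms at [z] tend to 0, hence are bounded, and at the smaller radius they are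
    dominated by a geometric series. *)
Lemma Cser_abs_smaller (a : nat -> C) (z l : C) (r : R) : 0 <= r < Cmod z ->
  is_Cser (fun k => a k * z ^ k)%C l -> ex_series (fun k => Cmod (a k) * r ^ k).
Proof.
  intros [Hr0 Hr] H. apply is_Cser_split in H. destruct H as [H1 H2].
  assert (L1 := ex_series_lim_0 _ (ex_intro _ _ H1)). assert (L2 := ex_series_lim_0 _ (ex_intro _ _ H2)).
  apply is_lim_seq_spec in L1, L2.
  destruct (L1 (mkposreal 1 Rlt_0_1)) as [N1 HN1]. destruct (L2 (mkposreal 1 Rlt_0_1)) as [N2 HN2]. change (pos
    (mkposreal 1 Rlt_0_1)) with 1 in HN1, HN2.
  set (N := (N1 + N2)%nat). apply (ex_series_incr_n (V := R_NormedModule) _ N).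
  (* The factor 2: from rank [N] on, the real and the imaginary part of a term at [z] are each below
     1. *)
  apply ex_series_Rle with (fun k => (2 * (r / Cmod z) ^ N) * (r / Cmod z) ^ k).
  - intros k; split; [apply Rmult_le_pos; [apply Cmod_ge_0|apply pow_le; lra]|].
    specialize (HN1 (N + k)%nat ltac:(lia)). specialize (HN2 (N + k)%nat ltac:(lia)).
    rewrite Rminus_0_r in HN1, HN2.
    assert (Ha : Cmod (a (N + k)%nat * z ^ (N + k)) <= 2) by (eapply Rle_trans; [apply Cmod_le_add|]; lra).
    rewrite Cmod_mult, Cmod_pow in Ha.
    rewrite Rmult_assoc, <- pow_add. unfold Rdiv. rewrite Rpow_mult_distr, pow_inv.
    assert (Hz : 0 < Cmod z ^ (N + k)) by (apply pow_lt; lra).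
    assert (0 <= r ^ (N + k)) by (apply pow_le; lra).
    replace (Cmod (a (N + k)%nat) * r ^ (N + k)) with (Cmod (a (N + k)%nat) * Cmod z ^ (N + k) * (r ^ (N + k) * / Cmod
      z ^ (N + k))) by (field; lra).
    apply Rmult_le_compat_r; [|exact Ha]. apply Rmult_le_pos; [assumption|apply Rlt_le, Rinv_0_lt_compat, Hz].
  - apply (ex_series_scal (V := R_NormedModule)). apply ex_series_geom.
    rewrite Rabs_right; [apply Rlt_div_l; lra|]. apply Rle_ge, Rmult_le_pos; [lra|apply Rlt_le, Rinv_0_lt_compat; lra].
Qed.

Lemma Cpow_neq_0 (z : C) k : z <> 0 -> (z ^ k)%C <> 0.
Proof. intros H. apply Cpow_nz, H. Qed.

Lemma Csum_Sn (a : nat -> C) n : Csum a (S n) = (Csum a n + a (S n))%C.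
Proof. exact (sum_Sn a n). Qed.

(** At the first nonzero coefficient [a k], a zero [z] close to 0 forces
    [Cmod (a k) <= Cmod z * Series b] with [b] independent of [z]; zeros that accumulate at 0
    contradict this. *)
Lemma pseries_isolated_zero (a : nat -> C) (r : R) (F : C -> C) : 0 < r ->
  (forall z, Cmod z < r -> is_Cser (fun k => a k * z ^ k)%C (F z)) ->
  (forall d, 0 < d -> exists z, 0 < Cmod z < d /\ F z = 0) ->
  forall k, a k = 0.
Proof.
  intros Hr HF Hz.
  assert (Habs : ex_series (fun k => Cmod (a k) * (r / 2) ^ k)).
  { apply (Cser_abs_smaller a (RtoC (3 * r / 4)) (F (RtoC (3 * r / 4)))).
    - rewrite Cmod_R, Rabs_right by lra. lra.
    - apply HF. rewrite Cmod_R, Rabs_right by lra. lra. }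
  intros k. induction k as [k IH] using (well_founded_induction Wf_nat.lt_wf).
  set (b := fun j => Cmod (a (S k + j)%nat) * (r / 2) ^ j).
  assert (Hb : ex_series b).
  { apply (ex_series_incr_n (V := R_NormedModule) _ (S k)) in Habs.
    eapply ex_series_ext; [|apply (ex_series_scal (V := R_NormedModule) (/ (r / 2) ^ S k)); exact Habs].
    intros j. scal_R. unfold b. rewrite pow_add. to_R. field. apply pow_nonzero; lra. }
  assert (Hb0 : 0 <= Series b).
  { apply Series_nonneg; [|exact Hb]. intros j; unfold b; apply Rmult_le_pos; [apply Cmod_ge_0|apply pow_le; lra]. }
  apply NNPP. intros Hak. assert (Hak' : 0 < Cmod (a k)) by (apply Cmod_gt_0, Hak).
  destruct (Hz (Rmin (r / 2) (Cmod (a k) / (Series b + 1)))) as [z [[Hz0 Hz1] Hz2]].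
  { apply Rmin_glb_lt; [lra|apply Rdiv_lt_0_compat; lra]. }
  assert (Hzr := Rlt_le_trans _ _ _ Hz1 (Rmin_l _ _)). assert (Hza := Rlt_le_trans _ _ _ Hz1 (Rmin_r _ _)).
  assert (Hzn : z <> 0) by (apply Cmod_gt_0; exact Hz0).
  assert (HFz := HF z ltac:(lra)). rewrite Hz2 in HFz.
  assert (Hsum : Csum (fun j => a j * z ^ j)%C k = (a k * z ^ k)%C).
  { destruct k as [|k]; [rewrite sum_O; reflexivity|].
    rewrite Csum_Sn. replace (Csum (fun j => a j * z ^ j)%C k) with (RtoC 0); [to_C; ring|].
    assert (Hs : forall n, (n <= k)%nat -> Csum (fun j => a j * z ^ j)%C n = RtoC 0).
    { intros n Hn. induction n; [rewrite sum_O, IH by lia; to_C; ring|]. rewrite Csum_Sn, IHn, IH by lia. to_C; ring. }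
    symmetry; apply Hs; lia. }
  assert (HT : is_Cser (fun j => a (S k + j)%nat * z ^ (S k + j))%C (- (a k * z ^ k))%C).
  { apply (is_series_incr_n (V := C_NormedModule) (fun j => a j * z ^ j)%C (S k)); [lia|].
    simpl Init.Nat.pred. eapply evar_last; [exact HFz|]. change (RtoC 0 = - (a k * z ^ k) + Csum (fun j => a j * z ^ j) k)%C.
    rewrite Hsum. ring. }
  apply (Cser_scal (/ z ^ k)%C) in HT.
  assert (Hn := Cpow_neq_0 z k Hzn).
  assert (HT2 : Cmod (a k) <= Cmod z * Series b).
  { replace (Cmod (a k)) with (Cmod (/ z ^ k * - (a k * z ^ k))%C).
    2:{ replace (/ z ^ k * - (a k * z ^ k))%C with (- a k)%C by (field; exact Hn). apply Cmod_opp. }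
    rewrite <- Series_scal_l.
    eapply Cser_norm_le; [|apply (ex_series_scal (V := R_NormedModule) (Cmod z) b); exact Hb|exact HT].
    intros j. cbv beta. unfold b. rewrite Cpow_add_r, Cpow_S.
    replace (/ z ^ k * (a (S k + j)%nat * (z * z ^ k * z ^ j)))%C with (z * (a (S k + j)%nat * z ^ j))%C by (field;
      exact Hn).
    rewrite !Cmod_mult, Cmod_pow. apply Rmult_le_compat_l; [lra|]. apply Rmult_le_compat_l; [apply Cmod_ge_0|].
    apply pow_incr. lra. }
  apply Rlt_div_r in Hza; [|lra]. nra.
Qed.

Lemma analytic_at_minus (F G : C -> C) z0 : analytic_at F z0 -> analytic_at G z0 -> analytic_at (fun z => F z - G z)%C z0.
Proof.
  intros [a [r [Hr Ha]]] [b [q [Hq Hb]]]. exists (fun k => a k - b k)%C, (Rmin r q). split; [apply Rmin_glb_lt; assumption|].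
  intros z Hz. assert (H1 := Ha z (Rlt_le_trans _ _ _ Hz (Rmin_l _ _))). assert (H2 := Hb z (Rlt_le_trans _ _ _ Hz
    (Rmin_r _ _))).
  apply Cpseries_iff in H1. apply Cpseries_iff in H2. apply Cpseries_iff.
  eapply evar_last; [eapply Cser_ext; [|apply (Cser_plus _ _ _ _ H1 (Cser_scal (-1) _ _ H2))]|].
  - intros k; cbv beta. ring.
  - to_C. ring.
Qed.

(** Identity theorem along a segment. At the supremum [T] of the parameters up to which [D]
    vanishes, zeros accumulate at [g T], so [D] vanishes on a disc around it and [T] cannot be less
    than 1. *)
Lemma segment_continuation (D : C -> C) (p q : C) (d : R) : 0 < d ->
  (forall t : R, 0 <= t <= 1 -> analytic_at D (p + RtoC t * (q - p))%C) ->
  (forall z, Cmod (z - p) < d -> D z = 0) -> D q = 0.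
Proof.
  intros Hd HA H0.
  destruct (Ceq_dec q p) as [->|Hqp].
  { apply H0. replace (p - p)%C with (RtoC 0) by ring. rewrite Cmod_0; exact Hd. }
  assert (Hm : 0 < Cmod (q - p)) by (apply Cmod_gt_0; apply Cminus_eq_contra; exact Hqp).
  set (g := fun t : R => (p + RtoC t * (q - p))%C).
  assert (Hgg : forall s t, Cmod (g s - g t) = Rabs (s - t) * Cmod (q - p)).
  { intros s t. unfold g. replace (p + RtoC s * (q - p) - (p + RtoC t * (q - p)))%C with (RtoC (s - t) * (q - p))%C by
    (rewrite RtoC_minus; ring).
    rewrite Cmod_mult, Cmod_R. reflexivity. }
  set (E := fun t => 0 <= t <= 1 /\ forall v, 0 <= v <= t -> D (g v) = 0).
  set (t0 := Rmin 1 (d / (2 * Cmod (q - p)))).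
  assert (Ht0 : 0 < t0). { apply Rmin_glb_lt; [lra|apply Rdiv_lt_0_compat; lra]. }
  assert (HE0 : E t0).
  { split; [split; [lra|apply Rmin_l]|]. intros v Hv. apply H0. unfold g.
    replace (p + RtoC v * (q - p) - p)%C with (RtoC v * (q - p))%C by ring. rewrite Cmod_mult, Cmod_R, Rabs_right by lra.
    assert (v <= d / (2 * Cmod (q - p))) by (eapply Rle_trans; [apply Hv|apply Rmin_r]).
    apply (Rmult_le_compat_r (Cmod (q - p))) in H; [|lra].
    replace (d / (2 * Cmod (q - p)) * Cmod (q - p)) with (d / 2) in H by (field; lra). lra. }
  destruct (completeness E) as [T [HT1 HT2]].
  { exists 1. intros t [Ht _]; lra. }
  { exists t0; exact HE0. }
  assert (HTt0 : t0 <= T) by (apply HT1, HE0).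
  assert (HT01 : T <= 1) by (apply HT2; intros t [Ht _]; lra).
  destruct (HA T ltac:(lra)) as [a [r [Hr Ha]]]. fold (g T) in Ha.
  assert (Hbefore : forall v, 0 <= v < T -> D (g v) = 0).
  { intros v Hv. apply NNPP; intros Hne.
    assert (HvT : is_upper_bound E v).
    { intros t [Ht1 Ht2]. apply Rnot_lt_le; intros Hlt. apply Hne, Ht2. lra. }
    specialize (HT2 v HvT). lra. }
  assert (Ha0 : forall k, a k = 0).
  { apply (pseries_isolated_zero a r (fun z => D (g T + z)%C) Hr).
    - intros z Hz. assert (Hz' : Cmod (g T + z - g T) < r) by (replace (g T + z - g T)%C with z by ring; exact Hz).
      apply Ha in Hz'. apply Cpseries_iff in Hz'. replace (g T + z - g T)%C with z in Hz' by ring. exact Hz'.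
    - intros e He.
      set (s := Rmin (T / 2) (e / (2 * Cmod (q - p)))).
      assert (Hs : 0 < s) by (apply Rmin_glb_lt; [lra|apply Rdiv_lt_0_compat; lra]).
      assert (Hs1 : s <= T / 2) by apply Rmin_l.
      assert (Hs2 : s * Cmod (q - p) <= e / 2).
      { assert (s <= e / (2 * Cmod (q - p))) by apply Rmin_r.
        apply (Rmult_le_compat_r (Cmod (q - p))) in H; [|lra].
        replace (e / (2 * Cmod (q - p)) * Cmod (q - p)) with (e / 2) in H by (field; lra). exact H. }
      exists (g (T - s)%R - g T)%C. rewrite Hgg. replace (T - s - T) with (- s) by ring. rewrite Rabs_Ropp, Rabs_right
        by lra.
      split; [split; [apply Rmult_lt_0_compat; lra|lra]|].
      replace (g T + (g (T - s)%R - g T))%C with (g (T - s)%R) by ring. apply Hbefore. lra. }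
  assert (Hdisc : forall z, Cmod (z - g T) < r -> D z = 0).
  { intros z Hz. apply Ha in Hz. apply Cpseries_iff in Hz. eapply is_Cser_unique; [exact Hz|].
    eapply Cser_ext; [|exact Cser_zero]. intros k; cbv beta. rewrite Ha0. ring. }
  assert (HgT : D (g T) = 0).
  { apply Hdisc. replace (g T - g T)%C with (RtoC 0) by ring. rewrite Cmod_0; exact Hr. }
  destruct (Req_dec T 1) as [HT|HT].
  { replace q with (g T); [exact HgT|]. unfold g. rewrite HT. ring. }
  exfalso.
  set (s := Rmin (1 - T) (r / (2 * Cmod (q - p)))).
  assert (Hs : 0 < s) by (apply Rmin_glb_lt; [lra|apply Rdiv_lt_0_compat; lra]).
  assert (Hs1 : s <= 1 - T) by apply Rmin_l.
  assert (Hs2 : s * Cmod (q - p) <= r / 2).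
  { assert (s <= r / (2 * Cmod (q - p))) by apply Rmin_r.
    apply (Rmult_le_compat_r (Cmod (q - p))) in H; [|lra].
    replace (r / (2 * Cmod (q - p)) * Cmod (q - p)) with (r / 2) in H by (field; lra). exact H. }
  assert (HE : E (T + s)).
  { split; [lra|]. intros v Hv. destruct (Rlt_dec v T) as [Hlt|Hge]; [apply Hbefore; lra|].
    apply Hdisc. rewrite Hgg, Rabs_right by lra. assert ((v - T) * Cmod (q - p) <= s * Cmod (q - p)) by (apply
      Rmult_le_compat_r; lra). lra. }
  specialize (HT1 _ HE). lra.
Qed.

(** The segment starts at 2 + i, off the real axis, so that it reaches the real point [s] without
    meeting the possible pole at 1. The unit disc around 2 + i lies in the half-plane of
    convergence, where both continuations are the Dirichlet series. *)
Lemma L_continuation_unique (g : Z -> C) (L1 L2 : C -> C) (s : C) : Im s = 0 -> Re s < 1 ->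
  is_L_continuation g L1 -> is_L_continuation g L2 -> L1 s = L2 s.
Proof.
  intros Hs1 Hs2 [A1 B1] [A2 B2].
  apply Ceq_minus. apply (segment_continuation (fun z => L1 z - L2 z)%C (2, 1) s 1); [lra| |].
  - intros t Ht. assert (Hne : ((2, 1) + RtoC t * (s - (2, 1)))%C <> 1).
    { intros E. destruct s as [x y]. simpl in Hs1, Hs2. subst y.
      assert (E1 := f_equal Re E). assert (E2 := f_equal Im E).
      unfold Re, Im, Cplus, Cmult, Cminus, Copp, RtoC in E1, E2. simpl in E1, E2.
      assert (t = 1) by lra. subst t. lra. }
    apply analytic_at_minus; [apply A1|apply A2]; exact Hne.
  - intros z Hz. assert (Hz1 : 1 < Re z).
    { assert (H := re_le_Cmod (z - (2, 1))). assert (H2 : Rabs (Re (z - (2, 1))%C) < 1) by lra.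
      apply Rabs_def2 in H2. unfold Re, Cminus, Cplus, Copp in *. simpl in *. lra. }
    rewrite (is_Cser_unique _ _ _ (B1 z Hz1) (B2 z Hz1)). ring.
Qed.

(** * The principal square root *)

(* The complement of the closed negative half-line and 0, where the principal square root is continuous. *)
Definition slit (x : C) : Prop := 0 < Re x \/ Im x <> 0.

Lemma Carg_cos_sin (z : C) : z <> 0 -> cos (Carg z) = Re z / Cmod z /\ sin (Carg z) = Im z / Cmod z.
Proof.
  intros Hz. assert (Hm : 0 < Cmod z) by (apply Cmod_gt_0, Hz).
  assert (Hb : -1 <= Re z / Cmod z <= 1).
  { assert (H := re_le_Cmod z). apply Rabs_le_between in H.
    split; [apply Rle_div_r; lra|apply Rle_div_l; lra]. }
  assert (Hs : sqrt (1 - (Re z / Cmod z)²) = Rabs (Im z) / Cmod z).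
  { replace (1 - (Re z / Cmod z)²) with ((Im z / Cmod z)²).
    - rewrite sqrt_Rsqr_abs. unfold Rdiv. rewrite Rabs_mult, (Rabs_right (/ Cmod z)); [reflexivity|].
      apply Rle_ge, Rlt_le, Rinv_0_lt_compat, Hm.
    - assert (H2 := Cmod2_alt z). unfold Rsqr.
      replace (1 - Re z / Cmod z * (Re z / Cmod z)) with ((Cmod z ^ 2 - Re z ^ 2) / Cmod z ^ 2) by (field; lra).
      rewrite H2 at 1. field; lra. }
  unfold Carg. destruct (Rle_dec 0 (Im z)) as [Hi|Hi].
  - rewrite cos_acos by exact Hb. rewrite sin_acos by exact Hb. split; [reflexivity|]. rewrite Hs, Rabs_right by lra.
    reflexivity.
  - rewrite cos_neg, sin_neg, cos_acos by exact Hb. rewrite sin_acos by exact Hb. split; [reflexivity|].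
    rewrite Hs, Rabs_left by lra. field. lra.
Qed.

Lemma Cexp_Clog (z : C) : z <> 0 -> Cexp (Clog z) = z.
Proof.
  intros Hz. assert (Hm : 0 < Cmod z) by (apply Cmod_gt_0, Hz).
  destruct (Carg_cos_sin z Hz) as [H1 H2]. unfold Cexp, Clog; simpl. rewrite exp_ln, H1, H2 by exact Hm.
  destruct z as [x y]; simpl in *. f_equal; field; lra.
Qed.

Lemma Carg_slit (z : C) : slit z -> - PI < Carg z < PI.
Proof.
  intros Hz. assert (Hz0 : z <> 0).
  { intros ->. destruct Hz as [H|H]; simpl in H; lra. }
  assert (Hm : 0 < Cmod z) by (apply Cmod_gt_0, Hz0).
  destruct (Carg_cos_sin z Hz0) as [H1 H2].
  assert (Hb := acos_bound (Re z / Cmod z)). assert (Hpi := PI_RGT_0).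
  assert (Hne : forall e, e = PI \/ e = - PI -> Carg z <> e).
  { intros e He E. assert (Hc : cos e = -1) by (destruct He as [->| ->]; rewrite ?cos_neg; apply cos_PI).
    assert (Hs : sin e = 0) by (destruct He as [->| ->]; rewrite ?sin_neg, sin_PI; ring).
    rewrite E in H1, H2. rewrite Hc in H1. rewrite Hs in H2.
    assert (Im z = 0). { symmetry in H2. apply (Rmult_eq_compat_r (Cmod z)) in H2. unfold Rdiv in H2. rewrite
      Rmult_assoc, Rinv_l in H2 by lra. lra. }
    assert (Re z = - Cmod z). { symmetry in H1. apply (Rmult_eq_compat_r (Cmod z)) in H1. unfold Rdiv in H1. rewrite
      Rmult_assoc, Rinv_l in H1 by lra. lra. }
    destruct Hz as [H'|H']; [lra|contradiction]. }
  assert (H3 : - PI <= Carg z <= PI) by (unfold Carg; destruct (Rle_dec 0 (Im z)); lra).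
  assert (N1 := Hne PI (or_introl eq_refl)). assert (N2 := Hne (- PI) (or_intror eq_refl)). lra.
Qed.

Definition rsqrt (x : C) : C := Cpower x (- / 2).

Lemma rsqrt_sq (x : C) : x <> 0 -> (rsqrt x * rsqrt x = / x)%C.
Proof.
  intros Hx. unfold rsqrt, Cpower. rewrite <- Cexp_plus.
  replace (- / 2 * Clog x + - / 2 * Clog x)%C with (- Clog x)%C by field.
  rewrite Cexp_opp, Cexp_Clog by exact Hx. reflexivity.
Qed.

Lemma rsqrt_neq_0 (x : C) : rsqrt x <> 0.
Proof. apply Cexp_neq_0. Qed.

Lemma rsqrt_Re (x : C) : slit x -> 0 < Re (rsqrt x).
Proof.
  intros Hx. assert (Ha := Carg_slit x Hx). unfold rsqrt, Cpower, Cexp.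
  assert (HI : Im (- / 2 * Clog x)%C = - (Carg x / 2)).
  { replace (- / 2)%C with (RtoC (- / 2)) by (rewrite RtoC_opp, RtoC_inv by lra; reflexivity). rewrite im_scal_l.
    unfold Clog, Im; simpl. field. }
  change (0 < exp (Re (- / 2 * Clog x)%C) * cos (Im (- / 2 * Clog x)%C)).
  rewrite HI. apply Rmult_lt_0_compat; [apply exp_pos|].
  rewrite cos_neg. apply cos_gt_0; lra.
Qed.

Lemma slit_neq_0 x : slit x -> x <> 0.
Proof. intros H ->. destruct H as [H|H]; simpl in H; lra. Qed.

(** Identities between principal roots reduce to their squares, without any computation of
    arguments. *)
Lemma sqrt_unique (u v : C) : (u * u = v * v)%C -> 0 < Re u -> 0 < Re v -> u = v.
Proof.
  intros H Hu Hv. assert (E : ((u - v) * (u + v) = 0)%C) by (replace ((u - v) * (u + v))%C with (u * u - v * v)%C by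
    ring; rewrite H; ring).
  destruct (Ceq_dec u v) as [|Hne]; [assumption|]. exfalso.
  apply (Cmult_neq_0 (u - v) (u + v)); [apply Cminus_eq_contra, Hne| |exact E].
  intros E2. assert (E3 := f_equal Re E2). rewrite re_plus in E3. simpl in E3. lra.
Qed.

(** A purely imaginary [w] has a negative square, which puts [x] on the cut. *)
Lemma Re_0_sq_not_slit (w x : C) : x <> 0 -> (w * w = / x)%C -> Re w = 0 -> ~ slit x.
Proof.
  intros Hx H Hw Hs. assert (E : (x * (w * w) = 1)%C) by (rewrite H; field; exact Hx).
  destruct w as [p q], x as [u v]. simpl in Hw. subst p.
  assert (E1 := f_equal Re E). assert (E2 := f_equal Im E). unfold Re, Im, Cmult, RtoC in E1, E2; simpl in E1, E2.
  destruct Hs as [Hs|Hs]; simpl in Hs; [assert (0 <= u * (q * q)) by (apply Rmult_le_pos; [lra|apply Rle_0_sqr]); lra|].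
  assert (v * (q * q) = 0) by lra. assert (q * q <> 0) by (intros Hq; rewrite Hq in E1; lra). apply Rmult_integral in
    H0. destruct H0; contradiction.
Qed.

(** Connectedness: a continuous inverse root along a curve off the cut never has real part 0, so it
    keeps the sign that makes it principal. *)
Lemma sqrt_curve (g : R -> C) (x : R -> C) :
  (forall s, 0 <= s <= 1 -> Ccont g s) ->
  (forall s, 0 <= s <= 1 -> slit (x s) /\ (g s * g s = / x s)%C) ->
  0 < Re (g 0) -> g 1 = rsqrt (x 1).
Proof.
  intros Hc Hx H0. apply sqrt_unique.
  - destruct (Hx 1 ltac:(lra)) as [H1 H2]. rewrite H2, rsqrt_sq; [reflexivity|apply slit_neq_0, H1].
  - apply Rnot_le_lt; intros Hle.
    assert (Hne : forall s, 0 <= s <= 1 -> Re (g s) <> 0).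
    { intros s Hs E. destruct (Hx s Hs) as [H1 H2]. exact (Re_0_sq_not_slit _ _ (slit_neq_0 _ H1) H2 E H1). }
    assert (Hlt : Re (g 1) < 0) by (generalize (Hne 1 ltac:(lra)); lra).
    destruct (Ranalysis5.IVT_interv (fun s => - Re (g s)) 0 1) as [z [Hz1 Hz2]]; try lra.
    + intros a Ha. apply continuity_pt_filterlim.
      apply (continuous_opp (fun s => Re (g s))). apply (proj1 (Ccont_split g a) (Hc a Ha)).
    + apply (Hne z Hz1). lra.
  - apply rsqrt_Re. apply (Hx 1); lra.
Qed.

(** * Binomial series *)

Fixpoint poch (p : R) (n : nat) : R := match n with O => 1 | S m => poch p m * (p + INR m) end.

Definition bcoef (p : R) (n : nat) : R := poch p n / INR (fact n).

(* The binomial series of [(1 - u)^(-p)]. *)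
Definition Bser (p : R) (u : C) : C := CSeries (fun n => RtoC (bcoef p n) * u ^ n)%C.

Lemma poch_pos p n : 0 < p -> 0 < poch p n.
Proof. intros Hp. induction n; simpl; [lra|]. apply Rmult_lt_0_compat; [exact IHn|]. generalize (pos_INR n); lra. Qed.

Lemma bcoef_pos p n : 0 < p -> 0 < bcoef p n.
Proof. intros Hp. apply Rdiv_lt_0_compat; [apply poch_pos, Hp|apply INR_fact_lt_0]. Qed.

Lemma bcoef_S p n : bcoef p (S n) = bcoef p n * ((p + INR n) / INR (S n)).
Proof.
  unfold bcoef. change (poch p (S n)) with (poch p n * (p + INR n)). change (fact (S n)) with (S n * fact n)%nat.
  rewrite mult_INR. field. split; [|apply INR_fact_neq_0]. rewrite S_INR. generalize (pos_INR n); lra.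
Qed.

Lemma bcoef_summable p rho : 0 < p -> 0 <= rho < 1 -> ex_series (fun n => bcoef p n * rho ^ n).
Proof.
  intros Hp [Hr0 Hr1]. destruct (Req_dec rho 0) as [->|Hr].
  { apply (ex_series_incr_1 (V := R_NormedModule)). exists 0.
    apply is_series_ext with (fun _ => 0); [intros n; simpl; to_R; ring|]. exact (proj1 (proj1 (is_Cser_split _ _)
      Cser_zero)). }
  assert (Hpos : forall n, 0 < bcoef p n * rho ^ n) by (intros n; apply Rmult_lt_0_compat; [apply bcoef_pos, Hp|apply
    pow_lt; lra]).
  eapply ex_series_ext; [|apply (ex_series_DAlembert (fun n => bcoef p n * rho ^ n) rho Hr1)].
  - intros n. cbv beta. rewrite Rabs_right; [reflexivity|]. apply Rle_ge, Rlt_le, Hpos.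
  - intros n H. specialize (Hpos n). lra.
  - apply is_lim_seq_ext with (fun n => rho * (1 + (p - 1) * / INR (S n))).
    + intros n. rewrite bcoef_S. change (rho ^ S n) with (rho * rho ^ n).
      assert (Hn : 0 < INR (S n)) by (rewrite S_INR; generalize (pos_INR n); lra).
      assert (Hb := bcoef_pos p n Hp). assert (Hq : 0 < rho ^ n) by (apply pow_lt; lra).
      rewrite Rabs_right.
      * rewrite S_INR in *. field. lra.
      * apply Rle_ge, Rlt_le. apply Rdiv_lt_0_compat; [|apply Hpos]. apply Rmult_lt_0_compat; [|apply
        Rmult_lt_0_compat; lra].
        apply Rmult_lt_0_compat; [exact Hb|]. apply Rdiv_lt_0_compat; [generalize (pos_INR n); lra|exact Hn].
    + replace (Finite rho) with (Finite (rho * (1 + (p - 1) * 0))) by (f_equal; ring).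
      apply (is_lim_seq_scal_l _ rho (1 + (p - 1) * 0)). apply is_lim_seq_plus'; [apply is_lim_seq_const|].
      apply (is_lim_seq_scal_l _ (p - 1) 0).
      apply (is_lim_seq_incr_1 (fun n => / INR n)).
      replace (Finite 0) with (Rbar_inv p_infty) by reflexivity. apply is_lim_seq_inv; [apply is_lim_seq_INR|discriminate].
Qed.

Lemma bcoef_Cmod_summable p rho : 0 < p -> 0 <= rho < 1 -> ex_series (fun n => Cmod (RtoC (bcoef p n)) * rho ^ n).
Proof.
  intros Hp Hr. eapply ex_series_ext; [|apply (bcoef_summable p rho Hp Hr)].
  intros n; cbv beta. rewrite Cmod_R, Rabs_right; [reflexivity|]. apply Rle_ge, Rlt_le, bcoef_pos, Hp.
Qed.

Lemma Bser_Cser p u : 0 < p -> Cmod u < 1 -> is_Cser (fun n => RtoC (bcoef p n) * u ^ n)%C (Bser p u).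
Proof.
  intros Hp Hu. destruct (ex_Cser_le (fun n => RtoC (bcoef p n) * u ^ n)%C (fun n => Cmod (RtoC (bcoef p n)) * Cmod u ^
    n)) as [l Hl].
  - intros n. rewrite Cmod_mult, Cmod_pow. lra.
  - apply bcoef_Cmod_summable; [exact Hp|]. split; [apply Cmod_ge_0|exact Hu].
  - unfold Bser. rewrite (CSeries_unique _ _ Hl). exact Hl.
Qed.

Lemma poch_shift p n : p * poch (p + 1) n = poch p n * (p + INR n).
Proof.
  induction n; [simpl; ring|]. change (poch (p + 1) (S n)) with (poch (p + 1) n * (p + 1 + INR n)).
  change (poch p (S n)) with (poch p n * (p + INR n)). rewrite <- IHn, S_INR. ring.
Qed.

Lemma bcoef_shift p n : p * bcoef (p + 1) n = INR (S n) * bcoef p (S n).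
Proof.
  rewrite bcoef_S. unfold bcoef, Rdiv. rewrite <- Rmult_assoc, poch_shift.
  assert (Hn : INR (S n) <> 0) by (rewrite S_INR; generalize (pos_INR n); lra). field. split; [exact Hn|apply
    INR_fact_neq_0].
Qed.

(** Pascal's rule, the coefficientwise form of [Bser_step]. *)
Lemma bcoef_diff p n : 0 < p -> bcoef (p + 1) (S n) - bcoef (p + 1) n = bcoef p (S n).
Proof.
  intros Hp. rewrite bcoef_S. apply (Rmult_eq_reg_l p); [|lra].
  assert (Hn : INR (S n) <> 0) by (rewrite S_INR; generalize (pos_INR n); lra).
  replace (p * (bcoef (p + 1) n * ((p + 1 + INR n) / INR (S n)) - bcoef (p + 1) n)) with
    (p * bcoef (p + 1) n * p / INR (S n)) by (rewrite S_INR in *; field; lra).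
  rewrite bcoef_shift. field. exact Hn.
Qed.

Lemma Bser_step p u : 0 < p -> Cmod u < 1 -> ((1 - u) * Bser (p + 1) u = Bser p u)%C.
Proof.
  intros Hp Hu. assert (H := Bser_Cser (p + 1) u ltac:(lra) Hu).
  assert (H1 : is_Cser (fun n => RtoC (bcoef (p + 1) (S n)) * u ^ S n)%C (Bser (p + 1) u - 1)%C).
  { apply (is_series_incr_1 (V := C_NormedModule) (fun n => RtoC (bcoef (p + 1) n) * u ^ n)%C).
    eapply evar_last; [exact H|]. change (Bser (p + 1) u = Bser (p + 1) u - 1 + RtoC (1 / 1) * 1)%C.
    rewrite Rdiv_1_r. ring. }
  assert (H2 := Cser_plus _ _ _ _ H1 (Cser_scal (- u) _ _ H)).
  assert (H3 : is_Cser (fun n => RtoC (bcoef p (S n)) * u ^ S n)%C (Bser p u - 1)%C).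
  { apply (is_series_incr_1 (V := C_NormedModule) (fun n => RtoC (bcoef p n) * u ^ n)%C).
    eapply evar_last; [apply (Bser_Cser p u Hp Hu)|]. change (Bser p u = Bser p u - 1 + RtoC (1 / 1) * 1)%C.
    rewrite Rdiv_1_r. ring. }
  assert (E : (Bser (p + 1) u - 1 + - u * Bser (p + 1) u = Bser p u - 1)%C).
  { eapply is_Cser_unique; [exact H2|]. eapply Cser_ext; [|exact H3].
    intros n; cbv beta. rewrite <- (bcoef_diff p n Hp), RtoC_minus, Cpow_S. ring. }
  replace (Bser p u) with (Bser p u - 1 + 1)%C by ring. rewrite <- E. ring.
Qed.

Lemma Bser_holo p u : 0 < p -> Cmod u < 1 -> is_Cholo (Bser p) u (RtoC p * Bser (p + 1) u)%C.
Proof.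
  intros Hp Hu. assert (Hu0 := Cmod_ge_0 u).
  apply (pseries_holo (fun n => RtoC (bcoef p n)) ((Cmod u + 1) / 2)); try lra.
  - apply bcoef_Cmod_summable; lra.
  - intros w Hw. apply Bser_Cser; lra.
  - eapply Cser_ext; [|apply (Cser_scal p), Bser_Cser; lra].
    intros n; cbv beta. rewrite <- RtoC_mult, <- bcoef_shift, RtoC_mult. ring.
Qed.

Lemma Cmod_Rmult_lt (s : R) (u : C) : 0 <= s <= 1 -> Cmod u < 1 -> Cmod (s * u) < 1.
Proof. intros Hs Hu. rewrite Cmod_mult, Cmod_R, Rabs_right by lra. generalize (Cmod_ge_0 u). nra. Qed.

Lemma Bser_0 p : Bser p 0 = 1.
Proof.
  apply CSeries_unique. eapply evar_last; [apply (Cser_eventually_0 _ 0)|].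
  - intros [|k] Hk; [lia|]. rewrite Cpow_S. ring.
  - rewrite sum_O. unfold bcoef. change (RtoC (1 / 1) * 1 = 1)%C. rewrite Rdiv_1_r; ring.
Qed.

Lemma Cder_scale (u : C) t : is_Cder (fun s => RtoC s * u)%C t u.
Proof.
  eapply evar_last; [eapply Cder_ext; [|apply (Cder_cmult u), Cder_id]|].
  - intros s; cbv beta; ring.
  - to_C; ring.
Qed.

(** Along the ray [s * u] the left side has derivative 0: differentiation raises the exponent by 1,
    and [Bser_step] lowers it again. *)
Lemma Bser_half_sq u : Cmod u < 1 -> (Bser (/ 2) u * Bser (/ 2) u * (1 - u) = 1)%C.
Proof.
  intros Hu.
  set (g := fun s : R => (Bser (/ 2) (RtoC s * u) * Bser (/ 2) (RtoC s * u) * (1 + - 1 * (RtoC s * u)))%C).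
  assert (Hg : g 1 = g 0).
  { apply Cder_zero_const; [lra|]. intros x Hx.
    assert (Hxu := Cmod_Rmult_lt x u Hx Hu).
    assert (HB : is_Cder (fun s => Bser (/ 2) (RtoC s * u)%C) x ((RtoC (/ 2) * Bser (/ 2 + 1) (RtoC x * u)) * u)%C).
    { apply (Cder_comp (Bser (/ 2)) (fun s => RtoC s * u)%C); [apply Bser_holo; [lra|exact Hxu]|apply Cder_scale]. }
    unfold g. eapply evar_last; [apply Cder_mult; [apply Cder_mult; exact HB|apply Cder_plus; [apply Cder_const|apply
      Cder_cmult, Cder_scale]]|].
    to_C. assert (E := Bser_step (/ 2) (RtoC x * u)%C ltac:(lra) Hxu).
    rewrite <- E. rewrite RtoC_inv by lra. field. }
  unfold g in Hg. replace (1 * u)%C with u in Hg by ring. replace (0 * u)%C with (RtoC 0) in Hg by ring.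
  rewrite Bser_0 in Hg. replace (1 - u)%C with (1 + -1 * u)%C by ring. rewrite Hg. ring.
Qed.

(** The right side continues [rsqrt x0] along the segment from [x0] to [x0 * (1 - u)]. Since the
    segment avoids the cut, [sqrt_curve] identifies its end value with the principal branch. *)
Lemma rsqrt_expand (x0 u : C) : Cmod u < 1 -> (forall s, 0 <= s <= 1 -> slit (x0 * (1 - RtoC s * u))%C) ->
  rsqrt (x0 * (1 - u)) = (rsqrt x0 * Bser (/ 2) u)%C.
Proof.
  intros Hu Hs.
  assert (Hx0 : slit x0). { replace x0 with (x0 * (1 - RtoC 0 * u))%C by ring. apply Hs; lra. }
  assert (Hx0n := slit_neq_0 _ Hx0).
  assert (E := sqrt_curve (fun s => rsqrt x0 * Bser (/ 2) (RtoC s * u))%C (fun s => x0 * (1 - RtoC s * u))%C).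
  cbv beta in E. replace (1 * u)%C with u in E by ring. symmetry. apply E.
  - intros s Hs1. apply Ccont_mult; [apply Ccont_const|].
    eapply Cder_continuous. apply (Cder_comp (Bser (/ 2)) (fun s => RtoC s * u)%C); [apply Bser_holo; [lra|apply
      Cmod_Rmult_lt; assumption]|apply Cder_scale].
  - intros s Hs1. split; [apply Hs, Hs1|].
    assert (H1 := Bser_half_sq (RtoC s * u)%C (Cmod_Rmult_lt s u Hs1 Hu)).
    assert (H2 := rsqrt_sq x0 Hx0n).
    assert (Hn : (1 - RtoC s * u)%C <> 0).
    { intros E0. assert (H3 := Hs s Hs1). apply slit_neq_0 in H3. apply H3. rewrite E0. ring. }
    replace (rsqrt x0 * Bser (/ 2) (s * u) * (rsqrt x0 * Bser (/ 2) (s * u)))%C with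
      ((rsqrt x0 * rsqrt x0) * (Bser (/ 2) (s * u) * Bser (/ 2) (s * u)))%C by ring.
    rewrite H2. replace (Bser (/ 2) (s * u) * Bser (/ 2) (s * u))%C with (/ (1 - s * u))%C.
    + field. split; assumption.
    + replace (Bser (/ 2) (s * u) * Bser (/ 2) (s * u))%C with (Bser (/ 2) (s * u) * Bser (/ 2) (s * u) * (1 - s * u) /
      (1 - s * u))%C by (field; exact Hn).
      rewrite H1. field. exact Hn.
  - replace (0 * u)%C with (RtoC 0) by ring. rewrite Bser_0, Cmult_1_r. apply rsqrt_Re, Hx0.
Qed.

Lemma slit_open (x : C) : slit x -> exists d, 0 < d /\ forall h, Cmod h < d -> slit (x + h)%C.
Proof.
  intros [H|H].
  - exists (Re x); split; [exact H|]. intros h Hh. left. rewrite re_plus.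
    assert (H1 := re_le_Cmod h). assert (H2 : Rabs (Re h) < Re x) by lra. apply Rabs_def2 in H2. lra.
  - exists (Rabs (Im x)); split; [apply Rabs_pos_lt, H|]. intros h Hh. right. rewrite im_plus. intros E.
    assert (H1 := im_le_Cmod h). replace (Im x) with (- Im h) in Hh by lra. rewrite Rabs_Ropp in Hh. lra.
Qed.

(** Near [t] the function is [rsqrt (x t)] times a binomial series in [1 - x s / x t], by
    [rsqrt_expand]. *)
Lemma Cder_rsqrt (x : R -> C) t l : is_Cder x t l -> slit (x t) ->
  is_Cder (fun s => rsqrt (x s)) t (- rsqrt (x t) / (2 * x t) * l)%C.
Proof.
  intros Hx Hs. destruct (slit_open _ Hs) as [d [Hd Hd']]. assert (Hn := slit_neq_0 _ Hs).
  assert (Hm : 0 < Cmod (x t)) by (apply Cmod_gt_0, Hn).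
  assert (Hloc : locally t (fun s => Cmod (x s - x t) < Rmin d (Cmod (x t)))).
  { assert (Hc := Cder_continuous _ _ _ Hx). apply (filterlim_C (locally t) x (x t)); [exact Hc|]. apply Rmin_glb_lt;
    assumption. }
  apply (@is_derive_ext_loc R_AbsRing C_R_NormedModule (fun s => rsqrt (x t) * Bser (/ 2) (1 + (- / x t) * x s))%C).
  - revert Hloc. apply filter_imp. intros s Hs1.
    set (u := (1 + - / x t * x s)%C).
    assert (Hu : (x t * u = x t - x s)%C) by (unfold u; field; exact Hn).
    assert (Hxs : x s = (x t * (1 - u))%C) by (replace (x t * (1 - u))%C with (x t - x t * u)%C by ring; rewrite Hu; ring).
    assert (Hmu : Cmod (x t * u) < Rmin d (Cmod (x t))).
    { rewrite Hu, <- Cmod_opp. replace (- (x t - x s))%C with (x s - x t)%C by ring. exact Hs1. }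
    rewrite Hxs. symmetry. apply rsqrt_expand.
    + assert (H := Rlt_le_trans _ _ _ Hmu (Rmin_r _ _)). rewrite Cmod_mult in H. nra.
    + intros v Hv. replace (x t * (1 - v * u))%C with (x t + - (v * (x t * u)))%C by ring. apply Hd'.
      rewrite Cmod_opp, Cmod_mult, Cmod_R, Rabs_right by lra.
      assert (H := Rlt_le_trans _ _ _ Hmu (Rmin_l _ _)). generalize (Cmod_ge_0 (x t * u)). nra.
  - assert (E0 : (1 + - / x t * x t)%C = RtoC 0) by (field; exact Hn).
    eapply evar_last; [apply Cder_cmult; apply (Cder_comp (Bser (/ 2)) (fun s => 1 + - / x t * x s)%C)|].
    + rewrite E0. apply Bser_holo; [lra|]. rewrite Cmod_0; lra.
    + apply Cder_plus; [apply Cder_const|apply Cder_cmult; exact Hx].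
    + to_C. rewrite Bser_0, RtoC_inv by lra. field. exact Hn.
Qed.

(* [(1 - z)^(- nu - 3/2)] on the principal branch. *)
Definition Qker (nu : nat) (z : C) : C := (rsqrt (1 - z) / (1 - z) ^ S nu)%C.

Lemma Bser_powers (nu : nat) u : Cmod u < 1 -> (Bser (/ 2 + INR nu) u * (1 - u) ^ nu = Bser (/ 2) u)%C.
Proof.
  intros Hu. induction nu.
  - simpl INR. rewrite Rplus_0_r. simpl. ring.
  - rewrite S_INR. replace (/ 2 + (INR nu + 1)) with (/ 2 + INR nu + 1) by ring.
    rewrite <- IHnu, Cpow_S, <- (Bser_step (/ 2 + INR nu) u); [ring| |exact Hu]. generalize (pos_INR nu); lra.
Qed.

Lemma Cmod_lt_1_neq (u : C) : Cmod u < 1 -> (1 - u)%C <> 0.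
Proof.
  intros Hu E. assert (H : u = 1) by (apply Ceq_minus; replace (u - 1)%C with (- (1 - u))%C by ring; rewrite E; ring).
  rewrite H, Cmod_1 in Hu. lra.
Qed.

Lemma Qker_expand (nu : nat) (z0 u : C) : Cmod u < 1 ->
  (forall s, 0 <= s <= 1 -> slit ((1 - z0) * (1 - RtoC s * u))%C) ->
  Qker nu (z0 + (1 - z0) * u) = (Qker nu z0 * Bser (/ 2 + INR (S nu)) u)%C.
Proof.
  intros Hu Hs. unfold Qker. replace (1 - (z0 + (1 - z0) * u))%C with ((1 - z0) * (1 - u))%C by ring.
  rewrite (rsqrt_expand _ _ Hu Hs), <- (Bser_powers (S nu) u Hu), Cpow_mult_l.
  assert (Hx0 : slit (1 - z0)%C). { replace (1 - z0)%C with ((1 - z0) * (1 - RtoC 0 * u))%C by ring. apply Hs; lra. }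
  field. split; apply Cpow_nz; [apply slit_neq_0, Hx0|apply Cmod_lt_1_neq, Hu].
Qed.

Lemma rsqrt_1 : rsqrt 1 = 1.
Proof.
  assert (Hs : slit 1) by (left; simpl; lra).
  apply sqrt_unique; [rewrite rsqrt_sq by exact C1_nz; field|apply rsqrt_Re, Hs|simpl; lra].
Qed.

Lemma Qker_0 nu : Qker nu 0 = 1.
Proof. unfold Qker. replace (1 - 0)%C with (RtoC 1) by ring. rewrite rsqrt_1, Cpow_1_l. field. Qed.

Lemma Qker_Bser nu u : Cmod u < 1 -> Qker nu u = Bser (/ 2 + INR (S nu)) u.
Proof.
  intros Hu. assert (E := Qker_expand nu 0 u Hu).
  replace (0 + (1 - 0) * u)%C with u in E by ring. rewrite E, Qker_0; [ring|].
  intros s Hs. left. replace ((1 - 0) * (1 - RtoC s * u))%C with (1 - RtoC s * u)%C by ring.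
  assert (H := Cmod_Rmult_lt s u Hs Hu). assert (H1 := re_le_Cmod (RtoC s * u)%C).
  assert (H2 : Rabs (Re (RtoC s * u)%C) < 1) by lra. apply Rabs_def2 in H2.
  unfold Cminus. rewrite re_plus, re_opp. simpl (Re 1). lra.
Qed.

(** * Entire primitive of a Gaussian exponential *)

Definition Gcoef (k : nat) : R := / (INR (fact k) * (2 * INR k + 1)).

(* [Efun b] below is the primitive of [exp (b w^2)] vanishing at 0; [Gfun] is the entire function with [Efun b w = w
   Gfun (b w^2)]. *)
Definition Gfun (z : C) : C := CSeries (fun k => RtoC (Gcoef k) * z ^ k)%C.

Lemma Gcoef_bound k : 0 < Gcoef k <= / INR (fact k).
Proof.
  assert (H := INR_fact_lt_0 k). assert (H2 := pos_INR k). unfold Gcoef. split.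
  - apply Rinv_0_lt_compat, Rmult_lt_0_compat; lra.
  - apply Rinv_le_contravar; [exact H|]. nra.
Qed.

Lemma Gcoef_summable r : 0 <= r -> ex_series (fun k => Cmod (RtoC (Gcoef k)) * r ^ k).
Proof.
  intros Hr. apply ex_series_Rle with (fun k => / INR (fact k) * r ^ k); [|exists (exp r); apply exp_abs_series, Hr].
  intros k. assert (H := Gcoef_bound k). rewrite Cmod_R, Rabs_right by lra. assert (0 <= r ^ k) by (apply pow_le, Hr).
  split; [apply Rmult_le_pos; lra|apply Rmult_le_compat_r; lra].
Qed.

Lemma Gfun_Cser z : is_Cser (fun k => RtoC (Gcoef k) * z ^ k)%C (Gfun z).
Proof.
  destruct (ex_Cser_le (fun k => RtoC (Gcoef k) * z ^ k)%C (fun n => Cmod (RtoC (Gcoef n)) * Cmod z ^ n)) as [l Hl].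
  - intros n. rewrite Cmod_mult, Cmod_pow. lra.
  - apply Gcoef_summable, Cmod_ge_0.
  - unfold Gfun. rewrite (CSeries_unique _ _ Hl). exact Hl.
Qed.

(** Coefficientwise, [(1 + 2 * k) * Gcoef k] is [/ k!]. This differential equation is what makes
    [Efun b] a primitive of [exp (b w^2)]. *)
Lemma Gfun_holo z : exists l, is_Cholo Gfun z l /\ (Gfun z + 2 * z * l = Cexp z)%C.
Proof.
  assert (Hz := Cmod_ge_0 z).
  assert (Hex := pseries_deriv_ex (fun k => RtoC (Gcoef k)) (Cmod z + 1) z ltac:(lra) (Gcoef_summable (Cmod z + 1)
    ltac:(lra)) ltac:(lra)).
  destruct (ex_Cser_le _ _ (fun k => Rle_refl _) Hex) as [l Hl].
  exists l. split.
  - apply (pseries_holo (fun k => RtoC (Gcoef k)) (Cmod z + 1)); try lra; [apply Gcoef_summable; lra|intros w _; apply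
    Gfun_Cser|exact Hl].
  - assert (H1 : is_Cser (fun k => RtoC (INR k) * RtoC (Gcoef k) * z ^ k)%C (z * l)%C).
    { apply (is_series_decr_1 (V := C_NormedModule)). eapply evar_last; [eapply Cser_ext; [|apply (Cser_scal z _ _ Hl)]|].
      - intros k; cbv beta. rewrite Cpow_S. ring.
      - change (z * l = z * l + - (RtoC 0 * RtoC (Gcoef 0) * 1))%C. ring. }
    assert (H2 := Cser_plus _ _ _ _ (Gfun_Cser z) (Cser_scal 2 _ _ H1)).
    replace (2 * z * l)%C with (2 * (z * l))%C by ring.
    eapply is_Cser_unique; [exact H2|]. eapply Cser_ext; [|apply Cexp_series].
    intros k; cbv beta. unfold Gcoef.
    assert (Hk : RtoC (2 * INR k + 1) <> 0) by (intros E; apply RtoC_inj in E; generalize (pos_INR k); lra).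
    assert (Hf := INR_fact_neq_0_C k).
    rewrite RtoC_inv by (apply Rmult_integral_contrapositive_currified; [apply INR_fact_neq_0|generalize (pos_INR k); lra]).
    rewrite RtoC_mult. rewrite RtoC_plus, RtoC_mult in *. field. split; assumption.
Qed.

Definition Efun (b w : C) : C := (w * Gfun (b * (w * w)))%C.

Lemma Efun_opp b w : Efun b (- w) = (- Efun b w)%C.
Proof. unfold Efun. replace (- w * - w)%C with (w * w)%C by ring. ring. Qed.

Lemma Cder_Efun (b : C) (w : R -> C) t l : is_Cder w t l ->
  is_Cder (fun s => Efun b (w s)) t (Cexp (b * (w t * w t)) * l)%C.
Proof.
  intros Hw. destruct (Gfun_holo (b * (w t * w t))%C) as [g [Hg E]].
  unfold Efun. eapply evar_last.
  - apply Cder_mult; [exact Hw|]. apply (Cder_comp Gfun (fun s => b * (w s * w s))%C); [exact Hg|].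
    apply Cder_cmult, Cder_mult; exact Hw.
  - to_C. rewrite <- E. ring.
Qed.

(** * The Borel transform *)

(** Comparison with twice the telescoping series of 1 / (n (n + 1)), where n = k + 1. *)
Lemma ex_series_inv_sq : ex_series (fun k => / INR (S k) ^ 2).
Proof.
  apply ex_series_Rle with (fun k => 2 * (/ (INR (S k) * INR (S (S k))))).
  - intros k. rewrite (S_INR (S k)), (S_INR k). assert (H := pos_INR k). set (x := INR k) in *.
    split; [apply Rlt_le, Rinv_0_lt_compat; nra|].
    replace (2 * / ((x + 1) * (x + 1 + 1))) with (/ ((x + 1) * (x + 1 + 1) / 2)) by (field; lra).
    apply Rinv_le_contravar; [|nra]. apply Rdiv_lt_0_compat; [nra|lra].
  - apply (ex_series_scal (V := R_NormedModule)). exists 1.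
    assert (Hs : forall n, sum_n (fun k => / (INR (S k) * INR (S (S k)))) n = 1 - / INR (S (S n))).
    { induction n.
      - rewrite sum_O. simpl. field.
      - rewrite sum_Sn, IHn.
        change (1 - / INR (S (S n)) + / (INR (S (S n)) * INR (S (S (S n)))) = 1 - / INR (S (S (S n)))).
        rewrite (S_INR (S (S n))). assert (H := pos_INR (S n)). rewrite (S_INR (S n)). field. lra. }
    assert (H : is_lim_seq (sum_n (fun k => / (INR (S k) * INR (S (S k))))) 1); [|exact H].
    apply is_lim_seq_ext with (fun n => 1 - / INR (S (S n))); [intros n; rewrite Hs; reflexivity|].
    replace (Finite 1) with (Finite (1 - 0)) by (f_equal; ring). apply is_lim_seq_minus'; [apply is_lim_seq_const|].
    apply (is_lim_seq_incr_1 (fun n => / INR (S n))), (is_lim_seq_incr_1 (fun n => / INR n)).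
    replace (Finite 0) with (Rbar_inv p_infty) by reflexivity. apply is_lim_seq_inv; [apply is_lim_seq_INR|discriminate].
Qed.

(** [xi M k] is the singular point i pi n^2 / M with n = k + 1, and [xs M k] is its modulus. *)
Definition xs (M : nat) (k : nat) : R := PI * INR (S k) ^ 2 / INR M.
Definition xi (M : nat) (k : nat) : C := (Ci * RtoC (xs M k))%C.

Lemma xs_pos M k : (0 < M)%nat -> 0 < xs M k.
Proof.
  intros HM. apply lt_0_INR in HM. unfold xs. assert (H := PI_RGT_0). assert (0 < INR (S k)) by (rewrite S_INR;
    generalize (pos_INR k); lra).
  apply Rdiv_lt_0_compat; [|exact HM]. apply Rmult_lt_0_compat; [exact H|]. apply pow_lt; assumption.
Qed.

Lemma xs_ge M k : (0 < M)%nat -> PI / INR M <= xs M k.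
Proof.
  intros HM. apply lt_0_INR in HM. unfold xs, Rdiv. assert (H := PI_RGT_0).
  apply Rmult_le_compat_r; [apply Rlt_le, Rinv_0_lt_compat, HM|]. rewrite S_INR. generalize (pos_INR k). intros Hk. nra.
Qed.

Lemma Cmod_Ci : Cmod Ci = 1.
Proof. unfold Cmod, Ci; simpl. replace (0 * (0 * 1) + 1 * (1 * 1)) with 1 by ring. apply sqrt_1. Qed.

Lemma Cmod_xi M k : (0 < M)%nat -> Cmod (xi M k) = xs M k.
Proof. intros HM. unfold xi. rewrite Cmod_mult, Cmod_Ci, Cmod_R, Rabs_right by (apply Rle_ge, Rlt_le, xs_pos, HM). ring. Qed.

Lemma xi_neq_0 M k : (0 < M)%nat -> xi M k <> 0.
Proof. intros HM. apply Cmod_gt_0. rewrite Cmod_xi by exact HM. apply xs_pos, HM. Qed.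

Lemma ex_series_inv_xs M : (0 < M)%nat -> ex_series (fun k => / xs M k).
Proof.
  intros HM. eapply ex_series_ext; [|apply (ex_series_scal (V := R_NormedModule) (INR M / PI)), ex_series_inv_sq].
  intros k. scal_R. unfold xs. apply lt_0_INR in HM. assert (H := PI_RGT_0). assert (0 < INR (S k)) by (rewrite S_INR;
    generalize (pos_INR k); lra).
  to_R; field. lra.
Qed.

(* The Borel transform is the sum over [k] of copies of one algebraic function, singular at [xi M k] only. *)
Definition phi_term (nu M : nat) (A : nat -> C) (k : nat) (x : C) : C :=
  (A k * (RtoC (/ 2 + INR nu) / xi M k) * Qker nu (x / xi M k))%C.
Definition phi (nu M : nat) (A : nat -> C) (x : C) : C := CSeries (fun k => phi_term nu M A k x).

Lemma Cmod_rsqrt (x : C) : x <> 0 -> Cmod (rsqrt x) = sqrt (/ Cmod x).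
Proof.
  intros Hx. assert (H := f_equal Cmod (rsqrt_sq x Hx)). rewrite Cmod_mult, Cmod_inv in H by exact Hx.
  rewrite <- H. symmetry. apply sqrt_square, Cmod_ge_0.
Qed.

Definition Qbound (nu : nat) (s : R) : R := sqrt (/ s) * (/ s) ^ S nu.

Lemma Qker_bound nu z s : 0 < s -> s <= Cmod (1 - z) -> Cmod (Qker nu z) <= Qbound nu s.
Proof.
  intros Hs Hz. assert (Hn : (1 - z)%C <> 0) by (apply Cmod_gt_0; lra).
  unfold Qker, Qbound. rewrite Cmod_div by (apply Cpow_nz, Hn). rewrite Cmod_rsqrt, Cmod_pow by exact Hn.
  unfold Rdiv. rewrite <- pow_inv.
  assert (H1 : / Cmod (1 - z) <= / s) by (apply Rinv_le_contravar; lra).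
  assert (H2 : 0 < / Cmod (1 - z)) by (apply Rinv_0_lt_compat; lra).
  apply Rmult_le_compat; [apply sqrt_pos|apply pow_le; lra|apply sqrt_le_1; lra|apply pow_incr; lra].
Qed.

(** The distance from the singular point 1 to a ray is bounded below: [1 - r u] equals
    [u * (Cconj u - r)], and the imaginary part of the second factor does not depend on [r]. *)
Lemma ray_dist (u : C) (r : R) : Cmod u = 1 -> Rabs (Im u) <= Cmod (1 - RtoC r * u).
Proof.
  intros Hu. replace (Cmod (1 - RtoC r * u)) with (Cmod (Cconj u - RtoC r)).
  - replace (Im u) with (- Im (Cconj u - RtoC r)%C).
    + rewrite Rabs_Ropp. apply im_le_Cmod.
    + destruct u; unfold Im, Cconj, Cminus, Cplus, Copp, RtoC; simpl; ring.
  - assert (H : (Cconj u * u = 1)%C). { rewrite Cmult_comm, <- Cmod2_conj, Hu. rewrite pow1. reflexivity. }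
    replace (1 - RtoC r * u)%C with ((Cconj u - RtoC r) * u)%C by (rewrite <- H; ring).
    rewrite Cmod_mult, Hu. ring.
Qed.

Lemma unit_Im_pos (u : C) : Cmod u = 1 -> Rabs (Im u) <= 1.
Proof. intros H. rewrite <- H. apply im_le_Cmod. Qed.

(** For [r <= / 2] the real part is at least 1/4; for larger [r] the imaginary part [r * Im u]
    exceeds the perturbation. *)
Lemma ray_slit (u h : C) (r : R) : Cmod u = 1 -> Im u <> 0 -> 0 <= r -> Cmod h <= Rabs (Im u) / 4 ->
  slit (1 - RtoC r * u - h)%C.
Proof.
  intros Hu Hi Hr Hh. assert (Hs := Rabs_pos_lt _ Hi). assert (H1 := unit_Im_pos u Hu).
  assert (Hhr := re_le_Cmod h). assert (Hhi := im_le_Cmod h).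
  destruct (Rle_dec r (/ 2)) as [Hr2|Hr2].
  - left. unfold Cminus. rewrite !re_plus, !re_opp, re_scal_l. change (Re 1) with 1.
    assert (Hur := re_le_Cmod u). rewrite Hu in Hur. apply Rabs_le_between in Hur.
    assert (r * Re u <= / 2) by nra. assert (Re h <= / 4) by (generalize (Rle_abs (Re h)); lra). lra.
  - right. unfold Cminus. rewrite !im_plus, !im_opp, im_scal_l. change (Im 1) with 0. intros E.
    assert (E2 : Im h = - (r * Im u)) by lra. rewrite E2, Rabs_Ropp, Rabs_mult, (Rabs_right r) in Hhi by lra. nra.
Qed.

(** By [ray_dist], a radius of a quarter of [Cmod y * Rabs (Im u)] keeps the relative displacement
    [v] within 1/4. The resulting bound depends neither on the position on the ray nor on [y]. *)
Lemma Qker_wiener nu (u x0 y : C) (r R0 : R) : 0 < R0 -> Cmod u = 1 -> Im u <> 0 -> 0 <= r -> y <> 0 -> (x0 / y = RtoC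
  r * u)%C ->
  R0 <= Cmod y * Rabs (Im u) / 4 ->
  wiener x0 R0 (fun x => Qker nu (x / y)) (Qbound nu (Rabs (Im u)) * Series (fun n => bcoef (/ 2 + INR (S nu)) n * (/
    4) ^ n)).
Proof.
  intros HR Hu Hi Hr Hy Hx0 HR0. set (z0 := (x0 / y)%C).
  assert (Hs := Rabs_pos_lt _ Hi). assert (Hm : 0 < Cmod y) by (apply Cmod_gt_0, Hy).
  assert (Hd : Rabs (Im u) <= Cmod (1 - z0)) by (unfold z0; rewrite Hx0; apply ray_dist, Hu).
  assert (Hn : (1 - z0)%C <> 0) by (apply Cmod_gt_0; lra).
  set (p := / 2 + INR (S nu)). assert (Hp : 0 < p) by (unfold p; rewrite S_INR; generalize (pos_INR nu); lra).
  set (e := (/ (y * (1 - z0)))%C).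
  assert (He : Cmod e * R0 <= / 4).
  { unfold e. rewrite Cmod_inv, Cmod_mult by (apply Cmult_neq_0; assumption).
    apply (Rmult_le_reg_l (Cmod y * Cmod (1 - z0))); [apply Rmult_lt_0_compat; lra|].
    rewrite <- Rmult_assoc, Rinv_r, Rmult_1_l by (apply Rmult_integral_contrapositive_currified; lra). nra. }
  exists (fun n => Qker nu z0 * (RtoC (bcoef p n) * e ^ n))%C.
  assert (Hb : ex_series (fun n => bcoef p n * (/ 4) ^ n)) by (apply bcoef_summable; lra).
  assert (Hle : forall n, 0 <= Cmod (Qker nu z0 * (RtoC (bcoef p n) * e ^ n)) * R0 ^ n <= Qbound nu (Rabs (Im u)) *
    (bcoef p n * (/ 4) ^ n)).
  { intros n. assert (HR0' : 0 <= R0 ^ n) by (apply pow_le; lra). split; [apply Rmult_le_pos; [apply Cmod_ge_0|exact HR0']|].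
    assert (Hbn := bcoef_pos p n Hp).
    rewrite !Cmod_mult, Cmod_R, Cmod_pow, (Rabs_right (bcoef p n)) by lra.
    replace (Cmod (Qker nu z0) * (bcoef p n * Cmod e ^ n) * R0 ^ n) with (Cmod (Qker nu z0) * (bcoef p n * (Cmod e *
      R0) ^ n)) by (rewrite Rpow_mult_distr; ring).
    assert (0 <= Cmod e * R0) by (apply Rmult_le_pos; [apply Cmod_ge_0|lra]).
    apply Rmult_le_compat; [apply Cmod_ge_0|apply Rmult_le_pos; [lra|apply pow_le; assumption]|apply Qker_bound; [exact
      Hs|exact Hd]|].
    apply Rmult_le_compat_l; [lra|]. apply pow_incr. lra. }
  assert (Hb' : ex_series (fun n => Qbound nu (Rabs (Im u)) * (bcoef p n * (/ 4) ^ n))) by (apply (ex_series_scal (V :=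
    R_NormedModule)); exact Hb).
  repeat split.
  - eapply ex_series_Rle; [exact Hle|exact Hb'].
  - rewrite <- Series_scal_l. apply Series_le; [exact Hle|exact Hb'].
  - intros x Hx. set (v := (e * (x - x0))%C).
    assert (Hv : Cmod v < 1).
    { unfold v. rewrite Cmod_mult. assert (Cmod e * Cmod (x - x0) <= Cmod e * R0) by (apply Rmult_le_compat_l; [apply
      Cmod_ge_0|exact Hx]). lra. }
    replace (x / y)%C with (z0 + (1 - z0) * v)%C.
    2:{ unfold v, e. unfold z0 at 1. field_simplify_eq; [|split; assumption]. unfold z0; field; exact Hy. }
    rewrite Qker_expand; [|exact Hv|].
    + eapply Cser_ext; [|apply (Cser_scal (Qker nu z0)), (Bser_Cser p v Hp Hv)].
      intros n; cbv beta. unfold v. rewrite Cpow_mult_l. ring.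
    + intros s Hs1. replace ((1 - z0) * (1 - s * v))%C with (1 - RtoC r * u - s * ((x - x0) / y))%C.
      2:{ rewrite <- Hx0. fold z0. unfold v, e. field. split; assumption. }
      apply ray_slit; trivial. rewrite Cmod_mult, Cmod_R, Rabs_right, Cmod_div by (try lra; exact Hy).
      assert (Hxy : Cmod (x - x0) / Cmod y <= Rabs (Im u) / 4).
      { apply Rle_div_l; [exact Hm|]. lra. }
      assert (0 <= Cmod (x - x0) / Cmod y) by (apply Rmult_le_pos; [apply Cmod_ge_0|apply Rlt_le, Rinv_0_lt_compat, Hm]).
      nra.
Qed.

Lemma coef_bound nu M A K k : (0 < M)%nat -> Cmod (A k) <= K ->
  Cmod (A k * (RtoC (/ 2 + INR nu) / xi M k))%C <= K * (/ 2 + INR nu) * / xs M k.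
Proof.
  intros HM HA. rewrite Cmod_mult, Cmod_div, Cmod_xi, Cmod_R by (try apply xi_neq_0; exact HM).
  assert (H := pos_INR nu). rewrite Rabs_right by lra. unfold Rdiv. rewrite Rmult_assoc. apply Rmult_le_compat_r;
    [|exact HA].
  apply Rmult_le_pos; [lra|apply Rlt_le, Rinv_0_lt_compat, xs_pos, HM].
Qed.

(** All singular points lie on the imaginary half-axis, so division by any of them carries the ray
    of direction [Ci * u] to the ray of direction [u], and the singularity to 1. *)
Lemma ray_xi M k t (e u : C) : (0 < M)%nat -> e = (Ci * u)%C -> (RtoC t * e / xi M k = RtoC (t / xs M k) * u)%C.
Proof.
  intros HM ->. assert (H := xs_pos M k HM). unfold xi. rewrite RtoC_div by lra. field. split; [intros E; apply
    RtoC_inj in E; lra|exact Ci_nz].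
Qed.

(** One radius [R0] serves all terms because every [xs M k] is at least [PI / INR M]; the norms are
    summable like 1/k^2 thanks to the factor [/ xi M k], so bounded [A] suffices. *)
Lemma phi_analytic nu M A K (e u : C) t : (0 < M)%nat -> (forall k, Cmod (A k) <= K) ->
  e = (Ci * u)%C -> Cmod u = 1 -> Im u <> 0 -> 0 <= t ->
  analytic_at (phi nu M A) (RtoC t * e)%C.
Proof.
  intros HM HA He Hu Hi Ht.
  set (R0 := PI / INR M * Rabs (Im u) / 4). assert (Hs := Rabs_pos_lt _ Hi). assert (HMR := lt_0_INR M HM).
  assert (HpM : 0 < PI / INR M) by (apply Rdiv_lt_0_compat; [apply PI_RGT_0|exact HMR]).
  assert (HR0 : 0 < R0) by (unfold R0; nra).
  assert (HK : 0 <= K) by (eapply Rle_trans; [apply Cmod_ge_0|apply (HA 0%nat)]).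
  set (Q := Qbound nu (Rabs (Im u)) * Series (fun n => bcoef (/ 2 + INR (S nu)) n * (/ 4) ^ n)).
  assert (Hw : forall k, wiener (RtoC t * e) R0 (phi_term nu M A k) (K * (/ 2 + INR nu) * / xs M k * Q)).
  { intros k. assert (HQ : wiener (RtoC t * e) R0 (fun x => Qker nu (x / xi M k)) Q).
    { apply (Qker_wiener nu u _ _ (t / xs M k)); trivial.
      - apply Rmult_le_pos; [exact Ht|apply Rlt_le, Rinv_0_lt_compat, xs_pos, HM].
      - apply xi_neq_0, HM.
      - apply ray_xi; assumption.
      - rewrite Cmod_xi by exact HM. unfold R0, Rdiv. assert (H := xs_ge M k HM). unfold Rdiv in H.
        apply Rmult_le_compat_r; [lra|]. apply Rmult_le_compat_r; lra. }
    eapply wiener_le; [|apply (wiener_scal _ _ _ _ (A k * (RtoC (/ 2 + INR nu) / xi M k))%C HQ)].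
    apply Rmult_le_compat_r; [apply (wiener_nonneg _ _ _ _ HR0 HQ)|]. apply coef_bound; auto. }
  assert (HB : ex_series (fun k => K * (/ 2 + INR nu) * / xs M k * Q)).
  { apply ex_series_scal_r. apply (ex_series_scal (V := R_NormedModule)). apply ex_series_inv_xs, HM. }
  eapply (wiener_analytic _ R0); [exact HR0|]. eapply (wiener_series _ _ _ _ _ HR0 Hw HB).
  intros s Hs1. destruct (ex_Cser_le (fun k => phi_term nu M A k s) _ (fun k => wiener_norm _ _ _ _ s HR0 (Hw k) Hs1)
    HB) as [l Hl].
  unfold phi. rewrite (CSeries_unique _ _ Hl). exact Hl.
Qed.

(** In this disc [x / xi M k] has modulus at most 1/2; every kernel is expanded in its binomial
    series and the double series is exchanged. The coefficients match because [(nu + 1/2)] times the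
    binomial coefficient for the exponent [nu + 3/2] is [poch (/ 2 + INR nu) (S n) / n!]. *)
Lemma phi_germ nu M A K (c : nat -> C) x : (0 < M)%nat -> (forall k, Cmod (A k) <= K) ->
  (forall p, is_Cser (fun k => A k * RtoC (poch (/ 2 + INR nu) (S p)) / xi M k ^ S p)%C (c (S p))) ->
  Cmod x < PI / INR M / 2 ->
  @is_pseries C_AbsRing C_NormedModule (Borel_coeff c) x (phi nu M A x).
Proof.
  intros HM HA Hc Hx. apply Cpseries_iff. assert (HMR := lt_0_INR M HM).
  assert (HK : 0 <= K) by (eapply Rle_trans; [apply Cmod_ge_0|apply (HA 0%nat)]).
  set (al := / 2 + INR nu). set (p := / 2 + INR (S nu)).
  assert (Hal : 0 < al) by (unfold al; generalize (pos_INR nu); lra).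
  assert (Hpal : p = al + 1) by (unfold p, al; rewrite S_INR; ring).
  assert (Hp : 0 < p) by lra.
  assert (Hz : forall k, Cmod (x / xi M k) <= / 2).
  { intros k. rewrite Cmod_div, Cmod_xi by (try apply xi_neq_0; exact HM). assert (H := xs_ge M k HM). assert (H' :=
    xs_pos M k HM).
    apply Rle_div_l; [exact H'|]. lra. }
  set (b := fun k n => K * al * / xs M k * (bcoef p n * (/ 2) ^ n)).
  assert (Hbs : ex_series (fun n => bcoef p n * (/ 2) ^ n)) by (apply bcoef_summable; lra).
  set (S0 := Series (fun n => bcoef p n * (/ 2) ^ n)).
  assert (Hex : ex_series (fun k => K * al * / xs M k * S0)).
  { apply ex_series_scal_r. apply (ex_series_scal (V := R_NormedModule)). apply ex_series_inv_xs, HM. }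
  assert (Hab : forall k n, Cmod (A k * (RtoC al / xi M k) * (RtoC (bcoef p n) * (x / xi M k) ^ n)) <= b k n).
  { intros k n. unfold b. rewrite Cmod_mult. assert (Hb := bcoef_pos p n Hp).
    apply Rmult_le_compat; try apply Cmod_ge_0; [apply coef_bound; auto|].
    rewrite Cmod_mult, Cmod_R, Cmod_pow, Rabs_right by lra. apply Rmult_le_compat_l; [lra|].
    apply pow_incr. split; [apply Cmod_ge_0|apply Hz]. }
  assert (Hrow : forall k, is_Cser (fun n => A k * (RtoC al / xi M k) * (RtoC (bcoef p n) * (x / xi M k) ^ n))%C
    (phi_term nu M A k x)).
  { intros k. unfold phi_term. apply Cser_scal. rewrite Qker_Bser by (eapply Rle_lt_trans; [apply Hz|lra]).
    apply Bser_Cser; [exact Hp|]. eapply Rle_lt_trans; [apply Hz|lra]. }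
  destruct (double_series (fun k n => A k * (RtoC al / xi M k) * (RtoC (bcoef p n) * (x / xi M k) ^ n))%C b
     (fun k => K * al * / xs M k * S0) (fun k => phi_term nu M A k x) (fun n => Borel_coeff c n * x ^ n)%C) as [L [H1
       H2]]; trivial.
  - intros k. unfold b. apply (ex_series_scal (V := R_NormedModule)). exact Hbs.
  - intros k. unfold b. rewrite Series_scal_l. unfold S0; lra.
  - intros n. eapply evar_last; [eapply Cser_ext; [|apply (Cser_scal (x ^ n / RtoC (INR (fact n))) _ _ (Hc n))]|].
    + intros k. cbv beta. fold al.
      assert (E : RtoC (poch al (S n)) = (RtoC al * RtoC (bcoef p n) * RtoC (INR (fact n)))%C).
      { rewrite <- !RtoC_mult. f_equal. rewrite Hpal. unfold bcoef.
        change (poch al (S n)) with (poch al n * (al + INR n)). rewrite <- poch_shift. field. apply INR_fact_neq_0. }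
      rewrite E. assert (Hxi := xi_neq_0 M k HM). unfold Cdiv. rewrite Cpow_mult_l, Cpow_inv, Cpow_S by exact Hxi.
      field. repeat split; first [exact Hxi|apply Cpow_nz, Hxi|apply INR_fact_neq_0_C].
    + to_C. unfold Borel_coeff. field. apply INR_fact_neq_0_C.
  - unfold phi. rewrite (CSeries_unique _ _ H1). exact H2.
Qed.

(** * Lateral sums *)

(* A primitive of [(nu + 1/2) exp (- b z) (1 - z)^(- nu - 3/2)]; with [w = (1 - z)^(1/2)] its transcendental part is
   the odd function [Efun b w]. *)
Definition Psi (nu : nat) (b z : C) : C :=
  let v := rsqrt (1 - z) in
  let E := (Cexp (- b) * Efun b ((1 - z) * v))%C in
  match nu with
  | O => (Cexp (- (b * z)) * v - 2 * b * E)%C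
  | S _ => (Cexp (- (b * z)) * (v * v * v + 2 * b * v) - 4 * b * b * E)%C
  end.

Lemma Qker_rsqrt nu z : (1 - z)%C <> 0 -> Qker nu z = (rsqrt (1 - z) * (rsqrt (1 - z) * rsqrt (1 - z)) ^ S nu)%C.
Proof.
  intros H. unfold Qker. rewrite rsqrt_sq by exact H. rewrite Cpow_inv by exact H. reflexivity.
Qed.

(** With v = (1 - z)^(-1/2) and w = (1 - z) v one has w^2 = 1 - z, dv/dz = v^3 / 2 and dw/dz = - v /
    2. Since exp(- b) exp(b w^2) = exp(- b z), the derivative of the [Efun] term cancels the surplus
    multiple of v exp(- b z) and only the highest power of v remains. *)
Lemma Psi_deriv nu b zeta t : (nu <= 1)%nat -> slit (1 - RtoC t * zeta)%C ->
  is_Cder (fun s => Psi nu b (RtoC s * zeta)) t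
    (Cexp (- (b * (RtoC t * zeta))) * (RtoC (/ 2 + INR nu) * zeta) * Qker nu (RtoC t * zeta))%C.
Proof.
  intros Hnu Hs. assert (Hn := slit_neq_0 _ Hs).
  assert (Hz := Cder_scale zeta t).
  assert (H1z : is_Cder (fun s => 1 - RtoC s * zeta)%C t (- zeta)%C).
  { eapply evar_last; [eapply Cder_ext; [|apply (Cder_plus _ _ _ _ _ (Cder_const 1 t) (Cder_cmult (-1) _ _ _ Hz))]|].
    - intros s; cbv beta; ring.
    - to_C; ring. }
  assert (Hv := Cder_rsqrt _ _ _ H1z Hs).
  assert (He : is_Cder (fun s => Cexp (- (b * (RtoC s * zeta)))) t (Cexp (- (b * (RtoC t * zeta))) * (- b * zeta))%C).
  { apply (Cder_Cexp (fun s => - (b * (RtoC s * zeta)))%C).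
    eapply Cder_ext; [|apply (Cder_cmult (- b)%C _ _ _ Hz)]. intros s; cbv beta; ring. }
  assert (HE := Cder_Efun b _ _ _ (Cder_mult _ _ _ _ _ H1z Hv)). cbv beta in HE, Hv.
  set (v := rsqrt (1 - t * zeta)) in *.
  assert (Hvv : (v * v = / (1 - t * zeta))%C) by (apply rsqrt_sq, Hn).
  assert (Hww : ((1 - t * zeta) * v * ((1 - t * zeta) * v) = 1 - t * zeta)%C).
  { replace ((1 - t * zeta) * v * ((1 - t * zeta) * v))%C with ((1 - t * zeta) * (1 - t * zeta) * (v * v))%C by ring.
    rewrite Hvv. field. exact Hn. }
  rewrite Hww in HE.
  assert (Hexp : (Cexp (- b) * Cexp (b * (1 - t * zeta)) = Cexp (- (b * (t * zeta))))%C) by (rewrite <- Cexp_plus;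
    f_equal; ring).
  assert (Hvl : (- v / (2 * (1 - t * zeta)) * - zeta = v * v * v * zeta / 2)%C).
  { replace (v * v * v)%C with (v * (v * v))%C by ring. rewrite Hvv. field. exact Hn. }
  rewrite Hvl in Hv, HE.
  assert (Hwl : (- zeta * v + (1 - t * zeta) * (v * v * v * zeta / 2) = - (v * zeta / 2))%C).
  { replace (v * v * v)%C with (v * (v * v))%C by ring. rewrite Hvv. field. exact Hn. }
  rewrite Hwl in HE.
  rewrite Qker_rsqrt by exact Hn. fold v.
  destruct nu as [|[|nu]]; [| |lia].
  - unfold Psi. eapply evar_last.
    + eapply Cder_ext; [|apply (Cder_plus _ _ _ _ _ (Cder_mult _ _ _ _ _ He Hv) (Cder_cmult (- (2 * b) * Cexp (- b))%C
      _ _ _ HE))].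
      intros s; cbv beta. ring.
    + to_C. fold v. simpl INR. rewrite Rplus_0_r, RtoC_inv by lra.
      replace (Cexp (b * (1 - t * zeta))) with (Cexp (- (b * (t * zeta))) / Cexp (- b))%C by (rewrite <- Hexp; field;
        apply Cexp_neq_0).
      simpl Cpow. field. apply Cexp_neq_0.
  - unfold Psi. eapply evar_last.
    + eapply Cder_ext; [|apply (Cder_plus _ _ _ _ _ (Cder_mult _ _ _ _ _ He (Cder_plus _ _ _ _ _ (Cder_mult _ _ _ _ _
      (Cder_mult _ _ _ _ _ Hv Hv) Hv) (Cder_cmult (2 * b)%C _ _ _ Hv))) (Cder_cmult (- (4 * b * b) * Cexp (- b))%C _ _
        _ HE))].
      intros s; cbv beta. ring.
    + to_C. fold v. simpl INR. rewrite RtoC_plus, RtoC_inv by lra.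
      replace (Cexp (b * (1 - t * zeta))) with (Cexp (- (b * (t * zeta))) / Cexp (- b))%C by (rewrite <- Hexp; field;
        apply Cexp_neq_0).
      simpl Cpow. field. apply Cexp_neq_0.
Qed.

(** The substitute for deforming a contour: the difference of two values of the primitive is an
    integral over the segment between them. *)
Lemma Efun_segment b p q m : (forall s, 0 <= s <= 1 -> exp (Re (b * ((q + RtoC s * (p - q)) * (q + RtoC s * (p -
  q))))%C) <= m) ->
  Cmod (Efun b p - Efun b q) <= Cmod (p - q) * m.
Proof.
  intros Hm.
  assert (Hg : forall s, is_Cder (fun s => q + RtoC s * (p - q))%C s (p - q)%C).
  { intros s. eapply evar_last; [apply Cder_plus; [apply Cder_const|apply Cder_scale]|]. to_C; ring. }
  assert (HI : is_CRInt (fun s => Cexp (b * ((q + RtoC s * (p - q)) * (q + RtoC s * (p - q)))) * (p - q))%C 0 1 (Efun b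
    p - Efun b q)%C).
  { eapply evar_last; [apply (CRInt_FTC (fun s => Efun b (q + RtoC s * (p - q))%C))|].
    - intros x _. apply Cder_Efun, Hg.
    - intros x _. apply Ccont_mult; [|apply Ccont_const].
      eapply Cder_continuous. apply (Cder_Cexp (fun s => b * ((q + RtoC s * (p - q)) * (q + RtoC s * (p - q))))%C).
      apply Cder_cmult, Cder_mult; apply Hg.
    - to_C. replace (q + 1 * (p - q))%C with p by ring. replace (q + 0 * (p - q))%C with q by ring. reflexivity. }
  assert (Hc := @is_RInt_const R_NormedModule 0 1 (Cmod (p - q) * m)).
  eapply Rle_trans; [eapply (CRInt_norm_le _ (fun _ => Cmod (p - q) * m) 0 1 _ _ Rle_0_1); [|exact HI|exact Hc]|].
  - intros s Hs. cbv beta. rewrite Cmod_mult, Cmod_Cexp, Rmult_comm. apply Rmult_le_compat_l; [apply Cmod_ge_0|apply Hm, Hs].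
  - scal_R. lra.
Qed.

(** By oddness the sum is the increment of [Efun b] over the horizontal segment from [- Cconj w] to
    [w]. On it the real part of b z^2 is a convex function of the abscissa, as [0 < Re b], so the
    endpoints bound it. *)
Lemma Efun_sum_bound b w m : 0 < Re b ->
  exp (Re (b * (w * w))%C) <= m -> exp (Re (b * (Cconj w * Cconj w))%C) <= m ->
  Cmod (Efun b w + Efun b (Cconj w)) <= 2 * Cmod w * m.
Proof.
  intros Hb H1 H2.
  replace (Efun b w + Efun b (Cconj w))%C with (Efun b w - Efun b (- Cconj w))%C by (rewrite Efun_opp; ring).
  assert (Hm0 : 0 < m) by (generalize (exp_pos (Re (b * (w * w))%C)); lra).
  eapply Rle_trans; [apply (Efun_segment b w (- Cconj w) m)|].
  - intros s Hs. destruct b as [br bi], w as [X Y].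
    set (f := fun a => br * (a * a - Y * Y) - bi * (2 * a * Y)).
    assert (E : forall a z, z = (a, Y) -> Re ((br, bi) * (z * z))%C = f a).
    { intros a z ->. unfold f, Re, Cmult; simpl. ring. }
    set (a := - X + 2 * X * s).
    rewrite (E a) by (unfold a, Cconj, Copp, Cminus, Cplus, Cmult, RtoC; simpl; f_equal; ring).
    rewrite (E X) in H1 by reflexivity.
    replace (Cconj (X, Y) * Cconj (X, Y))%C with (((- X)%R, Y) * ((- X)%R, Y))%C in H2 by (unfold Cconj, Cmult; simpl;
      f_equal; ring).
    rewrite (E (- X)) in H2 by reflexivity. simpl in Hb.
    assert (Ha : f a <= Rmax (f X) (f (- X))).
    { assert (Hc : f a <= s * f X + (1 - s) * f (- X)).
      { unfold f, a. assert (0 <= s * (1 - s)) by nra. assert (0 <= X * X) by nra.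
        assert (0 <= br * (s * (1 - s) * (X * X))) by (apply Rmult_le_pos; [lra|apply Rmult_le_pos; lra]). nra. }
      generalize (Rmax_l (f X) (f (- X))) (Rmax_r (f X) (f (- X))). nra. }
    eapply Rle_trans; [|exact (Rmax_case (f X) (f (- X)) (fun r => exp r <= m) H1 H2)].
    destruct Ha as [Ha| ->]; [apply Rlt_le, exp_increasing, Ha|lra].
  - apply Rmult_le_compat_r; [lra|]. eapply Rle_trans; [apply Cmod_triangle|]. rewrite !Cmod_opp, Cmod_conj. lra.
Qed.

Lemma filterlim_exp_bound (f : R -> C) (B k : R) : 0 < k ->
  (forall t, 0 <= t -> Cmod (f t) <= B * exp (- (k * t))) ->
  filterlim f (Rbar_locally p_infty) (locally (RtoC 0)).
Proof.
  intros Hk HB. apply (filterlim_C (Rbar_locally p_infty)). intros e He.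
  assert (HB0 : 0 <= B).
  { specialize (HB 0 (Rle_refl _)). rewrite Rmult_0_r, Ropp_0, exp_0 in HB. generalize (Cmod_ge_0 (f 0)); lra. }
  assert (H0 : 0 <= B / k / e) by (repeat apply Rmult_le_pos; try lra; apply Rlt_le, Rinv_0_lt_compat; lra).
  exists (B / k / e). intros t Ht. replace (f t - 0)%C with (f t) by ring.
  eapply Rle_lt_trans; [apply HB; lra|]. rewrite exp_Ropp.
  assert (Hx := exp_ineq1_le (k * t)). assert (He1 := exp_pos (k * t)).
  apply (Rmult_lt_reg_r (exp (k * t))); [exact He1|]. rewrite Rmult_assoc, Rinv_l, Rmult_1_r by lra.
  apply (Rmult_lt_compat_l (k * e)) in Ht; [|apply Rmult_lt_0_compat; lra].
  replace (k * e * (B / k / e)) with B in Ht by (field; lra). nra.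
Qed.

(** Half of the decay rate pays for the linear factor. *)
Lemma lin_exp_bound (x rho t : R) : 0 < x -> 0 < rho -> 0 <= t ->
  (1 + x * t) * exp (- (rho * t)) <= (1 + 2 * x / rho) * exp (- (rho / 2 * t)).
Proof.
  intros Hx Hr Ht. replace (- (rho * t)) with (- (rho / 2 * t) + - (rho / 2 * t)) by field. rewrite exp_plus.
  assert (H := exp_pos (- (rho / 2 * t))).
  rewrite <- Rmult_assoc. apply Rmult_le_compat_r; [lra|].
  rewrite exp_Ropp. assert (H1 := exp_ineq1_le (rho / 2 * t)). assert (H2 := exp_pos (rho / 2 * t)).
  apply (Rmult_le_reg_r (exp (rho / 2 * t))); [exact H2|]. rewrite Rmult_assoc, Rinv_l, Rmult_1_r by lra.
  assert (Hq : 0 < 2 * x / rho) by (apply Rdiv_lt_0_compat; lra).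
  assert (E : 2 * x / rho * (rho / 2 * t) = x * t) by (field; lra).
  assert (0 <= rho / 2 * t) by nra. nra.
Qed.

Lemma rsqrt_conj x : slit x -> rsqrt (Cconj x) = Cconj (rsqrt x).
Proof.
  intros Hx. assert (Hc : slit (Cconj x)). { destruct Hx as [H|H]; [left; rewrite re_conj; exact H|right; rewrite
    im_conj; lra]. }
  apply sqrt_unique.
  - rewrite rsqrt_sq by (apply slit_neq_0, Hc). rewrite <- Cmult_conj, rsqrt_sq by (apply slit_neq_0, Hx).
    symmetry. apply Cinv_conj, slit_neq_0, Hx.
  - apply rsqrt_Re, Hc.
  - rewrite re_conj. apply rsqrt_Re, Hx.
Qed.

(* The branches of [w] on the two sides of the cut tend to be opposite, so the odd terms cancel in the average. *)
Lemma Psi_sum_lim nu b u x rho : Cmod u = 1 -> Im u <> 0 -> 0 < x -> 0 < Re b -> 0 < rho ->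
  rho <= Re (b * (RtoC x * u))%C -> rho <= Re (b * (RtoC x * Cconj u))%C ->
  filterlim (fun t => Psi nu b (RtoC t * (RtoC x * u)) + Psi nu b (RtoC t * (RtoC x * Cconj u)))%C
    (Rbar_locally p_infty) (locally (RtoC 0)).
Proof.
  intros Hu Hi Hx Hb Hrho H1 H2. assert (Hs := Rabs_pos_lt _ Hi).
  set (V := sqrt (/ Rabs (Im u))).
  assert (HV : 0 <= V) by apply sqrt_pos.
  (* [V] bounds [rsqrt] on both rays. The first summand of [D] covers the algebraic part and the
     second the [Efun] part, each for both values of [nu]. *)
  set (D := 2 * (V + V * V * V + 2 * Cmod b * V) + (2 * Cmod b + 4 * Cmod b * Cmod b) * 2).
  assert (Hb0 := Cmod_ge_0 b).
  assert (HD : 0 <= D).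
  { unfold D. assert (0 <= V * V * V) by (repeat apply Rmult_le_pos; lra). assert (0 <= Cmod b * V) by (apply
    Rmult_le_pos; lra).
    assert (0 <= Cmod b * Cmod b) by (apply Rmult_le_pos; lra). lra. }
  apply (filterlim_exp_bound _ (D * (1 + 2 * x / rho)) (rho / 2)); [lra|].
  intros t Ht. rewrite Rmult_assoc. eapply Rle_trans; [|apply Rmult_le_compat_l; [exact HD|apply lin_exp_bound; assumption]].
  set (z1 := (RtoC t * (RtoC x * u))%C). set (z2 := (RtoC t * (RtoC x * Cconj u))%C).
  (* The two rays are conjugate, so the principal roots [v] and [w] on the second are the conjugates
     of those on the first; [b] is not conjugated. *)
  assert (Hz12 : z2 = Cconj z1) by (unfold z1, z2; destruct u; unfold Cconj, Cmult, RtoC; simpl; f_equal; ring).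
  assert (Hz1 : z1 = (RtoC (t * x) * u)%C) by (unfold z1; rewrite RtoC_mult; ring).
  assert (Htx : 0 <= t * x) by (apply Rmult_le_pos; lra).
  assert (Hd1 : Rabs (Im u) <= Cmod (1 - z1)) by (rewrite Hz1; apply ray_dist, Hu).
  assert (Hsl : slit (1 - z1)%C).
  { replace (1 - z1)%C with (1 - RtoC (t * x) * u - 0)%C by (rewrite Hz1; ring). apply ray_slit; trivial. rewrite
    Cmod_0; lra. }
  assert (Hc2 : (1 - z2 = Cconj (1 - z1))%C) by (rewrite Hz12, Cminus_conj; f_equal; unfold Cconj, RtoC; simpl;
    f_equal; ring).
  assert (Hn := slit_neq_0 _ Hsl).
  set (v := rsqrt (1 - z1)). assert (Hv2 : rsqrt (1 - z2) = Cconj v) by (rewrite Hc2; apply rsqrt_conj, Hsl).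
  assert (HVv : Cmod v <= V).
  { unfold v, V. rewrite Cmod_rsqrt by exact Hn. apply sqrt_le_1_alt. apply Rinv_le_contravar; lra. }
  set (w := ((1 - z1) * v)%C). assert (Hw2 : ((1 - z2) * Cconj v)%C = Cconj w) by (rewrite Hc2; unfold w; rewrite
    Cmult_conj; reflexivity).
  assert (Hww : (w * w = 1 - z1)%C).
  { unfold w. replace ((1 - z1) * v * ((1 - z1) * v))%C with ((1 - z1) * (1 - z1) * (v * v))%C by ring. unfold v.
    rewrite rsqrt_sq by exact Hn. field. exact Hn. }
  assert (Hwm : Cmod w <= 1 + x * t).
  { assert (E : Cmod w * Cmod w = Cmod (1 - z1)) by (rewrite <- Cmod_mult, Hww; reflexivity).
    assert (E2 : Cmod (1 - z1) <= 1 + x * t).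
    { eapply Rle_trans; [apply Cmod_triangle|]. rewrite Cmod_opp, Cmod_1, Hz1, Cmod_mult, Hu, Cmod_R, Rabs_right by
      lra. lra. }
    generalize (Cmod_ge_0 w). nra. }
  set (e := exp (- (rho * t))). assert (He : 0 < e) by apply exp_pos.
  assert (Hexp : forall y, rho <= Re (b * y)%C -> exp (Re (- (b * (RtoC t * y)))%C) <= e).
  { intros y Hy. unfold e. assert (E : Re (- (b * (RtoC t * y)))%C = - (t * Re (b * y)%C)).
    { replace (b * (RtoC t * y))%C with (RtoC t * (b * y))%C by ring. rewrite re_opp, re_scal_l. reflexivity. }
    rewrite E. assert (E2 : - (t * Re (b * y)%C) <= - (rho * t)) by nra.
    destruct E2 as [E2| ->]; [apply Rlt_le, exp_increasing, E2|lra]. }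
  assert (He1 : Cmod (Cexp (- (b * z1))) <= e) by (rewrite Cmod_Cexp; apply Hexp, H1).
  assert (He2 : Cmod (Cexp (- (b * z2))) <= e) by (rewrite Cmod_Cexp; apply Hexp, H2).
  assert (HE : Cmod (Cexp (- b) * (Efun b w + Efun b (Cconj w))) <= 2 * ((1 + x * t) * e)).
  { rewrite Cmod_mult, Cmod_Cexp, re_opp, exp_Ropp. assert (Hebp := exp_pos (Re b)).
    apply (Rmult_le_reg_l (exp (Re b))); [exact Hebp|]. rewrite <- Rmult_assoc, Rinv_r, Rmult_1_l by lra.
    eapply Rle_trans; [apply (Efun_sum_bound b w (exp (Re b) * e)); [exact Hb| |]|].
    - rewrite Hww. replace (b * (1 - z1))%C with (b + - (b * z1))%C by ring. rewrite re_plus, exp_plus.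
      apply Rmult_le_compat_l; [lra|apply Hexp, H1].
    - rewrite <- Cmult_conj, Hww, <- Hc2. replace (b * (1 - z2))%C with (b + - (b * z2))%C by ring. rewrite re_plus,
      exp_plus.
      apply Rmult_le_compat_l; [lra|apply Hexp, H2].
    - assert (0 < exp (Re b) * e) by (apply Rmult_lt_0_compat; lra). nra. }
  assert (H1t : 1 <= 1 + x * t) by nra.
  assert (Hve : forall z y, Cmod (Cexp (- (b * z))) <= e -> Cmod (Cexp (- (b * z)) * y) <= Cmod y * ((1 + x * t) * e)).
  { intros z y Hz. rewrite Cmod_mult, Rmult_comm. apply Rmult_le_compat_l; [apply Cmod_ge_0|]. nra. }
  assert (Hv3 : forall y, Cmod y <= V -> Cmod (y * y * y + 2 * b * y) <= V * V * V + 2 * Cmod b * V).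
  { intros y Hy. assert (Hy0 := Cmod_ge_0 y). eapply Rle_trans; [apply Cmod_triangle|]. rewrite !Cmod_mult, Cmod_R,
    Rabs_right by lra.
    assert (Cmod y * Cmod y <= V * V) by (apply Rmult_le_compat; lra). apply Rplus_le_compat.
    - apply Rmult_le_compat; try lra. apply Rmult_le_pos; lra.
    - apply Rmult_le_compat_l; lra. }
  set (T := (1 + x * t) * e) in *. assert (HT : 0 < T) by (apply Rmult_lt_0_compat; lra).
  assert (HVc : Cmod (Cconj v) <= V) by (rewrite Cmod_conj; exact HVv).
  assert (0 <= V * V * V) by (repeat apply Rmult_le_pos; lra). assert (0 <= Cmod b * V) by (apply Rmult_le_pos; lra).
  assert (0 <= Cmod b * Cmod b) by (apply Rmult_le_pos; lra).
  assert (0 <= V * V * V * T) by (apply Rmult_le_pos; lra). assert (0 <= Cmod b * V * T) by (apply Rmult_le_pos; lra).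
  assert (0 <= Cmod b * Cmod b * T) by (apply Rmult_le_pos; lra). assert (0 <= Cmod b * T) by (apply Rmult_le_pos; lra).
  assert (0 <= V * T) by (apply Rmult_le_pos; lra).
  unfold Psi. rewrite Hv2. fold v. fold w. rewrite Hw2. destruct nu.
  - replace (Cexp (- (b * z1)) * v - 2 * b * (Cexp (- b) * Efun b w) + (Cexp (- (b * z2)) * Cconj v - 2 * b * (Cexp (-
    b) * Efun b (Cconj w))))%C
      with (Cexp (- (b * z1)) * v + Cexp (- (b * z2)) * Cconj v + (- (2 * b)) * (Cexp (- b) * (Efun b w + Efun b (Cconj
        w))))%C by ring.
    eapply Rle_trans; [apply Cmod_triangle|]. rewrite (Cmod_mult (- (2 * b))), Cmod_opp, Cmod_mult, Cmod_R, (Rabs_right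
      2) by lra.
    apply (Rmult_le_compat_l (2 * Cmod b)) in HE; [|lra].
    assert (G1 := Cmod_triangle (Cexp (- (b * z1)) * v) (Cexp (- (b * z2)) * Cconj v)).
    assert (G2 := Hve z1 v He1). assert (G3 := Hve z2 (Cconj v) He2).
    assert (Cmod v * T <= V * T) by (apply Rmult_le_compat_r; lra). assert (Cmod (Cconj v) * T <= V * T) by (apply
      Rmult_le_compat_r; lra).
    unfold D. lra.
  - replace (Cexp (- (b * z1)) * (v * v * v + 2 * b * v) - 4 * b * b * (Cexp (- b) * Efun b w) + (Cexp (- (b * z2)) *
    (Cconj v * Cconj v * Cconj v + 2 * b * Cconj v) - 4 * b * b * (Cexp (- b) * Efun b (Cconj w))))%C
      with (Cexp (- (b * z1)) * (v * v * v + 2 * b * v) + Cexp (- (b * z2)) * (Cconj v * Cconj v * Cconj v + 2 * b *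
        Cconj v) + (- (4 * b * b)) * (Cexp (- b) * (Efun b w + Efun b (Cconj w))))%C by ring.
    eapply Rle_trans; [apply Cmod_triangle|]. rewrite (Cmod_mult (- (4 * b * b))), Cmod_opp, !(Cmod_mult _ b), Cmod_R,
      (Rabs_right 4) by lra.
    apply (Rmult_le_compat_l (4 * Cmod b * Cmod b)) in HE; [|nra].
    assert (G1 := Cmod_triangle (Cexp (- (b * z1)) * (v * v * v + 2 * b * v)) (Cexp (- (b * z2)) * (Cconj v * Cconj v *
      Cconj v + 2 * b * Cconj v))).
    assert (G2 := Hve z1 (v * v * v + 2 * b * v)%C He1). assert (G3 := Hve z2 (Cconj v * Cconj v * Cconj v + 2 * b *
      Cconj v)%C He2).
    assert (Q1 := Rmult_le_compat_r T _ _ (Rlt_le _ _ HT) (Hv3 _ HVv)). assert (Q2 := Rmult_le_compat_r T _ _ (Rlt_le _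
      _ HT) (Hv3 _ HVc)).
    unfold D. lra.
Qed.

Lemma ray_slit0 (u : C) (r : R) : Cmod u = 1 -> Im u <> 0 -> 0 <= r -> slit (1 - RtoC r * u)%C.
Proof.
  intros Hu Hi Hr. replace (1 - RtoC r * u)%C with (1 - RtoC r * u - 0)%C by ring.
  apply ray_slit; trivial. rewrite Cmod_0. generalize (Rabs_pos (Im u)); lra.
Qed.

Lemma Ccont_pow (f : R -> C) n t : Ccont f t ->
  Ccont (fun s => f s ^ n)%C t.
Proof.
  intros H. induction n; [apply Ccont_const|]. simpl. apply Ccont_mult; assumption.
Qed.

Definition Laplace_term (nu : nat) (b zeta : C) (t : R) : C :=
  (Cexp (- (b * (RtoC t * zeta))) * (RtoC (/ 2 + INR nu) * zeta) * Qker nu (RtoC t * zeta))%C.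

Lemma Laplace_term_RInt nu b zeta T : (nu <= 1)%nat -> (forall t, 0 <= t -> slit (1 - RtoC t * zeta)%C) -> 0 <= T ->
  is_CRInt (Laplace_term nu b zeta) 0 T (Psi nu b (RtoC T * zeta) - Psi nu b 0)%C.
Proof.
  intros Hnu Hs HT.
  (* The kernel rewritten as a product of powers of [rsqrt], whose continuity is available factor by
     factor. *)
  pose (g := fun t : R => (Cexp (- (b * (RtoC t * zeta))) * (RtoC (/ 2 + INR nu) * zeta) *
     (rsqrt (1 + - 1 * (RtoC t * zeta)) * (rsqrt (1 + - 1 * (RtoC t * zeta)) * rsqrt (1 + - 1 * (RtoC t * zeta))) ^ S
       nu))%C).
  assert (Hg : forall t, 0 <= t -> Laplace_term nu b zeta t = g t).
  { intros t Ht. unfold Laplace_term, g. replace (1 + - 1 * (RtoC t * zeta))%C with (1 - RtoC t * zeta)%C by ring.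
    rewrite Qker_rsqrt by (apply slit_neq_0, Hs, Ht). reflexivity. }
  apply (CRInt_ext g). { rewrite Rmin_left, Rmax_right by lra. intros x Hx. symmetry; apply Hg; lra. }
  eapply evar_last; [apply (CRInt_FTC (fun t => Psi nu b (RtoC t * zeta)))|].
  - rewrite Rmin_left, Rmax_right by lra. intros x Hx. rewrite <- Hg by lra. apply Psi_deriv; [exact Hnu|apply Hs; lra].
  - rewrite Rmin_left, Rmax_right by lra. intros x Hx. unfold g.
    assert (Hx1 : slit (1 + - 1 * (RtoC x * zeta))%C) by (replace (1 + - 1 * (RtoC x * zeta))%C with (1 - RtoC x *
      zeta)%C by ring; apply Hs; lra).
    assert (Hv : Ccont (fun t => rsqrt (1 + - 1 * (RtoC t * zeta))) x).
    { eapply Cder_continuous. apply (Cder_rsqrt (fun t => 1 + - 1 * (RtoC t * zeta))%C); [|exact Hx1].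
      apply Cder_plus; [apply Cder_const|apply Cder_cmult, Cder_scale]. }
    apply Ccont_mult; [apply Ccont_mult; [|apply Ccont_const]|].
    + eapply Cder_continuous. apply (Cder_Cexp (fun t => - (b * (RtoC t * zeta)))%C).
      eapply Cder_ext; [|apply (Cder_cmult (- b)%C _ _ _ (Cder_scale zeta x))]. intros s; cbv beta. ring.
    + apply Ccont_mult; [exact Hv|]. apply Ccont_pow. apply Ccont_mult; exact Hv.
  - to_C. replace (0 * zeta)%C with (RtoC 0) by ring. reflexivity.
Qed.

Lemma Laplace_term_bound nu (b u : C) x t : Cmod u = 1 -> Im u <> 0 -> 0 < x -> 0 <= t ->
  Cmod (Laplace_term nu b (RtoC x * u) t) <= (/ 2 + INR nu) * x * Qbound nu (Rabs (Im u)) * exp (- (Re (b * (RtoC x *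
    u))%C * t)).
Proof.
  intros Hu Hi Hx Ht. unfold Laplace_term. rewrite !Cmod_mult, Hu, Cmod_Cexp, !Cmod_R.
  assert (Hnu := pos_INR nu). rewrite (Rabs_right (/ 2 + INR nu)), (Rabs_right x) by lra.
  replace (Re (- (b * (RtoC t * (RtoC x * u))))%C) with (- (Re (b * (RtoC x * u))%C * t)).
  2:{ replace (b * (RtoC t * (RtoC x * u)))%C with (RtoC t * (b * (RtoC x * u)))%C by ring. rewrite re_opp, re_scal_l.
    ring. }
  assert (HQ : Cmod (Qker nu (RtoC t * (RtoC x * u))) <= Qbound nu (Rabs (Im u))).
  { apply Qker_bound; [apply Rabs_pos_lt, Hi|]. replace (RtoC t * (RtoC x * u))%C with (RtoC (t * x) * u)%C by (rewrite
    RtoC_mult; ring).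
    apply ray_dist, Hu. }
  set (E := exp _). assert (HE : 0 < E) by apply exp_pos.
  replace ((/ 2 + INR nu) * x * Qbound nu (Rabs (Im u)) * E) with (E * ((/ 2 + INR nu) * (x * 1)) * Qbound nu (Rabs (Im
    u))) by ring.
  apply Rmult_le_compat_l; [|exact HQ]. apply Rmult_le_pos; [lra|]. apply Rmult_le_pos; lra.
Qed.

(** The Laplace integral of [phi] is taken term by term. With [b k = xi M k / tau] and
    [z k = e / xi M k] the product [b k * z k] is [e / tau] for every [k], so all terms decay at the
    same rate [rho], and their constants are summable. *)
Lemma lateral_sum (nu M : nat) (A : nat -> C) (K : R) (e u tau : C) :
  (nu <= 1)%nat -> (0 < M)%nat -> (forall k, Cmod (A k) <= K) ->
  e = (Ci * u)%C -> Cmod u = 1 -> Im u <> 0 -> tau <> 0 -> 0 < Re (e / tau)%C ->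
  exists (I : nat -> C) (L : C),
    (forall k, filterlim (fun T => Psi nu (xi M k / tau) (RtoC T * (RtoC (/ xs M k) * u)) - Psi nu (xi M k / tau) 0)%C
       (Rbar_locally p_infty) (locally (I k))) /\
    is_Cser (fun k => A k * I k)%C L /\
    @is_RInt_gen C_R_NormedModule
      (fun t : R => Cexp (- (RtoC t * e / tau)) * phi nu M A (RtoC t * e) * e)%C (at_point 0) (Rbar_locally p_infty) L.
Proof.
  intros Hnu HM HA He Hu Hi Htau Hrho.
  assert (HK : 0 <= K) by (eapply Rle_trans; [apply Cmod_ge_0|apply (HA 0%nat)]).
  set (z := fun k => (RtoC (/ xs M k) * u)%C). set (b := fun k => (xi M k / tau)%C).
  assert (Hx : forall k, 0 < / xs M k) by (intros k; apply Rinv_0_lt_compat, xs_pos, HM).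
  assert (Hxi : forall k, xi M k <> 0) by (intros k; apply xi_neq_0, HM).
  assert (Hz : forall k, (z k = e / xi M k)%C).
  { intros k. unfold z. replace (e / xi M k)%C with (RtoC 1 * e / xi M k)%C by (field; apply Hxi).
    rewrite (ray_xi M k 1 e u HM He). f_equal. f_equal. unfold Rdiv; ring. }
  assert (Hbz : forall k, (b k * z k = e / tau)%C).
  { intros k. rewrite Hz. unfold b. field. split; [exact Htau|apply Hxi]. }
  set (rho := Re (e / tau)%C) in *.
  assert (Hslit : forall k t, 0 <= t -> slit (1 - RtoC t * z k)%C).
  { intros k t Ht. replace (RtoC t * z k)%C with (RtoC (t * / xs M k) * u)%C by (unfold z; rewrite RtoC_mult; ring).
    apply ray_slit0; trivial. apply Rmult_le_pos; [exact Ht|apply Rlt_le, Hx]. }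
  assert (HB : forall k t, 0 <= t -> Cmod (Laplace_term nu (b k) (z k) t) <= (/ 2 + INR nu) * / xs M k * Qbound nu
    (Rabs (Im u)) * exp (- (rho * t))).
  { intros k t Ht. assert (H := Laplace_term_bound nu (b k) u (/ xs M k) t Hu Hi (Hx k) Ht). fold (z k) in H. rewrite
    Hbz in H. exact H. }
  assert (HJ := fun k T HT => Laplace_term_RInt nu (b k) (z k) T Hnu (Hslit k) HT).
  assert (HI : forall k, exists I : C, filterlim (fun T => Psi nu (b k) (RtoC T * z k) - Psi nu (b k) 0)%C
    (Rbar_locally p_infty) (locally I)).
  { intros k. apply (CRInt_lim_exp (Laplace_term nu (b k) (z k)) _ ((/ 2 + INR nu) * / xs M k * Qbound nu (Rabs (Im
    u))) rho Hrho).
    - intros T HT. apply HJ, HT.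
    - intros t Ht. apply HB, Ht. }
  pose (I := fun k => proj1_sig (ClassicalEpsilon.constructive_indefinite_description _ (HI k))).
  assert (HIk : forall k, filterlim (fun T => Psi nu (b k) (RtoC T * z k) - Psi nu (b k) 0)%C (Rbar_locally p_infty)
    (locally (I k))).
  { intros k. exact (proj2_sig (ClassicalEpsilon.constructive_indefinite_description _ (HI k))). }
  set (B := fun k => K * ((/ 2 + INR nu) * / xs M k * Qbound nu (Rabs (Im u)))).
  assert (HBs : ex_series B).
  { unfold B. apply (ex_series_scal (V := R_NormedModule)). apply ex_series_scal_r. apply (ex_series_scal (V :=
    R_NormedModule)). apply ex_series_inv_xs, HM. }
  assert (HAB : forall k t, 0 <= t -> Cmod (A k * Laplace_term nu (b k) (z k) t) <= B k * exp (- (rho * t))).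
  { intros k t Ht. rewrite Cmod_mult. unfold B. rewrite Rmult_assoc. apply Rmult_le_compat; try apply Cmod_ge_0; [apply
    HA|apply HB, Ht]. }
  set (g := fun t : R => (Cexp (- (RtoC t * e / tau)) * phi nu M A (RtoC t * e) * e)%C).
  assert (HB0 : forall k, 0 <= B k).
  { intros k. specialize (HAB k 0 (Rle_refl _)). rewrite Rmult_0_r, Ropp_0, exp_0 in HAB. generalize (Cmod_ge_0 (A k *
    Laplace_term nu (b k) (z k) 0)); lra. }
  assert (He0 : e <> 0). { intros E. rewrite He in E. apply (Cmult_neq_0 Ci u); [exact Ci_nz| |exact E]. apply
    Cmod_gt_0; lra. }
  assert (Hg : forall t, 0 <= t -> is_Cser (fun k => A k * Laplace_term nu (b k) (z k) t)%C (g t)).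
  { intros t Ht.
    assert (HT : forall k, (A k * Laplace_term nu (b k) (z k) t = (Cexp (- (RtoC t * e / tau)) * e) * phi_term nu M A k
      (RtoC t * e))%C).
    { intros k. unfold Laplace_term, phi_term. replace (b k * (RtoC t * z k))%C with (RtoC t * (b k * z k))%C by ring.
      rewrite Hbz. replace (RtoC t * (e / tau))%C with (RtoC t * e / tau)%C by (field; exact Htau).
      rewrite Hz. replace (RtoC t * (e / xi M k))%C with (RtoC t * e / xi M k)%C by (field; apply Hxi). field. apply Hxi. }
    destruct (ex_Cser_le (fun k => phi_term nu M A k (RtoC t * e)) (fun k => / Cmod (Cexp (- (RtoC t * e / tau)) * e) *
      (B k * exp (- (rho * t))))) as [l Hl].
    - intros k. assert (Hc : (Cexp (- (RtoC t * e / tau)) * e)%C <> 0) by (apply Cmult_neq_0; [apply Cexp_neq_0|exact He0]).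
      apply Cmod_gt_0 in Hc. apply (Rmult_le_reg_l (Cmod (Cexp (- (RtoC t * e / tau)) * e))); [exact Hc|].
      rewrite <- Rmult_assoc, Rinv_r, Rmult_1_l by lra. rewrite <- Cmod_mult, <- HT. apply HAB, Ht.
    - apply (ex_series_scal (V := R_NormedModule)). apply ex_series_scal_r, HBs.
    - eapply evar_last; [eapply Cser_ext; [|apply (Cser_scal (Cexp (- (RtoC t * e / tau)) * e)%C _ _ Hl)]|].
      + intros k; cbv beta. symmetry; apply HT.
      + to_C. unfold g, phi. rewrite (CSeries_unique _ _ Hl). ring. }
  destruct (CRInt_gen_series (fun k t => A k * Laplace_term nu (b k) (z k) t)%C g B rho
    (fun k T => A k * (Psi nu (b k) (RtoC T * z k) - Psi nu (b k) 0))%C (fun k => A k * I k)%C Hrho) as [L [G [H1 [H2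
      H3]]]]; trivial.
  - intros k T HT. apply CRInt_cmult, HJ, HT.
  - intros k. assert (Hl := HIk k).
    eapply (filterlim_comp _ _ _ _ (fun y => A k * y)%C); [exact Hl|].
    exact (@filterlim_scal_r C_AbsRing C_NormedModule (A k) (I k)).
  - exists I, L. split; [exact HIk|]. split; [exact H1|]. apply (CRInt_gen_0_infty g G L H2 H3).
Qed.

Lemma Cexp_Ci (th : R) : Cexp (Ci * RtoC th) = (cos th, sin th).
Proof.
  unfold Cexp. replace (Re (Ci * RtoC th)%C) with 0 by (unfold Re, Ci, Cmult, RtoC; simpl; ring).
  replace (Im (Ci * RtoC th)%C) with th by (unfold Im, Ci, Cmult, RtoC; simpl; ring).
  rewrite exp_0. f_equal; ring.
Qed.

Lemma Re_div_tau (th : R) (tau : C) : tau <> 0 -> - (PI / 2) < th - Carg tau < PI / 2 -> 0 < Re (Cexp (Ci * RtoC th) /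
  tau)%C.
Proof.
  intros Ht Ha. rewrite <- (Cexp_Clog tau Ht) at 1. unfold Cdiv. rewrite <- Cexp_opp, <- Cexp_plus.
  unfold Cexp, Re at 1. simpl fst. apply Rmult_lt_0_compat; [apply exp_pos|].
  match goal with |- 0 < cos ?x => replace x with (th - Carg tau) end.
  - apply cos_gt_0; lra.
  - unfold Clog; simpl. ring.
Qed.

(** The directions PI/2 - eps and PI/2 + eps are [Ci * um] and [Ci * up] with [um], [up] conjugate.
    For every [k] the two limits at infinity add up to 0 by [Psi_sum_lim], so the half-sum is minus
    the primitive at the origin, whatever [eps]. *)
Lemma median_sum (nu M : nat) (A : nat -> C) (K : R) (c : nat -> C) (tau V : C) :
  (nu <= 1)%nat -> (0 < M)%nat -> (forall k, Cmod (A k) <= K) -> 0 < Im tau ->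
  (forall p, is_Cser (fun k => A k * RtoC (poch (/ 2 + INR nu) (S p)) / xi M k ^ S p)%C (c (S p))) ->
  is_Cser (fun k => A k * - Psi nu (xi M k / tau) 0)%C V ->
  is_median_sum c tau (c 0%nat + V)%C.
Proof.
  intros Hnu HM HA Htau Hc HV. split; [exact Htau|]. intros eps Heps Harg.
  assert (Ht0 : tau <> 0) by (intros E; rewrite E in Htau; simpl in Htau; lra).
  assert (Hpi := PI_RGT_0).
  assert (Hsin : 0 < sin eps) by (apply sin_gt_0; lra). assert (Hcos : 0 < cos eps) by (apply cos_gt_0; lra).
  pose (um := (cos eps, - sin eps) : C). pose (up := (cos eps, sin eps) : C).
  assert (Hum : Cmod um = 1). { unfold Cmod, um; simpl. replace (cos eps * (cos eps * 1) + - sin eps * (- sin eps * 1))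
    with (Rsqr (sin eps) + Rsqr (cos eps)) by (unfold Rsqr; ring). rewrite sin2_cos2. apply sqrt_1. }
  assert (Hup : up = Cconj um) by (unfold up, um, Cconj; simpl; f_equal; ring).
  assert (Hup1 : Cmod up = 1) by (rewrite Hup, Cmod_conj; exact Hum).
  assert (Him : Im um <> 0) by (unfold um; simpl; lra). assert (Hip : Im up <> 0) by (unfold up; simpl; lra).
  assert (Hem : Cexp (Ci * RtoC (PI / 2 - eps)) = (Ci * um)%C).
  { rewrite Cexp_Ci, cos_shift, sin_shift. unfold um, Ci, Cmult; simpl. f_equal; ring. }
  assert (Hep : Cexp (Ci * RtoC (PI / 2 + eps)) = (Ci * up)%C).
  { rewrite Cexp_Ci, cos_plus, sin_plus, cos_PI2, sin_PI2. unfold up, Ci, Cmult; simpl. f_equal; ring. }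
  assert (Hrm : 0 < Re (Cexp (Ci * RtoC (PI / 2 - eps)) / tau)%C) by (apply Re_div_tau; [exact Ht0|lra]).
  assert (Hrp : 0 < Re (Cexp (Ci * RtoC (PI / 2 + eps)) / tau)%C) by (apply Re_div_tau; [exact Ht0|lra]).
  destruct (lateral_sum nu M A K _ um tau Hnu HM HA Hem Hum Him Ht0 Hrm) as [Im' [Lm [Hm1 [Hm2 Hm3]]]].
  destruct (lateral_sum nu M A K _ up tau Hnu HM HA Hep Hup1 Hip Ht0 Hrp) as [Ip' [Lp [Hp1 [Hp2 Hp3]]]].
  exists (c 0%nat + Lm)%C, (c 0%nat + Lp)%C.
  assert (Hborel : forall th u, Cexp (Ci * RtoC th) = (Ci * u)%C -> Cmod u = 1 -> Im u <> 0 -> is_Borel_continuation th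
    c (phi nu M A)).
  { intros th u E Hu1 Hi1. split.
    - exists (PI / INR M / 2). split; [apply Rdiv_lt_0_compat; [apply Rdiv_lt_0_compat; [exact Hpi|apply lt_0_INR,
      HM]|lra]|].
      intros x Hx. apply (phi_germ nu M A K); assumption.
    - intros t Ht. apply (phi_analytic nu M A K _ u); assumption. }
  assert (Hsum : (Lm + Lp = 2 * V)%C).
  { assert (H1 := Cser_plus _ _ _ _ Hm2 Hp2). assert (H2 := Cser_scal 2 _ _ HV).
    eapply is_Cser_unique; [exact H1|]. eapply Cser_ext; [|exact H2].
    intros k; cbv beta. set (P0 := Psi nu (xi M k / tau) 0) in *.
    assert (E : (Im' k + Ip' k = - (2 * P0))%C).
    { eapply (filterlim_C_unique (Rbar_locally p_infty)); [exact (filterlim_Cplus _ _ _ _ _ (Hm1 k) (Hp1 k))|].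
      assert (Hx : 0 < / xs M k) by (apply Rinv_0_lt_compat, xs_pos, HM).
      assert (Hb : forall e u, e = (Ci * u)%C -> (xi M k / tau * (RtoC (/ xs M k) * u))%C = (e / tau)%C).
      { intros e u ->. unfold xi. rewrite RtoC_inv by (generalize (xs_pos M k HM); lra). field.
        split; [exact Ht0|]. intros E0. apply RtoC_inj in E0. generalize (xs_pos M k HM); lra. }
      (* Both lateral directions have positive real part after division by [tau], and their sum is a
         positive multiple of [xi M k], because [um + Cconj um = 2 cos eps]. *)
      assert (HRb : 0 < Re (xi M k / tau)%C).
      { assert (E0 : Re (Cexp (Ci * RtoC (PI / 2 - eps)) / tau)%C + Re (Cexp (Ci * RtoC (PI / 2 + eps)) / tau)%C = 2 *
        cos eps * / xs M k * Re (xi M k / tau)%C).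
        { rewrite <- (Hb _ _ Hem), <- (Hb _ _ Hep), Hup, <- re_plus.
          replace (xi M k / tau * (RtoC (/ xs M k) * um) + xi M k / tau * (RtoC (/ xs M k) * Cconj um))%C with (RtoC (2
            * cos eps * / xs M k) * (xi M k / tau))%C.
          - rewrite re_scal_l. reflexivity.
          - replace (xi M k / tau * (RtoC (/ xs M k) * um) + xi M k / tau * (RtoC (/ xs M k) * Cconj um))%C with ((um +
            Cconj um) * RtoC (/ xs M k) * (xi M k / tau))%C by (unfold Cdiv; ring).
            replace (um + Cconj um)%C with (RtoC (2 * cos eps)) by (unfold um, Cconj, Cplus, RtoC; simpl; f_equal; ring).
            rewrite <- RtoC_mult. reflexivity. }
        assert (0 < 2 * cos eps * / xs M k) by (apply Rmult_lt_0_compat; lra). nra. }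
      assert (Hlim := Psi_sum_lim nu (xi M k / tau) um (/ xs M k) (Rmin (Re (Cexp (Ci * RtoC (PI / 2 - eps)) / tau)%C)
        (Re (Cexp (Ci * RtoC (PI / 2 + eps)) / tau)%C)) Hum Him Hx HRb).
      rewrite <- Hup in Hlim. rewrite (Hb _ _ Hem), (Hb _ _ Hep) in Hlim.
      specialize (Hlim ltac:(apply Rmin_glb_lt; assumption) ltac:(apply Rmin_l) ltac:(apply Rmin_r)).
      assert (Hl2 := filterlim_Cplus _ _ _ _ _ Hlim (@filterlim_const R C_UniformSpace (Rbar_locally p_infty) _ (- (2 *
        P0))%C)).
      replace (- (2 * P0))%C with (0 + - (2 * P0))%C by ring.
      eapply filterlim_ext; [|exact Hl2]. intros t; cbv beta. fold P0. ring. }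
    replace (A k * Im' k + A k * Ip' k)%C with (A k * (Im' k + Ip' k))%C by ring. rewrite E. ring. }
  split; [|split].
  - split; [lra|]. exists (phi nu M A), Lm. split; [apply (Hborel _ um); assumption|]. split; [|reflexivity]. exact Hm3.
  - split; [lra|]. exists (phi nu M A), Lp. split; [apply (Hborel _ up); assumption|]. split; [|reflexivity]. exact Hp3.
  - replace (c 0%nat + Lm + (c 0%nat + Lp))%C with (2 * c 0%nat + (Lm + Lp))%C by ring. rewrite Hsum. field.
Qed.

Lemma Psi_0 nu b : (nu <= 1)%nat -> Psi nu b 0 =
  match nu with O => (1 - 2 * b * (Cexp (- b) * Gfun b))%C | S _ => (1 + 2 * b - 4 * b * b * (Cexp (- b) * Gfun b))%C end.
Proof.
  intros Hnu. unfold Psi. replace (1 - 0)%C with (RtoC 1) by ring. rewrite rsqrt_1.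
  replace (- (b * 0))%C with (RtoC 0) by ring. rewrite Cexp_0. unfold Efun.
  replace (1 * 1 * Gfun (b * (1 * 1 * (1 * 1))))%C with (Gfun b) by (replace (b * (1 * 1 * (1 * 1)))%C with b by ring; ring).
  destruct nu; ring.
Qed.

(** * Periodic Bernoulli functions *)

(* [Fm m] is the 1-periodic extension of [- B_(m+1) / (m+1)!] through its Fourier series, absolutely convergent for [1
   <= m]. *)
Definition kap (k : nat) : R := 2 * PI * INR (S k).
Definition Fterm (m k : nat) (u : R) : R := 2 * cos (kap k * u - INR (S m) * (PI / 2)) / kap k ^ S m.
Definition Fm (m : nat) (u : R) : R := Series (fun k => Fterm m k u).

Lemma kap_ge k : 6 * INR (S k) <= kap k.
Proof.
  unfold kap. assert (H := PI2_3_2). assert (H2 : 3 <= PI) by lra.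
  assert (0 <= INR (S k)) by apply pos_INR. nra.
Qed.

Lemma INR_S_ge1 k : 1 <= INR (S k).
Proof. rewrite S_INR. generalize (pos_INR k); lra. Qed.

Lemma kap_pos k : 0 < kap k.
Proof. assert (H := kap_ge k). assert (H2 := INR_S_ge1 k). lra. Qed.

Lemma Fterm_bound m k u : (1 <= m)%nat -> Rabs (Fterm m k u) <= / INR (S k) ^ 2.
Proof.
  intros Hm. assert (Hk := kap_ge k). assert (Hk1 := INR_S_ge1 k).
  unfold Fterm, Rdiv. rewrite !Rabs_mult, (Rabs_right 2) by lra.
  assert (Hp : 2 * INR (S k) ^ 2 <= kap k ^ S m).
  { destruct m as [|m]; [lia|].
    assert (H1 : 1 <= kap k ^ m) by (apply pow_R1_Rle; lra).
    change (kap k ^ S (S m)) with (kap k * (kap k * kap k ^ m)).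
    assert (2 * INR (S k) ^ 2 <= kap k * kap k) by (set (i := INR (S k)) in *; replace (i ^ 2) with (i * i) by ring;
      nra). nra. }
  assert (Hp0 : 0 < INR (S k) ^ 2) by (apply pow_lt; lra).
  rewrite (Rabs_right (/ kap k ^ S m)) by (apply Rle_ge, Rlt_le, Rinv_0_lt_compat; lra).
  assert (Hc : Rabs (cos (kap k * u - INR (S m) * (PI / 2))) <= 1) by (apply Rabs_le, COS_bound).
  apply Rle_trans with (2 * / kap k ^ S m).
  - apply Rmult_le_compat_r; [apply Rlt_le, Rinv_0_lt_compat; lra|]. generalize (Rabs_pos (cos (kap k * u - INR (S m) *
    (PI / 2)))). lra.
  - apply (Rmult_le_reg_r (kap k ^ S m)); [lra|]. rewrite Rmult_assoc, Rinv_l, Rmult_1_r by lra.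
    apply (Rmult_le_reg_l (INR (S k) ^ 2)); [exact Hp0|]. rewrite <- Rmult_assoc, Rinv_r, Rmult_1_l by lra. lra.
Qed.

Lemma Fm_series m u : (1 <= m)%nat -> is_series (fun k => Fterm m k u) (Fm m u).
Proof.
  intros Hm. apply Series_correct. apply ex_series_Rabs.
  apply ex_series_Rle with (fun k => / INR (S k) ^ 2); [|apply ex_series_inv_sq].
  intros k; split; [apply Rabs_pos|apply Fterm_bound, Hm].
Qed.

Lemma Fm_Cser m u : (1 <= m)%nat -> is_Cser (fun k => RtoC (Fterm m k u)) (RtoC (Fm m u)).
Proof. intros Hm. apply Cser_RtoC, Fm_series, Hm. Qed.

Definition F_bound : R := Series (fun k => / INR (S k) ^ 2).

Lemma Fm_bound m u : (1 <= m)%nat -> Rabs (Fm m u) <= F_bound.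
Proof.
  intros Hm. rewrite <- Cmod_R. eapply Cser_norm_le; [|apply ex_series_inv_sq|apply (Fm_Cser m u Hm)].
  intros k; cbv beta. rewrite Cmod_R. apply Fterm_bound, Hm.
Qed.

Lemma Fterm_periodic m k u : Fterm m k (u + 1) = Fterm m k u.
Proof.
  unfold Fterm. f_equal. f_equal.
  replace (kap k * (u + 1) - INR (S m) * (PI / 2)) with ((kap k * u - INR (S m) * (PI / 2)) + 2 * INR (S k) * PI) by
    (unfold kap; ring).
  apply cos_period.
Qed.

Lemma Fm_periodic m u : Fm m (u + 1) = Fm m u.
Proof. apply Series_ext. intros k. apply Fterm_periodic. Qed.

Lemma Fm_periodic_nat m u n : Fm m (u + INR n) = Fm m u.
Proof.
  induction n; [simpl; f_equal; ring|]. rewrite S_INR. replace (u + (INR n + 1)) with (u + INR n + 1) by ring.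
  rewrite Fm_periodic. exact IHn.
Qed.

(** The phase [INR (S m) * (PI / 2)] is there for this: a derivative is a quarter turn and a factor
    [kap k]. *)
Lemma Fterm_derive m k u : is_derive (Fterm (S m) k) u (Fterm m k u).
Proof.
  assert (Hk := kap_pos k). unfold Fterm.
  replace (kap k * u - INR (S m) * (PI / 2)) with (kap k * u - INR (S (S m)) * (PI / 2) + PI / 2) by (rewrite (S_INR (S
    m)); field).
  assert (Hm : kap k ^ S m <> 0) by (apply pow_nonzero; lra).
  change (kap k ^ S (S m)) with (kap k * kap k ^ S m).
  generalize (INR (S (S m)) * (PI / 2)), (kap k ^ S m), Hm. intros c p Hp.
  auto_derive; trivial. rewrite cos_plus, cos_PI2, sin_PI2. unfold Rminus. field. split; [exact Hp|lra].
Qed.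

Lemma Fterm_continuous m k u : continuous (Fterm m k) u.
Proof. apply (@ex_derive_continuous R_AbsRing R_NormedModule). unfold Fterm. auto_derive. trivial. Qed.

Lemma Fm_continuous m u : (1 <= m)%nat -> continuous (Fm m) u.
Proof.
  intros Hm. destruct (tannery (locally u) (fun x k => RtoC (Fterm m k x)) (fun x => RtoC (Fm m x)) (fun k => RtoC
    (Fterm m k u)) (fun k => / INR (S k) ^ 2)) as [L [H1 H2]].
  - intros x n. rewrite Cmod_R. apply Fterm_bound, Hm.
  - apply ex_series_inv_sq.
  - intros x. apply Fm_Cser, Hm.
  - intros n. apply (Ccont_RtoC (Fterm m n)), Fterm_continuous.
  - rewrite (is_Cser_unique _ _ _ H1 (Fm_Cser m u Hm)) in H2.
    apply (filterlim_C_split (locally u)) in H2. exact (proj1 H2).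
Qed.

Lemma Fm_RInt m a b : (1 <= m)%nat -> a <= b -> is_RInt (Fm m) a b (Fm (S m) b - Fm (S m) a).
Proof.
  intros Hm Hab.
  destruct (CRInt_series (fun k t => RtoC (Fterm m k t)) (fun t => RtoC (Fm m t)) (fun k => / INR (S k) ^ 2) a b
    (fun k => RtoC (Fterm (S m) k b - Fterm (S m) k a)) Hab) as [J [H1 H2]].
  - intros k. apply CRInt_split. simpl. split.
    + apply (is_RInt_derive (Fterm (S m) k)); intros x _; [apply Fterm_derive|apply Fterm_continuous].
    + eapply evar_last; [apply (@is_RInt_const R_NormedModule a b 0)|]. scal_R. to_R; ring.
  - intros k t _. rewrite Cmod_R. apply Fterm_bound, Hm.
  - apply ex_series_inv_sq.
  - intros t _. apply Fm_Cser, Hm.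
  - assert (E : J = RtoC (Fm (S m) b - Fm (S m) a)).
    { eapply is_Cser_unique; [exact H1|]. apply Cser_RtoC. apply (is_series_minus (V := R_NormedModule)); apply
      Fm_series; lia. }
    rewrite E in H2. apply CRInt_split in H2. exact (proj1 H2).
Qed.

Lemma Fm_derive m u : (1 <= m)%nat -> is_derive (Fm (S m)) u (Fm m u).
Proof.
  intros Hm. apply (is_derive_ext (fun x => plus (Fm (S m) x - Fm (S m) (u - 1)) (Fm (S m) (u - 1)))).
  { intros x. unfold plus; simpl. ring. }
  eapply evar_last; [apply (@is_derive_plus R_AbsRing R_NormedModule); [|apply @is_derive_const]|apply plus_zero_r].
  apply (@is_derive_RInt R_NormedModule (Fm m) (fun x => Fm (S m) x - Fm (S m) (u - 1)) (u - 1)).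
  - exists (mkposreal 1 Rlt_0_1). intros y Hy. unfold ball in Hy; simpl in Hy; unfold AbsRing_ball, abs, minus, plus,
    opp in Hy; simpl in Hy.
    apply Rabs_def2 in Hy. apply Fm_RInt; [exact Hm|lra].
  - apply Fm_continuous, Hm.
Qed.

Lemma dirichlet_kernel n u : sum_n (fun k => 2 * cos (kap k * u)) n * sin (PI * u) = sin ((2 * INR n + 3) * (PI * u)) -
  sin (PI * u).
Proof.
  assert (H : forall a b, 2 * cos a * sin b = sin (a + b) - sin (a - b)) by (intros; rewrite sin_plus, sin_minus; ring).
  induction n.
  - rewrite sum_O, H. unfold kap. simpl INR. f_equal; f_equal; ring.
  - rewrite sum_Sn. change (plus ?a ?b) with (a + b). rewrite Rmult_plus_distr_r, IHn, H. unfold kap. rewrite !S_INR.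
    replace (2 * PI * (INR n + 1 + 1) * u + PI * u) with ((2 * (INR n + 1) + 3) * (PI * u)) by ring.
    replace (2 * PI * (INR n + 1 + 1) * u - PI * u) with ((2 * INR n + 3) * (PI * u)) by ring. ring.
Qed.

Lemma sum_n_derive (f df : nat -> R -> R) u n : (forall k, is_derive (f k) u (df k u)) ->
  is_derive (fun x => sum_n (fun k => f k x) n) u (sum_n (fun k => df k u) n).
Proof.
  intros H. induction n.
  - apply is_derive_ext with (f 0%nat); [intros; rewrite sum_O; reflexivity|]. rewrite sum_O. apply H.
  - apply is_derive_ext with (fun x => plus (sum_n (fun k => f k x) n) (f (S n) x)); [intros; rewrite sum_Sn; reflexivity|].
    rewrite sum_Sn. apply (@is_derive_plus R_AbsRing R_NormedModule); [exact IHn|apply H].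
Qed.

Lemma sin_kap_half k : sin (kap k * / 2) = 0.
Proof.
  replace (kap k * / 2) with (INR (S k) * PI) by (unfold kap; field). apply sin_eq_0_1. exists (Z.of_nat (S k)).
    rewrite <- INR_IZR_INZ. reflexivity.
Qed.

Lemma mean_value_bound (f df : R -> R) a b D : a <= b -> (forall t, a <= t <= b -> is_derive f t (df t)) ->
  (forall t, a <= t <= b -> Rabs (df t) <= D) -> Rabs (f b - f a) <= D * (b - a).
Proof.
  intros Hab Hd HD. destruct (MVT_gen f a b df) as [c [Hc1 Hc2]].
  - rewrite Rmin_left, Rmax_right by lra. intros x Hx. apply Hd; lra.
  - rewrite Rmin_left, Rmax_right by lra. intros x Hx. apply continuity_pt_filterlim.
    apply (@ex_derive_continuous R_AbsRing R_NormedModule). eexists. apply Hd, Hx.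
  - rewrite Rmin_left, Rmax_right in Hc1 by lra. rewrite Hc2, Rabs_mult, (Rabs_right (b - a)) by lra.
    apply Rmult_le_compat_r; [lra|apply HD, Hc1].
Qed.

(* Fourier series of a parabola: the Dirichlet kernel is integrated twice, away from 0. *)
Lemma F1_left x : 0 < x <= / 2 -> Fm 1 x = Fm 1 (/ 2) - (x - / 2) ^ 2 / 2.
Proof.
  intros Hx. assert (Hpi := PI_RGT_0).
  set (P := fun n u => sum_n (fun k => Fterm 1 k u) n).
  set (P' := fun n u => sum_n (fun k => 2 * sin (kap k * u) / kap k) n).
  set (P'' := fun n u => sum_n (fun k => 2 * cos (kap k * u)) n).
  assert (HP : forall n u, is_derive (P n) u (P' n u)).
  { intros n u. apply (sum_n_derive (fun k => Fterm 1 k) (fun k x => 2 * sin (kap k * x) / kap k)). intros k.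
    eapply evar_last; [apply Fterm_derive|]. to_R. unfold Fterm. simpl. rewrite Rmult_1_l, Rmult_1_r.
    replace (cos (kap k * u - PI / 2)) with (sin (kap k * u)) by (rewrite cos_minus, cos_PI2, sin_PI2; ring). reflexivity. }
  assert (HP' : forall n u, is_derive (P' n) u (P'' n u)).
  { intros n u. apply (sum_n_derive (fun k x => 2 * sin (kap k * x) / kap k) (fun k x => 2 * cos (kap k * x))). intros k.
    assert (Hk := kap_pos k). auto_derive; trivial. field. lra. }
  set (s0 := sin (PI * x)).
  assert (Hs0 : 0 < s0) by (apply sin_gt_0; nra).
  assert (Hs : forall u, x <= u <= / 2 -> s0 <= sin (PI * u)) by (intros u Hu; apply sin_incr_1; nra).
  set (lam := fun n => (2 * INR n + 3) * PI).
  assert (Hlam : forall n, 0 < lam n) by (intros n; unfold lam; generalize (pos_INR n); nra).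
  (* The second derivative of the partial sum is sin(lam u) / sin(PI u) - 1. Adding [u - / 2]
     removes the constant, and the last term is one integration by parts of the oscillating
     quotient; what remains, [dK], is of order 1 / lam. *)
  set (K := fun n u => P' n u + (u - / 2) + cos (lam n * u) / (lam n * sin (PI * u))).
  set (dK := fun n u => - (PI * cos (lam n * u) * cos (PI * u)) / (lam n * (sin (PI * u) * sin (PI * u)))).
  assert (HK : forall n u, x <= u <= / 2 -> is_derive (K n) u (dK n u)).
  { intros n u Hu. specialize (Hs u Hu). specialize (Hlam n).
    assert (HD := dirichlet_kernel n u). fold (P'' n u) in HD.
    replace ((2 * INR n + 3) * (PI * u)) with (lam n * u) in HD by (unfold lam; ring).
    assert (HP2 : P'' n u = sin (lam n * u) / sin (PI * u) - 1).
    { apply (Rmult_eq_reg_r (sin (PI * u))); [|lra]. rewrite HD. field. lra. }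
    apply (is_derive_ext (fun u => plus (P' n u) ((u - / 2) + cos (lam n * u) / (lam n * sin (PI * u))))).
    { intros t. unfold K, plus; simpl. ring. }
    eapply evar_last; [apply (@is_derive_plus R_AbsRing R_NormedModule); [apply HP'|]|].
    - auto_derive; [|reflexivity]. apply Rmult_integral_contrapositive_currified; lra.
    - unfold plus; simpl. rewrite HP2. unfold dK. to_R. field. lra. }
  (* The point 1/2 is the base of both integrations: all the sines vanish there, and [lam n / 2] is
     an odd multiple of PI / 2. *)
  assert (HKhalf : forall n, K n (/ 2) = 0).
  { intros n. unfold K. replace (P' n (/ 2)) with 0.
    - replace (lam n * / 2) with (PI / 2 + INR (S n) * PI) by (unfold lam; rewrite S_INR; field).
      rewrite cos_plus, cos_PI2. assert (E : sin (INR (S n) * PI) = 0) by (apply sin_eq_0_1; exists (Z.of_nat (S n));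
        rewrite <- INR_IZR_INZ; reflexivity).
      rewrite E. unfold Rdiv. ring.
    - unfold P'. symmetry. clear -n. induction n; [rewrite sum_O, sin_kap_half; unfold Rdiv; ring|].
      rewrite sum_Sn, IHn, sin_kap_half. unfold plus, Rdiv; simpl. ring. }
  set (C1 := PI / (s0 * s0)).
  assert (HC1 : 0 < C1) by (apply Rdiv_lt_0_compat; nra).
  assert (HdK : forall n u, x <= u <= / 2 -> Rabs (dK n u) <= C1 / lam n).
  { intros n u Hu. specialize (Hs u Hu). specialize (Hlam n). unfold dK, C1.
    assert (Hsq : s0 * s0 <= sin (PI * u) * sin (PI * u)) by nra.
    unfold Rdiv. rewrite Rabs_mult, Rabs_Ropp, !Rabs_mult, (Rabs_right PI) by lra.
    assert (Hpp : 0 < lam n * (sin (PI * u) * sin (PI * u))) by (apply Rmult_lt_0_compat; [exact Hlam|apply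
      Rmult_lt_0_compat; lra]).
    assert (Hp0 : 0 < lam n * (s0 * s0)) by (apply Rmult_lt_0_compat; [exact Hlam|apply Rmult_lt_0_compat; lra]).
    rewrite (Rabs_right (/ (lam n * (sin (PI * u) * sin (PI * u))))) by (apply Rle_ge, Rlt_le, Rinv_0_lt_compat, Hpp).
    assert (H1 : Rabs (cos (lam n * u)) <= 1) by (apply Rabs_le, COS_bound).
    assert (H2 : Rabs (cos (PI * u)) <= 1) by (apply Rabs_le, COS_bound).
    assert (H3 := Rabs_pos (cos (lam n * u))). assert (H4 := Rabs_pos (cos (PI * u))).
    replace (PI * / (s0 * s0) * / lam n) with (PI * 1 * 1 * / (lam n * (s0 * s0))) by (field; lra).
    apply Rmult_le_compat.
    - apply Rmult_le_pos; [apply Rmult_le_pos; lra|lra].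
    - apply Rlt_le, Rinv_0_lt_compat, Hpp.
    - apply Rmult_le_compat; [apply Rmult_le_pos; lra|lra|apply Rmult_le_compat_l; lra|lra].
    - apply Rinv_le_contravar; [exact Hp0|]. apply Rmult_le_compat_l; lra. }
  assert (HKb : forall n u, x <= u <= / 2 -> Rabs (K n u) <= C1 / lam n).
  { intros n u Hu. assert (H := mean_value_bound (K n) (dK n) u (/ 2) (C1 / lam n) ltac:(lra) (fun t Ht => HK n t
    ltac:(lra)) (fun t Ht => HdK n t ltac:(lra))).
    rewrite HKhalf in H. replace (0 - K n u) with (- K n u) in H by ring. rewrite Rabs_Ropp in H.
    assert (0 < C1 / lam n) by (apply Rdiv_lt_0_compat; [exact HC1|apply Hlam]). nra. }
  set (C2 := C1 + / s0).
  assert (HG : forall n, Rabs ((P n (/ 2) + (/ 2 - / 2) ^ 2 / 2) - (P n x + (x - / 2) ^ 2 / 2)) <= C2 / lam n).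
  { intros n. assert (Hi : 0 < / s0) by (apply Rinv_0_lt_compat; exact Hs0).
    assert (H0 : 0 < C2 / lam n) by (apply Rdiv_lt_0_compat; [unfold C2; lra|apply Hlam]).
    eapply Rle_trans; [apply (mean_value_bound (fun u => P n u + (u - / 2) ^ 2 / 2) (fun u => P' n u + (u - / 2)) x (/
      2) (C2 / lam n)); [lra| |]|nra].
    - intros t Ht. apply (is_derive_ext (fun u => plus (P n u) ((u - / 2) ^ 2 / 2))); [intros; reflexivity|].
      apply (@is_derive_plus R_AbsRing R_NormedModule); [apply HP|]. auto_derive; trivial. field.
    - intros t Ht. assert (H1 := HKb n t Ht). specialize (Hs t Ht). specialize (Hlam n).
      replace (P' n t + (t - / 2)) with (K n t + - (cos (lam n * t) / (lam n * sin (PI * t)))) by (unfold K; ring).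
      eapply Rle_trans; [apply Rabs_triang|]. rewrite Rabs_Ropp. unfold C2, Rdiv. rewrite Rmult_plus_distr_r.
      apply Rplus_le_compat; [exact H1|]. rewrite Rabs_mult.
      rewrite (Rabs_right (/ _)) by (apply Rle_ge, Rlt_le, Rinv_0_lt_compat; nra).
      assert (H2 : Rabs (cos (lam n * t)) <= 1) by (apply Rabs_le, COS_bound). assert (H3 := Rabs_pos (cos (lam n * t))).
      assert (H4 : 0 < lam n * s0) by nra.
      replace (/ s0 * / lam n) with (/ (lam n * s0)) by (field; lra).
      assert (/ (lam n * sin (PI * t)) <= / (lam n * s0)) by (apply Rinv_le_contravar; nra).
      assert (0 < / (lam n * sin (PI * t))) by (apply Rinv_0_lt_compat; nra). nra. }
  assert (HL : is_lim_seq (fun n => (P n (/ 2) + (/ 2 - / 2) ^ 2 / 2) - (P n x + (x - / 2) ^ 2 / 2))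
     ((Fm 1 (/ 2) + (/ 2 - / 2) ^ 2 / 2) - (Fm 1 x + (x - / 2) ^ 2 / 2))).
  { apply is_lim_seq_minus'; apply is_lim_seq_plus'; try apply is_lim_seq_const; apply (Fm_series 1); lia. }
  assert (HL0 : is_lim_seq (fun n => (P n (/ 2) + (/ 2 - / 2) ^ 2 / 2) - (P n x + (x - / 2) ^ 2 / 2)) 0).
  { apply is_lim_seq_abs_0. apply (is_lim_seq_le_le (fun _ => 0) _ (fun n => C2 * / lam n)).
    - intros n; split; [apply Rabs_pos|apply HG].
    - apply is_lim_seq_const.
    - replace (Finite 0) with (Finite (C2 * 0)) by (f_equal; ring). apply (is_lim_seq_scal_l _ C2 0).
      replace (Finite 0) with (Rbar_inv p_infty) by reflexivity. apply is_lim_seq_inv; [|discriminate].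
      apply (is_lim_seq_le_p_loc INR); [|apply is_lim_seq_INR]. exists 0%nat. intros n _. unfold lam. assert (H :=
        PI2_3_2). generalize (pos_INR n). intros. nra. }
  apply is_lim_seq_unique in HL. apply is_lim_seq_unique in HL0. rewrite HL in HL0. injection HL0 as E.
  replace ((/ 2 - / 2) ^ 2 / 2) with 0 in E by field. lra.
Qed.

Lemma F1_sym x : Fm 1 (1 - x) = Fm 1 x.
Proof.
  apply Series_ext. intros k. unfold Fterm. f_equal. f_equal.
  replace (INR 2 * (PI / 2)) with PI by (simpl; field).
  rewrite !cos_minus, cos_PI, sin_PI.
  replace (kap k * (1 - x)) with (- (kap k * x) + 2 * INR (S k) * PI) by (unfold kap; ring).
  rewrite cos_period, sin_period, cos_neg. ring.
Qed.

(** The endpoint 0 is reached by continuity along [/ INR (S (S n))], the right half by the symmetry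
    of [Fm 1]. *)
Lemma F1_half_formula x : 0 <= x <= 1 -> Fm 1 x = Fm 1 (/ 2) - (x - / 2) ^ 2 / 2.
Proof.
  intros Hx.
  assert (H0 : Fm 1 0 = Fm 1 (/ 2) - (0 - / 2) ^ 2 / 2).
  { set (u := fun n : nat => / INR (S (S n))).
    assert (Hu : is_lim_seq u 0).
    { apply (is_lim_seq_incr_1 (fun n => / INR (S n))), (is_lim_seq_incr_1 (fun n => / INR n)).
      replace (Finite 0) with (Rbar_inv p_infty) by reflexivity. apply is_lim_seq_inv; [apply is_lim_seq_INR|discriminate]. }
    assert (H1 : is_lim_seq (fun n => Fm 1 (u n)) (Fm 1 0)).
    { apply (filterlim_comp _ _ _ u (Fm 1) eventually (locally 0) (locally (Fm 1 0)) Hu). apply Fm_continuous; lia. }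
    assert (H2 : is_lim_seq (fun n => Fm 1 (u n)) (Fm 1 (/ 2) - (0 - / 2) ^ 2 / 2)).
    { apply is_lim_seq_ext with (fun n => Fm 1 (/ 2) - (u n - / 2) ^ 2 / 2).
      - intros n. symmetry. apply F1_left. unfold u. assert (H := INR_S_ge1 n). rewrite (S_INR (S n)).
        split; [apply Rinv_0_lt_compat; lra|apply Rinv_le_contravar; lra].
      - apply (filterlim_comp _ _ _ u (fun y => Fm 1 (/ 2) - (y - / 2) ^ 2 / 2) eventually (locally 0) (locally _) Hu).
        apply (@ex_derive_continuous R_AbsRing R_NormedModule (fun y => Fm 1 (/ 2) - (y - / 2) ^ 2 / 2) 0).
          auto_derive. trivial. }
    apply is_lim_seq_unique in H1. apply is_lim_seq_unique in H2. rewrite H1 in H2. injection H2 as E. exact E. }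
  destruct (Rle_dec x (/ 2)) as [Hh|Hh].
  - destruct (Req_dec x 0) as [->|Hn]; [exact H0|]. apply F1_left; lra.
  - rewrite <- F1_sym. destruct (Req_dec x 1) as [->|Hn].
    + replace (1 - 1) with 0 by ring. rewrite H0. field.
    + rewrite F1_left by lra. field.
Qed.

(** The missing constant is fixed by the mean value 0 over a period, which follows from the
    periodicity of the primitive [Fm 2]. *)
Lemma F1_closed x : 0 <= x <= 1 -> Fm 1 x = - (x ^ 2 - x + / 6) / 2.
Proof.
  intros Hx.
  assert (H1 := Fm_RInt 1 0 1 (le_n 1) Rle_0_1).
  assert (E : Fm 2 1 = Fm 2 0) by (rewrite <- (Fm_periodic 2 0); f_equal; ring). rewrite E, Rminus_diag in H1.
  assert (H2 : is_RInt (Fm 1) 0 1 (Fm 1 (/ 2) - / 24)).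
  { apply (is_RInt_ext (fun x => Fm 1 (/ 2) - (x - / 2) ^ 2 / 2)).
    - rewrite Rmin_left, Rmax_right by lra. intros t Ht. symmetry; apply F1_half_formula; lra.
    - replace (Fm 1 (/ 2) - / 24) with (minus (Fm 1 (/ 2) * 1 - (1 - / 2) ^ 3 / 6) (Fm 1 (/ 2) * 0 - (0 - / 2) ^ 3 /
      6)) by (unfold minus, plus, opp; simpl; field).
      apply (is_RInt_derive (fun t => Fm 1 (/ 2) * t - (t - / 2) ^ 3 / 6)).
      + intros t _. auto_derive; trivial. field.
      + intros t _. apply (@ex_derive_continuous R_AbsRing R_NormedModule). auto_derive. trivial. }
  assert (H3 : Fm 1 (/ 2) = / 24).
  { assert (E1 := @is_RInt_unique R_CompleteNormedModule _ _ _ _ H1). assert (E2 := @is_RInt_unique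
    R_CompleteNormedModule _ _ _ _ H2). rewrite E1 in E2. lra. }
  rewrite F1_half_formula by exact Hx. rewrite H3. field.
Qed.

(** * Hurwitz zeta function *)

(* [y^(- s)] *)
Definition pw (y : R) (s : C) : C := Cexp (- RtoC (ln y) * s).

Fixpoint Cpoch (s : C) (n : nat) : C := match n with O => RtoC 1 | S m => (Cpoch s m * (s + RtoC (INR m)))%C end.

Lemma Cmod_pw y s : Cmod (pw y s) = exp (- (ln y * Re s)).
Proof. unfold pw. rewrite Cmod_Cexp. f_equal. rewrite <- RtoC_opp, re_scal_l. ring. Qed.

Lemma pw_plus y p q : pw y (p + q) = (pw y p * pw y q)%C.
Proof. unfold pw. rewrite <- Cexp_plus. f_equal. ring. Qed.

Lemma pw_1 y : 0 < y -> pw y 1 = (/ RtoC y)%C.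
Proof.
  intros Hy. unfold pw. replace (- RtoC (ln y) * 1)%C with (- RtoC (ln y))%C by ring. rewrite Cexp_opp. f_equal.
  unfold Cexp. simpl. rewrite exp_ln, cos_0, sin_0 by exact Hy. unfold RtoC. f_equal; ring.
Qed.

Lemma pw_S y p : 0 < y -> pw y (p + 1) = (pw y p / RtoC y)%C.
Proof. intros Hy. rewrite pw_plus, pw_1 by exact Hy. reflexivity. Qed.

Lemma pw_mul x y s : 0 < x -> 0 < y -> pw (x * y) s = (pw x s * pw y s)%C.
Proof. intros Hx Hy. unfold pw. rewrite <- Cexp_plus, ln_mult, RtoC_plus by assumption. f_equal. ring. Qed.

Lemma Rpos_neq_C (y : R) : 0 < y -> RtoC y <> 0.
Proof. intros Hy E. apply RtoC_inj in E. lra. Qed.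

Lemma Cder_pw (f : R -> R) (df : R) p u : is_derive f u df -> 0 < f u -> is_Cder (fun v => pw (f v) p) u (- p * pw (f
  u) (p + 1) * RtoC df)%C.
Proof.
  intros Hf Hy. eapply evar_last.
  - apply (Cder_Cexp (fun v => - RtoC (ln (f v)) * p)%C).
    eapply Cder_ext; [|apply (Cder_cmult (- p)%C (fun v => RtoC (ln (f v)))), Cder_RtoC].
    + intros s; cbv beta; ring.
    + apply (is_derive_comp ln f u (/ f u) df); [apply is_derive_ln, Hy|exact Hf].
  - to_C. rewrite pw_S by exact Hy. unfold pw. change (scal df (/ f u)) with (df * / f u).
    rewrite RtoC_mult, RtoC_inv by lra. field. apply Rpos_neq_C, Hy.
Qed.

Lemma Cder_pw_shift y p u : 0 < y + u -> is_Cder (fun v => pw (y + v) p) u (- p * pw (y + u) (p + 1))%C.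
Proof.
  intros Hy. eapply evar_last; [apply (Cder_pw (fun v => y + v) 1); [|exact Hy]|].
  - auto_derive; trivial.
  - to_C; ring.
Qed.

Lemma pw_continuous y p u : 0 < y + u -> Ccont (fun v => pw (y + v) p) u.
Proof. intros Hy. eapply Cder_continuous. apply Cder_pw_shift, Hy. Qed.

(* Euler-Maclaurin step on an interval; [Fm 1] is [- B_2 / 2], which is why the signs differ from the usual ones. *)
Lemma F1_parts (d : R) (f df ddf Phi : R -> C) a b : 0 <= a - d -> a <= b -> b - d <= 1 ->
  (forall u, a <= u <= b -> is_Cder Phi u (f u)) ->
  (forall u, a <= u <= b -> is_Cder f u (df u)) ->
  (forall u, a <= u <= b -> is_Cder df u (ddf u)) ->
  (forall u, a <= u <= b -> Ccont ddf u) ->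
  is_CRInt (fun u => RtoC (Fm 1 (u - d)) * ddf u)%C a b
    ((RtoC (Fm 1 (b - d)) * df b - RtoC (/ 2 - (b - d)) * f b - Phi b) - (RtoC (Fm 1 (a - d)) * df a - RtoC (/ 2 - (a -
      d)) * f a - Phi a))%C.
Proof.
  intros Ha Hab Hb HPhi Hf Hdf Hc.
  set (q := fun u => - ((u - d) ^ 2 - (u - d) + / 6) / 2).
  apply (CRInt_ext (fun u => RtoC (q u) * ddf u)%C).
  { rewrite Rmin_left, Rmax_right by lra. intros x Hx. rewrite F1_closed by lra. reflexivity. }
  rewrite !F1_closed by lra.
  assert (Hq : forall u, is_Cder (fun u => RtoC (q u)) u (RtoC (/ 2 - (u - d)))).
  { intros u. apply Cder_RtoC. unfold q. auto_derive; trivial. field. }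
  assert (Hl : forall u, is_Cder (fun u => RtoC (/ 2 - (u - d))) u (RtoC (0 - 1))).
  { intros u. apply Cder_RtoC. auto_derive; [trivial|ring]. }
  eapply evar_last; [apply (CRInt_FTC (fun u => RtoC (q u) * df u + (- 1 * (RtoC (/ 2 - (u - d)) * f u) + - 1 * Phi u))%C)|].
  - rewrite Rmin_left, Rmax_right by lra. intros x Hx.
    eapply evar_last; [apply Cder_plus; [apply Cder_mult; [apply Hq|apply Hdf, Hx]|apply Cder_plus; apply Cder_cmult;
      [apply Cder_mult; [apply Hl|apply Hf, Hx]|apply HPhi, Hx]]|].
    to_C. rewrite (RtoC_minus 0 1). ring.
  - rewrite Rmin_left, Rmax_right by lra. intros x Hx. apply Ccont_mult; [|apply Hc, Hx].
    eapply Cder_continuous. apply Hq.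
  - to_C. unfold q. ring.
Qed.

(* [y^(-s) = psi K s y - psi K s (y + 1) + Rem K s y]: Euler-Maclaurin of order [K] on an interval of length 1. *)
Definition RI (K : nat) (s : C) (y : R) : C :=
  RInt (V := C_R_CompleteNormedModule) (fun u => RtoC (Fm (S K) u) * pw (y + u) (s + RtoC (INR (S (S K)))))%C 0 1.
Definition Rem (K : nat) (s : C) (y : R) : C := (Cpoch s (S (S K)) * RI K s y)%C.
Definition psi (K : nat) (s : C) (y : R) : C :=
  (pw y (s - 1) / (s - 1) + / 2 * pw y s
   - Csum (fun j => Cpoch s (S j) * RtoC (Fm (S j) 0) * pw y (s + RtoC (INR (S j)))) K)%C.

Lemma RI_correct K s y : 0 < y -> is_CRInt (fun u => RtoC (Fm (S K) u) * pw (y + u) (s + RtoC (INR (S (S K)))))%C 0 1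
  (RI K s y).
Proof.
  intros Hy. apply (@RInt_correct C_R_CompleteNormedModule).
  apply (@ex_RInt_continuous C_R_CompleteNormedModule). rewrite Rmin_left, Rmax_right by lra. intros u Hu.
  apply Ccont_mult; [apply (Ccont_RtoC (Fm (S K))), Fm_continuous; lia|apply pw_continuous; lra].
Qed.

Lemma Fm_1 m : Fm m 1 = Fm m 0.
Proof. rewrite <- (Fm_periodic m 0). f_equal; ring. Qed.

Lemma euler_maclaurin_0 (s : C) (y : R) : 0 < y -> s <> 1 -> pw y s = (psi 0 s y - psi 0 s (y + 1) + Rem 0 s y)%C.
Proof.
  intros Hy Hs. assert (Hs1 : (s - 1)%C <> 0) by (apply Cminus_eq_contra, Hs).
  assert (H := F1_parts 0 (fun u => pw (y + u) s) (fun u => - s * pw (y + u) (s + 1))%C (fun u => (s * (s + 1)) * pw (y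
    + u) (s + 1 + 1))%C (fun u => - / (s - 1) * pw (y + u) (s - 1))%C 0 1 ltac:(lra) ltac:(lra) ltac:(lra)).
  cbv beta in H. rewrite !Rminus_0_r in H.
  assert (H2 := CRInt_cmult (s * (s + 1))%C _ _ _ _ (RI_correct 0 s y Hy)).
  eassert (E : (s * (s + 1) * RI 0 s y)%C = _).
  { eapply CRInt_unique; [exact H2|]. eapply CRInt_ext; [|apply H; intros u Hu].
    2:{ eapply evar_last; [apply Cder_cmult, Cder_pw_shift; lra|]. to_C. replace (s - 1 + 1)%C with s by ring. field.
      exact Hs1. }
    2:{ apply Cder_pw_shift; lra. }
    2:{ eapply evar_last; [apply Cder_cmult, Cder_pw_shift; lra|]. to_C. ring. }
    2:{ apply Ccont_mult; [apply Ccont_const|apply pw_continuous; lra]. }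
    intros u _. cbv beta. rewrite Rminus_0_r. replace (s + 1 + 1)%C with (s + RtoC (INR 2))%C by (simpl INR; rewrite
      RtoC_plus; ring). ring. }
  unfold Rem. simpl Cpoch. replace (1 * (s + 0) * (s + 1) * RI 0 s y)%C with (s * (s + 1) * RI 0 s y)%C by ring. rewrite E.
  unfold psi. rewrite !sum_O. simpl Cpoch. simpl INR. rewrite Rplus_0_r, Fm_1, !RtoC_minus, RtoC_inv by lra.
  field. exact Hs1.
Qed.

Lemma Rem_step K s y : 0 < y -> (Rem K s y - Rem (S K) s y)%C =
  (- (Cpoch s (S (S K)) * RtoC (Fm (S (S K)) 0)) * (pw y (s + RtoC (INR (S (S K)))) - pw (y + 1) (s + RtoC (INR (S (S
    K))))))%C.
Proof.
  intros Hy. set (p := (s + RtoC (INR (S (S K))))%C).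
  assert (Hp : (s + RtoC (INR (S (S (S K)))))%C = (p + 1)%C) by (unfold p; rewrite (S_INR (S (S K))), RtoC_plus; ring).
  assert (H1 := RI_correct K s y Hy). assert (H2 := RI_correct (S K) s y Hy). fold p in H1. rewrite Hp in H2.
  assert (H : is_CRInt (fun u => RtoC (Fm (S K) u) * pw (y + u) p + RtoC (Fm (S (S K)) u) * (- p * pw (y + u) (p + 1)))%C 0 1
    (RtoC (Fm (S (S K)) 1) * pw (y + 1) p - RtoC (Fm (S (S K)) 0) * pw (y + 0) p)%C).
  { apply (CRInt_FTC (fun u => RtoC (Fm (S (S K)) u) * pw (y + u) p)%C).
    - rewrite Rmin_left, Rmax_right by lra. intros u Hu.
      apply (Cder_mult (fun u => RtoC (Fm (S (S K)) u)) (fun u => pw (y + u) p)); [apply (Cder_RtoC (Fm (S (S K))) u _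
        (Fm_derive (S K) u ltac:(lia)))|apply Cder_pw_shift; lra].
    - rewrite Rmin_left, Rmax_right by lra. intros u Hu. apply Ccont_plus; apply Ccont_mult.
      + apply (Ccont_RtoC (Fm (S K))), Fm_continuous; lia.
      + apply pw_continuous; lra.
      + apply (Ccont_RtoC (Fm (S (S K)))), Fm_continuous; lia.
      + apply Ccont_mult; [apply Ccont_const|apply pw_continuous; lra]. }
  eassert (E : (RI K s y + - p * RI (S K) s y)%C = _).
  { eapply CRInt_unique; [apply CRInt_plus; [exact H1|apply CRInt_cmult; exact H2]|]. eapply CRInt_ext; [|exact H].
    intros u _. cbv beta. ring. }
  unfold Rem. change (Cpoch s (S (S (S K)))) with (Cpoch s (S (S K)) * p)%C.
  replace (Cpoch s (S (S K)) * RI K s y - Cpoch s (S (S K)) * p * RI (S K) s y)%C with (Cpoch s (S (S K)) * (RI K s y +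
    - p * RI (S K) s y))%C by ring.
  rewrite E, Fm_1, Rplus_0_r. ring.
Qed.

Lemma psi_step K s y : psi (S K) s y = (psi K s y - Cpoch s (S (S K)) * RtoC (Fm (S (S K)) 0) * pw y (s + RtoC (INR (S
  (S K)))))%C.
Proof. unfold psi. rewrite Csum_Sn. ring. Qed.

(** Each integration by parts ([Rem_step]) moves one boundary term from the remainder into the
    difference of [psi]. *)
Lemma euler_maclaurin K (s : C) (y : R) : 0 < y -> s <> 1 -> pw y s = (psi K s y - psi K s (y + 1) + Rem K s y)%C.
Proof.
  intros Hy Hs. induction K; [apply euler_maclaurin_0; assumption|].
  rewrite IHK, !psi_step. assert (E := Rem_step K s y Hy).
  replace (Rem K s y) with ((Rem K s y - Rem (S K) s y) + Rem (S K) s y)%C by ring. rewrite E. ring.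
Qed.

Lemma wiener_pw s0 r y d : 0 < r -> exists B, wiener s0 r (fun s => pw y (s + d)) B.
Proof.
  intros Hr. eexists. eapply wiener_ext; [|eapply (wiener_scal _ _ _ _ (Cexp (- RtoC (ln y) * d)%C)), (wiener_exp s0 r
    (- RtoC (ln y))%C Hr)].
  intros s _. cbv beta. unfold pw. rewrite <- Cexp_plus. f_equal. ring.
Qed.

Lemma wiener_poch s0 r n : 0 < r -> exists B, wiener s0 r (fun s => Cpoch s n) B.
Proof.
  intros Hr. induction n as [|n [B IH]]; [eexists; exact (wiener_const s0 r 1)|].
  eexists. apply (wiener_mult s0 r (fun s => Cpoch s n) (fun s => s + RtoC (INR n))%C); [exact Hr|exact IH|apply
    wiener_shift, Hr].
Qed.

Lemma wiener_Csum s0 r (F : nat -> C -> C) n : 0 < r -> (forall k, (k <= n)%nat -> exists B, wiener s0 r (F k) B) ->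
  exists B, wiener s0 r (fun s => Csum (fun k => F k s) n) B.
Proof.
  intros Hr HF. induction n.
  - destruct (HF 0%nat (le_n 0)) as [B HB]. exists B. eapply wiener_ext; [|exact HB]. intros s _; rewrite sum_O; reflexivity.
  - destruct IHn as [B1 H1]; [intros k Hk; apply HF; lia|]. destruct (HF (S n) (le_n _)) as [B2 H2].
    exists (B1 + B2). eapply wiener_ext; [|apply (wiener_plus _ _ _ _ _ _ H1 H2 Hr)]. intros s _. rewrite Csum_Sn;
      reflexivity.
Qed.

Lemma wiener_psi s0 r K y : 0 < r -> r < Cmod (s0 - 1) -> exists B, wiener s0 r (fun s => psi K s y) B.
Proof.
  intros Hr Hs.
  destruct (wiener_pw s0 r y (- RtoC 1)%C Hr) as [B1 H1]. destruct (wiener_pw s0 r y 0 Hr) as [B2 H2].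
  destruct (wiener_Csum s0 r (fun j s => Cpoch s (S j) * RtoC (Fm (S j) 0) * pw y (s + RtoC (INR (S j))))%C K Hr) as [B3 H3].
  { intros k _. destruct (wiener_poch s0 r (S k) Hr) as [B4 H4]. destruct (wiener_pw s0 r y (RtoC (INR (S k))) Hr) as
    [B5 H5].
    eexists. eapply wiener_ext; [|eapply (wiener_scal _ _ _ _ (RtoC (Fm (S k) 0))), (wiener_mult _ _ _ _ _ _ Hr H4 H5)].
    intros s _; cbv beta. ring. }
  eexists. eapply wiener_ext; [|apply (wiener_plus _ _ _ _ _ _ (wiener_mult _ _ _ _ _ _ Hr H1 (wiener_inv s0 r 1 Hr Hs))
     (wiener_plus _ _ _ _ _ _ (wiener_scal _ _ _ _ (/ 2)%C H2) (wiener_scal _ _ _ _ (- 1)%C H3) Hr) Hr)].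
  intros s _; cbv beta. unfold psi. replace (s + 0)%C with s by ring. unfold Cminus, Cdiv. ring.
Qed.

(** The factor [/ y ^ 2] makes the remainders summable over y, y + 1, and so on. At [s0] the
    exponent has real part at least 3, and the expansion in [s - s0] costs at most
    [exp (ln (y + 1) * r) <= 2 * y]. *)
Lemma wiener_RI s0 r K y : 0 < r <= 1 -> 2 <= Re s0 + INR (S K) -> 1 <= y ->
  wiener s0 r (fun s => RI K s y) (F_bound * 2 * / y ^ 2).
Proof.
  intros Hr HK Hy. set (p := (s0 + RtoC (INR (S (S K))))%C).
  assert (HFb : 0 <= F_bound) by (eapply Rle_trans; [apply Rabs_pos|apply (Fm_bound 1 0 (le_n 1))]).
  assert (Hp : 3 <= Re p). { unfold p. rewrite re_plus. change (Re (RtoC (INR (S (S K))))) with (INR (S (S K))).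
    rewrite (S_INR (S K)). lra. }
  assert (Hlny : 0 <= ln y) by (rewrite <- ln_1; apply ln_le; lra).
  assert (Hly1 : forall u, 0 <= u <= 1 -> ln y <= ln (y + u) <= ln (y + 1)) by (intros u Hu; split; apply ln_le; lra).
  set (c := F_bound * / y ^ 3).
  assert (Hyp : 0 < y ^ 3) by (apply pow_lt; lra).
  assert (Hc : 0 <= c) by (apply Rmult_le_pos; [exact HFb|apply Rlt_le, Rinv_0_lt_compat, Hyp]).
  (* Taylor coefficients in [s - s0] of the integrand at [u]. *)
  set (a := fun (k : nat) (u : R) => (/ RtoC (INR (fact k)) * (RtoC (Fm (S K) u) * pw (y + u) p * (- RtoC (ln (y + u)))
    ^ k))%C).
  assert (HS := exp_abs_series (ln (y + 1) * r) ltac:(apply Rmult_le_pos; [specialize (Hly1 1 ltac:(lra)); lra|lra])).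
  assert (HaI : forall k, exists A, is_CRInt (a k) 0 1 A).
  { intros k. apply (@ex_RInt_continuous C_R_CompleteNormedModule (a k) 0 1). rewrite Rmin_left, Rmax_right by lra.
    intros u Hu.
    unfold a. apply Ccont_mult; [apply Ccont_const|]. apply Ccont_mult.
    - apply Ccont_mult; [apply (Ccont_RtoC (Fm (S K))), Fm_continuous; lia|apply pw_continuous; lra].
    - apply Ccont_pow. eapply Cder_continuous.
      eapply Cder_ext; [|apply (Cder_RtoC (fun v => - ln (y + v)))].
      + intros v. apply RtoC_opp.
      + auto_derive; [lra|reflexivity]. }
  pose (A := fun k => proj1_sig (ClassicalEpsilon.constructive_indefinite_description _ (HaI k))).
  assert (HA : forall k, is_CRInt (a k) 0 1 (A k)) by (intros k; exact (proj2_sig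
    (ClassicalEpsilon.constructive_indefinite_description _ (HaI k)))).
  eapply wiener_le; [|apply (wiener_RInt s0 r (fun u s => RtoC (Fm (S K) u) * pw (y + u) (s + RtoC (INR (S (S K)))))%C
    _ a A (fun k => c * (/ INR (fact k) * (ln (y + 1) * r) ^ k)) 0 1); try lra].
  - rewrite Series_scal_l, (is_series_unique _ _ HS). rewrite Rminus_0_r, Rmult_1_l.
    assert (He : exp (ln (y + 1) * r) <= 2 * y).
    { apply Rle_trans with (exp (ln (y + 1))); [|rewrite exp_ln; lra].
      assert (0 <= ln (y + 1)) by (specialize (Hly1 1 ltac:(lra)); lra).
      destruct (Rle_lt_or_eq_dec (ln (y + 1) * r) (ln (y + 1)) ltac:(nra)) as [Hlt|Heq]; [apply Rlt_le, exp_increasing,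
        Hlt|rewrite Heq; lra]. }
    unfold c. replace (F_bound * 2 * / y ^ 2) with (F_bound * / y ^ 3 * (2 * y)) by (field; lra).
    apply Rmult_le_compat_l; [exact Hc|exact He].
  - exact HA.
  - intros k u Hu. unfold a. rewrite !Cmod_mult, Cmod_inv, Cmod_pow, Cmod_opp, Cmod_pw, !Cmod_R by apply INR_fact_neq_0_C.
    specialize (Hly1 u Hu). rewrite (Rabs_right (INR (fact k))) by apply Rle_ge, pos_INR. rewrite (Rabs_right (ln (y +
      u))) by lra.
    assert (Hif : 0 < / INR (fact k)) by apply Rinv_0_lt_compat, INR_fact_lt_0.
    assert (Hpw : exp (- (ln (y + u) * Re p)) <= / y ^ 3).
    { apply Rle_trans with (exp (- (3 * ln y))).
      - assert (3 * ln y <= ln (y + u) * Re p) by nra. destruct (Rle_lt_or_eq_dec _ _ H) as [Hlt|Heq]; [apply Rlt_le,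
        exp_increasing; lra|rewrite Heq; lra].
      - rewrite exp_Ropp. replace (3 * ln y) with (ln y + (ln y + ln y)) by ring. rewrite !exp_plus, !exp_ln by lra.
        right. f_equal. ring. }
    assert (HF := Fm_bound (S K) u ltac:(lia)). assert (HF0 := Rabs_pos (Fm (S K) u)).
    assert (Hl : (ln (y + u)) ^ k * r ^ k <= (ln (y + 1) * r) ^ k).
    { rewrite <- Rpow_mult_distr. apply pow_incr. split; [apply Rmult_le_pos; lra|apply Rmult_le_compat_r; lra]. }
    assert (Hl0 : 0 <= ln (y + u) ^ k * r ^ k) by (apply Rmult_le_pos; apply pow_le; lra).
    assert (He0 := exp_pos (- (ln (y + u) * Re p))).
    assert (HFp : Rabs (Fm (S K) u) * exp (- (ln (y + u) * Re p)) <= c) by (unfold c; apply Rmult_le_compat; lra).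
    replace (/ INR (fact k) * (Rabs (Fm (S K) u) * exp (- (ln (y + u) * Re p)) * ln (y + u) ^ k) * r ^ k) with
      ((Rabs (Fm (S K) u) * exp (- (ln (y + u) * Re p))) * (/ INR (fact k) * (ln (y + u) ^ k * r ^ k))) by ring.
    apply Rmult_le_compat; [apply Rmult_le_pos; lra|apply Rmult_le_pos; lra|exact HFp|apply Rmult_le_compat_l; lra].
  - apply (ex_series_scal (V := R_NormedModule)). eexists; exact HS.
  - intros u s Hu Hs.
    eapply evar_last; [eapply Cser_ext; [|apply (Cser_scal (RtoC (Fm (S K) u) * pw (y + u) p)%C _ _ (Cexp_series (-
      RtoC (ln (y + u)) * (s - s0))%C))]|].
    + intros k; cbv beta. unfold a. rewrite Cpow_mult_l. ring.
    + to_C. unfold pw. rewrite <- Cmult_assoc, <- Cexp_plus. f_equal. f_equal. unfold p. ring.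
  - intros s Hs. apply RI_correct. lra.
Qed.

Lemma wiener_Rem s0 r K : 0 < r <= 1 -> 2 <= Re s0 + INR (S K) ->
  exists B, 0 <= B /\ forall y, 1 <= y -> wiener s0 r (fun s => Rem K s y) (B * / y ^ 2).
Proof.
  intros Hr HK. destruct (wiener_poch s0 r (S (S K)) ltac:(lra)) as [B HB]. exists (B * (F_bound * 2)). split.
  - apply Rmult_le_pos; [eapply wiener_nonneg; [|exact HB]; lra|].
    assert (0 <= F_bound) by (eapply Rle_trans; [apply Rabs_pos|apply (Fm_bound 1 0 (le_n 1))]). lra.
  - intros y Hy. rewrite Rmult_assoc. apply wiener_mult; [lra|exact HB|]. apply wiener_RI; assumption.
Qed.

(* The Hurwitz zeta function, for any order [K] with [1 <= Re s + K]. *)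
Definition ZK (K : nat) (s : C) (y : R) : C := (psi K s y + CSeries (fun j => Rem K s (y + INR j)))%C.

Lemma Rem_series_wiener s0 r K y : 0 < r <= 1 -> 2 <= Re s0 + INR (S K) -> 1 <= y ->
  (forall s, Cmod (s - s0) <= r -> is_Cser (fun j => Rem K s (y + INR j)) (CSeries (fun j => Rem K s (y + INR j)))) /\
  exists B, wiener s0 r (fun s => CSeries (fun j => Rem K s (y + INR j))) B.
Proof.
  intros Hr HK Hy. destruct (wiener_Rem s0 r K Hr HK) as [B [HB0 HB]].
  assert (Hw : forall j, wiener s0 r (fun s => Rem K s (y + INR j)) (B * / INR (S j) ^ 2)).
  { intros j. eapply wiener_le; [|apply HB; generalize (pos_INR j); lra]. apply Rmult_le_compat_l; [exact HB0|].
    apply Rinv_le_contravar; [apply pow_lt; generalize (INR_S_ge1 j); lra|]. apply pow_incr. rewrite S_INR. generalize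
      (pos_INR j); lra. }
  assert (HBs : ex_series (fun j => B * / INR (S j) ^ 2)) by (apply (ex_series_scal (V := R_NormedModule)),
    ex_series_inv_sq).
  assert (HS : forall s, Cmod (s - s0) <= r -> is_Cser (fun j => Rem K s (y + INR j)) (CSeries (fun j => Rem K s (y +
    INR j)))).
  { intros s Hs. destruct (ex_Cser_le (fun j => Rem K s (y + INR j)) _ (fun j => wiener_norm _ _ _ _ s (proj1 Hr) (Hw
    j) Hs) HBs) as [l Hl].
    rewrite (CSeries_unique _ _ Hl). exact Hl. }
  split; [exact HS|]. eexists. apply (wiener_series s0 r (fun j s => Rem K s (y + INR j)) _ _ (proj1 Hr) Hw HBs HS).
Qed.

Lemma Rem_Cser K s y : 2 <= Re s + INR (S K) -> 1 <= y -> is_Cser (fun j => Rem K s (y + INR j)) (CSeries (fun j => Rem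
  K s (y + INR j))).
Proof.
  intros HK Hy. apply (Rem_series_wiener s 1 K y); try lra.
  replace (s - s)%C with (RtoC 0) by ring. rewrite Cmod_0; lra.
Qed.

Lemma pw_lim_infty y p : 0 < y -> 0 < Re p -> filterlim (fun j => pw (y + INR j) p) eventually (locally (RtoC 0)).
Proof.
  intros Hy Hp. apply (filterlim_C eventually). intros e He.
  assert (HL : is_lim_seq (fun j => ln (y + INR j)) p_infty).
  { apply (filterlim_comp _ _ _ (fun j => y + INR j) ln eventually (Rbar_locally p_infty) (Rbar_locally p_infty));
    [|apply is_lim_ln_p].
    apply (is_lim_seq_plus (fun _ => y) INR y p_infty p_infty); [apply is_lim_seq_const|apply is_lim_seq_INR|reflexivity]. }
  apply is_lim_seq_spec in HL. destruct (HL (- ln e / Re p)) as [N HN]. exists N. intros n Hn. specialize (HN n Hn).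
  replace (pw (y + INR n) p - 0)%C with (pw (y + INR n) p) by ring. rewrite Cmod_pw. rewrite <- (exp_ln e He) at 1.
  apply exp_increasing. apply (Rmult_lt_compat_r (Re p)) in HN; [|exact Hp].
  unfold Rdiv in HN. rewrite Rmult_assoc, Rinv_l in HN by lra. lra.
Qed.

Lemma Csum_telescope (f : nat -> C) n : Csum (fun j => f j - f (S j))%C n = (f 0%nat - f (S n))%C.
Proof. induction n; [rewrite sum_O; reflexivity|rewrite Csum_Sn, IHn; to_C; ring]. Qed.

Lemma Cser_telescope (f : nat -> C) : filterlim f eventually (locally (RtoC 0)) -> is_Cser (fun j => f j - f (S j))%C
  (f 0%nat).
Proof.
  intros H. apply is_Cser_eps. intros e He. apply (filterlim_C eventually) with (2 := He) in H.
  destruct H as [N HN]. exists N. intros n Hn. rewrite Csum_telescope. specialize (HN (S n) ltac:(lia)).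
  replace (f 0%nat - f (S n) - f 0%nat)%C with (- (f (S n) - 0))%C by ring. rewrite Cmod_opp. exact HN.
Qed.

(** Summed over [y + j], the differences of remainders in [Rem_step] telescope to the term by which
    the two [psi] differ. *)
Lemma ZK_step K s y : 2 <= Re s + INR (S K) -> 1 <= y -> ZK K s y = ZK (S K) s y.
Proof.
  intros HK Hy. assert (HK' : 2 <= Re s + INR (S (S K))) by (rewrite (S_INR (S K)); lra).
  assert (H1 := Rem_Cser K s y HK Hy). assert (H2 := Rem_Cser (S K) s y HK' Hy).
  set (p := (s + RtoC (INR (S (S K))))%C).
  assert (Hp : 0 < Re p). { unfold p. rewrite re_plus. change (Re (RtoC (INR (S (S K))))) with (INR (S (S K))). lra. }
  assert (H3 := Cser_scal (- (Cpoch s (S (S K)) * RtoC (Fm (S (S K)) 0)))%C _ _ (Cser_telescope _ (pw_lim_infty y p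
    ltac:(lra) Hp))).
  assert (H4 := Cser_plus _ _ _ _ H1 (Cser_scal (- 1) _ _ H2)).
  set (a := CSeries (fun j => Rem K s (y + INR j))) in *. set (b := CSeries (fun j => Rem (S K) s (y + INR j))) in *.
  assert (E : (a + - 1 * b = - (Cpoch s (S (S K)) * RtoC (Fm (S (S K)) 0)) * pw (y + INR 0) p)%C).
  { eapply is_Cser_unique; [exact H4|]. eapply Cser_ext; [|exact H3]. intros j; cbv beta.
    assert (E0 := Rem_step K s (y + INR j) ltac:(generalize (pos_INR j); lra)). fold p in E0.
    rewrite S_INR, <- Rplus_assoc. replace (Rem K s (y + INR j) + - 1 * Rem (S K) s (y + INR j))%C with (Rem K s (y +
      INR j) - Rem (S K) s (y + INR j))%C by ring.
    symmetry; exact E0. }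
  unfold ZK. rewrite psi_step. fold p. fold a. fold b.
  replace a with ((a + - 1 * b) + b)%C by ring. rewrite E. simpl INR. rewrite Rplus_0_r. ring.
Qed.

(** * Finite sums and series over residue classes *)

Fixpoint psum (a : nat -> C) (n : nat) : C := match n with O => RtoC 0 | S m => (psum a m + a m)%C end.

Lemma Csum_psum (a : nat -> C) n : Csum a n = psum a (S n).
Proof. induction n; [rewrite sum_O; simpl; to_C; ring|rewrite Csum_Sn, IHn; reflexivity]. Qed.

Lemma psum_ext (f g : nat -> C) n : (forall l, (l < n)%nat -> f l = g l) -> psum f n = psum g n.
Proof. intros H. induction n; [reflexivity|]. simpl. rewrite IHn, H; auto. Qed.

Lemma psum_update (f g : nat -> C) (d : C) r n : (r < n)%nat -> (forall l, (l < n)%nat -> l <> r -> f l = g l) ->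
  f r = (g r + d)%C -> psum f n = (psum g n + d)%C.
Proof.
  intros Hr Hfg Hd. induction n; [lia|]. simpl. destruct (Nat.eq_dec r n) as [->|Hne].
  - rewrite Hd, (psum_ext f g n); [ring|]. intros l Hl. apply Hfg; lia.
  - rewrite IHn, (Hfg n); try lia; [ring|]. intros l Hl Hl2. apply Hfg; lia.
Qed.

(** For [l < M], the number of [j] with [l + j * M < N]. *)
Definition class_count (M l N : nat) : nat := (N / M + if (l <? N mod M)%nat then 1 else 0)%nat.

Lemma class_count_S M l N : (0 < M)%nat -> (l < M)%nat ->
  class_count M l (S N) = (class_count M l N + if (l =? N mod M)%nat then 1 else 0)%nat.
Proof.
  intros HM Hl. unfold class_count. assert (HN := Nat.div_mod N M ltac:(lia)). assert (Hr := Nat.mod_upper_bound N M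
    ltac:(lia)).
  set (q := (N / M)%nat) in *. set (r := (N mod M)%nat) in *.
  destruct (Nat.eq_dec (S r) M) as [E|E].
  - assert (Hd : (S N / M = S q)%nat) by (symmetry; apply (Nat.div_unique (S N) M (S q) 0); nia).
    assert (Hm : (S N mod M = 0)%nat) by (symmetry; apply (Nat.mod_unique (S N) M (S q) 0); nia).
    rewrite Hd, Hm. destruct (Nat.ltb_spec l 0), (Nat.ltb_spec l r), (Nat.eqb_spec l r); lia.
  - assert (Hd : (S N / M = q)%nat) by (symmetry; apply (Nat.div_unique (S N) M q (S r)); nia).
    assert (Hm : (S N mod M = S r)%nat) by (symmetry; apply (Nat.mod_unique (S N) M q (S r)); nia).
    rewrite Hd, Hm. destruct (Nat.ltb_spec l (S r)), (Nat.ltb_spec l r), (Nat.eqb_spec l r); lia.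
Qed.

Lemma psum_classes (u : nat -> C) M N : (0 < M)%nat ->
  psum u N = psum (fun l => psum (fun j => u (l + j * M)%nat) (class_count M l N)) M.
Proof.
  intros HM. induction N.
  - assert (H : forall n, psum (fun l => psum (fun j => u (l + j * M)%nat) (class_count M l 0)) n = RtoC 0).
    { intros n. induction n; [reflexivity|]. simpl psum at 1. rewrite IHn. unfold class_count. rewrite
      Nat.Div0.div_0_l, Nat.Div0.mod_0_l.
      simpl. ring. }
    rewrite H. reflexivity.
  - symmetry. simpl psum at 3. rewrite IHN. assert (Hr := Nat.mod_upper_bound N M ltac:(lia)).
    apply (psum_update _ _ (u N) (N mod M)); [exact Hr| |].
    + intros l Hl Hne. rewrite class_count_S by assumption. destruct (Nat.eqb_spec l (N mod M)); [contradiction|].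
      rewrite Nat.add_0_r. reflexivity.
    + rewrite class_count_S by assumption. rewrite Nat.eqb_refl, Nat.add_1_r. simpl psum at 1. f_equal. f_equal.
      unfold class_count. rewrite Nat.ltb_irrefl, Nat.add_0_r. assert (HN := Nat.div_mod N M ltac:(lia)). lia.
Qed.

Lemma filterlim_psum (f : nat -> nat -> C) (s : nat -> C) n : (forall l, (l < n)%nat -> filterlim (fun N => f N l)
  eventually (locally (s l))) ->
  filterlim (fun N => psum (f N) n) eventually (locally (psum s n)).
Proof.
  intros H. induction n; [exact (@filterlim_const nat C_UniformSpace eventually _ (RtoC 0))|]. simpl. apply
    (filterlim_Cplus eventually).
  - apply IHn. intros l Hl. apply H. lia.
  - apply H. lia.
Qed.

Lemma psum_lim (a : nat -> C) (s : C) : is_Cser a s -> filterlim (psum a) eventually (locally s).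
Proof.
  intros H. apply (filterlim_C eventually). intros e He. apply is_Cser_eps with (2 := He) in H. destruct H as [N HN].
  exists (S N). intros n Hn. destruct n as [|n]; [lia|]. rewrite <- Csum_psum. apply HN. lia.
Qed.

(** No absolute convergence is assumed: a partial sum of [u] is exactly a sum of partial sums of the
    classes, whose lengths tend to infinity. *)
Lemma Cser_classes (u s : nat -> C) M : (0 < M)%nat -> (forall l, (l < M)%nat -> is_Cser (fun j => u (l + j * M)%nat)
  (s l)) ->
  is_Cser u (psum s M).
Proof.
  intros HM H.
  assert (HL : filterlim (fun N => psum u N) eventually (locally (psum s M))).
  { eapply filterlim_ext; [intros N; symmetry; apply psum_classes; exact HM|].
    apply (filterlim_psum (fun N l => psum (fun j => u (l + j * M)%nat) (class_count M l N))).
    intros l Hl. apply (filterlim_comp _ _ _ (class_count M l) (psum (fun j => u (l + j * M)%nat)) eventually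
      eventually (locally (s l))).
    - intros P [N HN]. exists (N * M)%nat. intros n Hn. apply HN. unfold class_count.
      assert (N <= n / M)%nat by (apply Nat.div_le_lower_bound; lia). lia.
    - apply psum_lim, H, Hl. }
  apply is_Cser_eps. intros e He. apply (filterlim_C eventually) with (2 := He) in HL. destruct HL as [N HN].
  exists N. intros n Hn. rewrite Csum_psum. apply HN. lia.
Qed.

Definition EM_order (s : C) : nat := (Z.to_nat (up (Cmod s)) + 2)%nat.

Lemma EM_order_spec s : 2 <= Re s + INR (S (EM_order s)).
Proof.
  unfold EM_order. rewrite S_INR, plus_INR. assert (H := archimed (Cmod s)). assert (H0 := Cmod_ge_0 s).
  assert (Hz : (0 <= up (Cmod s))%Z). { apply le_IZR. lra. }
  rewrite INR_IZR_INZ, Z2Nat.id by exact Hz. assert (H1 := re_le_Cmod s). apply Rabs_le_between in H1. simpl (INR 2). lra.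
Qed.

Definition Zfun (s : C) (y : R) : C := ZK (EM_order s) s y.

Lemma ZK_add K n s y : 2 <= Re s + INR (S K) -> 1 <= y -> ZK K s y = ZK (n + K) s y.
Proof.
  intros HK Hy. induction n; [reflexivity|]. rewrite IHn. apply (ZK_step (n + K)); [|exact Hy].
  assert (INR (S K) <= INR (S (n + K))) by (apply le_INR; lia). lra.
Qed.

(** The order in [Zfun] varies with [s]; analyticity needs one fixed order on a whole disc. *)
Lemma Zfun_eq K s y : 2 <= Re s + INR (S K) -> 1 <= y -> Zfun s y = ZK K s y.
Proof.
  intros HK Hy. unfold Zfun. assert (H := EM_order_spec s). set (K' := EM_order s) in *.
  destruct (Nat.le_ge_cases K K') as [Hle|Hle].
  - replace K' with ((K' - K) + K)%nat by lia. symmetry. apply ZK_add; assumption.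
  - replace K with ((K - K') + K')%nat by lia. apply ZK_add; assumption.
Qed.

(** The first term is split off because the remainder estimates hold for [1 <= y], while [a] ranges
    over (0, 1]. *)
Definition hurwitz (s : C) (a : R) : C := (pw a s + Zfun s (a + 1))%C.

Lemma hurwitz_wiener (s0 : C) a : s0 <> 1 -> 0 < a -> exists r B, 0 < r /\ wiener s0 r (fun s => hurwitz s a) B.
Proof.
  intros Hs Ha. assert (Hd : 0 < Cmod (s0 - 1)) by (apply Cmod_gt_0, Cminus_eq_contra, Hs).
  set (r := Rmin 1 (Cmod (s0 - 1) / 2)).
  assert (Hr : 0 < r <= 1) by (unfold r; split; [apply Rmin_glb_lt; lra|apply Rmin_l]).
  assert (Hr2 : r < Cmod (s0 - 1)) by (unfold r; generalize (Rmin_r 1 (Cmod (s0 - 1) / 2)); lra).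
  (* One order more than at the centre, since [Re s] may drop by [r <= 1] inside the disc. *)
  set (K := S (EM_order s0)).
  assert (HK : 3 <= Re s0 + INR (S K)). { unfold K. assert (H := EM_order_spec s0). rewrite (S_INR (S _)). lra. }
  destruct (wiener_pw s0 r a 0 (proj1 Hr)) as [B1 H1].
  destruct (wiener_psi s0 r K (a + 1) (proj1 Hr) Hr2) as [B2 H2].
  destruct (Rem_series_wiener s0 r K (a + 1) Hr ltac:(lra) ltac:(lra)) as [_ [B3 H3]].
  exists r, (B1 + (B2 + B3)). split; [apply Hr|].
  eapply wiener_ext; [|apply (wiener_plus _ _ _ _ _ _ H1 (wiener_plus _ _ _ _ _ _ H2 H3 (proj1 Hr)) (proj1 Hr))].
  intros s Hs1. cbv beta. unfold hurwitz. rewrite (Zfun_eq K).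
  - unfold ZK. replace (s + 0)%C with s by ring. reflexivity.
  - assert (H := re_le_Cmod (s - s0)). unfold Cminus in H at 1. rewrite re_plus, re_opp in H. apply Rabs_le_between in
    H. lra.
  - lra.
Qed.

Lemma filterlim_Csum0 (f : nat -> nat -> C) n : (forall j, filterlim (f j) eventually (locally (RtoC 0))) ->
  filterlim (fun N => Csum (fun j => f j N) n) eventually (locally (RtoC 0)).
Proof.
  intros H. induction n.
  - eapply filterlim_ext; [|apply (H 0%nat)]. intros N; rewrite sum_O; reflexivity.
  - eapply filterlim_ext; [intros N; symmetry; apply Csum_Sn|]. replace (RtoC 0) with (0 + 0)%C by ring.
    apply (filterlim_Cplus eventually); [exact IHn|apply H].
Qed.

Lemma filterlim_Cscal0 (c : C) (f : nat -> C) : filterlim f eventually (locally (RtoC 0)) ->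
  filterlim (fun N => c * f N)%C eventually (locally (RtoC 0)).
Proof.
  intros H. replace (RtoC 0) with (c * 0)%C by ring. eapply (filterlim_comp _ _ _ _ (fun y => c * y)%C); [exact H|].
  exact (@filterlim_scal_r C_AbsRing C_NormedModule c (RtoC 0)).
Qed.

Lemma psi_lim_infty K s y : 1 < Re s -> 0 < y -> filterlim (fun j => psi K s (y + INR j)) eventually (locally (RtoC 0)).
Proof.
  intros Hs Hy. replace (RtoC 0) with (0 + (0 + 0))%C by ring.
  eapply filterlim_ext; [|apply (filterlim_Cplus eventually (fun j => / (s - 1) * pw (y + INR j) (s - 1))%C (fun j => /
    2 * pw (y + INR j) s + - 1 * Csum (fun i => Cpoch s (S i) * RtoC (Fm (S i) 0) * pw (y + INR j) (s + RtoC (INR (S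
      i)))) K)%C 0 (0 + 0))].
  - intros j; cbv beta. unfold psi, Cminus, Cdiv. ring.
  - apply filterlim_Cscal0, pw_lim_infty; [exact Hy|]. unfold Cminus. rewrite re_plus, re_opp. simpl (Re 1). lra.
  - apply (filterlim_Cplus eventually).
    + apply filterlim_Cscal0, pw_lim_infty; lra.
    + apply filterlim_Cscal0. apply (filterlim_Csum0 (fun i j => Cpoch s (S i) * RtoC (Fm (S i) 0) * pw (y + INR j) (s
      + RtoC (INR (S i))))%C).
      intros i. apply filterlim_Cscal0, pw_lim_infty; [exact Hy|]. rewrite re_plus. change (Re (RtoC (INR (S i)))) with
        (INR (S i)). generalize (pos_INR (S i)). lra.
Qed.

(** Euler-Maclaurin at each [y + INR j]; the [psi] differences telescope because [psi] tends to 0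
    when [1 < Re s]. *)
Lemma Zfun_Dirichlet s y : 1 < Re s -> 1 <= y -> is_Cser (fun j => pw (y + INR j) s) (Zfun s y).
Proof.
  intros Hs Hy. assert (Hs1 : s <> 1) by (intros E; rewrite E in Hs; simpl in Hs; lra).
  assert (HK := EM_order_spec s). set (K := EM_order s) in *.
  assert (H1 := Cser_telescope _ (psi_lim_infty K s y Hs ltac:(lra))). assert (H2 := Rem_Cser K s y HK Hy).
  eapply evar_last; [eapply Cser_ext; [|apply (Cser_plus _ _ _ _ H1 H2)]|].
  - intros j; cbv beta. rewrite S_INR, <- Rplus_assoc. symmetry. apply euler_maclaurin; [generalize (pos_INR j);
    lra|exact Hs1].
  - unfold Zfun, ZK. fold K. simpl INR. rewrite Rplus_0_r. reflexivity.
Qed.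

Lemma hurwitz_Dirichlet s a : 1 < Re s -> 0 < a -> is_Cser (fun j => pw (a + INR j) s) (hurwitz s a).
Proof.
  intros Hs Ha. apply (is_series_decr_1 (V := C_NormedModule)).
  eapply evar_last; [eapply Cser_ext; [|apply (Zfun_Dirichlet s (a + 1) Hs ltac:(lra))]|].
  - intros j; cbv beta. rewrite S_INR. f_equal. ring.
  - unfold hurwitz. simpl INR. rewrite Rplus_0_r. change (Zfun s (a + 1) = pw a s + Zfun s (a + 1) + - pw a s)%C. ring.
Qed.

(** * Hurwitz zeta values at nonpositive integers *)

Lemma Cpoch_zero m n : (m < n)%nat -> Cpoch (- RtoC (INR m)) n = 0.
Proof.
  induction n; intros H; [lia|]. simpl. destruct (Nat.eq_dec m n) as [->|Hne]; [ring|]. rewrite IHn by lia. ring.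
Qed.

Lemma Cpoch_shift s n : (s * Cpoch (s + 1) n = Cpoch s (S n))%C.
Proof.
  induction n; [simpl; ring|]. change (Cpoch (s + 1) (S n)) with (Cpoch (s + 1) n * (s + 1 + RtoC (INR n)))%C.
  change (Cpoch s (S (S n))) with (Cpoch s (S n) * (s + RtoC (INR (S n))))%C. rewrite <- IHn, S_INR, RtoC_plus. ring.
Qed.

Lemma Cpoch_fact m : Cpoch (- RtoC (INR m)) m = ((- 1) ^ m * RtoC (INR (fact m)))%C.
Proof.
  induction m; [simpl; ring|]. rewrite <- Cpoch_shift. rewrite S_INR, RtoC_plus.
  replace (- (INR m + 1) + 1)%C with (- RtoC (INR m))%C by ring. rewrite IHm.
  change (fact (S m)) with (S m * fact m)%nat. rewrite mult_INR, S_INR, RtoC_mult, RtoC_plus, Cpow_S. ring.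
Qed.

Lemma psi_trunc m y : psi (S m) (- RtoC (INR (S m))) y = psi m (- RtoC (INR (S m))) y.
Proof. rewrite psi_step, Cpoch_zero by lia. ring. Qed.

Lemma Csum_Cder (f df : nat -> R -> C) u n : (forall k, is_Cder (f k) u (df k u)) ->
  is_Cder (fun x => Csum (fun k => f k x) n) u (Csum (fun k => df k u) n).
Proof.
  intros H. induction n.
  - rewrite sum_O. eapply Cder_ext; [|apply (H 0%nat)]. intros s; rewrite sum_O; reflexivity.
  - rewrite Csum_Sn. eapply Cder_ext; [intros s; symmetry; apply Csum_Sn|]. apply Cder_plus; [exact IHn|apply H].
Qed.

Lemma Csum_scal (c : C) (f : nat -> C) n : Csum (fun k => c * f k)%C n = (c * Csum f n)%C.
Proof. induction n; [rewrite !sum_O; reflexivity|rewrite !Csum_Sn, IHn; to_C; ring]. Qed.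

Lemma Csum_ext (f g : nat -> C) n : (forall k, (k <= n)%nat -> f k = g k) -> Csum f n = Csum g n.
Proof. intros H. apply sum_n_ext_loc. exact H. Qed.

(** Differentiation shifts [s] by 1, as for powers. At negative integers this matches the relation
    between [Fm (S m)] and [Fm m] and drives the induction in [psi_value]. *)
Lemma psi_deriv K (s : C) y : 0 < y -> s <> 1 -> s <> 0 -> is_Cder (psi K s) y (- s * psi K (s + 1) y)%C.
Proof.
  intros Hy Hs1 Hs0. assert (Hs : (s - 1)%C <> 0) by (apply Cminus_eq_contra, Hs1).
  assert (Hp : forall p, is_Cder (fun v => pw v p) y (- p * pw y (p + 1))%C).
  { intros p. eapply evar_last; [apply (Cder_pw (fun v => v) 1); [apply @is_derive_id|exact Hy]|]. to_C; ring. }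
  eapply evar_last; [eapply Cder_ext; [|apply (Cder_plus _ _ _ _ _ (Cder_cmult (/ (s - 1))%C _ _ _ (Hp (s - 1)%C))
    (Cder_plus _ _ _ _ _ (Cder_cmult (/ 2)%C _ _ _ (Hp s)) (Cder_cmult (- 1)%C _ _ _ (Csum_Cder
      (fun j y => Cpoch s (S j) * RtoC (Fm (S j) 0) * pw y (s + RtoC (INR (S j))))%C
      (fun j y => Cpoch s (S j) * RtoC (Fm (S j) 0) * (- (s + RtoC (INR (S j))) * pw y (s + RtoC (INR (S j)) + 1)))%C y K
      (fun j => Cder_cmult _ _ _ _ (Hp (s + RtoC (INR (S j)))%C))))))]|].
  - intros t; cbv beta. unfold psi, Cminus, Cdiv. ring.
  - to_C. unfold psi.
    rewrite (Csum_ext _ (fun j => - s * (Cpoch (s + 1) (S j) * RtoC (Fm (S j) 0) * pw y (s + 1 + RtoC (INR (S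
      j)))))%C), Csum_scal.
    + replace (s - 1 + 1)%C with s by ring. replace (s + 1 - 1)%C with s by ring. field. split; assumption.
    + intros k _. replace (s + 1 + RtoC (INR (S k)))%C with (s + RtoC (INR (S k)) + 1)%C by ring.
      replace (- s * (Cpoch (s + 1) (S k) * RtoC (Fm (S k) 0) * pw y (s + RtoC (INR (S k)) + 1)))%C with
        (- (s * Cpoch (s + 1) (S k)) * RtoC (Fm (S k) 0) * pw y (s + RtoC (INR (S k)) + 1))%C by ring.
      rewrite Cpoch_shift. change (Cpoch s (S (S k))) with (Cpoch s (S k) * (s + RtoC (INR (S k))))%C. ring.
Qed.

Lemma pw_0 y : pw y 0 = 1.
Proof. unfold pw. replace (- RtoC (ln y) * 0)%C with (RtoC 0) by ring. apply Cexp_0. Qed.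

Lemma pw_small y p : 0 < y <= 1 -> Re p <= -1 -> Cmod (pw y p) <= y.
Proof.
  intros Hy Hp. rewrite Cmod_pw. rewrite <- (exp_ln y) at 2 by lra.
  assert (Hl : ln y <= 0) by (rewrite <- ln_1; apply ln_le; lra).
  assert (H : - (ln y * Re p) <= ln y) by nra. destruct H as [H| ->]; [apply Rlt_le, exp_increasing, H|lra].
Qed.

(** At s = - (n + 1) every power of [y] in [psi n] has exponent at least 1, except the last summand,
    [j = n], which is constant. *)
Lemma psi_near_0 n : exists B, forall y, 0 < y <= 1 ->
  Cmod (psi n (- RtoC (INR (S n))) y - - (Cpoch (- RtoC (INR (S n))) (S n) * RtoC (Fm (S n) 0))) <= B * y.
Proof.
  set (s := (- RtoC (INR (S n)))%C).
  assert (Hsum : exists B, 0 <= B /\ forall y, 0 < y <= 1 ->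
    Cmod (Csum (fun j => Cpoch s (S j) * RtoC (Fm (S j) 0) * pw y (s + RtoC (INR (S j))))%C n - Cpoch s (S n) * RtoC
      (Fm (S n) 0)) <= B * y).
  { assert (Hlow : forall k, (S k <= n)%nat -> exists B, 0 <= B /\ forall y, 0 < y <= 1 ->
      Cmod (Csum (fun j => Cpoch s (S j) * RtoC (Fm (S j) 0) * pw y (s + RtoC (INR (S j))))%C k) <= B * y).
    { assert (Ht : forall k y, (S k <= n)%nat -> 0 < y <= 1 ->
        Cmod (Cpoch s (S k) * RtoC (Fm (S k) 0) * pw y (s + RtoC (INR (S k)))) <= Cmod (Cpoch s (S k) * RtoC (Fm (S k)
          0)) * y).
      { intros k y Hk Hy. rewrite (Cmod_mult _ (pw _ _)). apply Rmult_le_compat_l; [apply Cmod_ge_0|]. apply pw_small;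
        [exact Hy|].
        unfold s. rewrite re_plus, re_opp. change (Re (RtoC (INR (S n)))) with (INR (S n)). change (Re (RtoC (INR (S
          k)))) with (INR (S k)).
        rewrite (S_INR n). assert (INR (S k) <= INR n) by (apply le_INR; lia). lra. }
      induction k; intros Hk.
      - eexists. split; [|intros y Hy; rewrite sum_O; apply Ht; assumption]. apply Cmod_ge_0.
      - destruct IHk as [B [HB0 HB]]; [lia|]. exists (B + Cmod (Cpoch s (S (S k)) * RtoC (Fm (S (S k)) 0))). split;
        [generalize (Cmod_ge_0 (Cpoch s (S (S k)) * RtoC (Fm (S (S k)) 0))); lra|].
        intros y Hy. rewrite Csum_Sn. eapply Rle_trans; [apply Cmod_triangle|]. rewrite Rmult_plus_distr_r. apply
          Rplus_le_compat; [apply HB, Hy|apply Ht; assumption]. }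
    assert (Hlast : forall y, (Cpoch s (S n) * RtoC (Fm (S n) 0) * pw y (s + RtoC (INR (S n))) = Cpoch s (S n) * RtoC
      (Fm (S n) 0))%C).
    { intros y. assert (E : (s + RtoC (INR (S n)))%C = RtoC 0) by (unfold s; ring). rewrite E. rewrite pw_0. ring. }
    destruct n as [|n].
    - exists 0. split; [lra|]. intros y Hy. rewrite sum_O, Hlast. replace (_ - _)%C with (RtoC 0) by ring. rewrite
      Cmod_0. lra.
    - destruct (Hlow n (le_n _)) as [B [HB0 HB]]. exists B. split; [exact HB0|]. intros y Hy. rewrite Csum_Sn, Hlast.
      assert (E : forall z c : C, (z + c - c)%C = z) by (intros; ring). rewrite E. apply HB, Hy. }
  destruct Hsum as [B [HB0 HB]]. exists (Cmod (/ (s - 1)) + Cmod (/ 2) + B). intros y Hy.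
  specialize (HB y Hy). unfold psi.
  set (T := Csum _ n) in *. set (c := (Cpoch s (S n) * RtoC (Fm (S n) 0))%C) in *.
  replace (pw y (s - 1) / (s - 1) + / 2 * pw y s - T - - c)%C with (/ (s - 1) * pw y (s - 1) + / 2 * pw y s + - (T -
    c))%C by (unfold Cdiv; ring).
  assert (Hre : Re s <= -1). { unfold s. rewrite re_opp. change (Re (RtoC (INR (S n)))) with (INR (S n)). generalize
    (INR_S_ge1 n). lra. }
  eapply Rle_trans; [apply Cmod_triangle|]. rewrite Cmod_opp, 2!Rmult_plus_distr_r. apply Rplus_le_compat; [|exact HB].
  eapply Rle_trans; [apply Cmod_triangle|]. rewrite (Cmod_mult (/ (s - 1))), (Cmod_mult (/ 2)).
  apply Rplus_le_compat; (apply Rmult_le_compat_l; [apply Cmod_ge_0|]); apply pw_small; trivial.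
  unfold Cminus. rewrite re_plus, re_opp. simpl (Re 1). lra.
Qed.

(* By induction on [n] the derivatives in [a] agree; the constants agree in the limit [a -> 0]. *)
Lemma psi_value n a : 0 < a <= 1 ->
  psi n (- RtoC (INR (S n))) a = ((- 1) ^ S (S n) * RtoC (INR (fact (S n)) * Fm (S n) (1 - a)))%C.
Proof.
  revert a. induction n; intros a Ha.
  - assert (E0 : Fm 1 0 = - / 12) by (rewrite F1_closed by lra; field).
    assert (E1 : INR (fact 1) * Fm 1 (1 - a) = - (a * a - a + / 6) / 2) by (rewrite F1_closed by lra; simpl; field).
    assert (E2 : RtoC (- (a * a - a + / 6) / 2) = (- (a * a - a + / 6) / 2)%C) by (rewrite RtoC_div, RtoC_opp,
      RtoC_plus, RtoC_minus, RtoC_mult, RtoC_inv by lra; reflexivity).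
    assert (E3 : RtoC (- / 12) = (- / 12)%C) by (rewrite RtoC_opp, RtoC_inv by lra; reflexivity).
    assert (Hpm : pw a (- RtoC 1) = RtoC a).
    { unfold pw. replace (- RtoC (ln a) * - RtoC 1)%C with (RtoC (ln a)) by ring. unfold Cexp; simpl. rewrite exp_ln,
      cos_0, sin_0 by lra. unfold RtoC; f_equal; ring. }
    unfold psi. rewrite sum_O, E0, E1, E2, E3. change (INR 1) with 1. simpl Cpoch.
    replace (- RtoC 1 - 1)%C with (- RtoC 1 + - RtoC 1)%C by ring.
    rewrite pw_plus, Hpm. replace (- RtoC 1 + RtoC 1)%C with (RtoC 0) by ring. rewrite pw_0.
    simpl Cpow. field.
  - set (s := (- RtoC (INR (S (S n))))%C).
    set (W := fun a => ((- 1) ^ S (S (S n)) * RtoC (INR (fact (S (S n))) * Fm (S (S n)) (1 - a)))%C).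
    set (D := fun a => (psi (S n) s a + - 1 * W a)%C).
    assert (Hn2 : 1 <= INR (S n)) by apply INR_S_ge1.
    assert (Hs0 : s <> 0) by (unfold s; rewrite <- RtoC_opp; intros E; apply RtoC_inj in E; rewrite S_INR in E; lra).
    assert (Hs1 : s <> 1) by (unfold s; rewrite <- RtoC_opp; intros E; apply RtoC_inj in E; rewrite S_INR in E; lra).
    assert (HD : forall x, 0 < x <= 1 -> is_Cder D x (RtoC 0)).
    { intros x Hx. eapply evar_last; [apply Cder_plus; [apply psi_deriv; [lra|exact Hs1|exact Hs0]|apply Cder_cmult;
      apply Cder_cmult; apply (Cder_RtoC (fun a => INR (fact (S (S n))) * Fm (S (S n)) (1 - a)) x (INR (fact (S (S n)))
        * (- 1 * Fm (S n) (1 - x))))]|].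
      - apply (is_derive_scal (fun a => Fm (S (S n)) (1 - a)) x (INR (fact (S (S n))))).
        apply (is_derive_comp (Fm (S (S n))) (fun a => 1 - a) x (Fm (S n) (1 - x)) (- 1)); [apply Fm_derive; lia|].
        auto_derive; [trivial|to_R; ring].
      - to_C. replace (s + 1)%C with (- RtoC (INR (S n)))%C by (unfold s; rewrite (S_INR (S n)), RtoC_plus; ring).
        rewrite psi_trunc, IHn by exact Hx. unfold s.
        change (fact (S (S n))) with (S (S n) * fact (S n))%nat. rewrite mult_INR, !RtoC_mult, !Cpow_S. ring. }
    destruct (psi_near_0 (S n)) as [B HB]. fold s in HB.
    assert (HBs : forall x, 0 < x <= 1 -> 0 <= B * x) by (intros x Hx; eapply Rle_trans; [apply Cmod_ge_0|apply (HB x Hx)]).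
    assert (HD0 : D a = 0).
    { assert (Hc : forall x, 0 < x <= a -> D a = D x).
      { intros x Hx. apply Cder_zero_const; [lra|]. intros t Ht. apply HD. lra. }
      set (c := (- (Cpoch s (S (S n)) * RtoC (Fm (S (S n)) 0)))%C) in *.
      (* The limits at 0 agree because [Cpoch (- m) m] is (-1)^m m! and [Fm] takes equal values at 0
         and 1. *)
      assert (HcW : (c + - 1 * W 0 = 0)%C).
      { unfold c, W, s. rewrite Cpoch_fact, Rminus_0_r, Fm_1, RtoC_mult, (Cpow_S _ (S (S n))). ring. }
      set (x := fun k : nat => a * / INR (S k)).
      assert (Hx : forall k, 0 < x k <= a).
      { intros k. assert (H := INR_S_ge1 k). assert (0 < / INR (S k) <= 1).
        { split; [apply Rinv_0_lt_compat; lra|]. rewrite <- Rinv_1. apply Rinv_le_contravar; lra. }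
        unfold x. split; [apply Rmult_lt_0_compat; lra|nra]. }
      assert (Hxl : is_lim_seq x 0).
      { replace (Finite 0) with (Finite (a * 0)) by (f_equal; ring). apply (is_lim_seq_scal_l _ a 0).
        apply (is_lim_seq_incr_1 (fun n => / INR n)). replace (Finite 0) with (Rbar_inv p_infty) by reflexivity. apply
          is_lim_seq_inv; [apply is_lim_seq_INR|discriminate]. }
      eapply (filterlim_C_unique eventually (fun k => D (x k))).
      - eapply filterlim_ext; [intros k; apply (Hc (x k) (Hx k))|]. exact (@filterlim_const nat C_UniformSpace
        eventually _ (D a)).
      - rewrite <- HcW. apply (filterlim_Cplus eventually (fun k => psi (S n) s (x k)) (fun k => - 1 * W (x k))%C).
        + apply (filterlim_C eventually). intros e He.
          assert (Hbx : is_lim_seq (fun k => B * x k) 0).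
          { replace (Finite 0) with (Finite (B * 0)) by (f_equal; ring). apply (is_lim_seq_scal_l _ B 0). exact Hxl. }
          apply is_lim_seq_spec in Hbx. destruct (Hbx (mkposreal e He)) as [N HN]. exists N. intros k Hk. specialize
            (HN k Hk).
          rewrite Rminus_0_r in HN. change (pos (mkposreal e He)) with e in HN.
          specialize (Hx k). eapply Rle_lt_trans; [apply HB; lra|]. eapply Rle_lt_trans; [apply Rle_abs|exact HN].
        + eapply (filterlim_comp _ _ _ x (fun y => - 1 * W y)%C eventually (locally 0)); [exact Hxl|].
          change (Ccont (fun y => - 1 * W y)%C 0).
          apply Ccont_mult; [apply Ccont_const|]. apply Ccont_mult; [apply Ccont_const|].
          apply (Ccont_RtoC (fun y => INR (fact (S (S n))) * Fm (S (S n)) (1 - y))).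
          apply (continuous_mult (K := R_AbsRing) (fun _ => INR (fact (S (S n))))); [apply continuous_const|].
          apply (continuous_comp (fun y => 1 - y) (Fm (S (S n)))); [|apply Fm_continuous; lia].
          apply (@ex_derive_continuous R_AbsRing R_NormedModule). auto_derive. trivial. }
    unfold D in HD0. fold (W a). apply Ceq_minus. rewrite <- HD0. ring.
Qed.

(** The Pochhammer factor of the remainders contains [s + n = 0], so Euler-Maclaurin is exact. *)
Lemma hurwitz_neg n a : 0 < a <= 1 -> hurwitz (- RtoC (INR n)) a = psi n (- RtoC (INR n)) a.
Proof.
  (* Order [n] would already be exact but just fails the convergence condition of [Zfun_eq]; the
     order [S n] meets it with equality. *)
  intros Ha. unfold hurwitz. rewrite (Zfun_eq (S n)); [|rewrite re_opp; change (Re (RtoC (INR n))) with (INR n);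
    rewrite !S_INR; lra|lra].
  assert (HR : forall y, Rem (S n) (- RtoC (INR n)) y = 0) by (intros y; unfold Rem; rewrite Cpoch_zero by lia; ring).
  assert (HR0 : forall y, Rem n (- RtoC (INR n)) y = 0) by (intros y; unfold Rem; rewrite Cpoch_zero by lia; ring).
  unfold ZK. rewrite (CSeries_unique _ 0); [|eapply Cser_ext; [|exact Cser_zero]; intros j; symmetry; apply HR].
  assert (Hs : (- RtoC (INR n))%C <> 1) by (rewrite <- RtoC_opp; intros E; apply RtoC_inj in E; generalize (pos_INR n); lra).
  rewrite (euler_maclaurin n _ a (proj1 Ha) Hs), HR0, psi_step, Cpoch_zero by lia. ring.
Qed.

Lemma hurwitz_neg_S n a : 0 < a <= 1 -> hurwitz (- RtoC (INR (S n))) a = ((- 1) ^ S (S n) * RtoC (INR (fact (S n)) * Fm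
  (S n) (1 - a)))%C.
Proof. intros Ha. rewrite hurwitz_neg, psi_trunc by exact Ha. apply psi_value, Ha. Qed.

Lemma hurwitz_0 a : 0 < a <= 1 -> hurwitz 0 a = RtoC (/ 2 - a).
Proof.
  intros Ha. replace (RtoC 0) with (- RtoC (INR 0))%C by (simpl INR; ring). rewrite hurwitz_neg by exact Ha.
  unfold psi. rewrite sum_O. change (Cpoch (- RtoC (INR 0)) 1) with (1 * (- RtoC (INR 0) + RtoC (INR 0)))%C.
  simpl INR. replace (- RtoC 0 - 1)%C with (- RtoC 1)%C by ring. replace (- RtoC 0)%C with (RtoC 0) by ring. rewrite pw_0.
  assert (Hpm : pw a (- RtoC 1) = RtoC a).
  { unfold pw. replace (- RtoC (ln a) * - RtoC 1)%C with (RtoC (ln a)) by ring. unfold Cexp; simpl. rewrite exp_ln,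
    cos_0, sin_0 by lra. unfold RtoC; f_equal; ring. }
  rewrite Hpm, RtoC_minus, RtoC_inv by lra. field.
Qed.

(** * Values of L at negative integers *)

(** With the residues 1, ..., M the Hurwitz arguments [INR (S l) / INR M] lie in (0, 1]. *)
Definition Lcont (M : nat) (g : Z -> C) (s : C) : C :=
  psum (fun l => g (Z.of_nat (S l)) * pw (INR M) s * hurwitz s (INR (S l) / INR M))%C M.

Lemma analytic_at_plus (F G : C -> C) z0 : analytic_at F z0 -> analytic_at G z0 -> analytic_at (fun z => F z + G z)%C z0.
Proof.
  intros [a [r [Hr Ha]]] [b [q [Hq Hb]]]. exists (fun k => a k + b k)%C, (Rmin r q). split; [apply Rmin_glb_lt; assumption|].
  intros z Hz. assert (H1 := Ha z (Rlt_le_trans _ _ _ Hz (Rmin_l _ _))). assert (H2 := Hb z (Rlt_le_trans _ _ _ Hz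
    (Rmin_r _ _))).
  apply Cpseries_iff in H1. apply Cpseries_iff in H2. apply Cpseries_iff.
  eapply Cser_ext; [|apply (Cser_plus _ _ _ _ H1 H2)]. intros k; cbv beta. ring.
Qed.

Lemma analytic_at_psum (F : nat -> C -> C) z0 n : (forall l, analytic_at (F l) z0) -> analytic_at (fun z => psum (fun l
  => F l z) n) z0.
Proof.
  intros H. induction n; simpl.
  - apply (wiener_analytic z0 1 _ _ Rlt_0_1 (wiener_const z0 1 0)).
  - apply (analytic_at_plus (fun z => psum (fun l => F l z) n) (F n)); [exact IHn|apply H].
Qed.

Lemma psum_scal (c : C) (f : nat -> C) n : psum (fun l => c * f l)%C n = (c * psum f n)%C.
Proof. induction n; simpl; [ring|rewrite IHn; ring]. Qed.

Lemma psum_plus (f g : nat -> C) n : psum (fun l => f l + g l)%C n = (psum f n + psum g n)%C.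
Proof. induction n; simpl; [ring|rewrite IHn; ring]. Qed.

Lemma Cser_psum (a : nat -> nat -> C) (s : nat -> C) n : (forall l, (l < n)%nat -> is_Cser (fun k => a l k) (s l)) ->
  is_Cser (fun k => psum (fun l => a l k) n) (psum s n).
Proof.
  intros H. induction n; [exact Cser_zero|]. simpl. apply Cser_plus; [apply IHn; intros l Hl; apply H; lia|apply H; lia].
Qed.

Lemma Cpower_pw (y : R) (s : C) : 0 < y -> Cpower (RtoC y) (- s) = pw y s.
Proof.
  intros Hy. unfold Cpower, pw. f_equal. replace (Clog (RtoC y)) with (RtoC (ln y)); [ring|].
  unfold Clog, Carg. rewrite Cmod_R, Rabs_right by lra. simpl. destruct (Rle_dec 0 0); [|lra].
  replace (y / y) with 1 by (field; lra). rewrite acos_1. reflexivity.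
Qed.

Lemma periodic_mul (M : nat) (g : Z -> C) n j : periodic M g -> g (n + Z.of_nat j * Z.of_nat M)%Z = g n.
Proof.
  intros Hg. induction j; [f_equal; lia|]. rewrite <- IHj. rewrite <- (Hg (n + Z.of_nat j * Z.of_nat M)%Z). f_equal. lia.
Qed.

Lemma class_arg (M l j : nat) : (0 < M)%nat -> INR (S (l + j * M)) = INR M * (INR (S l) / INR M + INR j).
Proof. intros HM. apply lt_0_INR in HM. rewrite !S_INR, plus_INR, mult_INR. field. lra. Qed.

Lemma residue_frac (M l : nat) : (l < M)%nat -> 0 < INR (S l) / INR M <= 1.
Proof.
  intros Hl. assert (HM : 0 < INR M) by (apply lt_0_INR; lia). assert (H := INR_S_ge1 l).
  split; [apply Rdiv_lt_0_compat; lra|]. apply Rle_div_l; [exact HM|]. rewrite Rmult_1_l. apply le_INR. lia.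
Qed.

Lemma Lcont_spec M g : (0 < M)%nat -> periodic M g -> is_L_continuation g (Lcont M g).
Proof.
  intros HM Hg. assert (HMR := lt_0_INR M HM). split.
  - intros s Hs. apply (analytic_at_psum (fun l s => g (Z.of_nat (S l)) * pw (INR M) s * hurwitz s (INR (S l) / INR M))%C).
    intros l. assert (Ha : 0 < INR (S l) / INR M) by (apply Rdiv_lt_0_compat; [generalize (INR_S_ge1 l); lra|exact HMR]).
    destruct (hurwitz_wiener s _ Hs Ha) as [r [B [Hr HB]]]. destruct (wiener_pw s r (INR M) 0 Hr) as [B2 H2].
    eapply (wiener_analytic s r); [exact Hr|].
    eapply wiener_ext; [|apply (wiener_scal _ _ _ _ (g (Z.of_nat (S l))) (wiener_mult _ _ _ _ _ _ Hr H2 HB))].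
    intros z _; cbv beta. replace (z + 0)%C with z by ring. ring.
  - intros s Hs. apply (Cser_classes _ (fun l => g (Z.of_nat (S l)) * pw (INR M) s * hurwitz s (INR (S l) / INR M))%C M HM).
    intros l Hl. destruct (residue_frac M l Hl) as [Ha _].
    eapply Cser_ext; [|apply (Cser_scal _ _ _ (hurwitz_Dirichlet s _ Hs Ha))].
    intros j; cbv beta. rewrite Cpower_pw by (generalize (INR_S_ge1 (l + j * M)); lra).
    rewrite (class_arg M l j HM), pw_mul; [|exact HMR|generalize (pos_INR j); lra].
    replace (Z.of_nat (S (l + j * M))) with (Z.of_nat (S l) + Z.of_nat j * Z.of_nat M)%Z by lia.
    rewrite (periodic_mul M g _ j Hg). ring.
Qed.

(** [Lcont] shows that a continuation exists, so the [epsilon] choice is one; uniqueness then gives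
    the value. *)
Lemma L_function_neg M g (m : nat) : (0 < M)%nat -> periodic M g -> L_function g (- RtoC (INR m)) = Lcont M g (- RtoC
  (INR m)).
Proof.
  intros HM Hg. apply (L_continuation_unique g).
  - rewrite im_opp. change (Im (RtoC (INR m))) with 0. ring.
  - rewrite re_opp. change (Re (RtoC (INR m))) with (INR m). generalize (pos_INR m). lra.
  - unfold L_function. apply epsilon_spec. exists (Lcont M g). apply Lcont_spec; assumption.
  - apply Lcont_spec; assumption.
Qed.

Lemma pw_neg_nat y m : 0 < y -> pw y (- RtoC (INR m)) = RtoC (y ^ m).
Proof.
  intros Hy. induction m.
  - simpl INR. replace (- RtoC 0)%C with (RtoC 0) by ring. rewrite pw_0. reflexivity.
  - assert (E := pw_S y (- RtoC (INR (S m))) Hy). replace (- RtoC (INR (S m)) + 1)%C with (- RtoC (INR m))%C in E by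
    (rewrite S_INR, RtoC_plus; ring).
    rewrite IHm in E. assert (Hn := Rpos_neq_C y Hy). simpl pow. rewrite RtoC_mult, E. field. exact Hn.
Qed.

(** * Discrete Fourier sums and L-values as Fourier series *)

(* [sqrt M] times the discrete Fourier transform, with residues 1, ..., M as in the L-series. *)
Definition DS (M : nat) (g : Z -> C) (n : Z) : C :=
  psum (fun l => g (Z.of_nat (S l)) * Cexp (- (Ci * RtoC (2 * PI * IZR n * (INR (S l) / INR M)))))%C M.

Lemma Cexp_nat_period (k : nat) : Cexp (Ci * RtoC (kap k)) = 1.
Proof.
  rewrite Cexp_Ci. unfold kap. replace (2 * PI * INR (S k)) with (0 + 2 * INR (S k) * PI) by ring.
  rewrite cos_period, sin_period, cos_0, sin_0. reflexivity.
Qed.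

Lemma Cexp_Ci_quarter (m : nat) : Cexp (Ci * RtoC (INR m * (PI / 2))) = (Ci ^ m)%C.
Proof.
  induction m; [simpl; replace (Ci * RtoC (0 * (PI / 2)))%C with (RtoC 0) by (rewrite Rmult_0_l; ring); apply Cexp_0|].
  rewrite S_INR, Rmult_plus_distr_r, RtoC_plus, Cmult_plus_distr_l, Cexp_plus, IHm, Rmult_1_l, Cexp_Ci, cos_PI2, sin_PI2.
  simpl. change (0, 1) with Ci. ring.
Qed.

Lemma two_cos (x : R) : RtoC (2 * cos x) = (Cexp (Ci * RtoC x) + Cexp (- (Ci * RtoC x)))%C.
Proof.
  replace (- (Ci * RtoC x))%C with (Ci * RtoC (- x))%C by (rewrite RtoC_opp; ring). rewrite !Cexp_Ci, cos_neg, sin_neg.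
  unfold RtoC, Cplus; simpl. f_equal; ring.
Qed.

Lemma Cexp_neg_Ci_quarter (m : nat) : Cexp (- (Ci * RtoC (INR m * (PI / 2)))) = ((- Ci) ^ m)%C.
Proof.
  rewrite Cexp_opp, Cexp_Ci_quarter, <- Ci_inv, Cpow_inv by exact Ci_nz. reflexivity.
Qed.

Lemma Fterm_exp m k a : RtoC (Fterm m k (1 - a)) =
  ((Cexp (- (Ci * RtoC (kap k * a))) * (- Ci) ^ S m + Cexp (Ci * RtoC (kap k * a)) * Ci ^ S m) / RtoC (kap k) ^ S m)%C.
Proof.
  assert (Hk := kap_pos k). unfold Fterm. rewrite RtoC_div, RtoC_pow by (apply pow_nonzero; lra). f_equal.
  rewrite two_cos. rewrite <- Cexp_neg_Ci_quarter, <- Cexp_Ci_quarter, <- !Cexp_plus.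
  f_equal.
  - rewrite <- (Cmult_1_l (Cexp (- (Ci * RtoC (kap k * a)) + _))), <- (Cexp_nat_period k), <- Cexp_plus. f_equal.
    rewrite !RtoC_minus, !RtoC_mult, RtoC_minus. ring.
  - rewrite <- (Cmult_1_l (Cexp (Ci * RtoC (kap k * a) + _))). replace (RtoC 1) with (Cexp (- (Ci * RtoC (kap k)))) at
    1 by (rewrite Cexp_opp, Cexp_nat_period; field; exact C1_nz).
    rewrite <- Cexp_plus. f_equal. rewrite !RtoC_minus, !RtoC_mult, RtoC_minus. ring.
Qed.

Lemma DS_kap M g k : DS M g (Z.of_nat (S k)) = psum (fun l => g (Z.of_nat (S l)) * Cexp (- (Ci * RtoC (kap k * (INR (S
  l) / INR M)))))%C M.
Proof. unfold DS, kap. rewrite <- INR_IZR_INZ. reflexivity. Qed.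

Lemma DS_kap_neg M g k : DS M g (- Z.of_nat (S k)) = psum (fun l => g (Z.of_nat (S l)) * Cexp (Ci * RtoC (kap k * (INR
  (S l) / INR M))))%C M.
Proof.
  unfold DS. apply psum_ext. intros l _. f_equal. f_equal. unfold kap. rewrite opp_IZR, <- INR_IZR_INZ.
  replace (2 * PI * - INR (S k) * (INR (S l) / INR M)) with (- (2 * PI * INR (S k) * (INR (S l) / INR M))) by ring.
  rewrite RtoC_opp. ring.
Qed.

(** The functional equation of L at negative integers: the Hurwitz values are Fourier series in the
    residue, and the finite sum over residues assembles the exponentials of each frequency into
    [DS]. *)
Lemma L_neg_series M g n : (0 < M)%nat -> periodic M g ->
  is_Cser (fun k => (- 1) ^ S (S n) * RtoC (INR (fact (S n)) * INR M ^ S n) *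
     ((DS M g (Z.of_nat (S k)) * (- Ci) ^ S (S n) + DS M g (- Z.of_nat (S k)) * Ci ^ S (S n)) / RtoC (kap k) ^ S (S n)))%C
   (L_function g (- RtoC (INR (S n)))).
Proof.
  intros HM Hg. rewrite (L_function_neg M) by assumption. unfold Lcont. assert (HMR := lt_0_INR M HM).
  eapply evar_last; [eapply Cser_ext; [|apply (Cser_scal ((- 1) ^ S (S n) * RtoC (INR (fact (S n)) * INR M ^ S n))%C),
    (Cser_psum
     (fun l k => g (Z.of_nat (S l)) * RtoC (Fterm (S n) k (1 - INR (S l) / INR M)))%C (fun l => g (Z.of_nat (S l)) *
       RtoC (Fm (S n) (1 - INR (S l) / INR M)))%C M)]|].
  - intros k; cbv beta. f_equal. rewrite DS_kap, DS_kap_neg. set (D := (RtoC (kap k) ^ S (S n))%C).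
    assert (E : forall F G : nat -> C, ((psum F M * (- Ci) ^ S (S n) + psum G M * Ci ^ S (S n)) / D = psum (fun l => (/
      D * (- Ci) ^ S (S n)) * F l + (/ D * Ci ^ S (S n)) * G l) M)%C).
    { intros F G. rewrite psum_plus, !psum_scal. unfold Cdiv. ring. }
    rewrite E. apply psum_ext. intros l _. rewrite Fterm_exp. fold D. unfold Cdiv. ring.
  - intros l Hl. apply Cser_scal, Fm_Cser. lia.
  - to_C. rewrite <- psum_scal. apply psum_ext. intros l Hl. destruct (residue_frac M l Hl) as [Ha Ha1].
    rewrite hurwitz_neg_S by (split; assumption). rewrite pw_neg_nat by exact HMR. rewrite !RtoC_mult. ring.
Qed.

Lemma L_0_value M g : (0 < M)%nat -> periodic M g -> L_function g 0 = psum (fun l => g (Z.of_nat (S l)) * RtoC (/ 2 -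
  INR (S l) / INR M))%C M.
Proof.
  intros HM Hg. assert (E := L_function_neg M g 0 HM Hg). simpl INR in E. replace (- RtoC 0)%C with (RtoC 0) in E by ring.
  rewrite E. unfold Lcont. apply psum_ext. intros l Hl. rewrite hurwitz_0 by (apply residue_frac, Hl). rewrite pw_0. ring.
Qed.

Lemma L_1_value M g : (0 < M)%nat -> periodic M g -> L_function g (- RtoC 1) = psum (fun l => g (Z.of_nat (S l)) * RtoC
  (INR M * Fm 1 (1 - INR (S l) / INR M)))%C M.
Proof.
  intros HM Hg. assert (E := L_function_neg M g 1 HM Hg). change (INR 1) with 1 in E.
  rewrite E. unfold Lcont. apply psum_ext. intros l Hl. assert (H := hurwitz_neg_S 0 _ (residue_frac M l Hl)). change
    (INR 1) with 1 in H. rewrite H.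
  assert (H2 := pw_neg_nat (INR M) 1 (lt_0_INR M HM)). change (INR 1) with 1 in H2. rewrite H2. change (INR (fact 1))
    with 1. rewrite pow_1, Rmult_1_l, RtoC_mult. simpl Cpow. ring.
Qed.

Lemma psum_shift (h : nat -> C) M : h M = h 0%nat -> psum (fun l => h (S l)) M = psum h M.
Proof.
  intros H. assert (E : forall n, (psum (fun l => h (S l)) n + h 0%nat = psum h n + h n)%C).
  { induction n; simpl; [ring|]. replace (psum (fun l => h (S l)) n + h (S n) + h 0%nat)%C with (psum (fun l => h (S
    l)) n + h 0%nat + h (S n))%C by ring. rewrite IHn. ring. }
  specialize (E M). rewrite H in E. replace (psum (fun l => h (S l)) M) with (psum (fun l => h (S l)) M + h 0%nat - h
    0%nat)%C by ring. rewrite E. ring.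
Qed.

Lemma psum_S_l (f : nat -> C) n : psum f (S n) = (f 0%nat + psum (fun l => f (S l)) n)%C.
Proof. induction n; [simpl; ring|]. change (psum f (S (S n))) with (psum f (S n) + f (S n))%C. rewrite IHn. simpl. ring. Qed.

Lemma psum_rev (f : nat -> C) n : psum f n = psum (fun l => f (n - 1 - l)%nat) n.
Proof.
  revert f. induction n; intros f; [reflexivity|]. rewrite psum_S_l.
  change (f 0%nat + psum (fun l => f (S l)) n = psum (fun l => f (S n - 1 - l)%nat) n + f (S n - 1 - n)%nat)%C.
  replace (S n - 1 - n)%nat with 0%nat by lia.
  replace (psum (fun l => f (S n - 1 - l)%nat) n) with (psum (fun l => f (S l)) n).
  - ring.
  - rewrite IHn. apply psum_ext. intros l Hl. f_equal. lia.
Qed.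

Lemma Cexp_int_period (n : Z) : Cexp (- (Ci * RtoC (2 * PI * IZR n))) = 1.
Proof.
  replace (- (Ci * RtoC (2 * PI * IZR n)))%C with (Ci * RtoC (- (2 * PI * IZR n)))%C by (rewrite RtoC_opp; ring).
    rewrite Cexp_Ci, cos_neg, sin_neg.
  assert (Hc : cos (2 * PI * IZR n) = 1 /\ sin (2 * PI * IZR n) = 0).
  { assert (Hs : sin (2 * PI * IZR n) = 0) by (apply sin_eq_0_1; exists (2 * n)%Z; rewrite mult_IZR; ring).
    split; [|exact Hs]. replace (2 * PI * IZR n) with (2 * (PI * IZR n)) by ring. rewrite cos_2a.
    assert (Hs2 : sin (PI * IZR n) = 0) by (apply sin_eq_0_1; exists n; ring). assert (H := sin2_cos2 (PI * IZR n)).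
      unfold Rsqr in H. rewrite Hs2 in *. lra. }
  destruct Hc as [-> ->]. unfold RtoC. f_equal. ring.
Qed.

Lemma DS_DFT M g n : (0 < M)%nat -> periodic M g -> DS M g n = (RtoC (sqrt (INR M)) * DFT M g n)%C.
Proof.
  intros HM Hg. assert (HMR := lt_0_INR M HM). unfold DFT.
  assert (Hs : RtoC (sqrt (INR M)) <> 0) by (apply Rpos_neq_C, sqrt_lt_R0, HMR).
  rewrite Cmult_assoc, Cinv_r, Cmult_1_l by exact Hs.
  change (sum_n ?f ?m) with (Csum f m). rewrite Csum_psum. replace (S (Init.Nat.pred M)) with M by lia.
  assert (HMC : RtoC (INR M) <> 0) by (apply Rpos_neq_C, HMR).
  unfold DS. set (h := fun l : nat => (g (Z.of_nat l) * Cexp (- (2 * PI * Ci * INR l * IZR n / INR M)))%C).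
  assert (E : forall l, (g (Z.of_nat (S l)) * Cexp (- (Ci * RtoC (2 * PI * IZR n * (INR (S l) / INR M)))))%C = h (S l)).
  { intros l. unfold h. f_equal. f_equal. rewrite RtoC_mult, RtoC_div, !RtoC_mult by lra. field. exact HMC. }
  rewrite (psum_ext _ (fun l => h (S l))) by (intros; apply E). apply psum_shift.
  unfold h. f_equal.
  - replace (Z.of_nat M) with (0 + Z.of_nat M)%Z by lia. rewrite Hg. reflexivity.
  - replace (- (2 * PI * Ci * INR M * IZR n / INR M))%C with (- (Ci * RtoC (2 * PI * IZR n)))%C by (rewrite !RtoC_mult;
    field; exact HMC).
    rewrite Cexp_int_period. simpl INR. replace (- (2 * PI * Ci * 0 * IZR n / INR M))%C with (RtoC 0) by (field; exact
      HMC). rewrite Cexp_0. reflexivity.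
Qed.

Lemma DS_reflect M (g : Z -> C) n : (0 < M)%nat -> periodic M g -> DS M g (- n) = DS M (fun j => g (- j)%Z) n.
Proof.
  intros HM Hg. assert (HMR := lt_0_INR M HM). assert (HMC : RtoC (INR M) <> 0) by (apply Rpos_neq_C, HMR).
  unfold DS at 1. rewrite psum_rev. unfold DS.
  set (h := fun l : nat => (g (- Z.of_nat l)%Z * Cexp (- (Ci * RtoC (2 * PI * IZR n * (INR l / INR M)))))%C).
  rewrite (psum_ext _ h).
  - symmetry. apply (psum_shift h). unfold h. f_equal.
    + rewrite <- (Hg (- Z.of_nat M)%Z). f_equal. lia.
    + replace (INR M / INR M) with 1 by (field; lra). rewrite Rmult_1_r, Cexp_int_period. simpl INR.
      replace (2 * PI * IZR n * (0 / INR M)) with 0 by (field; lra). replace (- (Ci * 0))%C with (RtoC 0) by ring.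
        rewrite Cexp_0. reflexivity.
  - intros l Hl. unfold h. replace (S (M - 1 - l)) with (M - l)%nat by lia. f_equal.
    + rewrite <- (Hg (- Z.of_nat l)%Z). f_equal. lia.
    + replace (Cexp (- (Ci * RtoC (2 * PI * IZR n * (INR l / INR M)))))%C with (Cexp (- (Ci * RtoC (2 * PI * IZR (-
      n)))) * Cexp (- (Ci * RtoC (2 * PI * IZR n * (INR l / INR M)))))%C by (rewrite Cexp_int_period; ring).
      rewrite <- Cexp_plus. f_equal. rewrite minus_INR, opp_IZR by lia.
      replace (2 * PI * - IZR n * ((INR M - INR l) / INR M)) with (2 * PI * - IZR n + 2 * PI * IZR n * (INR l / INR M))
        by (field; lra).
      rewrite (RtoC_plus (2 * PI * - IZR n)). ring.
Qed.

Lemma periodic_even M g : periodic M g -> periodic M (even_part g).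
Proof.
  intros H n. unfold even_part. rewrite H. replace (- (n + Z.of_nat M))%Z with (- n - Z.of_nat M)%Z by lia.
  rewrite <- (H (- n - Z.of_nat M)%Z). replace (- n - Z.of_nat M + Z.of_nat M)%Z with (- n)%Z by lia. reflexivity.
Qed.
Lemma periodic_odd M g : periodic M g -> periodic M (odd_part g).
Proof.
  intros H n. unfold odd_part. rewrite H. replace (- (n + Z.of_nat M))%Z with (- n - Z.of_nat M)%Z by lia.
  rewrite <- (H (- n - Z.of_nat M)%Z). replace (- n - Z.of_nat M + Z.of_nat M)%Z with (- n)%Z by lia. reflexivity.
Qed.

Lemma DS_ext M (f g : Z -> C) n : (forall j, f j = g j) -> DS M f n = DS M g n.
Proof. intros H. apply psum_ext. intros l _. rewrite H. reflexivity. Qed.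

Lemma DS_even M g n : (0 < M)%nat -> periodic M g -> (forall j, g (- j)%Z = g j) -> DS M g (- n) = DS M g n.
Proof. intros HM Hg He. rewrite DS_reflect by assumption. apply DS_ext, He. Qed.

Lemma DS_odd M g n : (0 < M)%nat -> periodic M g -> (forall j, g (- j)%Z = (- g j)%C) -> DS M g (- n) = (- DS M g n)%C.
Proof.
  intros HM Hg Ho. rewrite DS_reflect by assumption.
  replace (- DS M g n)%C with (- 1 * DS M g n)%C by ring. unfold DS. rewrite <- psum_scal. apply psum_ext. intros l _.
  rewrite Ho. ring.
Qed.

Lemma Cmod_psum_le (f : nat -> C) (B : nat -> R) n : (forall l, Cmod (f l) <= B l) -> Cmod (psum f n) <= Re (psum (fun
  l => RtoC (B l)) n).
Proof.
  intros H. induction n; simpl; [rewrite Cmod_0; lra|]. eapply Rle_trans; [apply Cmod_triangle|].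
  change (fst (psum (fun l => RtoC (B l)) n)) with (Re (psum (fun l => RtoC (B l)) n)). specialize (H n). lra.
Qed.

Lemma DS_bounded M g : exists K, 0 <= K /\ forall n, Cmod (DS M g n) <= K.
Proof.
  exists (Re (psum (fun l => RtoC (Cmod (g (Z.of_nat (S l))))) M)).
  assert (H : forall n, Cmod (DS M g n) <= Re (psum (fun l => RtoC (Cmod (g (Z.of_nat (S l))))) M)).
  { intros n. apply Cmod_psum_le. intros l. rewrite Cmod_mult, Cmod_Cexp.
    replace (Re (- (Ci * RtoC (2 * PI * IZR n * (INR (S l) / INR M))))%C) with 0 by (rewrite re_opp; unfold Re, Ci,
      Cmult, RtoC; simpl; ring).
    rewrite exp_0. lra. }
  split; [|exact H]. eapply Rle_trans; [apply Cmod_ge_0|apply (H 0%Z)].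
Qed.

(** Duplication formula: it converts the factorial in the L-value, divided by the P! of
    [Theta_tilde], into the Pochhammer symbol of the binomial kernel. *)
Lemma fact_even (P : nat) : INR (fact (2 * P)) = 4 ^ P * INR (fact P) * poch (/ 2 + INR 0) P.
Proof.
  induction P; [simpl; ring|]. replace (2 * S P)%nat with (S (S (2 * P))) by lia.
  change (fact (S (S (2 * P)))) with (S (S (2 * P)) * (S (2 * P) * fact (2 * P)))%nat. rewrite !mult_INR, IHP.
  change (fact (S P)) with (S P * fact P)%nat. rewrite mult_INR. change (poch (/ 2 + INR 0) (S P)) with (poch (/ 2 +
    INR 0) P * (/ 2 + INR 0 + INR P)).
  rewrite !S_INR, mult_INR. simpl (INR 2). simpl (INR 0). simpl (4 ^ S P). field.
Qed.

Lemma fact_odd (P : nat) : INR (fact (2 * P + 1)) = 4 ^ P * INR (fact P) * poch (/ 2 + INR 1) P.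
Proof.
  induction P; [simpl; ring|]. replace (2 * S P + 1)%nat with (S (S (2 * P + 1))) by lia.
  change (fact (S (S (2 * P + 1)))) with (S (S (2 * P + 1)) * (S (2 * P + 1) * fact (2 * P + 1)))%nat. rewrite
    !mult_INR, IHP.
  change (fact (S P)) with (S P * fact P)%nat. rewrite mult_INR. change (poch (/ 2 + INR 1) (S P)) with (poch (/ 2 +
    INR 1) P * (/ 2 + INR 1 + INR P)).
  rewrite !S_INR, plus_INR, mult_INR. simpl (INR 2). simpl (INR 1). simpl (INR 0). simpl (4 ^ S P). field.
Qed.

Lemma Ci_sq : (Ci * Ci = - 1)%C.
Proof. unfold Ci, Cmult, Copp, RtoC; simpl. f_equal; ring. Qed.

(** * Poisson summation on the half-line *)

(* [Int kp] is a primitive of [exp (i kp v) f v] with limit [Iinf kp] at infinity. *)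
Record osc_data (f df ddf : R -> C) (Int : R -> R -> C) (Iinf : R -> C) (B : R) : Prop := {
  osc_f : forall v, is_Cder f v (df v);
  osc_df : forall v, is_Cder df v (ddf v);
  osc_cont : forall v, Ccont ddf v;
  osc_f_bound : forall v, 0 <= v -> Cmod (f v) <= B * exp (- (1 * v));
  osc_df_bound : forall v, 0 <= v -> Cmod (df v) <= B * exp (- (1 * v));
  osc_ddf_bound : forall v, 0 <= v -> Cmod (ddf v) <= B * exp (- (1 * v));
  osc_Int : forall kp v, is_Cder (Int kp) v (Cexp (Ci * RtoC (kp * v)) * f v)%C;
  osc_lim : forall kp, filterlim (Int kp) (Rbar_locally p_infty) (locally (Iinf kp)) }.

(* [osc_X] and [osc_Y] are the integrals of [exp (i kp v) f] and [exp (i kp v) f''] over the half-line. *)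
Definition osc_X (Int : R -> R -> C) (Iinf : R -> C) (kp : R) : C := (Iinf kp - Int kp 0)%C.
Definition osc_Y (f df : R -> C) (Int : R -> R -> C) (Iinf : R -> C) (kp : R) : C :=
  (- (df 0%R - Ci * RtoC kp * f 0%R) - RtoC kp * RtoC kp * osc_X Int Iinf kp)%C.

Lemma Cder_osc kp v : is_Cder (fun v => Cexp (Ci * RtoC (kp * v))) v (Cexp (Ci * RtoC (kp * v)) * (Ci * RtoC kp))%C.
Proof.
  apply (Cder_Cexp (fun v => Ci * RtoC (kp * v))%C). apply Cder_cmult. apply (Cder_RtoC (fun v => kp * v)).
  auto_derive; [trivial|ring].
Qed.

Lemma Cmod_osc x : Cmod (Cexp (Ci * RtoC x)) = 1.
Proof. rewrite Cmod_Cexp, re_scal_r. replace (Re Ci) with 0 by reflexivity. rewrite Rmult_0_l. apply exp_0. Qed.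

(** Two integrations by parts at once: exp(i kp v) (f' - i kp f) - kp^2 [Int kp] is a primitive of
    exp(i kp v) f''. *)
Lemma osc_parts f df ddf Int Iinf B (D : osc_data f df ddf Int Iinf B) kp T :
  is_CRInt (fun v => Cexp (Ci * RtoC (kp * v)) * ddf v)%C 0 T
   ((Cexp (Ci * RtoC (kp * T)) * (df T - Ci * RtoC kp * f T) - RtoC kp * RtoC kp * Int kp T) - (df 0%R - Ci * RtoC kp *
     f 0%R - RtoC kp * RtoC kp * Int kp 0%R))%C.
Proof.
  eapply evar_last; [apply (CRInt_FTC (fun v => Cexp (Ci * RtoC (kp * v)) * (df v + (- (Ci * RtoC kp)) * f v) + (-
    (RtoC kp * RtoC kp)) * Int kp v)%C)|].
  - intros x _. eapply evar_last; [apply Cder_plus; [apply Cder_mult; [apply Cder_osc|apply Cder_plus; [apply (osc_df _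
    _ _ _ _ _ D)|apply Cder_cmult, (osc_f _ _ _ _ _ _ D)]]|apply Cder_cmult, (osc_Int _ _ _ _ _ _ D)]|].
    to_C. set (e := Cexp _).
    replace (e * (Ci * RtoC kp) * (df x + - (Ci * RtoC kp) * f x) + e * (ddf x + - (Ci * RtoC kp) * df x) + - (RtoC kp
      * RtoC kp) * (e * f x))%C
      with (e * ddf x - (Ci * Ci + 1) * (RtoC kp * RtoC kp * e * f x))%C by ring. rewrite Ci_sq. ring.
  - intros x _. apply Ccont_mult; [eapply Cder_continuous, Cder_osc|apply (osc_cont _ _ _ _ _ _ D)].
  - to_C. rewrite Rmult_0_r, Cmult_0_r, Cexp_0. ring.
Qed.

Lemma filterlim_unimodular_mult (u f : R -> C) B : (forall v, Cmod (u v) <= 1) -> (forall v, 0 <= v -> Cmod (f v) <= B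
  * exp (- (1 * v))) ->
  filterlim (fun v => u v * f v)%C (Rbar_locally p_infty) (locally (RtoC 0)).
Proof.
  intros Hu Hf. apply (filterlim_exp_bound _ B 1); [lra|]. intros t Ht. rewrite Cmod_mult. specialize (Hf t Ht).
    specialize (Hu t).
  assert (H := Cmod_ge_0 (f t)). assert (H2 := Cmod_ge_0 (u t)). nra.
Qed.

Lemma filterlim_Cscal {T} (F : (T -> Prop) -> Prop) {FF : Filter F} (c : C) (f : T -> C) l : filterlim f F (locally l) ->
  filterlim (fun x => c * f x)%C F (locally (c * l)%C).
Proof.
  intros H. eapply (filterlim_comp _ _ _ f (fun y => c * y)%C); [exact H|].
  apply (filterlim_scal_r (K := C_AbsRing) (V := C_NormedModule) c l).
Qed.

Lemma osc_parts_lim f df ddf Int Iinf B (D : osc_data f df ddf Int Iinf B) kp :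
  filterlim (fun T => (Cexp (Ci * RtoC (kp * T)) * (df T - Ci * RtoC kp * f T) - RtoC kp * RtoC kp * Int kp T) - (df
    0%R - Ci * RtoC kp * f 0%R - RtoC kp * RtoC kp * Int kp 0%R))%C
    (Rbar_locally p_infty) (locally (osc_Y f df Int Iinf kp)).
Proof.
  set (e := fun v => Cexp (Ci * RtoC (kp * v))). assert (He : forall v, Cmod (e v) <= 1) by (intros v; unfold e;
    rewrite Cmod_osc; lra).
  set (c0 := (- (df 0%R - Ci * RtoC kp * f 0%R - RtoC kp * RtoC kp * Int kp 0%R))%C).
  eapply filterlim_ext.
  2:{ replace (osc_Y f df Int Iinf kp) with (0 + ((- (Ci * RtoC kp)) * 0 + ((- (RtoC kp * RtoC kp)) * Iinf kp + c0)))%C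
    by (unfold osc_Y, osc_X, c0; ring).
      apply (filterlim_Cplus _); [apply (filterlim_unimodular_mult e df B He (osc_df_bound _ _ _ _ _ _ D))|].
      apply (filterlim_Cplus _); [apply (filterlim_Cscal _), (filterlim_unimodular_mult e f B He (osc_f_bound _ _ _ _ _
        _ D))|].
      apply (filterlim_Cplus _); [apply (filterlim_Cscal _), (osc_lim _ _ _ _ _ _ D)|].
      exact (@filterlim_const R C_UniformSpace _ _ c0). }
  intros x. cbv beta. unfold e, c0. ring.
Qed.

Lemma Fterm_1_exp k (v a : R) : RtoC (Fterm 1 k (v - a)) =
  (- / (RtoC (kap k) * RtoC (kap k)) * (Cexp (- (Ci * RtoC (kap k * a))) * Cexp (Ci * RtoC (kap k * v))
     + Cexp (Ci * RtoC (kap k * a)) * Cexp (Ci * RtoC (- kap k * v))))%C.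
Proof.
  rewrite <- Fterm_periodic. replace (v - a + 1) with (1 - (a - v)) by ring. rewrite Fterm_exp.
  assert (Hk : RtoC (kap k) <> 0) by apply Rpos_neq_C, kap_pos.
  rewrite <- !Cexp_plus.
  replace (- (Ci * RtoC (kap k * a)) + Ci * RtoC (kap k * v))%C with (- (Ci * RtoC (kap k * (a - v))))%C by (rewrite
    !RtoC_mult, RtoC_minus; ring).
  replace (Ci * RtoC (kap k * a) + Ci * RtoC (- kap k * v))%C with (Ci * RtoC (kap k * (a - v)))%C by (rewrite
    !RtoC_mult, RtoC_minus, RtoC_opp; ring).
  simpl Cpow. rewrite !Cmult_1_r. replace (- Ci * - Ci)%C with (Ci * Ci)%C by ring. rewrite Ci_sq. field. exact Hk.
Qed.

Lemma Fm_periodic_nat_sub m u n : Fm m (u - INR n) = Fm m u.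
Proof. rewrite <- (Fm_periodic_nat m (u - INR n) n). f_equal. ring. Qed.

(** The interval is cut at a, a + 1, and so on, where [v - a] is an integer; on each piece [Fm 1] is
    a polynomial and [F1_parts] applies. The incomplete piece [[0, a]] belongs to the period that
    starts at [a - 1]. *)
Lemma em_partial (f df ddf Phi : R -> C) a J : 0 < a <= 1 ->
  (forall v, is_Cder f v (df v)) -> (forall v, is_Cder df v (ddf v)) -> (forall v, Ccont ddf v) ->
  (forall v, is_Cder Phi v (f v)) ->
  is_CRInt (fun v => RtoC (Fm 1 (v - a)) * ddf v)%C 0 (a + INR J)
   (RtoC (Fm 1 0) * df (a + INR J)%R + / 2 * f (a + INR J)%R - Phi (a + INR J)%R + psum (fun j => f (a + INR j)%R) J
     + (Phi 0%R - RtoC (Fm 1 (1 - a)) * df 0%R - RtoC (/ 2 - a) * f 0%R))%C.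
Proof.
  intros Ha Hf Hdf Hc HPhi. induction J.
  - simpl INR. rewrite Rplus_0_r. eapply evar_last; [eapply CRInt_ext; [|apply (F1_parts (a - 1) f df ddf Phi 0 a); try
    lra; auto]|].
    + intros x _. cbv beta. f_equal. f_equal. rewrite <- (Fm_periodic 1 (x - a)). f_equal. ring.
    + to_C. replace (a - (a - 1)) with 1 by ring. replace (0 - (a - 1)) with (1 - a) by ring. rewrite Fm_1.
      simpl psum. rewrite !RtoC_minus, !RtoC_inv by lra. field.
  - eapply evar_last; [apply (is_RInt_Chasles (V := C_R_NormedModule)) with (1 := IHJ); eapply CRInt_ext; [|apply
    (F1_parts (a + INR J) f df ddf Phi (a + INR J) (a + INR (S J))); try (rewrite S_INR; lra); auto; lra]|].
    + intros x _. cbv beta. f_equal. f_equal. rewrite <- (Fm_periodic_nat_sub 1 (x - a) J). f_equal. ring.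
    + match goal with |- plus ?x ?y = ?z => change ((x + y)%C = z) end.
      replace (a + INR (S J) - (a + INR J)) with 1 by (rewrite S_INR; ring). rewrite Rminus_diag, Fm_1.
      simpl psum. rewrite !RtoC_minus, !RtoC_inv by lra. field.
Qed.

(* The Fourier expansion of [Fm 1] turns the Euler-Maclaurin remainder into half-line Fourier integrals: Poisson
   summation on [a + N]. *)
Lemma half_line f df ddf Int Iinf B a (D : osc_data f df ddf Int Iinf B) : 0 < a <= 1 ->
  exists L, is_Cser (fun k => - / (RtoC (kap k) * RtoC (kap k)) * (Cexp (- (Ci * RtoC (kap k * a))) * osc_Y f df Int
    Iinf (kap k)
     + Cexp (Ci * RtoC (kap k * a)) * osc_Y f df Int Iinf (- kap k)%R))%C L /\
  is_Cser (fun j => f (a + INR j)%R) (L + (osc_X Int Iinf 0%R + RtoC (Fm 1 (1 - a)) * df 0%R + RtoC (/ 2 - a) * f 0%R))%C.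
Proof.
  intros Ha.
  destruct (CRInt_gen_series (fun k v => RtoC (Fterm 1 k (v - a)) * ddf v)%C (fun v => RtoC (Fm 1 (v - a)) * ddf v)%C
    (fun k => / INR (S k) ^ 2 * B) 1
    (fun k T => - / (RtoC (kap k) * RtoC (kap k)) * (Cexp (- (Ci * RtoC (kap k * a))) *
        ((Cexp (Ci * RtoC (kap k * T)) * (df T - Ci * RtoC (kap k) * f T) - RtoC (kap k) * RtoC (kap k) * Int (kap k)
          T) - (df 0%R - Ci * RtoC (kap k) * f 0%R - RtoC (kap k) * RtoC (kap k) * Int (kap k) 0%R))
      + Cexp (Ci * RtoC (kap k * a)) *
        ((Cexp (Ci * RtoC ((- kap k) * T)) * (df T - Ci * RtoC (- kap k) * f T) - RtoC (- kap k) * RtoC (- kap k) * Int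
          (- kap k)%R T) - (df 0%R - Ci * RtoC (- kap k) * f 0%R - RtoC (- kap k) * RtoC (- kap k) * Int (- kap k)%R
            0%R))))%C
    (fun k => - / (RtoC (kap k) * RtoC (kap k)) * (Cexp (- (Ci * RtoC (kap k * a))) * osc_Y f df Int Iinf (kap k)
     + Cexp (Ci * RtoC (kap k * a)) * osc_Y f df Int Iinf (- kap k)%R))%C ltac:(lra)) as [L [G [HL [HG HGL]]]].
  - intros k T _. eapply CRInt_ext; [|apply CRInt_cmult, CRInt_plus; apply CRInt_cmult; apply (osc_parts _ _ _ _ _ _ D)].
    intros v _. cbv beta. rewrite Fterm_1_exp. ring.
  - intros k v Hv. rewrite Cmod_mult, Cmod_R, Rmult_assoc. apply Rmult_le_compat; [apply Rabs_pos|apply Cmod_ge_0|apply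
    Fterm_bound; lia|apply (osc_ddf_bound _ _ _ _ _ _ D), Hv].
  - apply (ex_series_scal_r B), ex_series_inv_sq.
  - intros v _. eapply Cser_ext; [|eapply evar_last; [apply (Cser_scal (ddf v)), (Fm_Cser 1 (v - a)); lia|]]; [|to_C;
    ring]. intros k; cbv beta; ring.
  - intros k. apply (filterlim_Cscal _), (filterlim_Cplus _); apply (filterlim_Cscal _); apply (osc_parts_lim _ _ _ _ _ _ D).
  - exists L. split; [exact HL|].
    assert (HPhi : forall v, is_Cder (Int 0%R) v (f v)).
    { intros v. eapply evar_last; [apply (osc_Int _ _ _ _ _ _ D)|]. to_C. rewrite Rmult_0_l, Cmult_0_r, Cexp_0. ring. }
    (* The same integral has the Fourier limit [L] and, at the points a + J, the Euler-Maclaurin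
       expression containing the partial sum; comparison gives the limit of the partial sums. *)
    assert (HJ : filterlim (fun J => a + INR J) eventually (Rbar_locally p_infty)).
    { apply (is_lim_seq_plus (fun _ => a) INR (Finite a) p_infty p_infty (is_lim_seq_const a) is_lim_seq_INR). reflexivity. }
    assert (Hlim : forall (h : R -> C) l, filterlim h (Rbar_locally p_infty) (locally l) -> filterlim (fun J => h (a +
      INR J)%R) eventually (locally l)).
    { intros h l Hh. eapply filterlim_comp; [exact HJ|exact Hh]. }
    assert (Hsum : filterlim (psum (fun j => f (a + INR j)%R)) eventually (locally (L + (osc_X Int Iinf 0%R + RtoC (Fm
      1 (1 - a)) * df 0%R + RtoC (/ 2 - a) * f 0%R))%C)).
    { assert (H1 := Hlim _ _ HGL). assert (H2 := Hlim _ _ (osc_lim _ _ _ _ _ _ D 0)).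
      assert (H3 := Hlim _ _ (filterlim_exp_bound f B 1 Rlt_0_1 (osc_f_bound _ _ _ _ _ _ D))).
      assert (H4 := Hlim _ _ (filterlim_exp_bound df B 1 Rlt_0_1 (osc_df_bound _ _ _ _ _ _ D))).
      set (c0 := (Int 0%R 0%R - RtoC (Fm 1 (1 - a)) * df 0%R - RtoC (/ 2 - a) * f 0%R)%C).
      eapply filterlim_ext.
      2:{ replace (L + _)%C with (L + (Iinf 0%R + (- / 2 * 0 + (- RtoC (Fm 1 0) * 0 + - c0))))%C by (unfold c0, osc_X; ring).
          apply (filterlim_Cplus _); [exact H1|]. apply (filterlim_Cplus _); [exact H2|].
          apply (filterlim_Cplus _); [apply (filterlim_Cscal _), H3|]. apply (filterlim_Cplus _); [apply
            (filterlim_Cscal _), H4|].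
          exact (@filterlim_const nat C_UniformSpace eventually _ (- c0)%C). }
      intros J. cbv beta.
      rewrite (CRInt_unique _ _ _ _ _ (HG (a + INR J) ltac:(generalize (pos_INR J); lra)) (em_partial f df ddf (Int
        0%R) a J Ha (osc_f _ _ _ _ _ _ D) (osc_df _ _ _ _ _ _ D) (osc_cont _ _ _ _ _ _ D) HPhi)).
      fold c0. ring. }
    apply is_Cser_eps. intros e He. apply (filterlim_C eventually) with (2 := He) in Hsum. destruct Hsum as [N HN].
    exists N. intros n Hn. rewrite Csum_psum. apply HN. lia.
Qed.

(** With the variable n / M each residue class is a shifted copy of the nonnegative integers, to
    which [half_line] applies; the phases at the shifts combine to [DS]. *)
Lemma theta_sum M g f df ddf Int Iinf B (D : osc_data f df ddf Int Iinf B) : (0 < M)%nat -> periodic M g ->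
  exists V, is_Cser (fun k => - / (RtoC (kap k) * RtoC (kap k)) * (DS M g (Z.of_nat (S k)) * osc_Y f df Int Iinf (kap k)
     + DS M g (- Z.of_nat (S k)) * osc_Y f df Int Iinf (- kap k)%R))%C V /\
  is_Cser (fun k => g (Z.of_nat (S k)) * f (INR (S k) / INR M)%R)%C
    (V + (psum (fun l => g (Z.of_nat (S l))) M * osc_X Int Iinf 0%R
      + psum (fun l => g (Z.of_nat (S l)) * RtoC (Fm 1 (1 - INR (S l) / INR M))) M * df 0%R
      + psum (fun l => g (Z.of_nat (S l)) * RtoC (/ 2 - INR (S l) / INR M)) M * f 0%R))%C.
Proof.
  intros HM Hg. assert (HMR := lt_0_INR M HM).
  set (a := fun l => INR (S l) / INR M).
  set (T := fun l k => (- / (RtoC (kap k) * RtoC (kap k)) * (Cexp (- (Ci * RtoC (kap k * a l))) * osc_Y f df Int Iinf (kap k)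
     + Cexp (Ci * RtoC (kap k * a l)) * osc_Y f df Int Iinf (- kap k)%R))%C).
  assert (H : forall l, (l < M)%nat -> is_Cser (T l) (CSeries (T l)) /\ is_Cser (fun j => f (a l + INR j)%R) (CSeries
    (T l) + (osc_X Int Iinf 0%R + RtoC (Fm 1 (1 - a l)) * df 0%R + RtoC (/ 2 - a l) * f 0%R))%C).
  { intros l Hl. destruct (half_line _ _ _ _ _ _ (a l) D (residue_frac M l Hl)) as [L [H1 H2]]. assert (E : CSeries (T
    l) = L) by (apply CSeries_unique; exact H1). rewrite E. split; [exact H1|exact H2]. }
  exists (psum (fun l => g (Z.of_nat (S l)) * CSeries (T l))%C M). split.
  - eapply Cser_ext; [|apply (Cser_psum (fun l k => g (Z.of_nat (S l)) * T l k)%C); intros l Hl; apply Cser_scal,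
    (proj1 (H l Hl))].
    intros k; cbv beta. rewrite DS_kap, DS_kap_neg. set (Yp := osc_Y _ _ _ _ (kap k)) in *. set (Ym := osc_Y _ _ _ _ (-
      kap k)) in *.
    set (d := (- / (RtoC (kap k) * RtoC (kap k)))%C).
    assert (E : forall F G : nat -> C, (d * (psum F M * Yp + psum G M * Ym))%C = psum (fun l => (d * Yp) * F l + (d *
      Ym) * G l)%C M).
    { intros F G. rewrite psum_plus, !psum_scal. ring. }
    rewrite E. apply psum_ext. intros l _. unfold T. fold d Yp Ym. unfold a. ring.
  - eapply evar_last; [apply (Cser_classes _ (fun l => g (Z.of_nat (S l)) * (CSeries (T l) + (osc_X Int Iinf 0%R + RtoC
    (Fm 1 (1 - a l)) * df 0%R + RtoC (/ 2 - a l) * f 0%R)))%C M HM)|].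
    + intros l Hl. eapply Cser_ext; [|apply Cser_scal, (proj2 (H l Hl))]. intros j; cbv beta.
      rewrite (class_arg M l j HM). replace (Z.of_nat (S (l + j * M))) with (Z.of_nat (S l) + Z.of_nat j * Z.of_nat
        M)%Z by lia.
      rewrite (periodic_mul M g _ j Hg). f_equal. f_equal. unfold a. field. lra.
    + to_C. rewrite (psum_ext _ (fun l => g (Z.of_nat (S l)) * CSeries (T l) + (osc_X Int Iinf 0%R * g (Z.of_nat (S l))
        + (df 0%R * (g (Z.of_nat (S l)) * RtoC (Fm 1 (1 - a l))) + f 0%R * (g (Z.of_nat (S l)) * RtoC (/ 2 - a
          l)))))%C) by (intros; ring).
      rewrite !psum_plus, !psum_scal. unfold a. ring.
Qed.

(** * Gaussian seeds *)

Definition gauss (c : C) (v : R) : C := Cexp (- c * (RtoC v * RtoC v)).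

Lemma Cmod_gauss c v : Cmod (gauss c v) = exp (- (Re c * v ^ 2)).
Proof. unfold gauss. rewrite Cmod_Cexp. f_equal. destruct c as [x y]. unfold Cmult, Copp, RtoC; simpl. ring. Qed.

(** The cube is at most exp(3 v), and [4 / g] comes from completing the square: g v^2 - 4 v + 4 / g
    = (g v - 2)^2 / g. *)
Lemma gauss_decay g v : 0 < g -> 0 <= v -> (1 + v) ^ 3 * exp (- (g * v ^ 2)) <= exp (4 / g) * exp (- (1 * v)).
Proof.
  intros Hg Hv.
  assert (H1 : 1 + v <= exp v) by (destruct (Req_dec v 0) as [->|Hn]; [rewrite exp_0; lra|apply Rlt_le, exp_ineq1; lra]).
  assert (H3 : (1 + v) ^ 3 <= exp (3 * v)).
  { replace (3 * v) with (v + (v + v)) by ring. rewrite !exp_plus. replace (exp v * (exp v * exp v)) with (exp v ^ 3)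
    by ring. apply pow_incr. lra. }
  apply Rle_trans with (exp (3 * v) * exp (- (g * v ^ 2))); [apply Rmult_le_compat_r; [apply Rlt_le, exp_pos|exact H3]|].
  rewrite <- !exp_plus. assert (H : 3 * v + - (g * v ^ 2) <= 4 / g + - (1 * v)).
  { assert (E : 4 / g + - (1 * v) - (3 * v + - (g * v ^ 2)) = (g * v - 2) ^ 2 / g) by (field; lra).
    assert (0 <= (g * v - 2) ^ 2 / g) by (apply Rdiv_le_0_compat; [apply pow2_ge_0|exact Hg]). lra. }
  destruct H as [H| ->]; [apply Rlt_le, exp_increasing, H|lra].
Qed.

Lemma gauss_poly_bound c (a0 a1 a2 a3 : C) v : 0 < Re c -> 0 <= v ->
  Cmod ((a0 + a1 * RtoC v + a2 * RtoC v ^ 2 + a3 * RtoC v ^ 3) * gauss c v) <= ((Cmod a0 + Cmod a1 + Cmod a2 + Cmod a3)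
    * exp (4 / Re c)) * exp (- (1 * v)).
Proof.
  intros Hc Hv. rewrite Cmod_mult, Cmod_gauss.
  assert (H := gauss_decay _ _ Hc Hv). assert (He := exp_pos (- (Re c * v ^ 2))).
  assert (Hp : Cmod (a0 + a1 * RtoC v + a2 * RtoC v ^ 2 + a3 * RtoC v ^ 3) <= (Cmod a0 + Cmod a1 + Cmod a2 + Cmod a3) *
    (1 + v) ^ 3).
  { assert (B0 := Cmod_ge_0 a0). assert (B1 := Cmod_ge_0 a1). assert (B2 := Cmod_ge_0 a2). assert (B3 := Cmod_ge_0 a3).
    assert (V2 : 0 <= v ^ 2) by (apply pow_le; lra). assert (V3 : 0 <= v ^ 3) by (apply pow_le; lra).
    assert (E : (1 + v) ^ 3 = 1 + 3 * v + 3 * v ^ 2 + v ^ 3) by ring. rewrite E.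
    rewrite !Rmult_plus_distr_r.
    repeat (eapply Rle_trans; [apply Cmod_triangle|]; apply Rplus_le_compat); rewrite ?Cmod_mult, ?Cmod_pow, ?Cmod_R,
      ?(Rabs_right v) by lra;
      first [apply Rmult_le_compat_l; [assumption|lra]|nra]. }
  apply Rle_trans with ((Cmod a0 + Cmod a1 + Cmod a2 + Cmod a3) * ((1 + v) ^ 3 * exp (- (Re c * v ^ 2)))).
  - rewrite <- Rmult_assoc. apply Rmult_le_compat_r; [lra|exact Hp].
  - rewrite Rmult_assoc. apply Rmult_le_compat_l; [|exact H].
    generalize (Cmod_ge_0 a0) (Cmod_ge_0 a1) (Cmod_ge_0 a2) (Cmod_ge_0 a3); lra.
Qed.

Lemma Cder_gauss c v : is_Cder (gauss c) v (- (2 * c) * RtoC v * gauss c v)%C.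
Proof.
  eapply evar_last; [apply (Cder_Cexp (fun v => - c * (RtoC v * RtoC v))%C), Cder_cmult, Cder_mult; apply Cder_id|].
  to_C. unfold gauss. ring.
Qed.

Lemma Cder_poly2 (a0 a1 a2 : C) v : is_Cder (fun v => a0 + a1 * RtoC v + a2 * RtoC v ^ 2)%C v (a1 + 2 * a2 * RtoC v)%C.
Proof.
  eapply evar_last; [eapply Cder_ext; [|apply (Cder_plus _ _ _ _ _ (Cder_plus _ _ _ _ _ (Cder_const a0 v) (Cder_cmult
    a1 _ _ _ (Cder_id v))) (Cder_cmult a2 _ _ _ (Cder_mult _ _ _ _ _ (Cder_id v) (Cder_id v))))]|].
  - intros s; cbv beta. simpl Cpow. ring.
  - to_C. ring.
Qed.

Lemma Cder_gauss_poly c (a0 a1 a2 : C) v :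
  is_Cder (fun v => (a0 + a1 * RtoC v + a2 * RtoC v ^ 2) * gauss c v)%C v
    ((a1 + (2 * a2 - 2 * c * a0) * RtoC v + - (2 * c * a1) * RtoC v ^ 2 + - (2 * c * a2) * RtoC v ^ 3) * gauss c v)%C.
Proof.
  eapply evar_last; [apply Cder_mult; [apply Cder_poly2|apply Cder_gauss]|]. to_C. simpl Cpow. ring.
Qed.

Lemma Ccont_gauss_poly c (a0 a1 a2 a3 : C) v :
  Ccont (fun v => (a0 + a1 * RtoC v + a2 * RtoC v ^ 2 + a3 * RtoC v ^ 3) * gauss c v)%C v.
Proof.
  assert (Hid : Ccont RtoC v) by (eapply Cder_continuous, Cder_id).
  apply Ccont_mult; [|eapply Cder_continuous, Cder_gauss].
  repeat apply Ccont_plus; try apply Ccont_mult; try apply Ccont_const; try apply Ccont_pow; exact Hid.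
Qed.

(** The exponent in the Fourier transform of [gauss c]; for [c = gauss_rate M tau] and [kp = kap k]
    it equals [xi M k / tau]. Completing the square gives the primitive [gauss_Int]. *)
Definition osc_exponent (c : C) (kp : R) : C := (RtoC kp * RtoC kp / (4 * c))%C.
Definition gauss_Int (c : C) (kp v : R) : C := (Cexp (- osc_exponent c kp) * Efun (- c) (RtoC v - Ci * RtoC kp / (2 * c)))%C.

Lemma Re_pos_neq_0 c : 0 < Re c -> c <> 0.
Proof. intros H E. rewrite E in H. simpl in H. lra. Qed.

Lemma Cder_gauss_Int c kp v : 0 < Re c -> is_Cder (gauss_Int c kp) v (Cexp (Ci * RtoC (kp * v)) * gauss c v)%C.
Proof.
  intros Hc. apply Re_pos_neq_0 in Hc.
  eapply evar_last; [apply Cder_cmult, (Cder_Efun (- c)%C (fun v => RtoC v - Ci * RtoC kp / (2 * c))%C)|].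
  - eapply Cder_ext; [|apply (Cder_plus _ _ _ _ _ (Cder_id v) (Cder_const (- (Ci * RtoC kp / (2 * c)))%C v))]. reflexivity.
  - to_C. replace (RtoC 1 + RtoC 0)%C with (RtoC 1) by ring. rewrite Cmult_1_r. unfold gauss. rewrite <- !Cexp_plus. f_equal.
    unfold osc_exponent. rewrite RtoC_mult.
    replace (- (RtoC kp * RtoC kp / (4 * c)) + - c * ((RtoC v - Ci * RtoC kp / (2 * c)) * (RtoC v - Ci * RtoC kp / (2 *
      c))))%C with
      (Ci * (RtoC kp * RtoC v) + - c * (RtoC v * RtoC v) - (Ci * Ci + 1) * (RtoC kp * RtoC kp / (4 * c)))%C by (field;
        exact Hc).
    rewrite Ci_sq. ring.
Qed.

Lemma gauss_Int_0 c kp : 0 < Re c -> gauss_Int c kp 0 = (- (Ci * RtoC kp / (2 * c)) * (Cexp (- osc_exponent c kp) *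
  Gfun (osc_exponent c kp)))%C.
Proof.
  intros Hc. apply Re_pos_neq_0 in Hc. unfold gauss_Int, Efun.
  replace (RtoC 0 - Ci * RtoC kp / (2 * c))%C with (- (Ci * RtoC kp / (2 * c)))%C by ring.
  replace (- c * (- (Ci * RtoC kp / (2 * c)) * - (Ci * RtoC kp / (2 * c))))%C with (osc_exponent c kp); [ring|].
  unfold osc_exponent. replace (- c * (- (Ci * RtoC kp / (2 * c)) * - (Ci * RtoC kp / (2 * c))))%C with (- (Ci * Ci) *
    (RtoC kp * RtoC kp / (4 * c)))%C by (field; exact Hc).
  rewrite Ci_sq. ring.
Qed.

Lemma exp_sq_decay g v : 0 < g -> 0 <= v -> (1 + v) * exp (- (g * v ^ 2)) <= exp (4 / g) * exp (- (1 * v)).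
Proof.
  intros Hg Hv. eapply Rle_trans; [|apply gauss_decay; assumption]. apply Rmult_le_compat_r; [apply Rlt_le, exp_pos|]. nra.
Qed.

Lemma Efun_lim_ex c : 0 < Re c -> exists G : C, filterlim (fun v => Efun (- c) (RtoC v)) (Rbar_locally p_infty) (locally G).
Proof.
  intros Hc. apply (CRInt_lim_exp (gauss c) _ (exp (4 / Re c)) 1); [lra| |].
  - intros T HT. eapply evar_last; [apply (CRInt_FTC (fun v => Efun (- c) (RtoC v)))|].
    + intros x _. eapply evar_last; [apply (Cder_Efun (- c)%C RtoC x _ (Cder_id x))|]. to_C. unfold gauss. ring.
    + intros x _. eapply Cder_continuous, Cder_gauss.
    + to_C. unfold Efun. ring.
  - intros t Ht. rewrite Cmod_gauss. eapply Rle_trans; [|apply exp_sq_decay; assumption].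
    assert (H := exp_pos (- (Re c * t ^ 2))). nra.
Qed.

Lemma exp_le_exp x y : x <= y -> exp x <= exp y.
Proof. intros [H| ->]; [apply Rlt_le, exp_increasing, H|lra]. Qed.

(** Shift of contour: the segment from [v] to [v - d] contributes an amount that decays like a
    Gaussian in [v]. *)
Lemma Efun_shift_lim c kp G : 0 < Re c -> filterlim (fun v => Efun (- c) (RtoC v)) (Rbar_locally p_infty) (locally G) ->
  filterlim (gauss_Int c kp) (Rbar_locally p_infty) (locally (Cexp (- osc_exponent c kp) * G)%C).
Proof.
  intros Hc HG. apply (filterlim_Cscal _). assert (Hcn := Re_pos_neq_0 _ Hc).
  set (d := (Ci * RtoC kp / (2 * c))%C).
  eapply filterlim_ext; [|replace G with (0 + G)%C by ring; apply (filterlim_Cplus _ (fun v => Efun (- c) (RtoC v - d)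
    - Efun (- c) (RtoC v))%C); [|exact HG]].
  - intros v; cbv beta. unfold Cminus. ring.
  - apply (filterlim_exp_bound _ (Cmod d * exp (Rabs (Re (osc_exponent c kp))) * exp (4 / Re c)) 1); [lra|]. intros v Hv.
    apply Rle_trans with (Cmod d * (exp (Rabs (Re (osc_exponent c kp))) * exp (- (Re c * v ^ 2)))).
    + eapply Rle_trans; [apply (Efun_segment (- c) (RtoC v - d) (RtoC v) (exp (Rabs (Re (osc_exponent c kp))) * exp (-
      (Re c * v ^ 2))))|].
      * intros s Hs. rewrite <- exp_plus. apply exp_le_exp.
        (* For [d = i kp / (2 c)] the cross term is purely imaginary and does not affect the
           modulus. *)
        assert (E : (- c * ((RtoC v + RtoC s * (RtoC v - d - RtoC v)) * (RtoC v + RtoC s * (RtoC v - d - RtoC v))))%C =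
          (- c * RtoC (v ^ 2) + RtoC (v * s * kp) * Ci + RtoC (s ^ 2) * osc_exponent c kp)%C).
        { unfold d, osc_exponent. rewrite !RtoC_mult, !RtoC_pow.
          replace (- c * ((RtoC v + RtoC s * (RtoC v - Ci * RtoC kp / (2 * c) - RtoC v)) * (RtoC v + RtoC s * (RtoC v -
            Ci * RtoC kp / (2 * c) - RtoC v))))%C
            with (- c * RtoC v ^ 2 + RtoC v * RtoC s * RtoC kp * Ci - (Ci * Ci) * RtoC s ^ 2 * (RtoC kp * RtoC kp / (4
              * c)))%C by (field; exact Hcn).
          rewrite Ci_sq. ring. }
        rewrite E, !re_plus, !re_scal_l, re_scal_r, re_opp. change (Re Ci) with 0.
        assert (H := Rle_abs (Re (osc_exponent c kp))). assert (H2 := Rabs_pos (Re (osc_exponent c kp))). assert (0 <=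
          s ^ 2 <= 1) by nra. nra.
      * right. f_equal. rewrite <- (Cmod_opp d). f_equal. ring.
    + rewrite !Rmult_assoc. apply Rmult_le_compat_l; [apply Cmod_ge_0|]. apply Rmult_le_compat_l; [apply Rlt_le, exp_pos|].
      eapply Rle_trans; [|apply exp_sq_decay; assumption]. assert (H := exp_pos (- (Re c * v ^ 2))). nra.
Qed.

Lemma gauss_bound_ex c (a b d e : C) : 0 < Re c -> exists B, forall v, 0 <= v -> Cmod ((a + b * RtoC v + d * RtoC v ^ 2
  + e * RtoC v ^ 3) * gauss c v) <= B * exp (- (1 * v)).
Proof. intros Hc. eexists. intros v Hv. apply gauss_poly_bound; assumption. Qed.

Lemma gauss_poly_osc c (a0 a1 : C) Int Iinf : 0 < Re c ->
  (forall kp v, is_Cder (Int kp) v (Cexp (Ci * RtoC (kp * v)) * ((a0 + a1 * RtoC v) * gauss c v))%C) ->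
  (forall kp, filterlim (Int kp) (Rbar_locally p_infty) (locally (Iinf kp))) ->
  exists B, osc_data (fun v => (a0 + a1 * RtoC v) * gauss c v)%C
    (fun v => (a1 + - (2 * c * a0) * RtoC v + - (2 * c * a1) * RtoC v ^ 2) * gauss c v)%C
    (fun v => (- (2 * c * a0) + - (6 * c * a1) * RtoC v + (4 * c * c * a0) * RtoC v ^ 2 + (4 * c * c * a1) * RtoC v ^
      3) * gauss c v)%C Int Iinf B.
Proof.
  intros Hc HI HL.
  destruct (gauss_bound_ex c a0 a1 0 0 Hc) as [B1 H1].
  destruct (gauss_bound_ex c a1 (- (2 * c * a0)) (- (2 * c * a1)) 0 Hc) as [B2 H2].
  destruct (gauss_bound_ex c (- (2 * c * a0)) (- (6 * c * a1)) (4 * c * c * a0) (4 * c * c * a1) Hc) as [B3 H3].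
  assert (Hm : forall (w : C) (u B : R) v, Cmod w <= B * exp (- (1 * v)) -> B <= u -> Cmod w <= u * exp (- (1 * v))).
  { intros w u B v H Hu. eapply Rle_trans; [exact H|]. apply Rmult_le_compat_r; [apply Rlt_le, exp_pos|exact Hu]. }
  exists (Rmax B1 (Rmax B2 B3)).
  assert (M1 := Rmax_l B1 (Rmax B2 B3)). assert (M2 := Rmax_r B1 (Rmax B2 B3)). assert (M3 := Rmax_l B2 B3). assert (M4
    := Rmax_r B2 B3).
  split.
  - intros v. eapply evar_last; [eapply Cder_ext; [|apply (Cder_gauss_poly c a0 a1 0 v)]|].
    + intros s; cbv beta. ring.
    + to_C. ring.
  - intros v. eapply evar_last; [apply (Cder_gauss_poly c)|]. to_C. ring.
  - intros v. apply Ccont_gauss_poly.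
  - intros v Hv. apply (Hm _ _ B1); [|lra]. eapply Rle_trans; [|apply (H1 v Hv)]. right. f_equal. ring.
  - intros v Hv. apply (Hm _ _ B2); [|lra]. eapply Rle_trans; [|apply (H2 v Hv)]. right. f_equal. ring.
  - intros v Hv. apply (Hm _ _ B3); [|lra]. apply H3, Hv.
  - exact HI.
  - exact HL.
Qed.

Lemma gauss_0 c : gauss c 0 = 1.
Proof. unfold gauss. replace (- c * (RtoC 0 * RtoC 0))%C with (RtoC 0) by ring. apply Cexp_0. Qed.

Lemma osc_exponent_opp c kp : osc_exponent c (- kp) = osc_exponent c kp.
Proof. unfold osc_exponent. rewrite RtoC_opp. unfold Cdiv. ring. Qed.

Lemma osc_exponent_0 c : osc_exponent c 0 = 0.
Proof. unfold osc_exponent, Cdiv. ring. Qed.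

(** The Dawson-type function: exp(- b) times the integral of exp(b w^2) over [0, 1]. *)
Definition Dfun (b : C) : C := (Cexp (- b) * Gfun b)%C.

Lemma gauss_Int_X c G kp : 0 < Re c ->
  osc_X (gauss_Int c) (fun kp => (Cexp (- osc_exponent c kp) * G)%C) kp = (Cexp (- osc_exponent c kp) * G + Ci * RtoC
    kp / (2 * c) * Dfun (osc_exponent c kp))%C.
Proof. intros Hc. unfold osc_X, Dfun. rewrite gauss_Int_0 by exact Hc. ring. Qed.

(** The even combination of [DS] multiplies the Gaussian term, the odd one the Dawson-type term. The
    half-line mass [G] is left as a hypothesis because this formula is itself used to compute it. *)
Lemma theta_gauss_0 M g c G : (0 < M)%nat -> periodic M g -> 0 < Re c ->
  filterlim (fun v => Efun (- c) (RtoC v)) (Rbar_locally p_infty) (locally G) ->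
  exists V, is_Cser (fun k => let b := osc_exponent c (kap k) in
     (DS M g (Z.of_nat (S k)) + DS M g (- Z.of_nat (S k))) * (Cexp (- b) * G)
     + (DS M g (Z.of_nat (S k)) - DS M g (- Z.of_nat (S k))) * (Ci / RtoC (kap k)) * (2 * b * Dfun b - 1))%C V /\
  is_Cser (fun k => g (Z.of_nat (S k)) * gauss c (INR (S k) / INR M))%C
    (V + (psum (fun l => g (Z.of_nat (S l))) M * G + psum (fun l => g (Z.of_nat (S l)) * RtoC (/ 2 - INR (S l) / INR
      M)) M))%C.
Proof.
  intros HM Hg Hc HG. assert (Hcn := Re_pos_neq_0 _ Hc).
  destruct (gauss_poly_osc c 1 0 (gauss_Int c) (fun kp => (Cexp (- osc_exponent c kp) * G)%C) Hc) as [B D].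
  { intros kp v. eapply evar_last; [apply Cder_gauss_Int, Hc|]. to_C. ring. }
  { intros kp. apply Efun_shift_lim; assumption. }
  destruct (theta_sum M g _ _ _ _ _ B D HM Hg) as [V [H1 H2]]. exists V. split.
  - eapply Cser_ext; [|exact H1]. intros k; cbv beta zeta. unfold osc_Y. rewrite !gauss_Int_X, osc_exponent_opp,
    gauss_0 by exact Hc.
    set (b := osc_exponent c (kap k)). set (D0 := Dfun b). set (E := Cexp (- b)).
    assert (Hk : RtoC (kap k) <> 0) by apply Rpos_neq_C, kap_pos.
    replace b with (RtoC (kap k) * RtoC (kap k) / (4 * c))%C by reflexivity. rewrite RtoC_opp. field. split; assumption.
  - rewrite gauss_Int_X, osc_exponent_0 in H2 by exact Hc. eapply evar_last; [eapply Cser_ext; [|exact H2]|].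
    + intros k; cbv beta. ring.
    + to_C. rewrite gauss_0. replace (- RtoC 0)%C with (RtoC 0) by ring. rewrite Cexp_0. field. exact Hcn.
Qed.

Lemma theta_gauss_1 M g c G : (0 < M)%nat -> periodic M g -> 0 < Re c ->
  filterlim (fun v => Efun (- c) (RtoC v)) (Rbar_locally p_infty) (locally G) ->
  exists V, is_Cser (fun k => let b := osc_exponent c (kap k) in
     (DS M g (Z.of_nat (S k)) + DS M g (- Z.of_nat (S k))) * (RtoC (INR M) / (RtoC (kap k) * RtoC (kap k))) * (1 + 2 *
       b - 4 * b * b * Dfun b)
     + (DS M g (Z.of_nat (S k)) - DS M g (- Z.of_nat (S k))) * (Ci / RtoC (kap k)) * (2 * b * RtoC (INR M)) * (Cexp (-
       b) * G))%C V /\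
  is_Cser (fun k => RtoC (INR (S k)) * g (Z.of_nat (S k)) * gauss c (INR (S k) / INR M))%C
    (V + (psum (fun l => g (Z.of_nat (S l))) M * (RtoC (INR M) / (2 * c)) + psum (fun l => g (Z.of_nat (S l)) * RtoC
      (INR M * Fm 1 (1 - INR (S l) / INR M))) M))%C.
Proof.
  intros HM Hg Hc HG. assert (Hcn := Re_pos_neq_0 _ Hc). assert (HMR := lt_0_INR M HM). set (m := RtoC (INR M)).
  assert (Hm : m <> 0) by apply Rpos_neq_C, HMR.
  (* The seed is M v exp(- c v^2), equal to n exp(- c v^2) at v = n / M. One integration by parts
     reduces its oscillating primitive to [gauss_Int]. *)
  set (Int := fun kp v => (- (m / (2 * c)) * (Cexp (Ci * RtoC (kp * v)) * gauss c v) + m / (2 * c) * (Ci * RtoC kp) *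
    gauss_Int c kp v)%C).
  set (Iinf := fun kp => (m / (2 * c) * (Ci * RtoC kp) * (Cexp (- osc_exponent c kp) * G))%C).
  destruct (gauss_poly_osc c 0 m Int Iinf Hc) as [B D].
  { intros kp v. eapply evar_last; [apply Cder_plus; [apply Cder_cmult, Cder_mult; [apply Cder_osc|apply
    Cder_gauss]|apply Cder_cmult, Cder_gauss_Int, Hc]|]. to_C. field. exact Hcn. }
  { intros kp. unfold Int, Iinf. eapply filterlim_ext; [intros v; reflexivity|].
    replace (m / (2 * c) * (Ci * RtoC kp) * (Cexp (- osc_exponent c kp) * G))%C with (- (m / (2 * c)) * 0 + m / (2 * c)
      * (Ci * RtoC kp) * (Cexp (- osc_exponent c kp) * G))%C by ring.
    apply (filterlim_Cplus _); apply (filterlim_Cscal _); [|apply Efun_shift_lim; assumption].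
    destruct (gauss_bound_ex c 1 0 0 0 Hc) as [B HB]. apply (filterlim_unimodular_mult (fun v => Cexp (Ci * RtoC (kp *
      v))) (gauss c) B).
    - intros v. rewrite Cmod_osc. lra.
    - intros v Hv. eapply Rle_trans; [|apply (HB v Hv)]. right. f_equal. ring. }
  assert (HX : forall kp, osc_X Int Iinf kp = (m / (2 * c) * (1 + Ci * RtoC kp * (Cexp (- osc_exponent c kp) * G) -
    RtoC kp * RtoC kp / (2 * c) * Dfun (osc_exponent c kp)))%C).
  { intros kp. unfold osc_X, Int, Iinf. rewrite gauss_Int_0, gauss_0, Rmult_0_r, Cmult_0_r, Cexp_0 by exact Hc. fold
    (Dfun (osc_exponent c kp)).
    set (D0 := Dfun _). set (E := (Cexp _ * G)%C).
    replace (m / (2 * c) * (Ci * RtoC kp) * E - (- (m / (2 * c)) * (1 * 1) + m / (2 * c) * (Ci * RtoC kp) * (- (Ci *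
      RtoC kp / (2 * c)) * D0)))%C
      with (m / (2 * c) * (1 + Ci * RtoC kp * E + Ci * Ci * (RtoC kp * RtoC kp / (2 * c)) * D0))%C by (field; exact Hcn).
    rewrite Ci_sq. ring. }
  destruct (theta_sum M g _ _ _ _ _ B D HM Hg) as [V [H1 H2]]. exists V. split.
  - eapply Cser_ext; [|exact H1]. intros k; cbv beta zeta. unfold osc_Y. rewrite !HX, osc_exponent_opp, gauss_0.
    set (b := osc_exponent c (kap k)). set (D0 := Dfun b). set (E := Cexp (- b)).
    assert (Hk : RtoC (kap k) <> 0) by apply Rpos_neq_C, kap_pos.
    replace b with (RtoC (kap k) * RtoC (kap k) / (4 * c))%C by reflexivity. rewrite RtoC_opp. field. split; assumption.
  - rewrite HX, osc_exponent_0 in H2. eapply evar_last; [eapply Cser_ext; [|exact H2]|].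
    + intros k; cbv beta. rewrite RtoC_div by lra. fold m. field. exact Hm.
    + to_C. rewrite gauss_0. rewrite (psum_ext (fun l => g (Z.of_nat (S l)) * RtoC (INR M * Fm 1 (1 - INR (S l) / INR
      M)))%C (fun l => m * (g (Z.of_nat (S l)) * RtoC (Fm 1 (1 - INR (S l) / INR M))))%C), psum_scal by (intros;
        rewrite RtoC_mult; fold m; ring).
      field. exact Hcn.
Qed.

(* Poisson summation for [M = 1], [tau = i] is self-dual, which determines the Gaussian integral. *)
Lemma gauss_integral_PI : filterlim (fun v => Efun (- RtoC PI) (RtoC v)) (Rbar_locally p_infty) (locally (/ 2)%C).
Proof.
  assert (HPI := PI_RGT_0). assert (Hc : 0 < Re (RtoC PI)) by exact HPI. assert (HPC := Rpos_neq_C _ HPI).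
  destruct (Efun_lim_ex _ Hc) as [G HG]. replace (/ 2)%C with G; [exact HG|].
  destruct (theta_gauss_0 1 (fun _ => RtoC 1) _ G (le_n 1) (fun _ => eq_refl) Hc HG) as [V [H1 H2]].
  assert (HDS : forall n, DS 1 (fun _ => RtoC 1) n = 1).
  { intros n. unfold DS. simpl psum. simpl INR. replace (1 / 1) with 1 by field. rewrite Rmult_1_r, Cexp_int_period. ring. }
  set (T := (V + (psum (fun _ => RtoC 1) 1 * G + psum (fun l => 1 * RtoC (/ 2 - INR (S l) / INR 1)) 1))%C) in *.
  assert (HT : is_Cser (fun k => RtoC (exp (- (PI * INR (S k) ^ 2)))) T).
  { eapply Cser_ext; [|exact H2]. intros k; cbv beta. unfold gauss, Cexp. change (INR 1) with 1.
    replace (- RtoC PI * (RtoC (INR (S k) / 1) * RtoC (INR (S k) / 1)))%C with (RtoC (- (PI * INR (S k) ^ 2))).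
    - change (Re (RtoC ?x)) with x. change (Im (RtoC ?x)) with 0. rewrite cos_0, sin_0. unfold RtoC, Cmult; simpl.
      f_equal; ring.
    - replace (INR (S k) / 1) with (INR (S k)) by field. rewrite RtoC_opp, !RtoC_mult. rewrite RtoC_pow. simpl. ring. }
  assert (HV : V = (2 * G * T)%C).
  { eapply is_Cser_unique; [exact H1|]. eapply Cser_ext; [|apply (Cser_scal (2 * G)%C _ _ HT)]. intros k; cbv beta
    zeta. rewrite !HDS.
    replace (Cexp (- osc_exponent (RtoC PI) (kap k))) with (RtoC (exp (- (PI * INR (S k) ^ 2)))); [ring|].
    replace (- osc_exponent (RtoC PI) (kap k))%C with (RtoC (- (PI * INR (S k) ^ 2))).
    - unfold Cexp. change (Re (RtoC ?x)) with x. change (Im (RtoC ?x)) with 0. rewrite cos_0, sin_0. unfold RtoC;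
      simpl. f_equal; ring.
    - unfold osc_exponent, kap. rewrite RtoC_opp, !RtoC_mult, RtoC_pow. field. exact HPC. }
  (* Self-duality turns the summation formula into (G - 1/2) (1 + 2 T) = 0, and [T] is a sum of
     positive numbers. *)
  assert (HTe : T = (2 * G * T + (G - / 2))%C).
  { unfold T at 1. rewrite HV. simpl psum. simpl INR. replace (/ 2 - 1 / 1) with (- / 2) by field. rewrite RtoC_opp,
    RtoC_inv by lra. ring. }
  assert (HRe : 0 <= Re T).
  { apply is_Cser_split in HT. destruct HT as [HT _]. rewrite <- (is_series_unique _ _ HT). apply Series_nonneg;
    [|eexists; exact HT].
    intros k. apply Rlt_le, exp_pos. }
  assert (Hn : (1 + 2 * T)%C <> 0).
  { intros E. apply (f_equal Re) in E. rewrite re_plus, re_scal_l in E. change (Re (RtoC 1)) with 1 in E. change (Re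
    (RtoC 0)) with 0 in E. lra. }
  assert (HE : ((G - / 2) * (1 + 2 * T) = 0)%C).
  { replace ((G - / 2) * (1 + 2 * T))%C with (2 * G * T + (G - / 2) - T)%C by field. rewrite <- HTe. ring. }
  assert (HG2 : (G - / 2)%C = 0).
  { replace (G - / 2)%C with ((G - / 2) * (1 + 2 * T) / (1 + 2 * T))%C by (field; exact Hn). rewrite HE. unfold Cdiv. ring. }
  replace G with (G - / 2 + / 2)%C by ring. rewrite HG2. ring.
Qed.

(** Rotation of the half-line: with q^2 = c / PI, the substitution by q turns [c] into PI on the ray
    of direction q. That ray is compared with the real axis over the vertical segments from
    [Re q * v] to [q * v], on which the integrand is at most exp(- Re c v^2). *)
Lemma gauss_integral c : 0 < Re c -> filterlim (fun v => Efun (- c) (RtoC v)) (Rbar_locally p_infty) (locally (/ 2 *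
  rsqrt (c / RtoC PI))%C).
Proof.
  intros Hc. assert (HPI := PI_RGT_0). assert (HPC := Rpos_neq_C _ HPI). assert (Hcn := Re_pos_neq_0 _ Hc).
  set (x := (c / RtoC PI)%C). assert (Hx : slit x).
  { left. unfold x, Cdiv. rewrite <- RtoC_inv, re_scal_r by lra. apply Rmult_lt_0_compat; [exact Hc|apply
    Rinv_0_lt_compat, HPI]. }
  assert (Hxn := slit_neq_0 x Hx). set (r := rsqrt x). assert (Hr := rsqrt_neq_0 x). fold r in Hr. assert (Hr2 :=
    rsqrt_sq x Hxn). fold r in Hr2.
  assert (HrRe := rsqrt_Re x Hx). fold r in HrRe.
  set (q := (x * r)%C).
  assert (Hq2 : (q * q = x)%C) by (unfold q; replace (x * r * (x * r))%C with (x * x * (r * r))%C by ring; rewrite Hr2;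
    field; exact Hxn).
  assert (Hqr : (q * r = 1)%C) by (unfold q; replace (x * r * r)%C with (x * (r * r))%C by ring; rewrite Hr2; field;
    exact Hxn).
  assert (HqRe : 0 < Re q).
  { replace q with (/ r)%C by (rewrite <- (Cmult_1_l (/ r)), <- Hqr; field; exact Hr). unfold Cinv. simpl.
    apply Rdiv_lt_0_compat; [exact HrRe|]. assert (H : 0 < Re r ^ 2) by (apply pow_lt, HrRe). assert (H2 := pow2_ge_0
      (Im r)). unfold Re, Im in *. simpl in *. lra. }
  replace (/ 2 * r)%C with (r * / 2)%C by ring.
  eapply filterlim_ext; [|apply (filterlim_Cscal _ r (fun v => Efun (- RtoC PI) (q * RtoC v)))].
  { intros v. cbv beta. unfold Efun. replace (- RtoC PI * (q * RtoC v * (q * RtoC v)))%C with (- (RtoC PI * (q * q)) *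
    (RtoC v * RtoC v))%C by ring.
    rewrite Hq2. replace (RtoC PI * x)%C with c by (unfold x; field; exact HPC).
    replace (r * (q * RtoC v * Gfun (- c * (RtoC v * RtoC v))))%C with (q * r * (RtoC v * Gfun (- c * (RtoC v * RtoC
      v))))%C by ring. rewrite Hqr. ring. }
  assert (H0 : filterlim (fun v => Efun (- RtoC PI) (RtoC (Re q * v))) (Rbar_locally p_infty) (locally (/ 2)%C)).
  { apply (filterlim_comp _ _ _ (fun v => Re q * v) (fun v => Efun (- RtoC PI) (RtoC v)) _ (Rbar_locally p_infty));
    [|exact gauss_integral_PI].
    intros P [N HN]. exists (N / Re q). intros v Hv. apply HN. apply Rlt_div_l in Hv; [rewrite Rmult_comm; exact
      Hv|exact HqRe]. }
  eapply filterlim_ext; [|replace (/ 2)%C with (0 + / 2)%C by ring; apply (filterlim_Cplus _ (fun v => Efun (- RtoC PI)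
    (q * RtoC v) - Efun (- RtoC PI) (RtoC (Re q * v)))%C); [|exact H0]].
  { intros v; cbv beta. ring. }
  apply (filterlim_exp_bound _ (Rabs (Im q) * exp (4 / Re c)) 1); [lra|]. intros v Hv.
  eapply Rle_trans; [apply (Efun_segment _ _ _ (exp (- (Re c * v ^ 2))))|].
  - intros s Hs. apply exp_le_exp.
    assert (Ec : Re c = PI * (Re q * Re q - Im q * Im q)).
    { replace c with (RtoC PI * (q * q))%C by (rewrite Hq2; unfold x; field; exact HPC). rewrite re_scal_l. unfold Re,
      Im, Cmult; simpl. ring. }
    match goal with |- Re ?z <= _ => assert (E : Re z = - (PI * v ^ 2 * (Re q * Re q - s ^ 2 * (Im q * Im q)))) end.
    { destruct q as [q1 q2]. unfold Re, Im, Cmult, Copp, Cplus, Cminus, RtoC; simpl. ring. }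
    rewrite E, Ec. assert (H1 : 0 <= s ^ 2 <= 1) by nra. assert (H2 : 0 <= Im q * Im q) by nra. assert (H3 : 0 <= PI *
      v ^ 2) by (apply Rmult_le_pos; [lra|apply pow2_ge_0]).
    assert (H4 : s ^ 2 * (Im q * Im q) <= Im q * Im q) by nra. nra.
  - assert (E : (q * RtoC v - RtoC (Re q * v))%C = (RtoC (Im q * v) * Ci)%C).
    { destruct q as [q1 q2]. unfold Re, Im, Ci, Cmult, Cminus, Cplus, Copp, RtoC; simpl. f_equal; ring. }
    rewrite E, Cmod_mult, Cmod_Ci, Cmod_R, Rabs_mult, (Rabs_right v), Rmult_1_r, !Rmult_assoc by lra.
    apply Rmult_le_compat_l; [apply Rabs_pos|]. eapply Rle_trans; [|apply exp_sq_decay; assumption].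
    assert (H := exp_pos (- (Re c * v ^ 2))). nra.
Qed.

(** * The four parity cases *)

(** The P-th power of the identity that writes the squared frequency (2 pi n)^2 through the singular
    point i pi n^2 / M. *)
Lemma xi_kap_pow M k P : (0 < M)%nat ->
  (4 ^ P * (Ci * Ci) ^ P * (RtoC (INR M) ^ P * RtoC (INR M) ^ P) * (PI * Ci / INR M) ^ P * xi M k ^ P = RtoC (kap k) ^
    P * RtoC (kap k) ^ P)%C.
Proof.
  intros HM. assert (HMC : RtoC (INR M) <> 0) by (apply Rpos_neq_C, lt_0_INR, HM).
  induction P; [simpl; ring|]. rewrite !Cpow_S.
  assert (E : (4 * (Ci * Ci) * (INR M * INR M) * (PI * Ci / INR M) * xi M k = RtoC (kap k) * RtoC (kap k))%C).
  { unfold xi, xs, kap. assert (HMR := lt_0_INR M HM). rewrite RtoC_div, !RtoC_mult, RtoC_pow by lra.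
    replace (4 * (Ci * Ci) * (INR M * INR M) * (PI * Ci / INR M) * (Ci * (PI * INR (S k) ^ 2 / INR M)))%C with
      (4 * (Ci * Ci) * (Ci * Ci) * PI * PI * INR (S k) ^ 2)%C by (field; exact HMC). rewrite Ci_sq. ring. }
  match goal with |- ?l = ?r => replace r with ((RtoC (kap k) * RtoC (kap k)) * (RtoC (kap k) ^ P * RtoC (kap k) ^
    P))%C by ring end.
  rewrite <- E, <- IHP. ring.
Qed.

(** Since (- i)^(2P + 1) = - i^(2P + 1), the value L(- 2P) retains the odd part of the spectrum and
    doubles it. These are the coefficients that [phi_germ] asks for with [nu = 0]. *)
Lemma Theta_tilde_coef_odd M g p : (0 < M)%nat -> periodic M g -> (forall n, DS M g (- n) = - DS M g n)%C ->
  is_Cser (fun k => (2 * DS M g (Z.of_nat (S k)) * (Ci / RtoC (kap k))) * RtoC (poch (/ 2 + INR 0) (S p)) / xi M k ^ S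
    p)%C (Theta_tilde 0 g M (S p)).
Proof.
  intros HM Hg Ho. unfold Theta_tilde.
  replace (- (2 * INR (S p) + INR 0))%C with (- RtoC (INR (S (2 * p + 1))))%C.
  2:{ f_equal. rewrite !S_INR, plus_INR, mult_INR. simpl (INR 2). simpl (INR 1). simpl (INR 0). rewrite !RtoC_plus,
    RtoC_mult, RtoC_plus. ring. }
  eapply evar_last; [eapply Cser_ext; [|apply (Cser_scal (/ RtoC (INR (fact (S p))) * (PI * Ci / INR M) ^ S p)%C _ _
    (L_neg_series M g (2 * p + 1) HM Hg))]|to_C; ring].
  intros k; cbv beta. rewrite Ho. replace (S (2 * p + 1)) with (2 * S p)%nat by lia. rewrite fact_even.
  set (P := S p). assert (HE := xi_kap_pow M k P HM).
  assert (Hk : RtoC (kap k) <> 0) by apply Rpos_neq_C, kap_pos.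
  assert (Hx := Cpow_neq_0 _ P (xi_neq_0 M k HM)). assert (HkP := Cpow_neq_0 _ P Hk).
  assert (HF : RtoC (INR (fact P)) <> 0) by (apply Rpos_neq_C, INR_fact_lt_0).
  rewrite !RtoC_mult, !RtoC_pow. rewrite !Cpow_S. replace (2 * P)%nat with (P + P)%nat by lia. rewrite !Cpow_add_r.
  replace ((- 1) ^ P)%C with ((Ci * Ci) ^ P)%C by (rewrite Ci_sq; reflexivity).
  assert (E1 : ((Ci * Ci) ^ P * (Ci * Ci) ^ P = 1)%C) by (rewrite <- Cpow_mult_l, Ci_sq; replace (-1 * -1)%C with (RtoC
    1) by ring; apply Cpow_1_l).
  assert (E2 : ((- Ci) ^ P * (- Ci) ^ P = (Ci * Ci) ^ P)%C) by (rewrite <- Cpow_mult_l; f_equal; ring).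
  assert (E3 : (Ci ^ P * Ci ^ P = (Ci * Ci) ^ P)%C) by (rewrite <- Cpow_mult_l; reflexivity).
  rewrite E1, E2, E3.
  set (D := DS M g _) in *. set (A := ((Ci * Ci) ^ P)%C) in *. set (X := (xi M k ^ P)%C) in *. set (Kp := (RtoC (kap k)
    ^ P)%C) in *. set (MP := (RtoC (INR M) ^ P)%C) in *.
  set (Z := ((PI * Ci / INR M) ^ P)%C) in *. set (po := RtoC (poch _ _)). set (F4 := (4 ^ P)%C) in *.
  (* The factors are grouped so that the left side of [xi_kap_pow] appears as one block. *)
  transitivity (2 * D * Ci * po * (F4 * A * (MP * MP) * Z * X) / (RtoC (kap k) * (Kp * Kp) * X))%C.
  - field. repeat split; assumption.
  - rewrite HE. field. repeat split; assumption.
Qed.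

Lemma Theta_tilde_coef_even M g p : (0 < M)%nat -> periodic M g -> (forall n, DS M g (- n) = DS M g n) ->
  is_Cser (fun k => (- (2 * DS M g (Z.of_nat (S k)) * (RtoC (INR M) / (RtoC (kap k) * RtoC (kap k))))) * RtoC (poch (/
    2 + INR 1) (S p)) / xi M k ^ S p)%C (Theta_tilde 1 g M (S p)).
Proof.
  intros HM Hg Ho. unfold Theta_tilde.
  replace (- (2 * INR (S p) + INR 1))%C with (- RtoC (INR (S (2 * p + 2))))%C.
  2:{ f_equal. rewrite !S_INR, plus_INR, mult_INR. simpl (INR 2). simpl (INR 1). simpl (INR 0). rewrite !RtoC_plus,
    RtoC_mult, RtoC_plus. ring. }
  eapply evar_last; [eapply Cser_ext; [|apply (Cser_scal (/ RtoC (INR (fact (S p))) * (PI * Ci / INR M) ^ S p)%C _ _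
    (L_neg_series M g (2 * p + 2) HM Hg))]|to_C; ring].
  intros k; cbv beta. rewrite Ho. replace (S (2 * p + 2)) with (2 * S p + 1)%nat by lia. rewrite fact_odd.
  set (P := S p). assert (HE := xi_kap_pow M k P HM).
  assert (Hk : RtoC (kap k) <> 0) by apply Rpos_neq_C, kap_pos.
  assert (Hx := Cpow_neq_0 _ P (xi_neq_0 M k HM)). assert (HkP := Cpow_neq_0 _ P Hk).
  assert (HF : RtoC (INR (fact P)) <> 0) by (apply Rpos_neq_C, INR_fact_lt_0).
  rewrite !RtoC_mult, !RtoC_pow. replace (2 * P + 1)%nat with (S (P + P))%nat by lia. rewrite !Cpow_S, !Cpow_add_r.
  replace ((- 1) ^ P)%C with ((Ci * Ci) ^ P)%C by (rewrite Ci_sq; reflexivity).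
  assert (E1 : ((Ci * Ci) ^ P * (Ci * Ci) ^ P = 1)%C) by (rewrite <- Cpow_mult_l, Ci_sq; replace (-1 * -1)%C with (RtoC
    1) by ring; apply Cpow_1_l).
  assert (E2 : ((- Ci) ^ P * (- Ci) ^ P = (Ci * Ci) ^ P)%C) by (rewrite <- Cpow_mult_l; f_equal; ring).
  assert (E3 : (Ci ^ P * Ci ^ P = (Ci * Ci) ^ P)%C) by (rewrite <- Cpow_mult_l; reflexivity).
  rewrite E1, E2, E3.
  set (D := DS M g _) in *. set (A := ((Ci * Ci) ^ P)%C) in *. set (X := (xi M k ^ P)%C) in *. set (Kp := (RtoC (kap k)
    ^ P)%C) in *. set (MP := (RtoC (INR M) ^ P)%C) in *.
  set (Z := ((PI * Ci / INR M) ^ P)%C) in *. set (po := RtoC (poch _ _)). set (F4 := (4 ^ P)%C) in *.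
  transitivity ((Ci * Ci) * (2 * D) * RtoC (INR M) * po * (F4 * A * (MP * MP) * Z * X) / (RtoC (kap k) * RtoC (kap k) *
    (Kp * Kp) * X))%C.
  - field. repeat split; assumption.
  - rewrite HE, Ci_sq. field. repeat split; assumption.
Qed.

Lemma psum_DS M g : psum (fun l => g (Z.of_nat (S l))) M = DS M g 0.
Proof.
  unfold DS. apply psum_ext. intros l _. replace (2 * PI * 0 * (INR (S l) / INR M)) with 0 by ring.
  replace (- (Ci * RtoC 0))%C with (RtoC 0) by ring. rewrite Cexp_0. ring.
Qed.

Lemma psum_reflect M (h : nat -> C) : psum (fun l => h (M - S l)%nat) M = psum h M.
Proof. rewrite (psum_rev h). apply psum_ext. intros l Hl. f_equal. lia. Qed.

Lemma periodic_sub M g l : periodic M g -> (l < M)%nat -> g (Z.of_nat (S l)) = g (- Z.of_nat (M - S l))%Z.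
Proof. intros Hg Hl. rewrite <- (Hg (- Z.of_nat (M - S l))%Z). f_equal. lia. Qed.

(** Under the reflection of j to M - j the weight 1/2 - j / M changes sign, so the residues strictly
    between 0 and M cancel; only j = M, with weight - 1/2, remains. *)
Lemma even_first_moment M g : (0 < M)%nat -> periodic M g -> (forall n, g (- n)%Z = g n) ->
  psum (fun l => g (Z.of_nat (S l)) * RtoC (/ 2 - INR (S l) / INR M))%C M = (- / 2 * g 0%Z)%C.
Proof.
  intros HM Hg He. assert (HMR := lt_0_INR M HM). set (h := fun l : nat => (g (Z.of_nat l) * RtoC (INR l / INR M - / 2))%C).
  assert (E1 : psum (fun l => g (Z.of_nat (S l)) * RtoC (/ 2 - INR (S l) / INR M))%C M = psum h M).
  { rewrite <- (psum_reflect M h). apply psum_ext. intros l Hl. unfold h. rewrite (periodic_sub M g l Hg Hl), He.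
    f_equal. f_equal.
    rewrite minus_INR by lia. field. lra. }
  assert (E2 : psum (fun l => g (Z.of_nat (S l)) * RtoC (/ 2 - INR (S l) / INR M))%C M = (- 1 * psum (fun l => h (S l))
    M)%C).
  { rewrite <- psum_scal. apply psum_ext. intros l Hl. unfold h. rewrite !RtoC_minus. ring. }
  assert (E3 : (psum h M + h M = h 0%nat + psum (fun l => h (S l)) M)%C) by (rewrite <- psum_S_l; reflexivity).
  assert (Eh0 : h 0%nat = (- / 2 * g 0%Z)%C) by (unfold h; simpl INR; replace (0 / INR M - / 2) with (- / 2) by (field;
    lra); rewrite RtoC_opp, RtoC_inv by lra; simpl Z.of_nat; ring).
  assert (EhM : h M = (/ 2 * g 0%Z)%C).
  { unfold h. replace (INR M / INR M - / 2) with (/ 2) by (field; lra). rewrite RtoC_inv by lra.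
    replace (Z.of_nat M) with (0 + Z.of_nat M)%Z by lia. rewrite Hg. ring. }
  rewrite Eh0, EhM in E3. set (S1 := psum _ M) in *. set (S2 := psum h M) in *. set (S3 := psum (fun l => h (S l)) M) in *.
  assert (E4 : S3 = (- S1)%C) by (rewrite E2; ring). rewrite E4, <- E1 in E3.
  assert (E5 : (2 * S1 = - g 0%Z)%C).
  { replace (2 * S1)%C with (S1 + / 2 * g 0%Z + S1 - / 2 * g 0%Z)%C by ring. rewrite E3. field. }
  replace S1 with (2 * S1 / 2)%C by field. rewrite E5. field.
Qed.

(** [Fm 1] is symmetric under the reflection of residues while [g] is antisymmetric, so the sum is
    its own opposite. *)
Lemma odd_F1_moment M g : (0 < M)%nat -> periodic M g -> (forall n, g (- n)%Z = (- g n)%C) ->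
  psum (fun l => g (Z.of_nat (S l)) * RtoC (INR M * Fm 1 (1 - INR (S l) / INR M)))%C M = 0.
Proof.
  intros HM Hg Ho. assert (HMR := lt_0_INR M HM). set (h := fun l : nat => (g (Z.of_nat l) * RtoC (INR M * Fm 1 (1 -
    INR l / INR M)))%C).
  assert (E1 : psum (fun l => h (S l)) M = psum h M).
  { apply psum_shift. unfold h. simpl INR. replace (1 - INR M / INR M) with 0 by (field; lra). replace (1 - 0 / INR M)
    with 1 by (field; lra). rewrite Fm_1.
    f_equal. replace (Z.of_nat M) with (0 + Z.of_nat M)%Z by lia. apply Hg. }
  assert (E2 : psum (fun l => h (S l)) M = (- 1 * psum h M)%C).
  { rewrite <- psum_scal, <- (psum_reflect M (fun l => - 1 * h l)%C). apply psum_ext. intros l Hl. unfold h. rewrite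
    (periodic_sub M g l Hg Hl), Ho.
    replace (1 - INR (M - S l) / INR M) with (1 - (1 - INR (S l) / INR M)) by (rewrite minus_INR by lia; field; lra).
      rewrite (F1_sym (1 - INR (S l) / INR M)). ring. }
  change (psum (fun l => h (S l)) M = 0). rewrite E1 in E2 |- *. set (s := psum h M) in *.
  assert (E3 : (2 * s = 0)%C) by (replace (2 * s)%C with (s + s)%C by ring; rewrite E2 at 1; ring).
  replace s with (2 * s / 2)%C by field. rewrite E3. field.
Qed.

Lemma osc_exponent_xi M k (tau : C) : (0 < M)%nat -> tau <> 0 -> osc_exponent (RtoC (PI * INR M) * (tau / Ci)) (kap k)
  = (xi M k / tau)%C.
Proof.
  intros HM Ht. assert (HMR := lt_0_INR M HM). assert (HMC := Rpos_neq_C _ HMR). assert (HPI := Rpos_neq_C _ PI_RGT_0).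
  unfold osc_exponent, xi, xs, kap. rewrite RtoC_div, !RtoC_mult, RtoC_pow by lra. field. repeat split; trivial. exact Ci_nz.
Qed.

Lemma gauss_theta M k (tau : C) : (0 < M)%nat ->
  gauss (RtoC (PI * INR M) * (tau / Ci)) (INR (S k) / INR M) = Cexp (Ci * PI * RtoC (INR (S k)) ^ 2 * tau / INR M).
Proof.
  intros HM. assert (HMR := lt_0_INR M HM). assert (HMC := Rpos_neq_C _ HMR).
  unfold gauss. f_equal. rewrite RtoC_div, RtoC_mult by lra.
  replace (tau / Ci)%C with (- Ci * tau)%C by (unfold Cdiv; rewrite <- Ci_inv; ring). field. exact HMC.
Qed.

Lemma theta_dual_exp M k (tau : C) : (0 < M)%nat -> tau <> 0 ->
  Cexp (Ci * PI * RtoC (INR (S k)) ^ 2 * (- / tau) / INR M) = Cexp (- (xi M k / tau)).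
Proof.
  intros HM Ht. assert (HMR := lt_0_INR M HM). assert (HMC := Rpos_neq_C _ HMR).
  f_equal. unfold xi, xs. rewrite RtoC_div, RtoC_mult, RtoC_pow by lra. field. split; assumption.
Qed.

Definition theta_term (tau : C) (nu : nat) (g : Z -> C) (M k : nat) : C :=
  (RtoC (INR (S k)) ^ nu * g (Z.of_nat (S k)) * Cexp (Ci * PI * RtoC (INR (S k)) ^ 2 * tau / INR M))%C.

Lemma Theta_unique tau nu g M T : is_Cser (theta_term tau nu g M) T -> Theta tau nu g M = T.
Proof. intros H. apply CSeries_unique. exact H. Qed.

(** Chosen so that [gauss] at n / M is exp(i pi n^2 tau / M), by [gauss_theta]. *)
Definition gauss_rate (M : nat) (tau : C) : C := (RtoC (PI * INR M) * (tau / Ci))%C.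

Lemma div_Ci (tau : C) : (tau / Ci)%C = (- Ci * tau)%C.
Proof. unfold Cdiv. rewrite <- Ci_inv. ring. Qed.

Lemma Re_div_Ci (tau : C) : Re (tau / Ci)%C = Im tau.
Proof. rewrite div_Ci. destruct tau as [x y]. unfold Re, Im, Cmult, Copp, Ci; simpl. ring. Qed.

Lemma gauss_rate_pos M (tau : C) : (0 < M)%nat -> 0 < Im tau -> 0 < Re (gauss_rate M tau).
Proof.
  intros HM Ht. unfold gauss_rate. rewrite re_scal_l, Re_div_Ci. apply Rmult_lt_0_compat; [|exact Ht].
  apply Rmult_lt_0_compat; [exact PI_RGT_0|apply lt_0_INR, HM].
Qed.

Lemma Im_pos_neq_0 (tau : C) : 0 < Im tau -> tau <> 0.
Proof. intros H E. rewrite E in H. simpl in H. lra. Qed.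

(** The factor [sqrt M] between [DS] and [DFT] cancels the [M] inside the Gaussian mass. *)
Lemma half_line_mass M (tau : C) : (0 < M)%nat -> 0 < Im tau ->
  (RtoC (sqrt (INR M)) * (/ 2 * rsqrt (gauss_rate M tau / RtoC PI)) = / 2 * Cpower (tau / Ci) (- / 2))%C.
Proof.
  intros HM Ht. assert (HMR := lt_0_INR M HM). assert (HMC := Rpos_neq_C _ HMR). assert (HPI := Rpos_neq_C _ PI_RGT_0).
  assert (Hs := sqrt_lt_R0 _ HMR). set (x := (tau / Ci)%C).
  assert (Hx : 0 < Re x) by (unfold x; rewrite Re_div_Ci; exact Ht).
  replace (gauss_rate M tau / RtoC PI)%C with (RtoC (INR M) * x)%C by (unfold gauss_rate; fold x; rewrite RtoC_mult;
    field; exact HPI).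
  assert (Hy : 0 < Re (RtoC (INR M) * x)) by (rewrite re_scal_l; apply Rmult_lt_0_compat; assumption).
  fold (rsqrt x).
  replace (RtoC (sqrt (INR M)) * (/ 2 * rsqrt (RtoC (INR M) * x)))%C with (/ 2 * (RtoC (sqrt (INR M)) * rsqrt (RtoC
    (INR M) * x)))%C by ring. f_equal.
  apply sqrt_unique.
  - replace (RtoC (sqrt (INR M)) * rsqrt (RtoC (INR M) * x) * (RtoC (sqrt (INR M)) * rsqrt (RtoC (INR M) * x)))%C with
      (RtoC (sqrt (INR M)) * RtoC (sqrt (INR M)) * (rsqrt (RtoC (INR M) * x) * rsqrt (RtoC (INR M) * x)))%C by ring.
    rewrite !rsqrt_sq by (apply Re_pos_neq_0; assumption). rewrite <- RtoC_mult, sqrt_sqrt by lra. field. split; [apply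
      Re_pos_neq_0; exact Hx|exact HMC].
  - rewrite re_scal_l. apply Rmult_lt_0_compat; [exact Hs|]. apply rsqrt_Re. left; exact Hy.
  - apply rsqrt_Re. left; exact Hx.
Qed.

Lemma theta_dual_term M (tau : C) nu g k : (0 < M)%nat -> 0 < Im tau ->
  theta_term (- / tau) nu g M k = (RtoC (INR (S k)) ^ nu * g (Z.of_nat (S k)) * Cexp (- osc_exponent (gauss_rate M tau)
    (kap k)))%C.
Proof.
  intros HM Ht. apply Im_pos_neq_0 in Ht. unfold theta_term, gauss_rate. rewrite osc_exponent_xi, theta_dual_exp by
    assumption. reflexivity.
Qed.

(** Convergence of the dual theta series is not proved separately: it is that of [V] divided by
    [q]. *)
Lemma theta_dual_series M (tau : C) nu g (q V : C) : (0 < M)%nat -> 0 < Im tau -> q <> 0 ->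
  is_Cser (fun k => q * (RtoC (INR (S k)) ^ nu * g (Z.of_nat (S k)) * Cexp (- osc_exponent (gauss_rate M tau) (kap
    k))))%C V ->
  V = (q * Theta (- / tau) nu g M)%C.
Proof.
  intros HM Ht Hq HV.
  rewrite (Theta_unique (- / tau)%C nu g M (/ q * V)%C).
  - field. exact Hq.
  - eapply Cser_ext; [|apply (Cser_scal (/ q)%C _ _ HV)]. intros k; cbv beta. rewrite theta_dual_term by assumption.
    field. exact Hq.
Qed.

Lemma theta_even_0 M g (tau : C) : (0 < M)%nat -> periodic M g -> (forall n, g (- n)%Z = g n) -> 0 < Im tau ->
  is_Cser (theta_term tau 0 g M)
    (/ 2 * DFT M g 0%Z * Cpower (tau / Ci) (- / 2) - / 2 * g 0%Z + Cpower (tau / Ci) (- / 2) * Theta (- / tau) 0 (DFT M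
      g) M)%C.
Proof.
  intros HM Hg He Ht. assert (Hc := gauss_rate_pos M tau HM Ht). assert (Hm := half_line_mass M tau HM Ht).
  destruct (theta_gauss_0 M g _ _ HM Hg Hc (gauss_integral _ Hc)) as [V [H1 H2]].
  set (G := (/ 2 * rsqrt (gauss_rate M tau / RtoC PI))%C) in *.
  assert (HV : V = (Cpower (tau / Ci) (- / 2) * Theta (- / tau) 0 (DFT M g) M)%C).
  { apply theta_dual_series; [exact HM|exact Ht|apply rsqrt_neq_0|]. eapply Cser_ext; [|exact H1]. intros k; cbv beta zeta.
    rewrite (DS_even M g) by assumption. rewrite DS_DFT by assumption. simpl Cpow.
    set (D := DFT M g _). set (E := Cexp (- _)).
    transitivity (2 * (RtoC (sqrt (INR M)) * G) * (D * E))%C; [ring|]. rewrite Hm. field. }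
  eapply evar_last; [eapply Cser_ext; [|exact H2]|].
  - intros k; cbv beta. unfold theta_term. rewrite <- gauss_theta by exact HM. simpl Cpow. fold (gauss_rate M tau). ring.
  - to_C. rewrite HV, even_first_moment, psum_DS, DS_DFT by assumption.
    transitivity ((RtoC (sqrt (INR M)) * G) * DFT M g 0 + - / 2 * g 0%Z + Cpower (tau / Ci) (- / 2) * Theta (- / tau) 0
      (DFT M g) M)%C; [ring|]. rewrite Hm. ring.
Qed.

Lemma Cmod_div_kap_le k (z : C) : Cmod (z / RtoC (kap k)) <= Cmod z.
Proof.
  assert (Hk := kap_ge k). assert (H := INR_S_ge1 k). unfold Cdiv. rewrite <- RtoC_inv, Cmod_mult, Cmod_R by lra.
  rewrite Rabs_right by (apply Rle_ge, Rlt_le, Rinv_0_lt_compat; lra).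
  rewrite <- (Rmult_1_r (Cmod z)) at 2. apply Rmult_le_compat_l; [apply Cmod_ge_0|]. rewrite <- Rinv_1. apply
    Rinv_le_contravar; lra.
Qed.

Lemma DS_odd_0 M g : (0 < M)%nat -> periodic M g -> (forall n, g (- n)%Z = (- g n)%C) -> DS M g 0 = 0.
Proof.
  intros HM Hg Ho. assert (E := DS_odd M g 0 HM Hg Ho). change (- 0)%Z with 0%Z in E. set (s := DS M g 0) in *.
  assert (E2 : (2 * s = 0)%C) by (replace (2 * s)%C with (s + s)%C by ring; rewrite E at 1; ring).
  replace s with (2 * s / 2)%C by field. rewrite E2. field.
Qed.

(** The meeting point of the two sides: the Dawson-type series [V] from the summation formula is
    term by term the series of [- Psi] at the origin that [median_sum] needs, and the boundary term
    is the constant coefficient L(0, g). Here the mean of [g] vanishes. *)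
Lemma theta_odd_0 M g (tau : C) : (0 < M)%nat -> periodic M g -> (forall n, g (- n)%Z = (- g n)%C) -> 0 < Im tau ->
  exists S, is_median_sum (Theta_tilde 0 g M) tau S /\ is_Cser (theta_term tau 0 g M) S.
Proof.
  intros HM Hg Ho Ht. assert (Hc := gauss_rate_pos M tau HM Ht). assert (Htn := Im_pos_neq_0 _ Ht).
  destruct (theta_gauss_0 M g _ _ HM Hg Hc (gauss_integral _ Hc)) as [V [H1 H2]].
  exists (Theta_tilde 0 g M 0%nat + V)%C. split.
  - destruct (DS_bounded M g) as [K [HK0 HK]].
    apply (median_sum 0 M (fun k => 2 * DS M g (Z.of_nat (S k)) * (Ci / RtoC (kap k)))%C (2 * K)); [lia|exact HM|
      |exact Ht| |].
    + intros k. replace (2 * DS M g (Z.of_nat (S k)) * (Ci / RtoC (kap k)))%C with ((2 * Ci * DS M g (Z.of_nat (S k)))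
      / RtoC (kap k))%C by (unfold Cdiv; ring).
      eapply Rle_trans; [apply Cmod_div_kap_le|]. rewrite !Cmod_mult, Cmod_Ci, Cmod_R, Rabs_right by lra. specialize
        (HK (Z.of_nat (S k))). lra.
    + intros p. apply Theta_tilde_coef_odd; [exact HM|exact Hg|]. intros n. apply DS_odd; assumption.
    + eapply Cser_ext; [|exact H1]. intros k; cbv beta zeta. rewrite (DS_odd M g) by assumption. rewrite Psi_0 by lia.
      unfold gauss_rate. rewrite osc_exponent_xi by assumption. fold (Dfun (xi M k / tau)). unfold Cdiv. ring.
  - eapply evar_last; [eapply Cser_ext; [|exact H2]|].
    + intros k; cbv beta. unfold theta_term. rewrite <- gauss_theta by exact HM. simpl Cpow. fold (gauss_rate M tau). ring.
    + to_C. rewrite psum_DS, DS_odd_0, <- L_0_value by assumption. unfold Theta_tilde. simpl INR. simpl Cpow.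
      replace (- (2 * 0 + 0))%C with (RtoC 0) by ring. field.
Qed.

Lemma theta_even_1 M g (tau : C) : (0 < M)%nat -> periodic M g -> (forall n, g (- n)%Z = g n) -> 0 < Im tau ->
  exists S, is_median_sum (Theta_tilde 1 g M) tau S /\
  is_Cser (theta_term tau 1 g M) (- (RtoC (sqrt (INR M)) / (2 * PI * Ci)) * DFT M g 0%Z * / tau + S)%C.
Proof.
  intros HM Hg He Ht. assert (Hc := gauss_rate_pos M tau HM Ht). assert (Htn := Im_pos_neq_0 _ Ht).
  assert (HMR := lt_0_INR M HM). assert (HMC := Rpos_neq_C _ HMR). assert (HPI := Rpos_neq_C _ PI_RGT_0).
  destruct (theta_gauss_1 M g _ _ HM Hg Hc (gauss_integral _ Hc)) as [V [H1 H2]].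
  exists (Theta_tilde 1 g M 0%nat + V)%C. split.
  - destruct (DS_bounded M g) as [K [HK0 HK]].
    apply (median_sum 1 M (fun k => - (2 * DS M g (Z.of_nat (S k)) * (RtoC (INR M) / (RtoC (kap k) * RtoC (kap k)))))%C
      (2 * K * INR M)); [lia|exact HM| |exact Ht| |].
    + intros k. assert (Hk : RtoC (kap k) <> 0) by apply Rpos_neq_C, kap_pos.
      replace (- (2 * DS M g (Z.of_nat (S k)) * (RtoC (INR M) / (RtoC (kap k) * RtoC (kap k)))))%C with ((- (2 * DS M g
        (Z.of_nat (S k)) * RtoC (INR M))) / RtoC (kap k) / RtoC (kap k))%C by (field; exact Hk).
      eapply Rle_trans; [apply Cmod_div_kap_le|]. eapply Rle_trans; [apply Cmod_div_kap_le|]. rewrite Cmod_opp,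
        !Cmod_mult, !Cmod_R, !Rabs_right by lra. specialize (HK (Z.of_nat (S k))).
      apply Rmult_le_compat_r; lra.
    + intros p. apply Theta_tilde_coef_even; [exact HM|exact Hg|]. intros n. apply DS_even; assumption.
    + eapply Cser_ext; [|exact H1]. intros k; cbv beta zeta. rewrite (DS_even M g) by assumption. rewrite Psi_0 by lia.
      unfold gauss_rate. rewrite osc_exponent_xi by assumption. fold (Dfun (xi M k / tau)). unfold Cdiv. ring.
  - eapply evar_last; [eapply Cser_ext; [|exact H2]|].
    + intros k; cbv beta. unfold theta_term. rewrite <- gauss_theta by exact HM. rewrite Cpow_1_r. fold (gauss_rate M
      tau). ring.
    + to_C. rewrite psum_DS, DS_DFT, <- L_1_value by assumption. unfold Theta_tilde. simpl INR. simpl Cpow.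
      replace (- (2 * 0 + 1))%C with (- RtoC 1)%C by ring. unfold gauss_rate. rewrite div_Ci, RtoC_mult.
      (* A factor [- (Ci * Ci) = 1] is inserted so that the powers of [Ci] on both sides match as
         formal quantities; [field] does not know that Ci^2 = - 1. *)
      replace (- (RtoC (sqrt (INR M)) / (2 * PI * Ci)))%C with (- (RtoC (sqrt (INR M)) / (2 * PI * Ci * (- (Ci *
        Ci)))))%C by (rewrite Ci_sq; f_equal; f_equal; ring).
      assert (HC := Ci_nz).
      transitivity (- (- (RtoC (sqrt (INR M)) * DFT M g 0) / (2 * PI * Ci * tau) * - (1)) + (Theta_tilde 1 g M 0 + V))%C.
      2:{ rewrite Ci_sq. unfold Theta_tilde. simpl INR. simpl Cpow. replace (- (2 * 0 + 1))%C with (- RtoC 1)%C by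
        ring. field. repeat split; assumption. }
      unfold Theta_tilde. simpl INR. simpl Cpow. replace (- (2 * 0 + 1))%C with (- RtoC 1)%C by ring. field. repeat
        split; assumption.
Qed.

Lemma Cpower_minus_3_2 (x : C) : x <> 0 -> Cpower x (- (3 / 2)) = (Cpower x (- / 2) / x)%C.
Proof.
  intros Hx. unfold Cpower. rewrite <- (Cexp_Clog x Hx) at 3. unfold Cdiv. rewrite <- Cexp_opp, <- Cexp_plus. f_equal. field.
Qed.

Lemma theta_odd_1 M g (tau : C) : (0 < M)%nat -> periodic M g -> (forall n, g (- n)%Z = (- g n)%C) -> 0 < Im tau ->
  is_Cser (theta_term tau 1 g M) (Ci * Cpower (tau / Ci) (- (3 / 2)) * Theta (- / tau) 1 (DFT M g) M)%C.
Proof.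
  intros HM Hg Ho Ht. assert (Hc := gauss_rate_pos M tau HM Ht). assert (Htn := Im_pos_neq_0 _ Ht). assert (Hm :=
    half_line_mass M tau HM Ht).
  assert (HMR := lt_0_INR M HM). assert (HMC := Rpos_neq_C _ HMR). assert (HPI := Rpos_neq_C _ PI_RGT_0).
  assert (Hx : (tau / Ci)%C <> 0) by (apply Re_pos_neq_0; rewrite Re_div_Ci; exact Ht).
  rewrite (Cpower_minus_3_2 _ Hx).
  destruct (theta_gauss_1 M g _ _ HM Hg Hc (gauss_integral _ Hc)) as [V [H1 H2]].
  set (G := (/ 2 * rsqrt (gauss_rate M tau / RtoC PI))%C) in *. fold (rsqrt (tau / Ci)) in *.
  assert (HV : V = (Ci * (rsqrt (tau / Ci) / (tau / Ci)) * Theta (- / tau) 1 (DFT M g) M)%C).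
  { apply theta_dual_series; [exact HM|exact Ht| |].
    - apply Cmult_neq_0; [exact Ci_nz|]. unfold Cdiv at 1. apply Cmult_neq_0; [apply rsqrt_neq_0|]. intros E. apply
      (f_equal (Cmult (tau / Ci)%C)) in E.
      rewrite Cinv_r, Cmult_0_r in E by exact Hx. exact (C1_nz E).
    - eapply Cser_ext; [|exact H1]. intros k; cbv beta zeta. rewrite (DS_odd M g) by assumption. rewrite DS_DFT by
      assumption. rewrite Cpow_1_r.
      set (D := DFT M g _). set (E := Cexp (- _)).
      transitivity (4 * (RtoC (sqrt (INR M)) * G) * (D * E) * Ci * (osc_exponent (gauss_rate M tau) (kap k) * RtoC (INR
        M) / RtoC (kap k)))%C; [unfold Cdiv; ring|]. rewrite Hm.
      (* This factor supplies both the n of the dual theta series and the extra division by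
         [tau / Ci] that turns the power - 1/2 into - 3/2. *)
      replace (osc_exponent (gauss_rate M tau) (kap k) * RtoC (INR M) / RtoC (kap k))%C with (/ 2 * (RtoC (INR (S k)) /
        (tau / Ci)))%C; [unfold Cdiv; field|].
      2:{ set (y := (tau / Ci)%C) in *. assert (HS : RtoC (INR (S k)) <> 0) by (apply Rpos_neq_C; generalize (INR_S_ge1
        k); lra).
          unfold osc_exponent, gauss_rate, kap. fold y. rewrite !RtoC_mult. field. repeat split; assumption. }
      split; [exact Ci_nz|exact Htn]. }
  eapply evar_last; [eapply Cser_ext; [|exact H2]|].
  - intros k; cbv beta. unfold theta_term. rewrite <- gauss_theta by exact HM. rewrite Cpow_1_r. fold (gauss_rate M
    tau). ring.
  - to_C. rewrite HV, odd_F1_moment, psum_DS, DS_odd_0 by assumption. ring.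
Qed.

Lemma even_part_even g n : even_part g (- n) = even_part g n.
Proof. unfold even_part. rewrite Z.opp_involutive. f_equal. ring. Qed.

Lemma odd_part_odd g n : odd_part g (- n) = (- odd_part g n)%C.
Proof. unfold odd_part. rewrite Z.opp_involutive. unfold Cdiv. ring. Qed.

Lemma theta_term_parity tau nu g M k : theta_term tau nu g M k = (theta_term tau nu (even_part g) M k + theta_term tau
  nu (odd_part g) M k)%C.
Proof. unfold theta_term, even_part, odd_part. field. Qed.

Theorem theorem3 (M : nat) (f : Z -> C) (hM : (0 < M)%nat)
  (hf : periodic M f) (tau : C) (htau : 0 < Im tau) :
  (exists S : C,
     is_median_sum (Theta_tilde 0 (odd_part f) M) tau S /\
     Theta tau 0 f M =
       (/ 2 * DFT M (even_part f) 0%Z * Cpower (tau / Ci) (- / 2)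
        - / 2 * even_part f 0%Z
        + S
        + Cpower (tau / Ci) (- / 2)
          * Theta (- / tau) 0 (DFT M (even_part f)) M)%C)
  /\
  (exists S : C,
     is_median_sum (Theta_tilde 1 (even_part f) M) tau S /\
     Theta tau 1 f M =
       (- (RtoC (sqrt (INR M)) / (2 * PI * Ci)) * DFT M (even_part f) 0%Z
          * / tau
        + S
        + Ci * Cpower (tau / Ci) (- (3 / 2))
          * Theta (- / tau) 1 (DFT M (odd_part f)) M)%C).
Proof.
  assert (He := periodic_even M f hf). assert (Ho := periodic_odd M f hf). split.
  - destruct (theta_odd_0 M _ tau hM Ho (odd_part_odd f) htau) as [S [HS H1]]. exists S. split; [exact HS|].
    assert (H2 := theta_even_0 M _ tau hM He (even_part_even f) htau).
    apply Theta_unique. eapply evar_last; [eapply Cser_ext; [intros k; symmetry; apply theta_term_parity|apply Cser_plus; [exact H2|exact H1]]|].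
    to_C. ring.
  - destruct (theta_even_1 M _ tau hM He (even_part_even f) htau) as [S [HS H1]]. exists S. split; [exact HS|].
    assert (H2 := theta_odd_1 M _ tau hM Ho (odd_part_odd f) htau).
    apply Theta_unique. eapply Cser_ext; [intros k; symmetry; apply theta_term_parity|]. apply Cser_plus; [exact H1|exact H2].
Qed.
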